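(* Let $\mathcal S$ be an operator system with injective envelope $I(\mathcal S)$. The following are equivalent: (1) $\mathcal S$ has the weak expectation property, i.e. the canonical inclusion $\mathcal S\hookrightarrow\mathcal S^{**}$ extends to a ucp map $I(\mathcal S)\to\mathcal S^{**}$; (2) for every $n$ and every null-subspace $J\subset M_n$, we have a complete order isomorphism $\mathcal S\otimes_{\min}(M_n/J)=\mathcal S\otimes_{\max}(M_n/J)$ (via the identity map of the algebraic tensor product); (3) for every operator system $\mathcal T$ we have a canonical complete order inclusion $\mathcal S\otimes_{\max}\mathcal T\subseteq I(\mathcal S)\otimes_{\max}\mathcal T$; in other words, $\mathcal S$ is (el,max)-nuclear; (4) for every $n$, every matrix system $\mathcal R\subseteq M_n$, every cp map $\varphi:\mathcal R\to\mathcal S$ and every $\epsilon>0$ there is a cp map $\tilde\varphi:M_n\to\mathcal S$ such that $\|\tilde\varphi|_{\mathcal R}-\varphi\|_{cb}\le\epsilon$.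
   Context: An operator system is a unital $*$-closed subspace of some $B(\mathcal H)$ with the induced matricial order; cp means completely positive, ucp means unital completely positive. A matrix system is an operator subsystem $\mathcal R\subseteq M_n$ for some $n$. $I(\mathcal S)$ denotes the (Hamana) injective envelope of $\mathcal S$ in the category of operator systems and ucp maps, with $\mathcal S\subseteq I(\mathcal S)$. Bidual: $\mathcal S^*$ is matrix ordered by $(f_{ij})\in M_n(\mathcal S^* )^+$ iff $s\mapsto(f_{ij}(s))$, $\mathcal S\to M_n$, is cp; $\mathcal S^{**}$, with the matrix order dual to that of $\mathcal S^*$ and unit the image of $1_{\mathcal S}$, is an operator system containing $\mathcal S$ canonically. Null-subspaces and quotients: a null-subspace $J\subset M_n$ is a $*$-closed subspace containing no positive element other than $0$. The operator system quotient $M_n/J$ is the algebraic quotient with unit $I_n+J$ where $x\in M_k(M_n/J)$ is positive iff for every $\epsilon>0$ the element $x+\epsilon\,(I_n+J)\otimes I_k$ has the form $(s_{ij}+J)$ with $(s_{ij})\in M_k(M_n)^+$. Tensor products (all on the algebraic tensor product $\mathcal S\otimes\mathcal T$ with unit $1\otimes1$): $\mathcal S\otimes_{\min}\mathcal T$ has cones $C_n^{\min}=\{[x_{ij}]\in M_n(\mathcal S\otimes\mathcal T): [(\phi\otimes\psi)(x_{ij})]\ge0$ for all $p,q\in\mathbb N$ and all ucp $\phi:\mathcal S\to M_p$, $\psi:\mathcal T\to M_q\}$. $\mathcal S\otimes_{\max}\mathcal T$ has cones $C_n^{\max}=\{x: x+\epsilon(1\otimes1)_n\in D_n^{\max}\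 \forall\epsilon>0\}$, where $(1\otimes 1)_n$ is the diagonal matrix with entries $1\otimes 1$ and $D_n^{\max}=\{X^*(S\otimes T)X: S\in M_p(\mathcal S)^+, T\in M_q(\mathcal T)^+, X \text{ a } pq\times n \text{ scalar matrix}, p,q\in\mathbb N\}$. $\mathcal S\otimes_{\rm el}\mathcal T$ has the operator system structure induced by the inclusion into $I(\mathcal S)\otimes_{\max}\mathcal T$. $\mathcal S$ is $(\alpha,\beta)$-nuclear if $\mathcal S\otimes_\alpha\mathcal T=\mathcal S\otimes_\beta\mathcal T$ (the identity is a complete order isomorphism) for every operator system $\mathcal T$. *)

(* Defs.v *)
From HB Require Import structures.
From mathcomp Require Import all_boot all_order all_algebra.
From mathcomp Require Import finmap.
From mathcomp Require Import all_classical all_reals ereal.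
From mathcomp Require Import complex mxtens.
From mathcomp Require Import topology normedtype sequences.
(* The notations of monalg clash with those of topology. *)
From mathcomp Require Import -(notations) monalg.

Set Implicit Arguments.
Unset Strict Implicit.
Unset Printing Implicit Defensive.

Import Order.TTheory GRing.Theory Num.Theory.
Import numFieldNormedType.Exports.

Local Open Scope ring_scope.
Local Open Scope complex_scope.
Local Open Scope classical_set_scope.
Local Open Scope quotient_scope.
Local Open Scope sesquilinear_scope.

Section Quotient.
Variables (K : nzRingType) (V : lmodType K) (I : submodClosed V).

Definition submod_pred : {pred V} := fun x => x \in I.

Lemma submod_pred_zmod : zmod_closed submod_pred.
Proof.
split; first exact: (rpred0 I).
move=> x y xI yI; have /(rpredZ (-1)) : y \in I by [].
by rewrite scaleN1r; apply: rpredD; exact: xI.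
Qed.

HB.instance Definition _ := GRing.isZmodClosed.Build V submod_pred submod_pred_zmod.

Definition lquot := Quotient.quot submod_pred.

HB.instance Definition _ := Choice.on lquot.
HB.instance Definition _ := GRing.Zmodule.on lquot.

Definition lquot_pi (x : V) : lquot := \pi_(Quotient.quot submod_pred) x.

Lemma lquot_pi_eq x y : lquot_pi x = lquot_pi y <-> x - y \in I.
Proof.
have -> : (x - y \in I) = (x - y \in submod_pred) by [].
by rewrite Quotient.idealrBE; exact: (rwP eqP).
Qed.

Lemma lquot_reprK (q : lquot) : lquot_pi (repr q) = q.
Proof. exact: reprK. Qed.

Lemma lquot_pi_zmod : zmod_morphism lquot_pi.
Proof. by move=> x y; rewrite /lquot_pi raddfB. Qed.

HB.instance Definition _ := GRing.isZmodMorphism.Build V lquot lquot_pi lquot_pi_zmod.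

Definition lquot_scale (a : K) (q : lquot) : lquot := lquot_pi (a *: repr q).

Lemma lquot_scaleE a x : lquot_scale a (lquot_pi x) = lquot_pi (a *: x).
Proof.
apply/lquot_pi_eq; rewrite -scalerBr rpredZ //.
by apply/lquot_pi_eq; rewrite lquot_reprK.
Qed.

Let scaleA a b q : lquot_scale a (lquot_scale b q) = lquot_scale (a * b) q.
Proof. by rewrite -[q]lquot_reprK !lquot_scaleE scalerA. Qed.
Let scale1 : left_id 1 lquot_scale.
Proof. by move=> q; rewrite -[q]lquot_reprK lquot_scaleE scale1r. Qed.
Let scaleDr : right_distributive lquot_scale +%R.
Proof.
by move=> a p q; rewrite -[p]lquot_reprK -[q]lquot_reprK -raddfD !lquot_scaleE
  scalerDr raddfD.
Qed.
Let scaleDl q : {morph lquot_scale^~ q : a b / a + b}.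
Proof. by move=> a b; rewrite -[q]lquot_reprK !lquot_scaleE scalerDl raddfD. Qed.

HB.instance Definition _ :=
  GRing.Zmodule_isLmodule.Build K lquot scaleA scale1 scaleDr scaleDl.

Lemma lquot_pi_scalable : scalable lquot_pi.
Proof. by move=> a x; rewrite -lquot_scaleE. Qed.

HB.instance Definition _ := GRing.isScalable.Build K V lquot *:%R lquot_pi lquot_pi_scalable.
End Quotient.

(* The algebraic tensor product: the free module on A * B modulo the submodule
   [tensor_null] generated by the bilinearity relations [tensor_rel]. *)
Section Tensor.
Variables (K : fieldType) (A B : lmodType K).
Local Notation free := (malg (A * B)%type K).
Local Notation gen a b := (mkmalgU ((a, b) : (A * B)%type) (1 : K)).

Definition tensor_rel : set free := [set z |
  (exists a x y b, z = gen (a *: x + y) b - a *: gen x b - gen y b) \/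
  (exists a x b c, z = gen x (a *: b + c) - a *: gen x b - gen x c)].

Definition tensor_null : {pred free} := fun z =>
  `[< forall P : {pred free}, submod_closed P ->
        (forall r, tensor_rel r -> r \in P) -> z \in P >].

Lemma tensor_null_closed : submod_closed tensor_null.
Proof.
split=> [|a x y /asboolP xN /asboolP yN]; apply/asboolP => P PS Pr.
  by case: PS.
by case: (PS) => _; apply; [exact: xN|exact: yN].
Qed.

HB.instance Definition _ := GRing.isSubmodClosed.Build K free tensor_null
  tensor_null_closed.

Definition tensor := lquot tensor_null.
HB.instance Definition _ := GRing.Lmodule.on tensor.

Definition tens (a : A) (b : B) : tensor := lquot_pi tensor_null (gen a b).

Lemma tens_bilinear : bilinear_for *:%R *:%R tens.
Proof.
have E z w : z - w \in tensor_null -> lquot_pi tensor_null z = lquot_pi tensor_null w.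
  by move/lquot_pi_eq.
split=> [b a x y|x a b c]; rewrite /tens -linearP; apply: E; rewrite opprD addrA;
  apply/asboolP => P _; apply; [left|right].
  by exists a, x, y, b.
by exists a, x, b, c.
Qed.

HB.instance Definition _ :=
  bilinear_isBilinear.Build K A B tensor *:%R *:%R tens tens_bilinear.

Section Lift.
Variables (W : lmodType K) (f : {bilinear A -> B -> W}).

Definition free_lift (g : free) : W := \sum_(k <- msupp g) mcoeff k g *: f k.1 k.2.

Lemma free_liftw (d : {fset (A * B)%type}) g : (msupp g `<=` d)%fset ->
  free_lift g = \sum_(k <- d) mcoeff k g *: f k.1 k.2.
Proof.
move=> sgd; rewrite /free_lift (big_fset_incl _ sgd) //= => k _ kg.
by rewrite mcoeff_outdom ?scale0r.
Qed.

Lemma free_lift_linear : linear free_lift.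
Proof.
move=> a g h; pose d := (msupp g `|` msupp h `|` msupp (a *: g + h))%fset.
have sg : (msupp g `<=` d)%fset by apply/fsubsetP=> k kg; rewrite !inE kg.
have sh : (msupp h `<=` d)%fset by apply/fsubsetP=> k kg; rewrite !inE kg orbT.
have sp : (msupp (a *: g + h) `<=` d)%fset.
  by apply/fsubsetP=> k kg; rewrite !inE kg orbT.
rewrite (free_liftw sg) (free_liftw sh) (free_liftw sp) scaler_sumr -big_split /=.
by apply: eq_bigr => k _; rewrite mcoeffD mcoeffZ scalerDl scalerA.
Qed.

HB.instance Definition _ :=
  GRing.isLinear.Build K free W *:%R free_lift free_lift_linear.

Lemma free_lift_gen a b : free_lift (gen a b) = f a b.
Proof. by rewrite (free_liftw msuppU_le) big_seq_fset1 mcoeffUU scale1r. Qed.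

Lemma free_lift0 g : g \in tensor_null -> free_lift g = 0.
Proof.
move/asboolP => /(_ [pred g | free_lift g == 0]) H; apply/eqP/H.
  split=> [|a x y]; rewrite !inE ?linear0 //= => /eqP x0 /eqP y0.
  by rewrite linearP /= x0 y0 scaler0 addr0.
move=> r; rewrite inE; case=> [[a] [x] [y] [b] ->|[a] [x] [b] [c] ->];
  by rewrite !linearB !linearZ /= !free_lift_gen ?linearPl ?linearPr
    scalerN addrAC addrK subrr.
Qed.

Definition tensor_lift (q : tensor) : W := free_lift (repr q).

Lemma tensor_lift_pi g : tensor_lift (lquot_pi tensor_null g) = free_lift g.
Proof.
apply/eqP; rewrite -subr_eq0 -linearB /=; apply/eqP/free_lift0.
by apply/lquot_pi_eq; rewrite lquot_reprK.
Qed.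

Lemma tensor_lift_linear : linear tensor_lift.
Proof.
move=> a p q; rewrite -[p]lquot_reprK -[q]lquot_reprK -linearP !tensor_lift_pi.
exact: linearP.
Qed.

HB.instance Definition _ :=
  GRing.isLinear.Build K tensor W *:%R tensor_lift tensor_lift_linear.

Lemma tensor_lift_tens a b : tensor_lift (tens a b) = f a b.
Proof. by rewrite tensor_lift_pi free_lift_gen. Qed.

End Lift.
End Tensor.

Section OperatorSystems.
Variable R : realType.
Local Notation C := R[i].

Definition dot_norm (V : lmodType C) (d : V -> V -> C) (x : V) : R :=
  Num.sqrt (complex.Re (d x x)).

(* As in mathcomp, [{dot _ for conj}] is linear in its first argument and
   conjugate linear in its second one. *)
Record hilbert := Hilbert {
  h_sort :> lmodType C;
  h_dot : {dot h_sort for (@Num.conj C)};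
  h_complete : forall u : nat -> h_sort,
    (forall e : R, 0 < e -> exists N, forall m n, (N <= m)%N -> (N <= n)%N ->
       dot_norm h_dot (u m - u n) < e) ->
    exists l, forall e : R, 0 < e -> exists N, forall n, (N <= n)%N ->
      dot_norm h_dot (u n - l) < e
}.

Definition hnorm (H : hilbert) : H -> R := dot_norm (@h_dot H).

(* These three records only carry the data of a matrix ordered space (the cones
   of M_n(V) for all n), of its unit, and of its norm: the axioms hold for the
   instances below and are not needed to define cp maps.  The involution is
   omitted as well: cp maps between the spaces below preserve it since the
   positive elements span. *)
Record mospace := MOSpace {
  mo_sort :> lmodType C;
  mo_cone : forall n, set 'M[mo_sort]_n
}.

Record uospace := UOSpace {
  uo_mo :> mospace;
  uo_one : uo_mo
}.

Record nmospace := NMOSpace {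
  nmo_mo :> mospace;
  nmo_norm : nmo_mo -> R;
  nmo_norm_ge0 : forall x, 0 <= nmo_norm x
}.

(* A unital *-closed subspace of B(H), given by a vector space [os_car] and its
   injective linear representation [os_act] by bounded operators of H. *)
Record opsys := OpSys {
  os_car : lmodType C;
  os_hilb : hilbert;
  os_act : {bilinear os_car -> os_hilb -> os_hilb};
  os_act_inj : forall x, (forall xi, os_act x xi = 0) -> x = 0;
  os_act_bounded : forall x, exists M : R, forall xi,
    hnorm (os_act x xi) <= M * hnorm xi;
  os_one : os_car;
  os_act_one : forall xi, os_act os_one xi = xi;
  os_act_adj : forall x, exists y, forall xi eta,
    h_dot _ (os_act y xi) eta = h_dot _ xi (os_act x eta)
}.

(* M_n(S) acts on the Hilbert sum H^n by matrix multiplication; its order and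
   norm are those induced by M_n(B(H)) = B(H^n). *)
Section Amplification.
Variables (S : opsys) (n : nat).
Local Notation H := (os_hilb S).

Definition sum_dot (xi eta : 'I_n -> H) : C := \sum_i h_dot H (xi i) (eta i).

Definition sum_norm (xi : 'I_n -> H) : R := Num.sqrt (complex.Re (sum_dot xi xi)).

Definition amp_act (X : 'M[os_car S]_n) (xi : 'I_n -> H) (i : 'I_n) : H :=
  \sum_j os_act S (X i j) (xi j).

Definition os_cone : set 'M[os_car S]_n :=
  [set X | forall xi, 0 <= sum_dot (amp_act X xi) xi].

Definition os_norm (X : 'M[os_car S]_n) : R :=
  inf [set M : R | 0 <= M /\ forall xi, sum_norm (amp_act X xi) <= M * sum_norm xi].
End Amplification.

Definition os_mospace (S : opsys) : mospace := MOSpace (@os_cone S).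

Coercion os_uospace (S : opsys) : uospace := @UOSpace (os_mospace S) (os_one S).

Lemma os_norm_ge0 (S : opsys) n (X : 'M[os_car S]_n) : 0 <= os_norm X.
Proof.
rewrite /os_norm; set E := [set M : R | _ /\ _].
have [->|/set0P E0] := eqVneq E set0; first by rewrite inf0.
by apply: lb_le_inf => // M [].
Qed.

Definition os_nmospace (S : opsys) : nmospace :=
  @NMOSpace (os_mospace S) (fun x => @os_norm S 1 (const_mx x))
    (fun x => os_norm_ge0 (const_mx x)).

Definition cp (A B : mospace) (f : A -> B) : Prop :=
  forall n (X : 'M[A]_n), mo_cone X -> mo_cone (map_mx f X).

Definition ucp (A B : uospace) (f : A -> B) : Prop :=
  cp f /\ f (uo_one A) = uo_one B.

Definition co_embedding (A B : uospace) (f : A -> B) : Prop :=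
  [/\ injective f, f (uo_one A) = uo_one B &
      forall n (X : 'M[A]_n), mo_cone X <-> mo_cone (map_mx f X)].

Definition co_iso (A B : uospace) (f : A -> B) : Prop := bijective f /\ co_embedding f.

Definition cb_norm (A B : opsys) (f : A -> B) : \bar R :=
  ereal_sup [set y | exists n (X : 'M[A]_n),
    os_norm X <= 1 /\ y = (os_norm (map_mx f X : 'M[B]_n))%:E].

End OperatorSystems.

Section ColumnHilbert.
Variables (R : realType) (n : nat).
Local Notation C := R[i].
Local Notation conjC := (@Num.conj C).

Definition cdot (v w : 'cV[C]_n) : C := \sum_i v i 0 * conjC (w i 0).

Lemma cdot_bilinear : bilinear_for *%R (conjC \; *%R) cdot.
Proof.
split=> [w a u v|v a u w] /=; rewrite /cdot mulr_sumr -big_split /=;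
  apply: eq_bigr => i _; rewrite !mxE.
  by rewrite mulrDl mulrA.
by rewrite rmorphD rmorphM mulrDr mulrCA.
Qed.

HB.instance Definition _ :=
  bilinear_isBilinear.Build C 'cV[C]_n 'cV[C]_n C *%R (conjC \; *%R) cdot cdot_bilinear.

Lemma cdot_hermitian v w : cdot v w = (-1) ^+ false * conjC (cdot w v).
Proof.
rewrite mul1r /cdot rmorph_sum; apply: eq_bigr => i _.
by rewrite rmorphM /= conjCK mulrC.
Qed.

HB.instance Definition _ :=
  isHermitianSesquilinear.Build C 'cV[C]_n false conjC cdot cdot_hermitian.

Lemma cdot_gt0 v : v != 0 -> 0 < cdot v v.
Proof.
have ge0 i : true -> 0 <= v i 0 * conjC (v i 0) by rewrite mul_conjC_ge0.
rewrite lt_def sumr_ge0 // andbT; apply: contra_neq => /eqP.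
rewrite psumr_eq0 // => /allP v0; apply/matrixP => i j; rewrite ord1 mxE.
by have := v0 i (mem_index_enum _); rewrite mul_conjC_eq0 => /eqP.
Qed.

HB.instance Definition _ := isDotProduct.Build C 'cV[C]_n cdot cdot_gt0.

Lemma Re_cdot (v : 'cV[C]_n) : complex.Re (cdot v v) =
  \sum_i (complex.Re (v i 0) ^+ 2 + complex.Im (v i 0) ^+ 2).
Proof.
rewrite /cdot raddf_sum; apply: eq_bigr => i _.
by case: (v i 0) => a b /=; rewrite mulrN opprK !expr2.
Qed.

Lemma cdot_coord (v : 'cV[C]_n) (i : 'I_n) :
  `|complex.Re (v i 0)| <= dot_norm cdot v /\ `|complex.Im (v i 0)| <= dot_norm cdot v.
Proof.
have s0 : 0 <= \sum_(j < n | j != i) (complex.Re (v j 0) ^+ 2 + complex.Im (v j 0) ^+ 2).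
  by apply: sumr_ge0 => j _; rewrite addr_ge0 ?sqr_ge0.
split; rewrite /dot_norm Re_cdot -sqrtr_sqr ler_wsqrtr // (bigD1 i) //= -addrA.
  by rewrite lerDl addr_ge0 ?sqr_ge0.
by rewrite addrCA lerDl addr_ge0 ?sqr_ge0.
Qed.

Lemma cdot_complete (u : nat -> 'cV[C]_n) :
  (forall e : R, 0 < e -> exists N, forall m n, (N <= m)%N -> (N <= n)%N ->
     dot_norm cdot (u m - u n) < e) ->
  exists l, forall e : R, 0 < e -> exists N, forall n, (N <= n)%N ->
    dot_norm cdot (u n - l) < e.
Proof.
move=> u_cauchy.
have cvg_coord (p : {additive C -> R}) : 
    (forall (v : 'cV[C]_n) i, `|p (v i 0)| <= dot_norm cdot v) ->
    forall i, cvgn (fun m => p (u m i 0)).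
  move=> pP i; apply: cauchy_cvg; apply: cauchy_exP => e e0.
  have [N HN] := u_cauchy e e0; exists (p (u N i 0)).
  exists N => // m /= Nm; rewrite /ball /= -raddfB.
  have := pP (u N - u m) i; rewrite !mxE => /le_lt_trans; apply; exact: HN.
have cr := cvg_coord (@complex.Re R) (fun v i => proj1 (cdot_coord v i)).
have ci := cvg_coord (@complex.Im R) (fun v i => proj2 (cdot_coord v i)).
exists (\col_i (limn (fun m => complex.Re (u m i 0)) +i*
                limn (fun m => complex.Im (u m i 0)))) => e e0.
set l := \col_i _.
have : (fun m => complex.Re (cdot (u m - l) (u m - l))) @ \oo --> (0 : R).
  have -> : (fun m => complex.Re (cdot (u m - l) (u m - l))) = fun m =>
      \sum_(i < n) ((complex.Re (u m i 0) - complex.Re (l i 0)) ^+ 2 +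
                    (complex.Im (u m i 0) - complex.Im (l i 0)) ^+ 2).
    apply/funext => m; rewrite Re_cdot; apply: eq_bigr => i _.
    by rewrite !mxE !raddfB.
  have z : (0 : R) = \sum_(i < n) (0 * 0 + 0 * 0).
    by rewrite big1 // => i _; rewrite mul0r addr0.
  rewrite [X in _ --> X]z; apply: cvg_big => [|i _]; first exact: add_continuous.
  have sq (p : C -> R) (a : R) : cvgn (fun m => p (u m i 0)) ->
      a = limn (fun m => p (u m i 0)) -> (p (u m i 0) - a) ^+ 2 @[m --> \oo] --> (0 * 0 : R).
    move=> pc ->; have pd : p (u m i 0) - limn (fun m => p (u m i 0)) @[m --> \oo] --> (0 : R).
      by apply/subr_cvg0.
    exact: (cvgM pd pd).
  by apply: cvgD; apply: sq; rewrite ?mxE //; [exact: cr|exact: ci].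
move=> /cvgrPdist_lt /(_ (e ^+ 2) (exprn_gt0 _ e0)) [N _ HN].
exists N => m Nm; have := HN m Nm; rewrite /= sub0r normrN => H.
rewrite -(ger0_norm (ltW e0)) -sqrtr_sqr /dot_norm ltr_sqrt ?exprn_gt0 //.
exact: le_lt_trans (ler_norm _) H.
Qed.

Lemma mulmx_bounded (A : 'M[C]_n) :
  exists M : R, forall v : 'cV[C]_n, dot_norm cdot (A *m v) <= M * dot_norm cdot v.
Proof.
pose c i := \sum_j (`|complex.Re (A i j)| + `|complex.Im (A i j)|).
exists (Num.sqrt (\sum_i (c i ^+ 2 + c i ^+ 2))) => v; set nv := dot_norm cdot v.
have nv0 : 0 <= nv by apply: sqrtr_ge0.
have c0 i : 0 <= c i by apply: sumr_ge0 => j _; rewrite addr_ge0.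
have vj j := cdot_coord v j.
have AvRe i : `|complex.Re ((A *m v) i 0)| <= c i * nv.
  rewrite mxE raddf_sum mulr_suml; apply: (le_trans (ler_norm_sum _ _ _)).
  apply: ler_sum => j _; have [vr vi] := vj j.
  case: (A i j) (v j 0) vr vi => [a b] [x y] /= vr vi.
  by apply: (le_trans (ler_normB _ _)); rewrite !normrM mulrDl lerD ?ler_wpM2l.
have AvIm i : `|complex.Im ((A *m v) i 0)| <= c i * nv.
  rewrite mxE raddf_sum mulr_suml; apply: (le_trans (ler_norm_sum _ _ _)).
  apply: ler_sum => j _; have [vr vi] := vj j.
  case: (A i j) (v j 0) vr vi => [a b] [x y] /= vr vi.
  by apply: (le_trans (ler_normD _ _)); rewrite !normrM mulrDl lerD ?ler_wpM2l.
have sq a i : `|a| <= c i * nv -> a ^+ 2 <= c i ^+ 2 * nv ^+ 2.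
  by move=> ?; rewrite -exprMn -real_normK ?num_real // lerXn2r ?nnegrE ?mulr_ge0.
rewrite -[X in _ * X]ger0_norm // -sqrtr_sqr -sqrtrM; last first.
  by apply: sumr_ge0 => i _; rewrite addr_ge0 ?sqr_ge0.
rewrite /dot_norm ler_wsqrtr // Re_cdot mulr_suml; apply: ler_sum => i _.
by rewrite mulrDl lerD ?sq.
Qed.

Definition column_hilbert : hilbert R := @Hilbert R 'cV[C]_n cdot cdot_complete.

Lemma cdot_adj (A : 'M[C]_n) (v w : 'cV[C]_n) :
  cdot ((A ^t conjC) *m v) w = cdot v (A *m w).
Proof.
rewrite /cdot; under eq_bigr do rewrite mxE mulr_suml.
under [RHS]eq_bigr do rewrite mxE rmorph_sum mulr_sumr.
rewrite exchange_big; apply: eq_bigr => i _; apply: eq_bigr => j _.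
by rewrite !mxE rmorphM mulrCA mulrA.
Qed.

Lemma mulmx_inj (A : 'M[C]_n) : (forall v : 'cV[C]_n, A *m v = 0) -> A = 0.
Proof.
move=> A0; apply/matrixP => i j; have /matrixP/(_ i 0) := A0 (delta_mx j 0).
rewrite !mxE (bigD1 j) //= big1 ?addr0 => [|k kj]; rewrite !mxE.
  by rewrite !eqxx mulr1.
by rewrite (negPf kj) mulr0.
Qed.

Lemma mulmx_adj (A : 'M[C]_n) :
  exists B : 'M[C]_n, forall v w : 'cV[C]_n, cdot (B *m v) w = cdot v (A *m w).
Proof. by exists (A ^t conjC) => v w; rewrite cdot_adj. Qed.

Definition matn : opsys R := @OpSys R 'M[C]_n column_hilbert
  (@mulmx C n n 1) mulmx_inj mulmx_bounded 1%:M (@mul1mx C n 1)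
  mulmx_adj.

Record matrix_system := MatrixSystem {
  ms_space :> {vspace 'M[C]_n};
  ms_one : 1%:M \in ms_space;
  ms_star : forall A, A \in ms_space -> A ^t conjC \in ms_space
}.

Section MatrixSystem.
Variable P : matrix_system.

Definition ms_act (A : subvs_of P) (v : 'cV[C]_n) : 'cV[C]_n := vsval A *m v.

Lemma ms_act_bilinear : bilinear_for *:%R *:%R ms_act.
Proof.
split=> [v a A B|A a v w]; rewrite /ms_act; last exact: linearP.
by rewrite linearP linearPl.
Qed.

HB.instance Definition _ := bilinear_isBilinear.Build C (subvs_of P) 'cV[C]_n
  'cV[C]_n *:%R *:%R ms_act ms_act_bilinear.

Lemma ms_act_inj A : (forall v, ms_act A v = 0) -> A = 0.
Proof. by move=> A0; apply/val_inj/mulmx_inj. Qed.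

Lemma ms_act_one v : ms_act (Subvs (ms_one P)) v = v.
Proof. exact: mul1mx. Qed.

Lemma ms_act_adj A : exists B, forall v w, cdot (ms_act B v) w = cdot v (ms_act A w).
Proof.
by exists (Subvs (ms_star (subvsP A))) => v w; rewrite /ms_act /= cdot_adj.
Qed.

Definition ms_opsys : opsys R := @OpSys R (subvs_of P) column_hilbert
  ms_act ms_act_inj (fun A => mulmx_bounded (vsval A)) (Subvs (ms_one P))
  ms_act_one ms_act_adj.
End MatrixSystem.

End ColumnHilbert.

Section Dual.
Variable R : realType.
Local Notation C := R[i].

Section BoundedFunctionals.
Variable A : nmospace R.

Definition bounded_functional : {pred A -> C^o} := fun f =>
  `[< linear f /\ exists M : R, forall x, `|f x| <= (M * nmo_norm x)%:C >].

Lemma bounded_functional_closed : submod_closed bounded_functional.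
Proof.
split=> [|a f g /asboolP[lf [M fM]] /asboolP[lg [N gN]]]; apply/asboolP.
  split=> [a x y|]; first by rewrite /= scaler0 addr0.
  by exists 0 => x; rewrite /= normr0 mul0r.
split=> [b x y|].
  rewrite -[LHS]/(a *: f (b *: x + y) + g (b *: x + y)).
  rewrite -[RHS]/(b *: (a *: f x + g x) + (a *: f y + g y)).
  by rewrite lf lg !scalerDr !scalerA (mulrC a b) addrACA.
have RD (r s : R) : (r + s)%:C = r%:C + s%:C by rewrite rmorphD.
have RM (r : R) : (complex.Re `|a| * r)%:C = `|a| * r%:C.
  by rewrite -[in RHS](RRe_real (normr_real a)) -rmorphM.
exists (complex.Re `|a| * M + N) => x; rewrite mulrDl -mulrA RD RM.
apply: (le_trans (ler_normD _ _)); rewrite lerD //.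
by rewrite -[(a *: f) x]/(a * f x) normrM ler_wpM2l.
Qed.

HB.instance Definition _ := GRing.isSubmodClosed.Build C (A -> C^o)
  bounded_functional bounded_functional_closed.

Record functional := Functional {
  functional_val :> A -> C^o;
  functionalP : functional_val \in bounded_functional
}.

HB.instance Definition _ := [isSub for functional_val].
HB.instance Definition _ := [Choice of functional by <:].
HB.instance Definition _ := [SubChoice_isSubLmodule of functional by <:].

Lemma functional_linear (f : functional) : linear f.
Proof. by have /asboolP[] := functionalP f. Qed.

HB.instance Definition _ (f : functional) :=
  GRing.isLinear.Build C A C^o *:%R (functional_val f) (functional_linear f).

Definition functional_norm (f : functional) : R :=
  inf [set M : R | 0 <= M /\ forall x, `|f x| <= (M * nmo_norm x)%:C].

Definition functional_cone n : set 'M[functional]_n :=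
  [set F : 'M[functional]_n | cp (fun x : A => \matrix_(i, j) F i j x : matn R n)].

Lemma functional_norm_ge0 f : 0 <= functional_norm f.
Proof.
rewrite /functional_norm; set E := [set M : R | _ /\ _].
have [->|/set0P E0] := eqVneq E set0; first by rewrite inf0.
by apply: lb_le_inf => // M [].
Qed.

Definition dual : nmospace R :=
  @NMOSpace R (@MOSpace R functional functional_cone) functional_norm
    functional_norm_ge0.

Lemma functional_le (f : functional) (x : A) :
  `|f x| <= (nmo_norm x * functional_norm f)%:C.
Proof.
have /asboolP[_ [M0 fM0]] := functionalP f.
rewrite normc_def lecR; set a := Num.sqrt _.
have le_a M : `|f x| <= (M * nmo_norm x)%:C -> a <= M * nmo_norm x.
  by rewrite normc_def lecR.
have := nmo_norm_ge0 x; rewrite le_eqVlt => /predU1P[x0|x_gt0].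
  by rewrite -x0 mul0r; apply: le_trans (le_a _ (fM0 x)) _; rewrite -x0 mulr0.
rewrite mulrC -ler_pdivrMr // /functional_norm; apply: lb_le_inf.
  exists (Num.max 0 M0); split=> [|y]; first by rewrite le_max lexx.
  by apply: le_trans (fM0 y) _; rewrite lecR ler_wpM2r ?nmo_norm_ge0 // le_max lexx orbT.
by move=> M [_ /(_ x)/le_a aM]; rewrite ler_pdivrMr.
Qed.

End BoundedFunctionals.

Section Bidual.
Variable A : nmospace R.

Lemma eval_bounded (x : A) :
  (fun f : functional A => f x : C^o) \in @bounded_functional (dual A).
Proof.
apply/asboolP; split=> [a f g|]; first by [].
exists (nmo_norm x) => f.
exact: functional_le.
Qed.

Definition eval_at (x : A) : dual (dual A) := Functional (eval_bounded x).

End Bidual.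

Definition bidual (S : opsys R) : uospace R :=
  @UOSpace R (dual (dual (os_nmospace S))) (@eval_at (os_nmospace S) (os_one S)).

Definition bidual_embedding (S : opsys R) (x : S) : bidual S :=
  @eval_at (os_nmospace S) x.

End Dual.

Section TensorMap.
Variables (K : fieldType) (A B A' B' : lmodType K).
Variables (f : {linear A -> A'}) (g : {linear B -> B'}).

Definition tens_comp (a : A) (b : B) : tensor A' B' := tens (f a) (g b).

Lemma tens_comp_bilinear : bilinear_for *:%R *:%R tens_comp.
Proof.
by split=> [b c x y|a c x y]; rewrite /tens_comp linearP (linearPl, linearPr).
Qed.

HB.instance Definition _ := bilinear_isBilinear.Build K A B (tensor A' B')
  *:%R *:%R tens_comp tens_comp_bilinear.

Definition tensor_map : {linear tensor A B -> tensor A' B'} := tensor_lift tens_comp.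
End TensorMap.

Section TensorMatrixMap.
Variables (K : fieldType) (A B : lmodType K) (p q : nat).
Variables (f : {linear A -> 'M[K]_p}) (g : {linear B -> 'M[K]_q}).

Definition tensmx_comp (a : A) (b : B) : 'M[K]_(p * q) := f a *t g b.

Lemma tensmx_comp_bilinear : bilinear_for *:%R *:%R tensmx_comp.
Proof.
split=> [b c x y|a c x y]; rewrite /tensmx_comp linearP; apply/matrixP => i j;
  rewrite !mxE.
  by rewrite mulrDl mulrA.
by rewrite mulrDr mulrCA.
Qed.

HB.instance Definition _ := bilinear_isBilinear.Build K A B 'M[K]_(p * q)
  *:%R *:%R tensmx_comp tensmx_comp_bilinear.

Definition tensor_matrix_map : {linear tensor A B -> 'M[K]_(p * q)} :=
  tensor_lift tensmx_comp.
End TensorMatrixMap.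

Section Main.
Variable R : realType.
Local Notation C := R[i].
Local Notation conjC := (@Num.conj C).

(* e (u (x) I_n) in M_n(V). *)
Definition unit_diag (V : lmodType C) (u : V) n (e : R) : 'M[V]_n :=
  \matrix_(i, j) ((e%:C *: u) *+ (i == j)).

Section Products.
Variables A B : uospace R.

Definition min_cone n : set 'M[tensor A B]_n := [set X |
  forall p q (phi : {linear A -> matn R p}) (psi : {linear B -> matn R q}),
    ucp phi -> ucp psi ->
    @mo_cone R (matn R (p * q)) n (map_mx (tensor_matrix_map phi psi) X)].

Definition tens_min : uospace R :=
  @UOSpace R (@MOSpace R (tensor A B) min_cone) (tens (uo_one A) (uo_one B)).

Definition tens_mx p q (S : 'M[A]_p) (T : 'M[B]_q) : 'M[tensor A B]_(p * q) :=
  \matrix_(i, j) tens (S (mxtens_unindex i).1 (mxtens_unindex j).1)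
                      (T (mxtens_unindex i).2 (mxtens_unindex j).2).

(* X^* Y X for a scalar matrix X. *)
Definition compress (V : lmodType C) m n (X : 'M[C]_(m, n)) (Y : 'M[V]_m) : 'M[V]_n :=
  \matrix_(i, j) \sum_k \sum_l (conjC (X k i) * X l j) *: Y k l.

Definition pre_max_cone n : set 'M[tensor A B]_n := [set Y |
  exists p q (S : 'M[A]_p) (T : 'M[B]_q) (X : 'M[C]_(p * q, n)),
    [/\ mo_cone S, mo_cone T & Y = compress X (tens_mx S T)]].

Definition max_cone n : set 'M[tensor A B]_n := [set Y |
  forall e : R, 0 < e -> pre_max_cone (Y + unit_diag (tens (uo_one A) (uo_one B)) n e)].

Definition tens_max : uospace R :=
  @UOSpace R (@MOSpace R (tensor A B) max_cone) (tens (uo_one A) (uo_one B)).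
End Products.

Section Quotient.
Variables (n : nat) (J : {vspace 'M[C]_n}).

(* A 1 x 1 matrix encodes a single element of M_n. *)
Definition null_subspace : Prop :=
  (forall x, x \in J -> x ^t conjC \in J) /\
  (forall x, x \in J -> @mo_cone R (matn R n) 1 (const_mx x) -> x = 0).

Definition matn_quot_car : lmodType C := lquot (pred_of_vspace J).

Definition matn_quot_one : matn_quot_car := lquot_pi (pred_of_vspace J) 1%:M.

Definition matn_quot_cone k : set 'M[matn_quot_car]_k := [set X |
  forall e : R, 0 < e -> exists2 s : 'M[matn R n]_k, mo_cone s &
    X + unit_diag matn_quot_one k e = map_mx (lquot_pi (pred_of_vspace J)) s].

Definition matn_quot : uospace R :=
  @UOSpace R (@MOSpace R matn_quot_car matn_quot_cone) matn_quot_one.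
End Quotient.

Definition injective_opsys (I : opsys R) : Prop :=
  forall (A B : opsys R) (j : {linear A -> B}), co_embedding j ->
  forall f : {linear A -> I}, ucp f ->
  exists2 g : {linear B -> I}, ucp g & forall a, g (j a) = f a.

(* Hamana's injective envelope: a minimal injective operator system containing
   S, where j ranges over the operator systems between S and I. *)
Definition injective_envelope (S I : opsys R) (kappa : {linear S -> I}) : Prop :=
  [/\ co_embedding kappa, injective_opsys I &
      forall (W : opsys R) (j : {linear W -> I}), co_embedding j ->
        injective_opsys W -> (forall s, exists w, j w = kappa s) ->
        forall x, exists w, j w = x].

Definition tens_el (S I : opsys R) (kappa : {linear S -> I}) (T : opsys R) : uospace R :=
  @UOSpace R (@MOSpace R (tensor S T) (fun n => [set X |
      @mo_cone R (tens_max I T) n (map_mx (tensor_map kappa idfun) X)]))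
    (tens (uo_one S) (uo_one T)).

Definition wep (S I : opsys R) (kappa : {linear S -> I}) : Prop :=
  exists2 Phi : {linear I -> bidual S}, ucp Phi &
    forall s, Phi (kappa s) = bidual_embedding s.

Definition el_max_nuclear (S I : opsys R) (kappa : {linear S -> I}) : Prop :=
  forall T : opsys R, @co_iso R (tens_el kappa T) (tens_max S T) idfun.

End Main.

(* Main.v *)
Require Import Defs.
From HB Require Import structures.
From mathcomp Require Import all_boot all_order all_algebra.
From mathcomp Require Import finmap.
From mathcomp Require Import all_classical all_reals ereal.
From mathcomp Require Import complex mxtens.
From mathcomp Require Import -(notations) monalg.
From mathcomp Require Import ring lra.

Set Implicit Arguments.
Unset Strict Implicit.
Unset Printing Implicit Defensive.

Import Order.TTheory GRing.Theory Num.Theory.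

Local Open Scope ring_scope.

(** The implications are proved in the order (1) -> (3) -> (2) -> (4) -> (1).

    (1) -> (3): if an element of [S (x) T] is positive in [I (x)max T] but not in
    [S (x)max T], separate it from the cone of the latter by a functional [f]. For every [t],
    [f (. (x) t)] is a functional on [S], and [b (x) t |-> Phi b (f (. (x) t))] is a
    positive functional on [I (x)max T] extending [f], a contradiction.

    (3) -> (2): [M_n / J] is a concrete operator system, on the Hilbert sum of all its ucp
    maps into matrix algebras, so (3) applies to it. An element of the minimal cone of
    [S (x) M_n / J] induces a cp map from a matrix system to [S], hence to [I]; by
    injectivity it extends to the full matrix algebra, and the Choi matrix of the extension
    shows that the element is positive in [I (x)max M_n / J].

    (2) -> (4): let [J] be the annihilator of the matrix system. A cp map on it is an
    element of the minimal cone of [S (x) M_n / J]; an approximate positive lift of that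
    element to [S (x) M_n] is the Choi matrix of an approximate extension.

    (4) -> (1): by Krein, it suffices that the evaluation on [S (x) S^*] be positive at
    the elements equal to [sum_kl P_kl (x) F_kl] in [I (x) S^*], with [P] and [F] positive.
    After a perturbation [F] may be taken unital, so that [F(S)] is a matrix system, on
    which the element induces a cp map to [S]. The Choi matrix of an approximate
    extension given by (4) pairs nonnegatively with [F]. *)

(** * Positive semidefinite matrices *)

(** The duality behind (2) and (4): under a bilinear trace pairing the dual of [M_n / J] is the
    annihilator of [J] in [M_n]. An element of [S (x) M_n / J] is thus a linear map from this
    annihilator to [S], and positivity in the minimal tensor product is complete positivity of that
    map. If [J] is the annihilator of a matrix system, this dual is the system itself. For a general
    null-subspace the dual need not contain the identity; a positive definite [D] in it takes its
    place, and conjugation by [B], where [D = B^* B], leads back to a matrix system. All separations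
    are algebraic: an order unit replaces a topology. They control only real parts of functionals,
    so the cones are first enlarged by all skew-hermitian elements, which makes the functionals real
    on hermitian ones; boundedness has to be recovered afterwards from positivity. In (4) -> (1),
    [S^*] has in general no order unit, and a perturbation must stay in the image of [S (x) S^*]; an
    additional corner takes care of this. *)

Definition mklin (K : nzRingType) (U V : lmodType K) (f : U -> V)
  (lf : linear f) : {linear U -> V} := HB.pack f (GRing.isLinear.Build K U V *:%R f lf).

Section Psd.
Variable C : numClosedFieldType.
Local Notation conjC := (@Num.conj C).

(** Polarization: applied to two opposite off-diagonal values of a form with real diagonal, it gives
    hermitian symmetry, for scalar matrices in [psd_herm] and for operators in [form_real_herm]. *)
Lemma conj_polar (x y : C) :
  x + y \is Num.real -> 'i * (x - y) \is Num.real -> y = conjC x.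
Proof.
move=> /CrealP; rewrite rmorphD /= => e1 /CrealP.
rewrite rmorphM rmorphB /= conjCi => e2.
have e3 : conjC x - conjC y = y - x.
  apply: (mulfI (neq0Ci C)); rewrite -[LHS]opprK -mulNr e2 -mulrN; congr (_ * _).
  by rewrite opprB.
have : conjC x *+ 2 = y *+ 2.
  rewrite !mulr2n -{1}[conjC x](subrK (conjC y)) e3.
  have -> : conjC x = x + y - conjC y by rewrite -e1 addrK.
  by ring.
by move=> e; apply: (mulIf (_ : 2%:R != 0 :> C)); rewrite ?pnatr_eq0 // !mulr_natr.
Qed.

(** The index set is any finite type, so that blocks, direct sums and products of index sets need no
    renumbering. In [C], [0 <= z] includes that [z] is real, whence hermitian symmetry
    ([psd_herm]). *)
Definition psd (I : finType) (M : I -> I -> C) :=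
  forall c : I -> C, 0 <= \sum_i \sum_j conjC (c i) * M i j * c j.

Lemma sum_two (I : finType) (i0 j0 : I) (a b : C) (f : I -> C) :
  \sum_i (a *+ (i == i0) + b *+ (i == j0)) * f i = a * f i0 + b * f j0.
Proof.
under eq_bigr do rewrite mulrDl.
rewrite big_split /=; congr (_ + _).
  rewrite (bigD1 i0) //= eqxx big1 ?addr0 // => i /negPf ->; by rewrite mul0r.
rewrite (bigD1 j0) //= eqxx big1 ?addr0 // => i /negPf ->; by rewrite mul0r.
Qed.

Lemma psd_two (I : finType) (M : I -> I -> C) : psd M -> forall i j a b,
  0 <= conjC a * a * M i i + conjC a * b * M i j + conjC b * a * M j i + conjC b * b * M j j.
Proof.
move=> pM i j a b; have := pM (fun k => a *+ (k == i) + b *+ (k == j)).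
congr (_ <= _).
have E k : \sum_l conjC (a *+ (k == i) + b *+ (k == j)) * M k l *
    (a *+ (l == i) + b *+ (l == j)) =
    (conjC a *+ (k == i) + conjC b *+ (k == j)) * (a * M k i + b * M k j).
  rewrite -(sum_two i j a b (M k)) mulr_sumr; apply: eq_bigr => l _.
  by rewrite rmorphD !rmorphMn /= -mulrA [M k l * _]mulrC.
under eq_bigr do rewrite E.
rewrite sum_two; by ring.
Qed.

Lemma psd_herm (I : finType) (M : I -> I -> C) : psd M ->
  forall i j, M j i = conjC (M i j).
Proof.
move=> pM i j.
have dr k : M k k \is Num.real.
  have := psd_two pM k k 1 0; rewrite !(rmorph0, rmorph1, mul0r, mulr0, mul1r, addr0).
  exact: ger0_real.
apply: conj_polar.
  have := ger0_real (psd_two pM i j 1 1); rewrite rmorph1 !mul1r => h.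
  have -> : M i j + M j i = M i i + M i j + M j i + M j j - M i i - M j j.
    by ring.
  by rewrite !rpredB.
have := ger0_real (psd_two pM i j 1 'i); rewrite rmorph1 conjCi !mul1r mulr1 => h.
rewrite mulrBr -mulNr.
have -> : 'i * M i j + - 'i * M j i =
   M i i + 'i * M i j + - 'i * M j i + - 'i * 'i * M j j - M i i - M j j.
  rewrite !mulNr -expr2 sqrCi; by ring.
by rewrite !rpredB.
Qed.

(** By the spectral theorem [M = P^* d P] with [P] unitary and [d >= 0]; [B] is the square root of
    [d] times [P]. The Schur product arguments below all rest on this factorization. *)
Lemma psd_factor (I : finType) (M : I -> I -> C) : psd M ->
  exists B : I -> I -> C, forall i j, M i j = \sum_k conjC (B k i) * B k j.
Proof.
move=> pM; set n := #|I|.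
pose A : 'M[C]_n := \matrix_(i, j) M (enum_val i) (enum_val j).
have Aherm : A \is hermsymmx.
  apply/is_hermitianmxP; rewrite expr0 scale1r; apply/matrixP => i j.
  by rewrite !mxE -psd_herm.
have := hermitian_normalmx Aherm => /orthomx_spectralP.
set P := spectralmx A; set d := spectral_diag A => AE.
have Pu : P \is unitarymx by apply: spectral_unitarymx.
have d0 k : 0 <= d 0 k.
  have -> : d 0 k = (P *m A *m invmx P) k k.
    rewrite AE !mulmxA mulmxV ?spectral_unit // mul1mx -mulmxA mulmxV ?spectral_unit //.
    by rewrite mulmx1 mxE eqxx.
  rewrite invmx_unitary // mxE.
  have := pM (fun i => conjC (P k (enum_rank i))).
  rewrite exchange_big (reindex_onto (@enum_val I _) enum_rank) /=; last first.
    by move=> i _; rewrite enum_rankK.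
  congr (_ <= _); apply: eq_big => [i|i _]; first by rewrite enum_valK eqxx.
  rewrite !mxE mulr_suml (reindex_onto (@enum_val I _) enum_rank) /=; last first.
    by move=> j _; rewrite enum_rankK.
  apply: eq_big => [j|j _]; first by rewrite enum_valK eqxx.
  by rewrite !mxE !enum_valK conjCK.
exists (fun k i => sqrtC (d 0 (enum_rank k)) * P (enum_rank k) (enum_rank i)) => i j.
have -> : M i j = A (enum_rank i) (enum_rank j) by rewrite mxE !enum_rankK.
rewrite AE invmx_unitary // mxE.
rewrite (reindex_onto enum_rank (@enum_val I _)) /=; last by move=> k _; rewrite enum_valK.
apply: eq_big => [k|k _]; first by rewrite enum_rankK eqxx.
rewrite mxE (bigD1 (enum_rank k)) //= big1 ?addr0 => [|l lk]; rewrite !mxE; last first.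
  by rewrite (negPf lk) mulr0.
rewrite eqxx mulr1n rmorphM /=.
have -> : conjC (sqrtC (d 0 (enum_rank k))) = sqrtC (d 0 (enum_rank k)).
  by apply: geC0_conj; rewrite sqrtC_ge0.
by rewrite mulrACA -expr2 sqrtCK mulrA [_ * d _ _]mulrC.
Qed.
End Psd.

(** * Positive matrices over an operator system *)

Section Opsys.
Variable R : realType.
Local Notation C := R[i].
Local Notation conjC := (@Num.conj C).

Lemma sum_prod (V : nmodType) (I J : finType) (f : I * J -> V) :
  \sum_u f u = \sum_i \sum_j f (i, j).
Proof. by rewrite pair_bigA; apply: eq_bigr => -[]. Qed.

Section Dot.
Variable H : hilbert R.
Implicit Types x y z : H.

Lemma dotDl x y z : h_dot H (x + y) z = h_dot H x z + h_dot H y z.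
Proof. exact: linearDl. Qed.
Lemma dotDr x y z : h_dot H z (x + y) = h_dot H z x + h_dot H z y.
Proof. exact: linearDr. Qed.
Lemma dotNl x z : h_dot H (- x) z = - h_dot H x z.
Proof. exact: linearNl. Qed.
Lemma dotNr x z : h_dot H z (- x) = - h_dot H z x.
Proof. exact: linearNr. Qed.
Lemma dotBl x y z : h_dot H (x - y) z = h_dot H x z - h_dot H y z.
Proof. exact: linearBl. Qed.
Lemma dotBr x y z : h_dot H z (x - y) = h_dot H z x - h_dot H z y.
Proof. exact: linearBr. Qed.
Lemma dot0l z : h_dot H 0 z = 0.
Proof. exact: linear0l. Qed.
Lemma dot0r z : h_dot H z 0 = 0.
Proof. exact: linear0r. Qed.
Lemma dotZl a x z : h_dot H (a *: x) z = a * h_dot H x z.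
Proof. by rewrite linearZl_LR. Qed.
Lemma dotZr a x z : h_dot H z (a *: x) = conjC a * h_dot H z x.
Proof. by rewrite linearZr_LR. Qed.
Lemma dot_suml I (r : seq I) (P : pred I) (f : I -> H) z :
  h_dot H (\sum_(i <- r | P i) f i) z = \sum_(i <- r | P i) h_dot H (f i) z.
Proof. exact: linear_sumlz. Qed.
Lemma dot_sumr I (r : seq I) (P : pred I) (f : I -> H) z :
  h_dot H z (\sum_(i <- r | P i) f i) = \sum_(i <- r | P i) h_dot H z (f i).
Proof. exact: linear_sumr. Qed.
Lemma dotC x y : h_dot H y x = conjC (h_dot H x y).
Proof. by rewrite (hermC (h_dot H)) expr0 mul1r. Qed.
Lemma dot_ge0 x : 0 <= h_dot H x x.
Proof. exact: dnorm_ge0. Qed.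
Lemma dot_eq0 x : (h_dot H x x == 0) = (x == 0).
Proof. exact: dnorm_eq0. Qed.
Lemma dot_inj x y : (forall z, h_dot H x z = h_dot H y z) -> x = y.
Proof.
by move=> e; apply/eqP; rewrite -subr_eq0 -dot_eq0 dotBl e subrr.
Qed.
End Dot.

Section Act.
Variable S : opsys R.
Local Notation H := (os_hilb S).
Lemma actDl (x y : os_car S) (v : H) : os_act S (x + y) v = os_act S x v + os_act S y v.
Proof. exact: linearDl. Qed.
Lemma actDr (x : os_car S) (v w : H) : os_act S x (v + w) = os_act S x v + os_act S x w.
Proof. exact: linearDr. Qed.
Lemma actNl (x : os_car S) (v : H) : os_act S (- x) v = - os_act S x v.
Proof. exact: linearNl. Qed.
Lemma actNr (x : os_car S) (v : H) : os_act S x (- v) = - os_act S x v.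
Proof. exact: linearNr. Qed.
Lemma actBl (x y : os_car S) (v : H) : os_act S (x - y) v = os_act S x v - os_act S y v.
Proof. exact: linearBl. Qed.
Lemma act0l (v : H) : os_act S 0 v = 0.
Proof. exact: linear0l. Qed.
Lemma act0r (x : os_car S) : os_act S x 0 = 0.
Proof. exact: linear0r. Qed.
Lemma actZl a (x : os_car S) (v : H) : os_act S (a *: x) v = a *: os_act S x v.
Proof. by rewrite linearZl_LR. Qed.
Lemma actZr a (x : os_car S) (v : H) : os_act S x (a *: v) = a *: os_act S x v.
Proof. by rewrite linearZr_LR. Qed.
Lemma act_suml I (r : seq I) (P : pred I) (f : I -> os_car S) (v : H) :
  os_act S (\sum_(i <- r | P i) f i) v = \sum_(i <- r | P i) os_act S (f i) v.
Proof. exact: linear_sumlz. Qed.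
Lemma act_sumr I (r : seq I) (P : pred I) (f : I -> H) (x : os_car S) :
  os_act S x (\sum_(i <- r | P i) f i) = \sum_(i <- r | P i) os_act S x (f i).
Proof. exact: linear_sumr. Qed.
End Act.

Section Cone.
Variable S : opsys R.
Local Notation H := (os_hilb S).
Implicit Types I J : finType.

(* [os_cone] for matrices indexed by an arbitrary finite type. *)
Definition gcone I (X : I -> I -> os_car S) := forall xi : I -> H,
  0 <= \sum_i \sum_j h_dot H (os_act S (X i j) (xi j)) (xi i).

Lemma os_coneP n (X : 'M[os_car S]_n) : os_cone X <-> gcone (fun i j => X i j).
Proof.
have E xi : sum_dot (amp_act X xi) xi =
    \sum_i \sum_j h_dot H (os_act S (X i j) (xi j)) (xi i).
  by apply: eq_bigr => i _; rewrite dot_suml.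
by split=> h xi; have := h xi; rewrite /= E.
Qed.

Lemma eq_gcone I (X Y : I -> I -> os_car S) : (forall i j, X i j = Y i j) ->
  gcone X -> gcone Y.
Proof.
move=> e h xi; have := h xi; congr (_ <= _).
by apply: eq_bigr => i _; apply: eq_bigr => j _; rewrite e.
Qed.

Lemma gcone_compress I J (X : I -> I -> os_car S) (A : I -> J -> C) : gcone X ->
  gcone (fun j j' => \sum_i \sum_i' (conjC (A i j) * A i' j') *: X i i').
Proof.
move=> h xi; have := h (fun i => \sum_j A i j *: xi j); congr (_ <= _).
transitivity (\sum_i \sum_i' \sum_j \sum_j'
   (conjC (A i j) * A i' j') * h_dot H (os_act S (X i i') (xi j')) (xi j)).
  apply: eq_bigr => i _; apply: eq_bigr => i' _.
  rewrite act_sumr dot_sumr; apply: eq_bigr => j _.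
  rewrite dotZr dot_suml mulr_sumr; apply: eq_bigr => j' _.
  by rewrite actZr dotZl mulrA.
under eq_bigr do rewrite exchange_big.
rewrite exchange_big; apply: eq_bigr => j _.
under eq_bigr do rewrite exchange_big.
rewrite exchange_big; apply: eq_bigr => j' _.
rewrite act_suml dot_suml; apply: eq_bigr => i _.
rewrite act_suml dot_suml; apply: eq_bigr => i' _.
by rewrite actZl dotZl.
Qed.

Lemma sum_delta (V : nmodType) I (i0 : I) (f : I -> V) :
  \sum_i f i *+ (i == i0) = f i0.
Proof.
by rewrite (bigD1 i0) //= eqxx big1 ?addr0 // => i /negPf ->; rewrite mulr0n.
Qed.

Lemma gcone_reindex I J (h : J -> I) (X : I -> I -> os_car S) : gcone X ->
  gcone (fun j j' => X (h j) (h j')).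
Proof.
move=> /(gcone_compress (fun i j => (i == h j)%:R)); apply: eq_gcone => j j'.
rewrite -[RHS](sum_delta (h j) (fun i => X i (h j'))); apply: eq_bigr => i _.
rewrite -(sum_delta (h j') (fun i' => X i i')) -sumrMnl; apply: eq_bigr => i' _.
rewrite conjC_nat -natrM scaler_nat mulnC mulrnA //.
Qed.

Lemma gcone_add I (X Y : I -> I -> os_car S) : gcone X -> gcone Y ->
  gcone (fun i j => X i j + Y i j).
Proof.
move=> hX hY xi; have := addr_ge0 (hX xi) (hY xi); congr (_ <= _).
rewrite -big_split; apply: eq_bigr => i _; rewrite -big_split; apply: eq_bigr => j _.
by rewrite actDl dotDl.
Qed.

Lemma gcone_sum I (K : finType) (X : K -> I -> I -> os_car S) : (forall k, gcone (X k)) ->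
  gcone (fun i j => \sum_k X k i j).
Proof.
move=> h xi; apply: (@le_trans _ _
  (\sum_k \sum_i \sum_j h_dot H (os_act S (X k i j) (xi j)) (xi i))).
  by apply: sumr_ge0 => k _; exact: h.
rewrite exchange_big /=; under eq_bigr do rewrite exchange_big /=.
rewrite le_eqVlt; apply/orP; left; apply/eqP.
by apply: eq_bigr => i _; apply: eq_bigr => j _; rewrite act_suml dot_suml.
Qed.

Lemma gcone_scale I (a : C) (X : I -> I -> os_car S) : 0 <= a -> gcone X ->
  gcone (fun i j => a *: X i j).
Proof.
move=> a0 h xi; have := mulr_ge0 a0 (h xi); congr (_ <= _).
rewrite mulr_sumr; apply: eq_bigr => i _; rewrite mulr_sumr; apply: eq_bigr => j _.
by rewrite actZl dotZl.
Qed.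

(** One half of Choi's theorem: a map on matrices with positive Choi matrix [X] is cp. Factoring [M]
    as [B^* B] turns the sum into a sum of compressions of [X]. *)
Lemma gcone_schur I J (M : I * J -> I * J -> C) (X : J -> J -> os_car S) :
  psd M -> gcone X ->
  gcone (fun u v => \sum_a \sum_b M (u, a) (v, b) *: X a b).
Proof.
move=> /psd_factor[B BE] hX.
have : gcone (fun u v => \sum_k \sum_a \sum_b
    (conjC (B k (u, a)) * B k (v, b)) *: X a b).
  apply: gcone_sum => k.
  exact: (gcone_compress (fun a u => B k (u, a)) hX).
apply: eq_gcone => u v; rewrite exchange_big; apply: eq_bigr => a _.
by rewrite exchange_big; apply: eq_bigr => b _; rewrite BE scaler_suml.
Qed.

Definition os_pos (s : os_car S) := forall v : H, 0 <= h_dot H (os_act S s v) v.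

Lemma os_posP s : os_pos s -> gcone (fun _ _ : 'I_1 => s).
Proof. by move=> h xi; rewrite !big_ord1; exact: h. Qed.

Lemma gcone_diag I (X : I -> I -> os_car S) i : gcone X -> os_pos (X i i).
Proof.
move=> h v; have := h (fun k => v *+ (k == i)); congr (_ <= _).
rewrite (bigD1 i) //= [X in _ + X]big1 ?addr0 => [|k ki].
  rewrite (bigD1 i) //= [X in _ + X]big1 ?addr0 => [|k ki].
    by rewrite eqxx.
  by rewrite (negPf ki) act0r dot0l.
by rewrite big1 // => j _; rewrite (negPf ki) dot0r.
Qed.

Lemma gcone_pos I (M : I -> I -> C) s : psd M -> os_pos s ->
  gcone (fun i j => M i j *: s).
Proof.
move=> /psd_factor[B BE] hs.
have hs' : gcone (fun _ _ : 'I_1 => s) by move=> xi; rewrite !big_ord1; exact: hs.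
have : gcone (fun u v => \sum_k \sum_(a < 1) \sum_(b < 1)
    (conjC (B k u) * B k v) *: s).
  apply: gcone_sum => k; exact: (gcone_compress (fun a u => B k u) hs').
apply: eq_gcone => i j; rewrite BE scaler_suml; apply: eq_bigr => k _.
by rewrite !big_ord1.
Qed.

End Cone.

(** The cones of an abstract [A] carry no axioms, not even invariance under permutations, so an
    enumeration of [I] is fixed; over a concrete operator system the choice is immaterial
    ([os_mconeP]). *)
Definition mcone (A : mospace R) (I : finType) (X : I -> I -> A) : Prop :=
  @mo_cone R A #|I| (\matrix_(i, j) X (enum_val i) (enum_val j)).

Lemma cp_mcone (A B : mospace R) (f : A -> B) (I : finType) (X : I -> I -> A) :
  cp f -> mcone X -> mcone (fun i j => f (X i j)).
Proof.
move=> cf /cf; congr mo_cone; apply/matrixP => i j.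
by rewrite !mxE.
Qed.

Lemma mo_coneP (A : mospace R) n (X : 'M[A]_n) :
  mo_cone X <-> mcone (fun i j => X i j).
Proof.
rewrite /mcone.
suff : forall m (e : m = n), mo_cone X <->
  mo_cone (\matrix_(i < m, j < m) X (cast_ord e i) (cast_ord e j)).
  move=> /(_ _ (card_ord n)); set Y := \matrix_(_, _) _; set Z := \matrix_(_, _) _.
  suff -> : Y = Z by [].
  by apply/matrixP => i j; rewrite !mxE !enum_val_ord.
move=> m e; subst m.
suff -> : (\matrix_(i < n, j < n) X (cast_ord (erefl n) i) (cast_ord (erefl n) j)) = X by [].
by apply/matrixP => i j; rewrite mxE !cast_ord_id.
Qed.

Lemma os_mconeP (S : opsys R) (I : finType) (X : I -> I -> os_car S) :
  mcone (A := os_mospace S) X <-> gcone X.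
Proof.
rewrite /mcone; split.
  move=> /os_coneP /(gcone_reindex (@enum_rank I)).
  by apply: eq_gcone => i j; rewrite mxE !enum_rankK.
move=> /(gcone_reindex (@enum_val I predT)) h; apply/os_coneP.
by apply: eq_gcone h => i j; rewrite mxE.
Qed.

Lemma mo_cone_os (S : opsys R) n (X : 'M[os_mospace S]_n) :
  mo_cone X <-> gcone (fun i j => X i j).
Proof. by rewrite mo_coneP os_mconeP. Qed.

(** A family of column vectors indexed by [I] is a single vector with two indices. *)
Lemma gcone_matn n (I : finType) (X : I -> I -> 'M[C]_n) :
  gcone (S := matn R n) X <->
  psd (fun (u v : I * 'I_n) => X u.1 v.1 u.2 v.2).
Proof.
have E (c : I * 'I_n -> C) :
  \sum_u \sum_v conjC (c u) * X u.1 v.1 u.2 v.2 * c v =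
  \sum_i \sum_j cdot (X i j *m \col_b c (j, b)) (\col_a c (i, a)).
  rewrite sum_prod; apply: eq_bigr => i _.
  rewrite exchange_big /= sum_prod; apply: eq_bigr => j _.
  rewrite exchange_big /=; apply: eq_bigr => a _; rewrite !mxE mulr_suml.
  by apply: eq_bigr => b _; rewrite !mxE [RHS]mulrC mulrA.
split=> h.
  by move=> c; rewrite E; exact: h (fun j => \col_b c (j, b)).
move=> xi; have := h (fun u => xi u.1 u.2 0); rewrite E; congr (_ <= _).
apply: eq_bigr => i _; apply: eq_bigr => j _.
by congr (cdot (_ *m _) _); apply/matrixP => a b; rewrite !mxE ord1.
Qed.

Lemma mo_cone_matn n k (X : 'M['M[C]_n]_k) :
  @mo_cone R (matn R n) k X <->
  psd (fun (u v : 'I_k * 'I_n) => X u.1 v.1 u.2 v.2).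
Proof. by rewrite (@mo_cone_os (matn R n)); exact: gcone_matn. Qed.

Lemma os_pos1 (S : opsys R) (x : os_car S) :
  @mo_cone R S 1 (const_mx x) <-> os_pos x.
Proof.
rewrite (@mo_cone_os S); split=> h.
  by move=> v; have := h (fun=> v); rewrite !big_ord1 mxE.
by move=> xi; rewrite !big_ord1 mxE.
Qed.
End Opsys.

(** * Adjoint, norm and order of the elements of an operator system *)

Section Star.
Variable R : realType.
Local Notation C := R[i].
Local Notation conjC := (@Num.conj C).
Local Notation Re := complex.Re.

Lemma ge0_RRe (x : C) : 0 <= x -> (Re x)%:C%C = x.
Proof. by move=> /ger0_real; exact: RRe_real. Qed.

Lemma conjCR (r : R) : conjC r%:C%C = r%:C%C.
Proof. exact: conjc_real. Qed.

Lemma sqrt_le_sq (a b : C) (M : R) : 0 <= a -> 0 <= b -> 0 <= M ->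
  (Num.sqrt (Re a) <= M * Num.sqrt (Re b)) <-> (a <= (M ^+ 2)%:C%C * b).
Proof.
move=> a0 b0 M0.
have ra : 0 <= Re a by rewrite -ler0c ge0_RRe.
have rb : 0 <= Re b by rewrite -ler0c ge0_RRe.
rewrite -(ge0_RRe a0) -(ge0_RRe b0) -rmorphM lecR /=.
have <- : Num.sqrt (M ^+ 2 * Re b) = M * Num.sqrt (Re b).
  by rewrite sqrtrM ?sqr_ge0 // sqrtr_sqr ger0_norm.
by rewrite ler_sqrt ?mulr_ge0 ?sqr_ge0.
Qed.

Section Hilb.
Variable H : hilbert R.
Implicit Types x y z : H.
Lemma hnorm_le x y (M : R) : 0 <= M ->
  (hnorm x <= M * hnorm y) <-> (h_dot H x x <= (M ^+ 2)%:C%C * h_dot H y y).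
Proof. by move=> M0; apply: sqrt_le_sq => //; exact: dot_ge0. Qed.

Lemma hnorm_ge0 x : 0 <= hnorm x.
Proof. exact: sqrtr_ge0. Qed.

Lemma dot_cross x y : h_dot H x y + h_dot H y x <= h_dot H x x + h_dot H y y.
Proof.
have := dot_ge0 (x - y); rewrite dotBl !dotBr => h; rewrite -subr_ge0.
by move: h; congr (_ <= _); ring.
Qed.

(** Cauchy-Schwarz for [n] terms: both sides are doubled so that [dot_cross] may be summed over all
    pairs of indices. *)
Lemma dot_sum_le n (x : 'I_n -> H) :
  h_dot H (\sum_i x i) (\sum_i x i) <= n%:R * \sum_i h_dot H (x i) (x i).
Proof.
rewrite -(ler_pM2l (_ : 0 < 2%:R)) ?ltr0n //.
have -> : 2%:R * h_dot H (\sum_i x i) (\sum_i x i) =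
    \sum_i \sum_j (h_dot H (x i) (x j) + h_dot H (x j) (x i)).
  rewrite mulr_natl mulr2n dot_suml; under eq_bigr do rewrite dot_sumr.
  rewrite {2}exchange_big -big_split; apply: eq_bigr => i _.
  by rewrite -big_split.
have -> : 2%:R * (n%:R * \sum_i h_dot H (x i) (x i)) =
    \sum_(i < n) \sum_(j < n) (h_dot H (x i) (x i) + h_dot H (x j) (x j)).
  have E i : \sum_(j < n) (h_dot H (x i) (x i) + h_dot H (x j) (x j)) =
    h_dot H (x i) (x i) *+ n + \sum_(j < n) h_dot H (x j) (x j).
    by rewrite big_split /= sumr_const card_ord.
  rewrite [RHS](eq_bigr _ (fun i _ => E i)) big_split /= sumr_const card_ord sumrMnl.
  rewrite -[X in X + _]mulr_natl -[X in _ + X]mulr_natl; by ring.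
by apply: ler_sum => i _; apply: ler_sum => j _; exact: dot_cross.
Qed.

End Hilb.

Section Sys.
Variable S : opsys R.
Local Notation H := (os_hilb S).
Local Notation dot := (h_dot H).
Local Notation act := (os_act S).
Implicit Types x y : os_car S.

Lemma os_eqP x y : (forall v w, dot (act x v) w = dot (act y v) w) -> x = y.
Proof.
move=> e; apply/eqP; rewrite -subr_eq0; apply/eqP/(@os_act_inj _ S) => v.
by rewrite actBl; apply/eqP; rewrite subr_eq0; apply/eqP/dot_inj.
Qed.

(** The involution is recovered from the representation: [os_act_adj] provides an adjoint, and
    injectivity of the action makes it unique. *)
Definition os_star x : os_car S := projT1 (cid (os_act_adj x)).

Lemma os_starP x v w : dot (act (os_star x) v) w = dot v (act x w).
Proof. by rewrite /os_star; case: cid. Qed.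

Lemma os_star_uniq x y : (forall v w, dot (act y v) w = dot v (act x w)) ->
  os_star x = y.
Proof. by move=> e; apply: os_eqP => v w; rewrite os_starP e. Qed.

Lemma os_starD x y : os_star (x + y) = os_star x + os_star y.
Proof. by apply: os_star_uniq => v w; rewrite !actDl dotDl dotDr !os_starP. Qed.

Lemma os_starZ a x : os_star (a *: x) = conjC a *: os_star x.
Proof. by apply: os_star_uniq => v w; rewrite !actZl dotZl dotZr os_starP. Qed.

Lemma os_starK x : os_star (os_star x) = x.
Proof.
apply: os_star_uniq => v w.
by rewrite dotC -os_starP -dotC.
Qed.

Lemma os_star1 : os_star (os_one S) = os_one S.
Proof. by apply: os_star_uniq => v w; rewrite !os_act_one. Qed.

Lemma form_real_herm x : (forall v, dot (act x v) v \is Num.real) -> os_star x = x.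
Proof.
move=> h; apply: os_star_uniq => v w.
rewrite [RHS]dotC; apply: conj_polar.
  have := h (v + w); rewrite actDr dotDl !dotDr => hh.
  have -> : dot (act x w) v + dot (act x v) w = dot (act x v) v + dot (act x v) w +
    (dot (act x w) v + dot (act x w) w) - dot (act x v) v - dot (act x w) w by ring.
  by rewrite !rpredB.
have := h (v + 'i *: w); rewrite actDr dotDl !dotDr actZr !dotZl !dotZr conjCi => hh.
have -> : 'i * (dot (act x w) v - dot (act x v) w) = dot (act x v) v +
   - 'i * dot (act x v) w + ('i * dot (act x w) v + 'i * (- 'i * dot (act x w) w)) -
   dot (act x v) v - dot (act x w) w.
  by rewrite [_ * (- 'i * _)]mulrA mulrN -expr2 sqrCi; ring.
by rewrite !rpredB.
Qed.

Lemma os_pos_herm x : os_pos x -> os_star x = x.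
Proof. by move=> h; apply: form_real_herm => v; exact: ger0_real. Qed.

Lemma os_posD x y : os_pos x -> os_pos y -> os_pos (x + y).
Proof. by move=> hx hy v; rewrite actDl dotDl addr_ge0. Qed.
Lemma os_posZ a x : 0 <= a -> os_pos x -> os_pos (a *: x).
Proof. by move=> a0 hx v; rewrite actZl dotZl mulr_ge0. Qed.
Lemma os_pos_one : os_pos (os_one S).
Proof. by move=> v; rewrite os_act_one dot_ge0. Qed.
Lemma os_pos0 : os_pos (0 : os_car S).
Proof. by move=> v; rewrite act0l dot0l. Qed.

Lemma sum_dot_ge0 n (xi : 'I_n -> H) : 0 <= sum_dot xi xi.
Proof. by apply: sumr_ge0 => i _; exact: dot_ge0. Qed.

Lemma sum_norm_le n (xi eta : 'I_n -> H) (M : R) : 0 <= M ->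
  (sum_norm xi <= M * sum_norm eta) <->
  (sum_dot xi xi <= (M ^+ 2)%:C%C * sum_dot eta eta).
Proof. by move=> M0; apply: sqrt_le_sq => //; exact: sum_dot_ge0. Qed.

Lemma act_bounded x : exists2 M : R, 0 <= M &
  forall v, dot (act x v) (act x v) <= (M ^+ 2)%:C%C * dot v v.
Proof.
have [M hM] := @os_act_bounded _ S x; exists `|M| => // v.
apply/hnorm_le => //; apply: le_trans (hM v) _.
by rewrite ler_wpM2r ?hnorm_ge0 // ler_norm.
Qed.

(** [os_norm] is an infimum, zero by default on the empty set; the existence of a finite bound is
    what makes it a bound for the action in [os_normP]. *)
Lemma amp_bounded n (X : 'M[os_car S]_n) : exists2 M : R, 0 <= M &
  forall xi, sum_norm (amp_act X xi) <= M * sum_norm xi.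
Proof.
have [B hB] : exists B : 'I_n -> 'I_n -> R, forall i j v,
    dot (act (X i j) v) (act (X i j) v) <= (B i j ^+ 2)%:C%C * dot v v.
  have /choice[B hB] : forall ij : 'I_n * 'I_n, exists b : R, forall v,
    dot (act (X ij.1 ij.2) v) (act (X ij.1 ij.2) v) <= (b ^+ 2)%:C%C * dot v v.
    by move=> ij; have [b _ hb] := act_bounded (X ij.1 ij.2); exists b.
  by exists (fun i j => B (i, j)) => i j; exact: hB (i, j).
pose M2 := n%:R * \sum_i \sum_j B i j ^+ 2.
have M20 : 0 <= M2.
  by apply: mulr_ge0 => //; apply: sumr_ge0 => i _; apply: sumr_ge0 => j _; exact: sqr_ge0.
exists (Num.sqrt M2) => [|xi]; first exact: sqrtr_ge0.
apply/sum_norm_le; first exact: sqrtr_ge0.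
rewrite sqr_sqrtr // rmorphM rmorph_nat -mulrA rmorph_sum mulr_suml mulr_sumr.
apply: ler_sum => i _; apply: le_trans (dot_sum_le _) _.
rewrite ler_wpM2l // rmorph_sum mulr_suml; apply: ler_sum => j _.
apply: le_trans (hB i j (xi j)) _; rewrite ler_wpM2l //.
  by rewrite ler0c sqr_ge0.
by rewrite /sum_dot (bigD1 j) //= lerDl; apply: sumr_ge0 => k _; exact: dot_ge0.
Qed.

Lemma os_normP n (X : 'M[os_car S]_n) xi :
  sum_norm (amp_act X xi) <= os_norm X * sum_norm xi.
Proof.
have [M M0 hM] := amp_bounded X.
have sn0 : 0 <= sum_norm xi by apply: sqrtr_ge0.
move: sn0; rewrite le_eqVlt => /predU1P[x0|x_gt0].
  by rewrite -x0 mulr0; have := hM xi; rewrite -x0 mulr0.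
rewrite -ler_pdivrMr //; apply: lb_le_inf; first by exists M.
by move=> N [_ /(_ xi)]; rewrite ler_pdivrMr.
Qed.

Lemma os_norm_le n (X : 'M[os_car S]_n) M : 0 <= M ->
  (forall xi, sum_norm (amp_act X xi) <= M * sum_norm xi) -> os_norm X <= M.
Proof.
move=> M0 h; apply: ge_inf => //; exists 0 => N [].
by [].
Qed.

Definition onorm x : R := os_norm (const_mx x : 'M[os_car S]_1).

Lemma onorm_ge0 x : 0 <= onorm x.
Proof. exact: os_norm_ge0. Qed.

Lemma onormP x v : dot (act x v) (act x v) <= (onorm x ^+ 2)%:C%C * dot v v.
Proof.
have := os_normP (const_mx x : 'M[os_car S]_1) (fun=> v).
move/sum_norm_le => /(_ (os_norm_ge0 _)).
by rewrite /sum_dot /amp_act !big_ord1 mxE.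
Qed.

Lemma onorm_le x (M : R) : 0 <= M ->
  (forall v, dot (act x v) (act x v) <= (M ^+ 2)%:C%C * dot v v) -> onorm x <= M.
Proof.
move=> M0 h; apply: os_norm_le => // xi; apply/sum_norm_le => //.
by rewrite /sum_dot /amp_act !big_ord1 mxE.
Qed.

(** Expanding [|x v - M v|^2 >= 0] gives [2 M <x v, v> <= |x v|^2 + M^2 |v|^2 <= 2 M^2 |v|^2]. The
    division by [2 M] sets the case [M = 0] apart, where [x v = 0]. *)
Lemma herm_le (x : os_car S) (M : R) : 0 <= M -> os_star x = x ->
  (forall v, dot (act x v) (act x v) <= (M ^+ 2)%:C%C * dot v v) ->
  os_pos (M%:C%C *: os_one S - x).
Proof.
move=> M0 hx hM v; rewrite actBl actZl os_act_one dotBl dotZl.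
move: M0; rewrite le_eqVlt => /predU1P[M0|M0].
  have := hM v; rewrite -M0 expr0n /= mul0r => h.
  have -> : act x v = 0 by apply/eqP; rewrite -dot_eq0 eq_le h dot_ge0.
  by rewrite dot0l subr0.
have h := dot_ge0 (act x v - M%:C%C *: v).
have hr : dot v (act x v) = dot (act x v) v by rewrite -os_starP hx.
move: h; rewrite dotBl !dotBr !dotZl !dotZr conjCR hr => h.
have M0' : 0 < 2%:R * M%:C%C :> C by rewrite mulr_gt0 ?ltr0n // ltcR.
rewrite -(pmulr_rge0 _ M0').
have := lerD h (hM v); rewrite add0r -subr_ge0 rmorphXn /= => h2.
by apply: le_trans h2 _; rewrite le_eqVlt; apply/orP; left; apply/eqP; ring.
Qed.

(** With [w = x^* v] one has [<x w, v> = |w|^2]. Expanding [|x w - M^2 v|^2 >= 0], for [M] the norm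
    of [x], and bounding [|x w|^2] by [M^2 |w|^2] yields [M^2 |w|^2 <= M^4 |v|^2]. *)
Lemma onorm_star x v :
  dot (act (os_star x) v) (act (os_star x) v) <= (onorm x ^+ 2)%:C%C * dot v v.
Proof.
set w := act (os_star x) v; set M := onorm x.
have := onorm_ge0 x; rewrite -/M le_eqVlt => /predU1P[M0|M0].
  have h := onormP x w; move: h; rewrite -/M -M0 expr0n /= !mul0r => h.
  have xw : act x w = 0 by apply/eqP; rewrite -dot_eq0 eq_le h dot_ge0.
  by rewrite {1}/w os_starP xw dot0r.
have h := dot_ge0 (act x w - (M ^+ 2)%:C%C *: v).
have e1 : dot v (act x w) = dot w w by rewrite -os_starP.
have e2 : dot (act x w) v = dot w w by rewrite dotC e1 -dotC.
move: h; rewrite dotBl !dotBr !dotZl !dotZr conjCR e1 e2 => h.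
have M0' : 0 < (M ^+ 2)%:C%C :> C by rewrite ltcR exprn_gt0.
rewrite -subr_ge0 -(pmulr_rge0 _ M0').
have := lerD h (onormP x w); rewrite add0r -subr_ge0 => h2.
by apply: le_trans h2 _; rewrite le_eqVlt; apply/orP; left; apply/eqP; ring.
Qed.

Lemma herm_le_onorm x : os_star x = x ->
  os_pos ((onorm x)%:C%C *: os_one S - x) /\ os_pos ((onorm x)%:C%C *: os_one S + x).
Proof.
move=> hx; split.
  by apply: herm_le => //; [exact: onorm_ge0|exact: onormP].
rewrite -[x in _ + x]opprK; apply: herm_le; first exact: onorm_ge0.
  by rewrite -scaleN1r os_starZ hx rmorphN rmorph1.
by move=> v; rewrite actNl dotNl dotNr opprK; exact: onormP.
Qed.

Lemma herm_parts x : exists h k, [/\ os_star h = h, os_star k = k, x = h + 'i *: k,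
  onorm h <= onorm x & onorm k <= onorm x].
Proof.
have half_le (a b : os_car S) : (forall v, dot (act a v) (act a v) <= (onorm x ^+ 2)%:C%C * dot v v) ->
   (forall v, dot (act b v) (act b v) <= (onorm x ^+ 2)%:C%C * dot v v) ->
   onorm (2%:R^-1 *: (a + b)) <= onorm x.
  move=> ha hb; apply: onorm_le => [|v]; first exact: onorm_ge0.
  rewrite actZl dotZl dotZr actDl dotDl !dotDr.
  have := dot_cross (act a v) (act b v) => hc.
  have := lerD (ha v) (hb v) => hab.
  rewrite fmorphV rmorph_nat.
  have h4 : 0 < 4%:R :> C by rewrite ltr0n.
  rewrite -(ler_pM2l h4).
  have -> : 4%:R * (2%:R^-1 * (2%:R^-1 * (dot (act a v) (act a v) + dot (act a v) (act b v)
    + (dot (act b v) (act a v) + dot (act b v) (act b v))))) =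
    (dot (act a v) (act a v) + dot (act b v) (act b v)) +
    (dot (act a v) (act b v) + dot (act b v) (act a v)) :> C by field.
  have -> : 4%:R * ((onorm x ^+ 2)%:C%C * dot v v) =
    2%:R * ((onorm x ^+ 2)%:C%C * dot v v + (onorm x ^+ 2)%:C%C * dot v v) :> C by ring.
  apply: (@le_trans _ _ (2%:R * (dot (act a v) (act a v) + dot (act b v) (act b v)))).
    by rewrite [leRHS]mulr_natl mulr2n lerD2l.
  by rewrite ler_pM2l ?ltr0n.
have i2 : 'i * 'i = -1 :> C by rewrite -expr2 sqrCi.
exists (2%:R^-1 *: (x + os_star x)), (2%:R^-1 *: ((- 'i) *: x + 'i *: os_star x)); split.
by rewrite os_starZ os_starD os_starK addrC fmorphV rmorph_nat.
  rewrite os_starZ os_starD !os_starZ os_starK fmorphV rmorph_nat rmorphN /= conjCi opprK.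
  by rewrite addrC.
  rewrite !scalerDr !scalerA addrACA -!scalerDl.
  have -> : 'i / 2 * - 'i = 2%:R^-1 :> C by rewrite mulrAC mulrN i2 opprK mul1r.
  have -> : 'i / 2 * 'i = - 2%:R^-1 :> C by rewrite mulrAC i2 mulN1r.
  rewrite subrr scale0r addr0 -[LHS]scale1r; congr (_ *: _); by field.
by apply: half_le => v; [exact: onormP|exact: onorm_star].
have i1 : 'i * - 'i = 1 :> C by rewrite mulrN i2 opprK.
have j1 : - 'i * 'i = 1 :> C by rewrite mulNr i2 opprK.
apply: half_le => v; rewrite actZl dotZl dotZr mulrA.
  rewrite rmorphN /= conjCi opprK j1 mul1r; exact: onormP.
rewrite conjCi i1 mul1r; exact: onorm_star.
Qed.

(** Positive elements span: the real and imaginary parts of [x] are hermitian, and a hermitian [y]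
    is [(|y| 1 + y) - |y| 1]. *)
Lemma os_pos_ind (P : os_car S -> Prop) :
  (forall a x y, P x -> P y -> P (a *: x + y)) -> (forall x, os_pos x -> P x) ->
  forall x, P x.
Proof.
move=> Pl Pp x; have [h [k [hh hk -> _ _]]] := herm_parts x.
have Ph y : os_star y = y -> P y.
  move=> /herm_le_onorm[_ h2].
  have -> : y = (- (onorm y)%:C%C) *: os_one S + ((onorm y)%:C%C *: os_one S + y).
    by rewrite scaleNr addrA addNr add0r.
  by apply: Pl; apply: Pp => //; exact: os_pos_one.
by rewrite addrC; apply: Pl; exact: Ph.
Qed.

Lemma pos_functional_herm (f : os_car S -> C) : linear (f : os_car S -> C^o) ->
  (forall x, os_pos x -> 0 <= f x) -> forall x, f (os_star x) = conjC (f x).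
Proof.
move=> lf fp; apply: os_pos_ind => [a x y hx hy|x xp].
  rewrite os_starD os_starZ.
  have -> := lf (conjC a) (os_star x) (os_star y); have -> := lf a x y.
  by rewrite rmorphD rmorphM /= hx hy.
by rewrite os_pos_herm // geC0_conj // fp.
Qed.

(** Positive functionals are automatically bounded, hence elements of the dual. The factor 2 is the
    price of treating the real and imaginary parts separately, each by [- |y| 1 <= y <= |y| 1]. *)
Lemma pos_functional_le (f : os_car S -> C) : linear (f : os_car S -> C^o) ->
  (forall x, os_pos x -> 0 <= f x) ->
  forall x, `|f x| <= (2 * Re (f (os_one S)) * onorm x)%:C%C.
Proof.
move=> lf fp x.
have fD a b : f (a + b) = f a + f b by have := lf 1 a b; rewrite !scale1r.
have fZ a b : f (a *: b) = a * f b.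
  have f0 : f 0 = 0 by have := lf (-1) 0 0; rewrite !scaleN1r oppr0 addr0 addNr.
  by have := lf a b 0; rewrite !addr0 f0 addr0.
have fB a b : f (a - b) = f a - f b by rewrite fD -scaleN1r fZ mulN1r.
have f1 : 0 <= f (os_one S) by apply: fp; exact: os_pos_one.
have hf y : os_star y = y -> onorm y <= onorm x -> `|f y| <= (Re (f (os_one S)) * onorm x)%:C%C.
  move=> hy ny; rewrite rmorphM /= ge0_RRe //.
  have [h1 h2] := herm_le_onorm hy.
  have := fp _ h1; have := fp _ h2; rewrite fB fD fZ => k2 k1.
  have fr : f y \is Num.real.
    apply/CrealP; rewrite -[in RHS]hy; symmetry.
    exact: pos_functional_herm.
  apply: (@le_trans _ _ ((onorm y)%:C%C * f (os_one S))).
    rewrite real_ler_norml //; apply/andP; split; rewrite -subr_ge0 //.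
    by rewrite opprK addrC.
  by rewrite mulrC ler_wpM2l // lecR.
have [h [k [hh hk xE nh nk]]] := herm_parts x.
rewrite {1}xE fD fZ; apply: le_trans (ler_normD _ _) _.
rewrite normrM normCi mul1r -mulrA mulr_natl mulr2n.
by rewrite rmorphD lerD // hf.
Qed.
End Sys.
End Star.

(** * Krein's extension and separation theorems *)

Section Riesz.
Variable R : realType.
Local Notation C := R[i].

Section RieszReal.
Variables (V L : lmodType R) (K : set V) (j : {linear L -> V}) (f0 : {linear L -> R^o}).
Hypothesis K0 : K 0.
Hypothesis KD : forall x y, K x -> K y -> K (x + y).
Hypothesis KZ : forall (r : R) x, 0 <= r -> K x -> K (r *: x).
Hypothesis f0_pos : forall l, K (j l) -> 0 <= f0 l.
Hypothesis majorized : forall v, exists l, K (j l - v).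

Let graph0 : set (V * R) := [set p | exists l, p = (j l, f0 l)]%classic.
Let lin (G : set (V * R)) := forall (a : R) p q, G p -> G q ->
  G (a *: p.1 + q.1, a * p.2 + q.2).
Let pos (G : set (V * R)) := forall p, G p -> K p.1 -> 0 <= p.2.
(** Partial extensions are encoded by their graphs. Zorn's lemma also meets the empty chain, whose
    union is empty; joining [graph0] makes the empty set admissible. *)
Let ok (G : set (V * R)) := lin (G `|` graph0)%classic /\ pos (G `|` graph0)%classic.

Let graph0_lin : lin graph0.
Proof.
move=> a p q [l ->] [m ->]; exists (a *: l + m) => /=.
by rewrite !linearP.
Qed.

(** The value at [v] is the supremum of the values forced from below, by those [w] in the domain
    with [v - w] in the cone. Majorizing [- v] makes this set nonempty, and majorizing [v] makes it
    bounded. *)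
Lemma riesz_extend_one (G : set (V * R)) : (graph0 `<=` G)%classic -> lin G -> pos G ->
  forall v, (forall r, ~ G (v, r)) ->
  exists G' : set (V * R), [/\ (G `<=` G')%classic, lin G', pos G' & exists r, G' (v, r)].
Proof.
move=> g0G lG pG v vG.
have G00 : G (0, 0) by apply: g0G; exists 0; rewrite !linear0.
have GZ a p : G p -> G (a *: p.1, a * p.2).
  by move=> Gp; have := lG a p (0, 0) Gp G00; rewrite /= !addr0.
pose Lo : set R := [set r | exists w, G (w, r) /\ K (v - w)]%classic.
have up_Lo w r : G (w, r) -> K (w - v) -> ubound Lo r.
  move=> Gw Kw s [w' [Gw' Kw']].
  have := lG (-1) _ _ Gw' Gw => /pG /=; rewrite scaleN1r mulN1r addrC [- s + _]addrC subr_ge0; apply.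
  by have := KD Kw Kw'; rewrite addrA subrK.
have Lo0 : Lo !=set0%classic.
  have [l Kl] := majorized (- v).
  exists (- f0 l); exists (- j l); split; last by rewrite opprK addrC -[v]opprK.
  by have := GZ (-1) (j l, f0 l) (g0G _ (ex_intro _ l erefl)); rewrite /= scaleN1r mulN1r.
have LoU : has_ubound Lo.
  have [l Kl] := majorized v; exists (f0 l); apply: up_Lo Kl.
  by apply: g0G; exists l.
pose a := sup Lo.
pose G' : set (V * R) := [set p | exists w r t, G (w, r) /\ p = (w + t *: v, r + t * a)]%classic.
exists G'; split.
by move=> [w r] Gw; exists w, r, 0; rewrite scale0r mul0r !addr0.
move=> b _ _ [w [r [t [Gw ->]]]] [w' [r' [t' [Gw' ->]]]].
  exists (b *: w + w'), (b * r + r'), (b * t + t'); split; first exact: (lG b _ _ Gw Gw').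
  congr (_, _) => /=.
    by rewrite scalerDr scalerDl scalerA addrACA.
  by ring.
move=> _ [w [r [t [Gw ->]]]] /=.
  case: (ltgtP t 0) => [t0|t0|->]; last by rewrite scale0r mul0r !addr0; exact: pG Gw.
    move=> Kp; have t0' : 0 < - t by rewrite oppr_gt0.
    have ti : 0 <= (- t)^-1 by rewrite invr_ge0 ltW.
    have := KZ ti Kp; rewrite scalerDr scalerA.
    have -> : (- t)^-1 * t = -1.
      by rewrite -[t in _ * t]opprK mulrN mulVf // gt_eqF.
    rewrite scaleN1r => Kw.
    have := up_Lo _ _ (GZ (- t)^-1 _ Gw) Kw => h.
    have : a <= (- t)^-1 * r by apply: ge_sup.
    by rewrite mulrC ler_pdivlMr // mulrN -subr_ge0 opprK mulrC.
  move=> Kp; have ti : 0 <= t^-1 by rewrite invr_ge0 ltW.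
  have := KZ ti Kp; rewrite scalerDr scalerA mulVf ?gt_eqF // scale1r => Kw.
  have : - (t^-1 * r) <= a.
    apply: ub_le_sup => //; exists (- (t^-1 *: w)); split; last by rewrite opprK addrC.
    by have := GZ (- t^-1) _ Gw; rewrite /= scaleNr mulNr.
  by rewrite -mulrN mulrC ler_pdivrMr // -subr_ge0 opprK addrC mulrC.
by exists a, 0, 0, 1; rewrite scale1r mul1r !add0r.
Qed.

Theorem riesz_extension : exists f : {linear V -> R^o},
  (forall v, K v -> 0 <= f v) /\ (forall l, f (j l) = f0 l).
Proof.
have [A [okA maxA]] : exists A, ok A /\ forall B, (A `<` B)%classic -> ~ ok B.
  apply: Zorn_bigcup => F Fok Ftot; split.
    move=> a p q [[X FX Xp]|gp] [[Y FY Yq]|gq].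
    have [XY|YX] := Ftot _ _ FX FY.
        have [lY _] := Fok _ FY.
        have := lY a p q (or_introl (XY _ Xp)) (or_introl Yq).
        by case=> ?; [left; exists Y|right].
      have [lX _] := Fok _ FX.
      have := lX a p q (or_introl Xp) (or_introl (YX _ Yq)).
      by case=> ?; [left; exists X|right].
    have [lX _] := Fok _ FX; have := lX a p q (or_introl Xp) (or_intror gq).
      by case=> ?; [left; exists X|right].
    have [lY _] := Fok _ FY; have := lY a p q (or_intror gp) (or_introl Yq).
      by case=> ?; [left; exists Y|right].
    by right; exact: graph0_lin.
  move=> p [[X FX Xp]|[l ->]]; last exact: f0_pos.
  by have [_ pX] := Fok _ FX; apply: pX; left.
pose G := (A `|` graph0)%classic.
have [lG pG] : lin G /\ pos G by [].
have g0G : (graph0 `<=` G)%classic by move=> p; right.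
have tot v : exists r, G (v, r).
  apply: contrapT => /forallNP nv.
  have [G' [GG' lG' pG' [r G'r]]] := riesz_extend_one g0G lG pG nv.
  have AG' : (A `<` G')%classic.
    split; first by move=> p Ap; apply: GG'; left.
    by move=> G'A; apply: (nv r); left; exact: G'A.
  apply: (maxA _ AG'); split.
    suff -> : (G' `|` graph0)%classic = G' by [].
    by apply/setUidPl => p gp; apply: GG'; right.
  suff -> : (G' `|` graph0)%classic = G' by [].
  by apply/setUidPl => p gp; apply: GG'; right.
(* The difference of two values at [v] is a value at [0], which lies in the cone; so positivity
   makes the graph single-valued. *)
have uniq v r s : G (v, r) -> G (v, s) -> r <= s.
  move=> Gr Gs; have := lG (-1) _ _ Gr Gs => /pG /=.
  by rewrite scaleN1r addNr mulN1r addrC subr_ge0; apply.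
have /choice[f fG] := tot.
have fE v r : G (v, r) -> f v = r.
  by move=> Gr; apply/eqP; rewrite eq_le (uniq _ _ _ (fG v) Gr) (uniq _ _ _ Gr (fG v)).
have flin : linear (f : V -> R^o).
  by move=> a x y; apply: fE; exact: (lG a _ _ (fG x) (fG y)).
pose F : {linear V -> R^o} := mklin flin.
exists F; split=> [v Kv|l]; first exact: (pG _ (fG v)).
by apply: fE; apply: g0G; exists l.
Qed.
End RieszReal.

Section Complexify.

Definition realify (V : lmodType C) := V : Type.
Variable V : lmodType C.
HB.instance Definition _ := GRing.Zmodule.on (realify V).
Let rscale (r : R) (v : realify V) : realify V := (r%:C%C *: (v : V)).
Let rscaleA a b v : rscale a (rscale b v) = rscale (a * b) v.
Proof. by rewrite /rscale scalerA rmorphM. Qed.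
Let rscale1 : left_id 1 rscale.
Proof. by move=> v; rewrite /rscale rmorph1 scale1r. Qed.
Let rscaleDr : right_distributive rscale +%R.
Proof. by move=> a v w; rewrite /rscale scalerDr. Qed.
Let rscaleDl v : {morph rscale^~ v : a b / a + b}.
Proof. by move=> a b; rewrite /rscale rmorphD scalerDl. Qed.
HB.instance Definition _ := GRing.Zmodule_isLmodule.Build R (realify V)
  rscaleA rscale1 rscaleDr rscaleDl.

Lemma realify_scaleE (r : R) (v : V) : r *: (v : realify V) = r%:C%C *: v.
Proof. by []. Qed.

(** The functional is [g v - i g (i v)], the only complex linear one with real part [g]. *)
Lemma complexify (g : {linear realify V -> R^o}) :
  exists f : {linear V -> C^o}, forall v, complex.Re (f v) = g v.
Proof.
pose f (v : V) : C^o := (g v +i* (- g ('i *: v)))%C.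
have gD x y : g (x + y : V) = g x + g y by exact: raddfD.
have gZ (r : R) (x : V) : g (r%:C%C *: x) = r * g x by exact: (linearZ_LR g r (x : realify V)).
have gN (x : V) : g (- x) = - g x by exact: raddfN.
have flin : linear f.
  move=> [a b] x y.
  have E z : g ((a +i* b)%C *: z : V) = a * g z + b * g ('i *: z : V).
    have -> : (a +i* b)%C *: z = a%:C%C *: z + b%:C%C *: ('i *: z) :> V.
      by rewrite scalerA -scalerDl [(a +i* b)%C]complexE /= -complexiE mulrC [b%:C%C * _]mulrC.
    by rewrite gD !gZ.
  rewrite /f scalerDr !gD; apply/eqP; rewrite eq_complex /=; apply/andP; split; apply/eqP.
    by rewrite E; ring.
  have -> : 'i *: ((a +i* b)%C *: x) = (a +i* b)%C *: ('i *: x) :> V.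
    by rewrite !scalerA mulrC.
  rewrite E scalerA -expr2 sqrCi scaleN1r gN; by ring.
by exists (mklin flin).
Qed.
End Complexify.

Section Cone.
Variables (V : lmodType C) (K : set V).
Definition convex_cone := [/\ K 0, (forall x y, K x -> K y -> K (x + y)) &
  forall (r : R) x, 0 <= r -> K x -> K (r%:C%C *: x)].
Hypothesis Kc : convex_cone.

Theorem krein_extension (L : lmodType C) (j : {linear L -> V}) (f0 : {linear L -> C^o}) :
  (forall l, K (j l) -> 0 <= complex.Re (f0 l)) -> (forall v, exists l, K (j l - v)) ->
  exists f : {linear V -> C^o}, (forall v, K v -> 0 <= complex.Re (f v)) /\
     forall l, f (j l) = f0 l.
Proof.
move=> f0p maj; have [K0 KD KZ] := Kc.
have jlin : linear (j : realify L -> realify V).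
  by move=> a x y; rewrite realify_scaleE linearP.
have flin : linear (fun l : realify L => complex.Re (f0 l) : R^o).
  move=> a x y; rewrite realify_scaleE linearP; case: (f0 x) (f0 y) => [u v] [u' v'] /=.
  by rewrite mul0r subr0.
pose j' : {linear realify L -> realify V} := mklin jlin.
pose f' : {linear realify L -> R^o} := mklin flin.
have [g [gp gj]] := @riesz_extension (realify V) (realify L) K j' f' K0 KD KZ f0p maj.
have [f fg] := complexify g.
exists f; split=> [v Kv|l]; first by rewrite fg; exact: gp.
apply/eqP; rewrite eq_complex; apply/andP; split; apply/eqP.
  by rewrite fg; exact: gj.
(* Equality of the real parts at [i l] is equality of the imaginary parts at [l]. *)
have h := gj ('i *: l); move: (h).
have -> : g (j' ('i *: l)) = complex.Re (f (j ('i *: l))) by rewrite fg.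
have -> : f' ('i *: l) = complex.Re (f0 ('i *: l)) by [].
rewrite !linearZ /= -complexiE.
case: (f (j l)) (f0 l) => [u v] [u' v'] /=.
by rewrite !mul0r !mul1r !sub0r => /oppr_inj.
Qed.

(** On the span of [e] and [x] set [f e = 1] and [f x = p], with [p] the supremum of the [u] such
    that [x - u e] is in the cone. As [x + d e] is not in the cone, [p <= - d]: the margin [d] is
    what makes the separation strict. *)
Theorem krein_separation (e x : V) (d : R) : K e ->
  (forall v, exists t : R, K (t%:C%C *: e - v)) -> 0 < d -> ~ K (x + d%:C%C *: e) ->
  exists f : {linear V -> C^o}, [/\ (forall v, K v -> 0 <= complex.Re (f v)),
     complex.Re (f e) = 1 & complex.Re (f x) < 0].
Proof.
move=> Ke ou d0 nK; have [K0 KD KZ] := Kc.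
(* If a negative multiple of [e] were in the cone, the order unit would put every vector in it,
   [x + d e] included. *)
have nKe (t : R) : t < 0 -> ~ K (t%:C%C *: e).
  move=> t0 Kt; apply: nK; have [s Ks] := ou (- (x + d%:C%C *: e)).
  have [s0|s0] := leP s 0.
    have := KD _ _ Ks (KZ (- s) _ _ Ke); rewrite oppr_ge0 opprK => /(_ s0).
    by rewrite addrAC -scalerDl rmorphN subrr scale0r add0r.
  have c0 : 0 <= s / - t by rewrite divr_ge0 // ?oppr_ge0 ltW.
  have := KD _ _ Ks (KZ _ _ c0 Kt); rewrite opprK addrAC scalerA -scalerDl -rmorphM -rmorphD /=.
  have -> : s + s / - t * t = 0 by field; rewrite lt_eqF.
  by rewrite scale0r add0r.
pose U : set R := [set u | K (x - u%:C%C *: e)]%classic.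
have ubU : ubound U (- d).
  move=> u Ku; rewrite leNgt; apply/negP => du; apply: nK.
  have := KD _ _ Ku (KZ (u + d) _ _ Ke).
  have -> : 0 <= u + d by rewrite -[d]opprK subr_ge0 ltW.
  move=> /(_ isT); rewrite rmorphD scalerDl addrA subrK; exact.
have U0 : (U !=set0)%classic.
  have [t Kt] := ou (- x); exists (- t); rewrite /U /=.
  by move: Kt; rewrite opprK rmorphN scaleNr opprK addrC.
have hU : has_sup U by split=> //; exists (- d).
pose p := sup U.
have pd : p <= - d by apply: ge_sup.
pose jf (ab : R^o * R^o) : realify V := (ab.1 : R)%:C%C *: e + (ab.2 : R)%:C%C *: x.
pose ff (ab : R^o * R^o) : R^o := ab.1 + ab.2 * p.
have jlin : linear jf.
  move=> a [u v] [u' v']; rewrite realify_scaleE /jf /=.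
  rewrite scalerDr !scalerA !rmorphD !rmorphM !scalerDl addrACA //.
have flin : linear ff.
  move=> a [u v] [u' v']; rewrite /ff /=.
  have -> : a *: (u + v * p : R^o) = a * (u + v * p) by [].
  have -> : a *: u = a * u by [].
  have -> : a *: v = a * v by [].
  by ring.
have Re1 u : u%:C%C *: x + 0%:C%C *: e = u%:C%C *: x by rewrite scale0r addr0.
have [] := @riesz_extension (realify V) (R^o * R^o)%type K
  (mklin jlin) (mklin flin) K0 KD KZ.
move=> [a b] /=; rewrite /jf /ff /= => Kab.
  case: (ltgtP b 0) => [b0|b0|b0].
  have b0' : 0 < - b by rewrite oppr_gt0.
    have bi : 0 <= (- b)^-1 by rewrite invr_ge0 ltW.
    have := KZ _ _ bi Kab; rewrite scalerDr !scalerA -!rmorphM /=.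
    have -> : (- b)^-1 * b = -1 by field; rewrite lt_eqF.
    rewrite rmorphN rmorph1 scaleN1r => Kx.
    have : p <= (- b)^-1 * a.
      apply: ge_sup => // u Ku; rewrite leNgt; apply/negP => lt.
      apply: (nKe ((- b)^-1 * a - u)); first by rewrite subr_lt0.
      have := KD _ _ Kx Ku; rewrite addrA subrK rmorphB scalerBl; exact.
    by rewrite mulrC ler_pdivlMr // mulrN -subr_ge0 opprK mulrC.
  have bi : 0 <= b^-1 by rewrite invr_ge0 ltW.
    have := KZ _ _ bi Kab; rewrite scalerDr !scalerA -!rmorphM /=.
    rewrite mulVf ?gt_eqF // scale1r => Kx.
    have : - (b^-1 * a) <= p.
      apply: ub_le_sup; first by exists (- d).
      by rewrite /U /= rmorphN scaleNr opprK addrC.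
    by rewrite -mulrN mulrC ler_pdivrMr // -subr_ge0 opprK addrC mulrC.
  move: Kab; rewrite b0 scale0r addr0 mul0r addr0 leNgt => Ka; apply/negP => a0.
    exact: nKe Ka.
move=> v; have [t Kt] := ou v; exists (t, 0); rewrite /= /jf /=.
  by rewrite scale0r addr0.
move=> g [gp gj]; have [f fg] := complexify g.
exists f; split=> [v Kv||]; rewrite fg; first exact: gp.
  have := gj (1, 0); rewrite /= /jf /ff /= scale1r scale0r mul0r !addr0.
  exact.
have := gj (0, 1); rewrite /= /jf /ff /= scale1r scale0r mul1r !add0r => ->.
by apply: le_lt_trans pd _; rewrite oppr_lt0.
Qed.
End Cone.
End Riesz.

(** * Tensor products *)

Section TensorAlg.
Variable K : fieldType.

Definition mkbilin (A B W : lmodType K) (f : A -> B -> W)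
  (h : bilinear_for *:%R *:%R f) : {bilinear A -> B -> W} :=
  HB.pack f (bilinear_isBilinear.Build K A B W *:%R *:%R f h).

#[local] Arguments tens : simpl never.
#[local] Arguments tensor_lift : simpl never.
#[local] Arguments lquot_pi : simpl never.

Section Gen.
Variables A B : lmodType K.

Lemma tensZl k (a : A) (b : B) : tens (k *: a) b = k *: tens a b.
Proof. by rewrite linearZl_LR. Qed.
Lemma tensor_spanned (z : tensor A B) : exists m (a : 'I_m -> A) (b : 'I_m -> B),
  z = \sum_l tens (a l) (b l).
Proof.
pose g : malg (A * B)%type K := repr z.
have -> : z = lquot_pi (@tensor_null K A B) g by rewrite lquot_reprK.
rewrite [g]monalgE.
exists (size (msupp g)).
exists (fun l => mcoeff (nth (0, 0) (msupp g) l) g *: (nth (0, 0) (msupp g) l).1).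
exists (fun l => (nth (0, 0) (msupp g) l).2).
rewrite raddf_sum /= (big_nth (0, 0)) big_mkord; apply: eq_bigr => l _.
set k := nth _ _ _; rewrite tensZl /tens.
rewrite -linearZ /=; congr (lquot_pi _ _).
rewrite /k; case: (nth _ _ _) => x y /=.
apply/malgP => u; rewrite mcoeffZ !mcoeffU.
by rewrite mulr_natr.
Qed.

Lemma tensPl k x y b : tens (k *: x + y) b = k *: tens x b + tens y b :> tensor A B.
Proof. exact: linearPl. Qed.
Lemma tensPr a k x y : tens a (k *: x + y) = k *: tens a x + tens a y :> tensor A B.
Proof. exact: linearPr. Qed.
End Gen.

Lemma tensor_map_tens (A B A' B' : lmodType K) (f : {linear A -> A'}) (g : {linear B -> B'}) a b :
  tensor_map f g (tens a b) = tens (f a) (g b).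
Proof. by rewrite /tensor_map /= tensor_lift_tens. Qed.

Lemma tensor_matrix_map_tens (A B : lmodType K) p q (f : {linear A -> 'M[K]_p})
  (g : {linear B -> 'M[K]_q}) a b : tensor_matrix_map f g (tens a b) = f a *t g b.
Proof. by rewrite /tensor_matrix_map /= tensor_lift_tens. Qed.
End TensorAlg.

(* An abstract tensor product: unfolding the construction of [tensor] makes
   unification compare the structures of R[i] inherited along different paths. *)
Section TensorC.
Variable R : realType.
Local Notation C := R[i].
Local Notation conjC := (@Num.conj C).

Definition bil (A B W : lmodType C) (f : A -> B -> W) :=
  (forall k x y b, f (k *: x + y) b = k *: f x b + f y b) /\
  (forall a k x y, f a (k *: x + y) = k *: f a x + f a y).

Record tprod (A B : lmodType C) := TProd {
  tp_sort :> lmodType C;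
  tn : A -> B -> tp_sort;
  tn_bil : bil tn;
  tn_spanned : forall z, exists m (a : 'I_m -> A) (b : 'I_m -> B), z = \sum_l tn (a l) (b l);
  tn_lift : forall (W : lmodType C) (f : A -> B -> W), bil f ->
    exists g : {linear tp_sort -> W}, forall a b, g (tn a b) = f a b
}.
Arguments tn {A B t} a b.

Section TensorProd.
Variables A B : lmodType C.
Let T : lmodType C := tensor A B.
Let t (a : A) (b : B) : T := tens a b.

Lemma tens_bil : bil t.
Proof.
split=> [k x y b|a k x y].
  have h := @tensPl _ A B k x y b; exact_no_check h.
have h := @tensPr _ A B a k x y; exact_no_check h.
Qed.

Lemma tens_spanned (z : T) : exists m (a : 'I_m -> A) (b : 'I_m -> B),
  z = \sum_l t (a l) (b l).
Proof. have h := @tensor_spanned _ A B z; exact_no_check h. Qed.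

Lemma tens_lift (W : lmodType C) (f : A -> B -> W) : bil f ->
  exists g : {linear T -> W}, forall a b, g (t a b) = f a b.
Proof.
case=> fl fr.
have fb : bilinear_for *:%R *:%R f by split=> [b k x y|a k x y]; [exact: fl|exact: fr].
pose g : T -> W := tensor_lift (mkbilin fb).
have gl : linear g.
  have h := tensor_lift_linear (mkbilin fb); exact_no_check h.
exists (mklin gl) => a b; have h := tensor_lift_tens (mkbilin fb) a b.
exact_no_check h.
Qed.

Definition tensor_tprod : tprod A B := TProd tens_bil tens_spanned tens_lift.
End TensorProd.

Section Lift.
Variables (A B W : lmodType C) (Z : tprod A B) (f : A -> B -> W) (h : bil f).
Definition tlift : {linear Z -> W} := projT1 (cid (tn_lift Z h)).
Lemma tlift_tn a b : tlift (tn a b) = f a b.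
Proof. by rewrite /tlift; case: cid. Qed.
End Lift.

Section Gen.
Variables (A B : lmodType C) (Z : tprod A B).
Local Notation tn := (@tn A B Z).

Lemma tnDl (a a' : A) (b : B) : tn (a + a') b = tn a b + tn a' b.
Proof. by have [h _] := tn_bil Z; have := h 1 a a' b; rewrite !scale1r. Qed.
Lemma tnDr (a : A) (b b' : B) : tn a (b + b') = tn a b + tn a b'.
Proof. by have [_ h] := tn_bil Z; have := h a 1 b b'; rewrite !scale1r. Qed.
Lemma tn0l (b : B) : tn (0 : A) b = 0.
Proof. by apply: (addrI (tn 0 b)); rewrite -tnDl !addr0. Qed.
Lemma tn0r (a : A) : tn a (0 : B) = 0.
Proof. by apply: (addrI (tn a 0)); rewrite -tnDr !addr0. Qed.
Lemma tnZl k (a : A) (b : B) : tn (k *: a) b = k *: tn a b.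
Proof. by have [h _] := tn_bil Z; have := h k a 0 b; rewrite tn0l !addr0. Qed.
Lemma tnZr k (a : A) (b : B) : tn a (k *: b) = k *: tn a b.
Proof. by have [_ h] := tn_bil Z; have := h a k b 0; rewrite tn0r !addr0. Qed.
Lemma tnNl (a : A) (b : B) : tn (- a) b = - tn a b.
Proof. by rewrite -scaleN1r tnZl scaleN1r. Qed.
Lemma tnNr (a : A) (b : B) : tn a (- b) = - tn a b.
Proof. by rewrite -scaleN1r tnZr scaleN1r. Qed.
Lemma tnBl (a a' : A) (b : B) : tn (a - a') b = tn a b - tn a' b.
Proof. by rewrite tnDl tnNl. Qed.
Lemma tnBr (a : A) (b b' : B) : tn a (b - b') = tn a b - tn a b'.
Proof. by rewrite tnDr tnNr. Qed.
Lemma tn_suml I (r : seq I) (P : pred I) (f : I -> A) (b : B) :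
  tn (\sum_(i <- r | P i) f i) b = \sum_(i <- r | P i) tn (f i) b.
Proof. exact: (big_morph (fun a => tn a b) (fun x y => tnDl x y b) (tn0l b)). Qed.
Lemma tn_sumr I (r : seq I) (P : pred I) (f : I -> B) (a : A) :
  tn a (\sum_(i <- r | P i) f i) = \sum_(i <- r | P i) tn a (f i).
Proof. exact: (big_morph (tn a) (tnDr a) (tn0r a)). Qed.

Lemma tp_ind (P : Z -> Prop) : P 0 ->
  (forall x y, P x -> P y -> P (x + y)) -> (forall a b, P (tn a b)) ->
  forall z, P z.
Proof.
move=> P0 PD Pt z; have [m [a [b ->]]] := tn_spanned z.
by apply: big_ind.
Qed.

Lemma tp_ext (W : lmodType C) (f g : {linear Z -> W}) :
  (forall a b, f (tn a b) = g (tn a b)) -> f =1 g.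
Proof.
move=> e; apply: tp_ind => [|x y hx hy|//]; first by rewrite !linear0.
by rewrite !linearD hx hy.
Qed.

Lemma slice_bil (g : {linear B -> C^o}) : bil (fun (a : A) (b : B) => (g b : C) *: a).
Proof.
split=> [k x y b|a k x y].
  by rewrite scalerDr !scalerA mulrC.
by rewrite linearP scalerDl scalerA.
Qed.

(** The slice map [id (x) g]. *)
Definition slice (g : {linear B -> C^o}) : {linear Z -> A} := tlift Z (slice_bil g).

Lemma slice_tn g a b : slice g (tn a b) = (g b : C) *: a.
Proof. exact: tlift_tn. Qed.

(** Induction on the number of simple tensors. If [g] does not vanish at the last [b], the vanishing
    of the slice along [g] expresses the last [a] through the others, and the last term is absorbed
    by modifying the other [b]. *)
Lemma slice_inj (G : {linear B -> C^o} -> Prop) :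
  (forall b, (forall g, G g -> g b = 0) -> b = 0) ->
  forall z, (forall g, G g -> slice g z = 0) -> z = 0.
Proof.
move=> sep z hz; have [m [a [b zE]]] := tn_spanned z.
rewrite {}zE in hz *.
have {}hz g : G g -> \sum_l (g (b l) : C) *: a l = 0.
  by move/hz; rewrite linear_sum; under eq_bigr do rewrite slice_tn.
elim: m a b hz => [|m IH] a b hz; first by rewrite big_ord0.
have [b0|] := pselect (b ord_max = 0).
  rewrite big_ord_recr /= b0 tn0r addr0; apply: IH => g /hz.
  by rewrite big_ord_recr /= b0 linear0 scale0r addr0.
move=> bn0; have [g [Gg gb]] : exists g, G g /\ g (b ord_max) <> 0.
  apply: contrapT => h; apply: bn0; apply: sep => g Gg; apply: contrapT => gb.
  by apply: h; exists g.
pose w := widen_ord (leqnSn m); pose c l : C := (g (b (w l)) : C) / g (b ord_max).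
have am : a ord_max = - \sum_(l < m) c l *: a (w l).
  have := hz g Gg; rewrite big_ord_recr /= => /eqP; rewrite addr_eq0 => /eqP e.
  have -> : a ord_max = (g (b ord_max) : C)^-1 *: ((g (b ord_max) : C) *: a ord_max).
    by rewrite scalerA mulVf ?scale1r //; apply/eqP.
  rewrite -[X in _ *: X]opprK -e scalerN scaler_sumr; congr (- _).
  by apply: eq_bigr => l _; rewrite scalerA mulrC.
have -> : \sum_(l < m.+1) tn (a l) (b l) =
  \sum_(l < m) tn (a (w l)) (b (w l) - c l *: b ord_max).
  rewrite big_ord_recr /= am tnNl tn_suml -sumrN -big_split; apply: eq_bigr => l _.
  by rewrite tnBr tnZl tnZr.
apply: IH => h Gh; have := hz h Gh; rewrite big_ord_recr /= am scalerN scaler_sumr.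
rewrite -sumrN -big_split /= => e; rewrite -[RHS]e; apply: eq_bigr => l _.
rewrite linearB linearZ /= scalerBl scalerA; congr (_ - _ *: _).
by rewrite -[_ *: _]/(_ * _) mulrC.
Qed.
End Gen.

Arguments slice {A B Z} g.

Section Map.
Variables (A B A' : lmodType C) (Z : tprod A B) (Z' : tprod A' B) (f : {linear A -> A'}).
Lemma mapl_bil : bil (fun (a : A) (b : B) => tn (f a) b : Z').
Proof.
by split=> [k x y b|a k x y]; rewrite ?linearP ?tnDl ?tnZl ?tnDr ?tnZr.
Qed.
Definition mapl : {linear Z -> Z'} := tlift Z mapl_bil.
Lemma mapl_tn a b : mapl (tn a b) = tn (f a) b.
Proof. exact: tlift_tn. Qed.

Lemma slice_mapl (g : {linear B -> C^o}) z : slice g (mapl z) = f (slice g z).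
Proof.
have h : slice g \o mapl =1 f \o slice g.
  apply: (@tp_ext _ _ _ _ (slice g \o mapl) (f \o slice g)) => a b /=.
  by rewrite mapl_tn !slice_tn linearZ.
exact: h.
Qed.

(** Slices commute with [mapl], so that the injectivity of [f] applies to each slice. *)
Lemma mapl_inj (G : {linear B -> C^o} -> Prop) :
  (forall b, (forall g, G g -> g b = 0) -> b = 0) -> injective f -> injective mapl.
Proof.
move=> sep fi x y e; apply/eqP; rewrite -subr_eq0; apply/eqP.
apply: (slice_inj sep) => g Gg; apply: fi.
by rewrite linear0 -slice_mapl linearB /= e subrr linear0.
Qed.
End Map.

Section MxMap.
Variables (A B : lmodType C) (Z : tprod A B) (p q : nat) (f : {linear A -> 'M[C]_p}) (g : {linear B -> 'M[C]_q}).
Lemma mxmap_bil : bil (fun (a : A) (b : B) => (f a *t g b)%R).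
Proof.
split=> [k x y b|a k x y]; rewrite linearP; apply/matrixP => i j; rewrite !mxE.
  by rewrite mulrDl mulrA.
by rewrite mulrDr mulrCA.
Qed.
Definition mxmap : {linear Z -> 'M[C]_(p * q)} := tlift Z mxmap_bil.
Lemma mxmap_tn a b : mxmap (tn a b) = (f a *t g b)%R.
Proof. exact: tlift_tn. Qed.
End MxMap.

(* Through the conjugate module, conjugate linear maps become linear and can be
   lifted to the tensor product. *)
Section ConjMod.
Variable V : lmodType C.
Record conjmod := Conj { unconj : V }.
HB.instance Definition _ := [isNew for unconj].
HB.instance Definition _ := [Choice of conjmod by <:].
Let cadd x y := Conj (unconj x + unconj y).
Let copp x := Conj (- unconj x).
Let caddA : associative cadd.
Proof. by move=> x y z; rewrite /cadd addrA. Qed.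
Let caddC : commutative cadd.
Proof. by move=> x y; rewrite /cadd addrC. Qed.
Let cadd0 : left_id (Conj 0) cadd.
Proof. by move=> [x]; rewrite /cadd add0r. Qed.
Let caddN : left_inverse (Conj 0) copp cadd.
Proof. by move=> [x]; rewrite /cadd /copp /= addNr. Qed.
HB.instance Definition _ := GRing.isZmodule.Build conjmod caddA caddC cadd0 caddN.
Let cscale (a : C) (v : conjmod) : conjmod := Conj ((conjC a : C) *: unconj v).
Let cscaleA a b v : cscale a (cscale b v) = cscale (a * b) v.
Proof. by rewrite /cscale scalerA rmorphM. Qed.
Let cscale1 : left_id 1 cscale.
Proof. by move=> [v]; rewrite /cscale rmorph1 scale1r. Qed.
Let cscaleDr : right_distributive cscale +%R.
Proof. by move=> a [v] [w]; rewrite /cscale /= scalerDr. Qed.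
Let cscaleDl v : {morph cscale^~ v : a b / a + b}.
Proof. by move=> a b; rewrite /cscale rmorphD scalerDl. Qed.
HB.instance Definition _ := GRing.Zmodule_isLmodule.Build C conjmod
  cscaleA cscale1 cscaleDr cscaleDl.
Lemma ConjP (a : C) (v w : V) :
  a *: Conj v + Conj w = Conj ((conjC a : C) *: v + w).
Proof. by []. Qed.
Lemma unconjP (a : C) (v w : conjmod) :
  unconj (a *: v + w) = (conjC a : C) *: unconj v + unconj w.
Proof. by []. Qed.
End ConjMod.

Definition conj_linear (U V : lmodType C) (f : U -> V) :=
  forall a x y, f (a *: x + y) = (conjC a : C) *: f x + f y.

Section Props.
Variables (U V : lmodType C) (f : U -> V).
Hypothesis fc : conj_linear f.
Lemma conj_linear0 : f 0 = 0.
Proof. by have := fc (-1) 0 0; rewrite scaler0 addr0 rmorphN rmorph1 scaleN1r addNr. Qed.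
Lemma conj_linearD x y : f (x + y) = f x + f y.
Proof. by have := fc 1 x y; rewrite rmorph1 !scale1r. Qed.
Lemma conj_linearZ a x : f (a *: x) = (conjC a : C) *: f x.
Proof. by have := fc a x 0; rewrite !addr0 conj_linear0 addr0. Qed.
Lemma conj_linear_sum I (r : seq I) (P : pred I) (F : I -> U) :
  f (\sum_(i <- r | P i) F i) = \sum_(i <- r | P i) f (F i).
Proof. exact: (big_morph f conj_linearD conj_linear0). Qed.
End Props.

Section Tstar.
Variables (A B : lmodType C) (Z : tprod A B) (sA : A -> A) (sB : B -> B).
Hypotheses (cA : conj_linear sA) (cB : conj_linear sB).

Lemma tstar_bil : bil (fun (a : A) (b : B) => Conj (tn (sA a) (sB b) : Z)).
Proof.
split=> [k x y b|a k x y].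
  by rewrite ConjP cA tnDl tnZl.
by rewrite ConjP cB tnDr tnZr.
Qed.

Definition tstar (z : Z) : Z := unconj (tlift Z tstar_bil z).

Lemma tstar_conj : conj_linear tstar.
Proof. by move=> a x y; rewrite /tstar linearP unconjP. Qed.

Lemma tstar_tn a b : tstar (tn a b) = tn (sA a) (sB b).
Proof. by rewrite /tstar tlift_tn. Qed.

End Tstar.
End TensorC.

Arguments tn {R A B t} a b.
Arguments slice {R A B Z} g.

(** * The cones of the maximal tensor product *)

Section Max.
Variable R : realType.
Local Notation C := R[i].
Local Notation conjC := (@Num.conj C).

Section MaxD.
Variables (A B : uospace R) (Z : tprod A B).

Definition max_form (I J : finType) n (S : I -> I -> A) (T : J -> J -> B) (X : I -> J -> 'I_n -> C) :
  'M[Z]_n := \matrix_(i, j)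
  \sum_k \sum_l \sum_k' \sum_l' (conjC (X k l i) * X k' l' j) *: (tn (S k k') (T l l') : Z).

(* [pre_max_cone] for matrices indexed by arbitrary finite types. *)
Definition maxD n (Y : 'M[Z]_n) : Prop :=
  exists (I J : finType) (S : I -> I -> A) (T : J -> J -> B) (X : I -> J -> 'I_n -> C),
    [/\ mcone S, mcone T & Y = max_form S T X].

Definition tunit n (e : R) : 'M[Z]_n := unit_diag (tn (uo_one A) (uo_one B) : Z) n e.

Lemma tunitE n e : tunit n e = \matrix_(i, j) ((e%:C%C * (i == j)%:R) *: (tn (uo_one A) (uo_one B) : Z)).
Proof.
apply/matrixP => i j; rewrite !mxE; case: (i == j); first by rewrite mulr1n mulr1.
by rewrite mulr0n mulr0 scale0r.
Qed.

Lemma max_form_compress (I J : finType) n m (S : I -> I -> A) (T : J -> J -> B)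
  (X : I -> J -> 'I_n -> C) (W : 'I_n -> 'I_m -> C) :
  \matrix_(i, j) (\sum_k \sum_l (conjC (W k i) * W l j) *: max_form S T X k l) =
  max_form S T (fun k l i => \sum_u W u i * X k l u).
Proof.
apply/matrixP => i j; rewrite !mxE.
transitivity (\sum_u \sum_v \sum_k \sum_l \sum_k' \sum_l'
  (conjC (W u i * X k l u) * (W v j * X k' l' v)) *: (tn (S k k') (T l l') : Z)).
  apply: eq_bigr => u _; apply: eq_bigr => v _; rewrite mxE scaler_sumr.
  apply: eq_bigr => k _; rewrite scaler_sumr; apply: eq_bigr => l _.
  rewrite scaler_sumr; apply: eq_bigr => k' _; rewrite scaler_sumr.
  by apply: eq_bigr => l' _; rewrite scalerA rmorphM mulrACA.
under eq_bigr do rewrite exchange_big /=.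
rewrite exchange_big /=; apply: eq_bigr => k _.
under eq_bigr do rewrite exchange_big /=.
rewrite exchange_big /=; apply: eq_bigr => l _.
under eq_bigr do rewrite exchange_big /=.
rewrite exchange_big /=; apply: eq_bigr => k' _.
under eq_bigr do rewrite exchange_big /=.
rewrite exchange_big /=; apply: eq_bigr => l' _.
rewrite rmorph_sum mulr_suml scaler_suml; apply: eq_bigr => u _.
by rewrite mulr_sumr scaler_suml.
Qed.

Definition mscale (V : lmodType C) n (a : C) (Y : 'M[V]_n) : 'M[V]_n := map_mx ( *:%R a) Y.

Lemma maxD_compress n m (Y : 'M[Z]_n) (W : 'I_n -> 'I_m -> C) : maxD Y ->
  maxD (\matrix_(i, j) (\sum_k \sum_l (conjC (W k i) * W l j) *: Y k l)).
Proof.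
move=> [I [J [S [T [X [hS hT ->]]]]]]; rewrite max_form_compress.
by exists I, J, S, T, (fun k l i => \sum_u W u i * X k l u).
Qed.

Lemma maxD_scale n (Y : 'M[Z]_n) (a : C) : 0 <= a -> maxD Y -> maxD (mscale a Y).
Proof.
move=> a0 /(@maxD_compress _ n _ (fun k i => sqrtC a * (k == i)%:R)).
congr maxD; apply/matrixP => i j; rewrite !mxE.
rewrite (bigD1 i) //= [X in _ + X]big1 ?addr0 => [|k ki]; last first.
  by rewrite big1 // => l _; rewrite (negPf ki) mulr0 rmorph0 mul0r scale0r.
rewrite (bigD1 j) //= big1 ?addr0 => [|l lj]; last first.
  by rewrite (negPf lj) !mulr0 scale0r.
rewrite !eqxx !mulr1.
have -> : conjC (sqrtC a) = sqrtC a by apply: geC0_conj; rewrite sqrtC_ge0.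
by rewrite -expr2 sqrtCK.
Qed.

End MaxD.

Lemma maxD_map (A A' B : uospace R) (Z : tprod A B) (Z' : tprod A' B) (f : {linear A -> A'}) n (Y : 'M[Z]_n) :
  cp f -> maxD Y -> maxD (map_mx (mapl Z Z' f) Y).
Proof.
move=> cf [I [J [S [T [X [hS hT ->]]]]]].
exists I, J, (fun i j => f (S i j)), T, X; split=> //; first exact: cp_mcone.
apply/matrixP => i j; rewrite !mxE linear_sum; apply: eq_bigr => k _.
rewrite linear_sum; apply: eq_bigr => l _.
rewrite linear_sum; apply: eq_bigr => k' _.
rewrite linear_sum; apply: eq_bigr => l' _.
by rewrite linearZ /= mapl_tn.
Qed.

Section OS.
Variables (S T : opsys R) (Z : tprod (os_car S) (os_car T)).

Lemma gcone_sumtype (V : opsys R) (I J : finType) (X : I -> I -> os_car V) (Y : J -> J -> os_car V) :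
  gcone X -> gcone Y -> gcone (fun a b : I + J => match a, b with
   | inl i, inl j => X i j | inr i, inr j => Y i j | _, _ => 0 end).
Proof.
move=> hX hY xi; rewrite big_sumType /=; apply: addr_ge0.
  have := hX (fun i => xi (inl i)); congr (_ <= _); apply: eq_bigr => i _.
  rewrite big_sumType /= [X in _ = _ + X]big1 ?addr0 // => j _.
  by rewrite act0l dot0l.
have := hY (fun i => xi (inr i)); congr (_ <= _); apply: eq_bigr => i _.
rewrite big_sumType /= [X in _ = X + _]big1 ?add0r // => j _.
by rewrite act0l dot0l.
Qed.

(** Both factors become direct sums, and the scalar matrix vanishes on mixed pairs of indices, so
    that the cross terms [S1 (x) T2] and [S2 (x) T1] are compressed away. *)
Lemma maxD_add n (Y Y' : 'M[Z]_n) : @maxD S T Z n Y -> @maxD S T Z n Y' -> @maxD S T Z n (Y + Y').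
Proof.
move=> [I1 [J1 [S1 [T1 [X1 [/os_mconeP hS1 /os_mconeP hT1 ->]]]]]].
move=> [I2 [J2 [S2 [T2 [X2 [/os_mconeP hS2 /os_mconeP hT2 ->]]]]]].
exists (I1 + I2)%type, (J1 + J2)%type.
exists (fun a b => match a, b with | inl i, inl j => S1 i j | inr i, inr j => S2 i j | _, _ => 0 end).
exists (fun a b => match a, b with | inl i, inl j => T1 i j | inr i, inr j => T2 i j | _, _ => 0 end).
exists (fun a b i => match a, b with | inl k, inl l => X1 k l i | inr k, inr l => X2 k l i | _, _ => 0 end).
split; [apply/os_mconeP; exact: gcone_sumtype|apply/os_mconeP; exact: gcone_sumtype|].
apply/matrixP => i j; rewrite !mxE big_sumType /=; congr (_ + _).
  apply: eq_bigr => k _; rewrite big_sumType /= [X in _ = _ + X]big1 ?addr0; last first.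
    move=> l _; rewrite big1 // => k' _; rewrite big1 // => l' _.
    by rewrite rmorph0 mul0r scale0r.
  apply: eq_bigr => l _; rewrite big_sumType /= [X in _ = _ + X]big1 ?addr0; last first.
    by move=> k' _; rewrite big1 // => l' _; rewrite tn0l scaler0.
  apply: eq_bigr => k' _; rewrite big_sumType /= [X in _ = _ + X]big1 ?addr0 // => l' _.
  by rewrite tn0r scaler0.
apply: eq_bigr => k _; rewrite big_sumType /= [X in _ = X + _]big1 ?add0r; last first.
  move=> l _; rewrite big1 // => k' _; rewrite big1 // => l' _.
  by rewrite rmorph0 mul0r scale0r.
apply: eq_bigr => l _; rewrite big_sumType /= [X in _ = X + _]big1 ?add0r; last first.
  by move=> k' _; rewrite big1 // => l' _; rewrite tn0l scaler0.
apply: eq_bigr => k' _; rewrite big_sumType /= [X in _ = X + _]big1 ?add0r // => l' _.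
by rewrite tn0r scaler0.
Qed.

Lemma psd_id (I : finType) : psd (fun i j : I => (i == j)%:R : C).
Proof.
move=> c; apply: sumr_ge0 => i _; rewrite (bigD1 i) //= big1 ?addr0.
  by rewrite eqxx mulr1 mulrC mul_conjC_ge0.
by move=> j ji; rewrite eq_sym (negPf ji) mulr0 mul0r.
Qed.

(** If [M = W^* W], this is the compression by [W] of [s (x) diag(t, ..., t)]. *)
Lemma maxD_simple n (M : 'I_n -> 'I_n -> C) (s : os_car S) (t : os_car T) :
  psd M -> os_pos s -> os_pos t -> @maxD S T Z n (\matrix_(i, j) (M i j *: (tn s t : Z))).
Proof.
move=> /psd_factor[W WE] hs ht.
exists 'I_1, 'I_n, (fun _ _ => s), (fun i j => (i == j)%:R *: t), (fun _ l i => W l i).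
split; [apply/os_mconeP; exact: os_posP|apply/os_mconeP|].
  exact: gcone_pos (@psd_id _) ht.
apply/matrixP => i j; rewrite !mxE big_ord1 WE scaler_suml; apply: eq_bigr => k _.
rewrite big_ord1 (bigD1 k) //= big1 ?addr0 => [|l lk].
  by rewrite eqxx scale1r.
by rewrite eq_sym (negPf lk) scale0r tn0r scaler0.
Qed.

Lemma os_star_conj (V : opsys R) : conj_linear (@os_star R V).
Proof. by move=> a x y; rewrite os_starD os_starZ. Qed.

Definition ts (z : Z) : Z := @tstar _ _ _ Z _ _ (@os_star_conj S) (@os_star_conj T) z.
Definition mstar n (Y : 'M[Z]_n) : 'M[Z]_n := \matrix_(i, j) ts (Y j i).

Lemma ts_conj : conj_linear ts.
Proof. exact: tstar_conj. Qed.
Lemma ts_tn s t : ts (tn s t) = tn (os_star s) (os_star t).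
Proof. exact: tstar_tn. Qed.
Lemma tsD x y : ts (x + y) = ts x + ts y.
Proof. exact: (conj_linearD ts_conj). Qed.
Lemma tsZ a x : ts (a *: x) = (conjC a : C) *: ts x.
Proof. exact: (conj_linearZ ts_conj). Qed.
Lemma ts_sum I (r : seq I) (P : pred I) (F : I -> Z) :
  ts (\sum_(i <- r | P i) F i) = \sum_(i <- r | P i) ts (F i).
Proof. exact: (conj_linear_sum ts_conj). Qed.

(** Evaluated at [v] and [w], the principal block at [i] and [j] becomes a positive scalar matrix of
    size 2, to which [psd_herm] applies. *)
Lemma gcone_herm (V : opsys R) (I : finType) (X : I -> I -> os_car V) : gcone X ->
  forall i j, os_star (X i j) = X j i.
Proof.
move=> hX i j; apply: os_star_uniq => v w.
pose M (a b : bool) : C := h_dot _ (os_act V (X (if a then i else j) (if b then i else j))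
   (if b then v else w)) (if a then v else w).
have pM : psd M.
  have h2 := gcone_reindex (fun a : bool => if a then i else j) hX.
  move=> c; have := h2 (fun a => c a *: (if a then v else w)); congr (_ <= _).
  apply: eq_bigr => a _; apply: eq_bigr => b _.
  by rewrite actZr dotZl dotZr /M; ring.
have := psd_herm pM true false; rewrite /M /= => ->.
by rewrite -dotC.
Qed.

Lemma maxD_herm n (Y : 'M[Z]_n) : @maxD S T Z n Y -> mstar Y = Y.
Proof.
move=> [I [J [s [t [X [/os_mconeP hs /os_mconeP ht ->]]]]]].
apply/matrixP => i j; rewrite !mxE.
rewrite ts_sum; under eq_bigr do rewrite ts_sum; rewrite pair_bigA /=.
under [RHS]eq_bigr do under eq_bigr do rewrite pair_bigA /=.
rewrite [RHS]pair_bigA /=.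
under eq_bigr do (rewrite ts_sum; under eq_bigr do rewrite ts_sum; rewrite pair_bigA /=).
rewrite exchange_big /=; apply: eq_bigr => -[k l] _; apply: eq_bigr => -[k' l'] _ /=.
rewrite tsZ ts_tn (gcone_herm hs) (gcone_herm ht) rmorphM /= conjCK.
by rewrite mulrC.
Qed.

Lemma ts0 : ts 0 = 0.
Proof. exact: (conj_linear0 ts_conj). Qed.
Lemma mstar0 n : mstar (0 : 'M[Z]_n) = 0.
Proof. by apply/matrixP => i j; rewrite !mxE ts0. Qed.
Lemma mstarD n (Y Y' : 'M[Z]_n) : mstar (Y + Y') = mstar Y + mstar Y'.
Proof. by apply/matrixP => i j; rewrite !mxE tsD. Qed.
Lemma mstarZ n a (Y : 'M[Z]_n) : mstar (mscale a Y) = mscale (conjC a) (mstar Y).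
Proof. by apply/matrixP => i j; rewrite !mxE tsZ. Qed.

Lemma tunitD n (r s : R) : @tunit S T Z n (r + s) = @tunit S T Z n r + @tunit S T Z n s.
Proof. by rewrite !tunitE; apply/matrixP => i j; rewrite !mxE -scalerDl -mulrDl rmorphD. Qed.

Lemma maxD_unit n (r : R) : 0 <= r -> @maxD S T Z n (@tunit S T Z n r).
Proof.
move=> r0; rewrite tunitE.
have := maxD_simple (@psd_id 'I_n) (@os_pos_one _ S) (@os_pos_one _ T).
have r0' : 0 <= r%:C%C :> C by rewrite ler0c.
move=> /(maxD_scale r0'); congr maxD.
by apply/matrixP => i j; rewrite !mxE scalerA.
Qed.

Lemma quad_delta (I : finType) (i0 j0 : I) (c : C) (v : I -> C) :
  \sum_i \sum_j conjC (v i) * (c *+ ((i == i0) && (j == j0))) * v j =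
  conjC (v i0) * c * v j0.
Proof.
rewrite -(sum_delta i0 (fun i => conjC (v i) * c * v j0)); apply: eq_bigr => i _.
rewrite -(sum_delta j0 (fun j => conjC (v i) * c * v j)) -sumrMnl; apply: eq_bigr => j _.
by case: (i == i0) (j == j0) => -[] /=; rewrite ?mulr1n ?mulr0n ?mulr0 ?mul0r ?mul0rn.
Qed.

(** This dominates an off-diagonal entry by the identity. From [|v_i - c v_j|^2 >= 0], twice the
    real part of [conj(v_i) c v_j] is at most [|v_i|^2 + |c|^2 |v_j|^2], hence at most [1 + |c|^2]
    times the squared norm of [v]. *)
Lemma psd_le_one n (i0 j0 : 'I_n) (c : C) : psd (fun i j : 'I_n =>
  (1 + conjC c * c) * (i == j)%:R - (c *+ ((i == i0) && (j == j0)) + conjC c *+ ((i == j0) && (j == i0)))).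
Proof.
move=> v; set s := \sum_i conjC (v i) * v i.
have E : \sum_i \sum_j conjC (v i) * ((1 + conjC c * c) * (i == j)%:R -
    (c *+ ((i == i0) && (j == j0)) + conjC c *+ ((i == j0) && (j == i0)))) * v j =
  (1 + conjC c * c) * s - (conjC (v i0) * c * v j0 + conjC (v j0) * conjC c * v i0).
  rewrite -(quad_delta i0 j0 c v) -(quad_delta j0 i0 (conjC c) v) mulr_sumr -big_split -sumrB.
  apply: eq_bigr => i _; rewrite -[X in _ * (_ * X)](sum_delta i v).
  rewrite !mulr_sumr -big_split -sumrB; apply: eq_bigr => j _ /=.
  have EE (x y a b d : C) : x * (a - (b + d)) * y = x * a * y - (x * b * y + x * d * y) by ring.
  rewrite EE; congr (_ - _); rewrite [j == i]eq_sym -mulr_natr; by ring.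
rewrite E.
have vs i : conjC (v i) * v i <= s.
  rewrite /s (bigD1 i) //= lerDl; apply: sumr_ge0 => j _.
  by rewrite mulrC mul_conjC_ge0.
have cc : 0 <= conjC c * c by rewrite mulrC mul_conjC_ge0.
have h : 0 <= (v i0 - c * v j0) * conjC (v i0 - c * v j0) by apply: mul_conjC_ge0.
have h2 := lerD (vs i0) (ler_wpM2l cc (vs j0)).
rewrite subr_ge0; apply: le_trans (_ : _ <= conjC (v i0) * v i0 + conjC c * c * (conjC (v j0) * v j0)) _.
  rewrite -subr_ge0; move: h; congr (_ <= _); rewrite rmorphB rmorphM /=; by ring.
by rewrite mulrDl mul1r.
Qed.

(** The order unit property of [1 (x) 1], stated for twice the real part of [Y] so that it is
    additive and applies to matrices that are not hermitian. *)
Definition bounded_above n (Y : 'M[Z]_n) :=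
  exists2 r : R, 0 <= r & @maxD S T Z n (@tunit S T Z n r - (Y + mstar Y)).

Lemma bounded_aboveD n (Y Y' : 'M[Z]_n) : bounded_above Y -> bounded_above Y' ->
  bounded_above (Y + Y').
Proof.
move=> [r r0 hr] [s s0 hs]; exists (r + s); first exact: addr_ge0.
have := maxD_add hr hs; congr maxD.
by rewrite tunitD mstarD addrACA -opprD addrACA.
Qed.

Definition single n (i0 j0 : 'I_n) (z : Z) : 'M[Z]_n :=
  \matrix_(i, j) (z *+ ((i == i0) && (j == j0))).

Lemma singleD n (i0 j0 : 'I_n) z w : single i0 j0 (z + w) = single i0 j0 z + single i0 j0 w.
Proof. by apply/matrixP => i j; rewrite !mxE mulrnDl. Qed.

Lemma bounded_above0 n : bounded_above (0 : 'M[Z]_n).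
Proof.
exists 0 => //; have := @maxD_unit n 0 (lexx 0); congr maxD.
apply/matrixP => i j; rewrite !mxE.
have -> : ts 0 = 0 by exact: (conj_linear0 ts_conj).
by rewrite addr0 subr0.
Qed.

(** Let [F] be the sum of the scalar matrix with entry [c] at [(i0, j0)] and of its adjoint. Then
    [g a b - F (x) s (x) t] is the sum of [(g - F) (x) s (x) t], [g (a - s) (x) b] and
    [g s (x) (b - t)], all positive; the norms [a] and [b] dominate [s] and [t]. *)
Lemma bounded_above_pos n (i0 j0 : 'I_n) (c : C) s t : os_pos s -> os_pos t ->
  bounded_above (single i0 j0 (c *: tn s t)).
Proof.
move=> hs ht.
have [hs' _] := herm_le_onorm (os_pos_herm hs).
have [ht' _] := herm_le_onorm (os_pos_herm ht).
set a := onorm s in hs'; set b := onorm t in ht'.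
have a0 : 0 <= a%:C%C :> C by rewrite ler0c onorm_ge0.
have b0 : 0 <= b%:C%C :> C by rewrite ler0c onorm_ge0.
have g0 : 0 <= 1 + conjC c * c by rewrite addr_ge0 // mulrC mul_conjC_ge0.
set g := 1 + conjC c * c in g0.
exists (complex.Re g * a * b).
  by rewrite !mulr_ge0 ?onorm_ge0 // -ler0c ge0_RRe.
have h1 := maxD_simple (psd_le_one i0 j0 c) hs ht.
have h2 := maxD_scale g0 (maxD_simple (@psd_id 'I_n) hs' (os_posZ b0 (@os_pos_one _ T))).
have h3 := maxD_scale g0 (maxD_simple (@psd_id 'I_n) hs ht').
have := maxD_add h1 (maxD_add h2 h3); congr maxD.
rewrite tunitE; apply/matrixP => i j; rewrite !mxE !rmorphM /= (ge0_RRe g0).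
have -> : ts ((c *: tn s t) *+ ((j == i0) && (i == j0))) =
   (conjC c : C) *: tn s t *+ ((j == i0) && (i == j0)).
  case: (_ && _); last exact: (conj_linear0 ts_conj).
  by rewrite !mulr1n tsZ ts_tn !os_pos_herm.
have e : tn (a%:C%C *: os_one S - s) (b%:C%C *: os_one T) + tn s (b%:C%C *: os_one T - t) =
   (a%:C%C * b%:C%C) *: tn (os_one S) (os_one T) - tn s t :> Z.
  by rewrite tnBl tnBr !tnZl !tnZr scalerA addrA subrK.
rewrite -[X in _ + X](scalerDr g) -scalerDr e [(j == i0) && _]andbC.
rewrite scalerBl scalerDl !scalerBr !scalerA [X in X + _ = _]addrC -addrA.
rewrite [X in _ + X]addrC subrK addrC -!scalerMnl; congr (_ *: _ - _).
by rewrite -/g; ring.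
Qed.

Lemma bounded_above_all n (Y : 'M[Z]_n) : bounded_above Y.
Proof.
have h i0 j0 : forall z, bounded_above (single (n := n) i0 j0 z).
  apply: tp_ind => [|x y hx hy|s t].
      have -> : single (n := n) i0 j0 0 = 0 by apply/matrixP => i j; rewrite !mxE mul0rn.
      exact: bounded_above0.
    by rewrite singleD; exact: bounded_aboveD.
  suff : forall c : C, bounded_above (single (n := n) i0 j0 (c *: tn s t)).
    by move=> /(_ 1); rewrite scale1r.
  move: s; apply: os_pos_ind => [a x y hx hy c|s hs].
    by rewrite tnDl tnZl scalerDr singleD scalerA; exact: bounded_aboveD.
  move: t; apply: os_pos_ind => [a x y hx hy c|t ht c].
    by rewrite tnDr tnZr scalerDr singleD scalerA; exact: bounded_aboveD.
  exact: bounded_above_pos.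
have -> : Y = \sum_i \sum_j single i j (Y i j).
  apply/matrixP => i j; rewrite !summxE (bigD1 i) //= [X in _ + X]big1 ?addr0.
    rewrite summxE (bigD1 j) //= big1 ?addr0; first by rewrite mxE !eqxx.
    by move=> l lj; rewrite mxE eqxx eq_sym (negPf lj).
  move=> k ki; rewrite summxE big1 // => l _.
  by rewrite mxE eq_sym (negPf ki).
apply: big_ind => [||i _]; [exact: bounded_above0|exact: bounded_aboveD|].
by apply: big_ind => [||j _]; [exact: bounded_above0|exact: bounded_aboveD|exact: h].
Qed.
End OS.
Section Defs_level.
Variables A B : uospace R.
Local Notation ZZ := (tensor_tprod A B).

Lemma pre_max_coneP n (Y : 'M[tensor A B]_n) :
  @pre_max_cone R A B n Y <-> @maxD A B ZZ n Y.
Proof.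
split.
  move=> [p [q [S [T [X [hS hT ->]]]]]].
  exists 'I_p, 'I_q, (fun i j => S i j), (fun i j => T i j),
    (fun k l i => X (mxtens_index (k, l)) i).
  split; [exact: (proj1 (mo_coneP _) hS)|exact: (proj1 (mo_coneP _) hT)|].
  apply/matrixP => i j; rewrite !mxE.
  have bij (V : nmodType) (f : 'I_p -> 'I_q -> V) : \sum_k \sum_l f k l =
    \sum_(u < p * q) f (mxtens_unindex u).1 (mxtens_unindex u).2.
    rewrite pair_bigA (reindex (@mxtens_unindex p q)) //=.
    exists (@mxtens_index p q) => x _; [exact: mxtens_unindexK|exact: mxtens_indexK].
  rewrite bij; apply: eq_bigr => u _; rewrite bij; apply: eq_bigr => v _.
  rewrite !mxE -!surjective_pairing !mxtens_unindexK.
  by [].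
move=> [I [J [S [T [X [hS hT ->]]]]]].
exists #|I|, #|J|, (\matrix_(i, j) S (enum_val i) (enum_val j)),
  (\matrix_(i, j) T (enum_val i) (enum_val j)),
  (\matrix_(u, i) X (enum_val (mxtens_unindex u).1) (enum_val (mxtens_unindex u).2) i).
split => //.
have bij (V : nmodType) (f : I -> J -> V) : \sum_k \sum_l f k l =
  \sum_(u < #|I| * #|J|) f (enum_val (mxtens_unindex u).1) (enum_val (mxtens_unindex u).2).
  rewrite pair_bigA (reindex (fun u : 'I_(#|I| * #|J|) =>
     (enum_val (mxtens_unindex u).1, enum_val (mxtens_unindex u).2))) //=.
  exists (fun kl => mxtens_index (enum_rank kl.1, enum_rank kl.2)) => [u _|[k l] _].
    transitivity (mxtens_index ((mxtens_unindex u).1, (mxtens_unindex u).2)).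
      by congr (mxtens_index (_, _)); exact: enum_valK.
    by rewrite -surjective_pairing mxtens_unindexK.
  have h := mxtens_indexK (enum_rank k, enum_rank l).
  change ((enum_val (mxtens_unindex (mxtens_index (enum_rank k, enum_rank l))).1,
    enum_val (mxtens_unindex (mxtens_index (enum_rank k, enum_rank l))).2) = (k, l)).
  by rewrite h !enum_rankK.
apply/matrixP => i j; rewrite !mxE bij; apply: eq_bigr => u _.
rewrite bij; apply: eq_bigr => v _.
by rewrite !mxE.
Qed.

Lemma max_coneP n (Y : 'M[tensor A B]_n) :
  @mo_cone R (tens_max A B) n Y <-> forall e : R, 0 < e -> @maxD A B ZZ n ((Y : 'M[ZZ]_n) + tunit ZZ n e).
Proof. by split=> h e e0; have := h e e0 => /pre_max_coneP. Qed.

End Defs_level.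
End Max.

(** * Separation from the maximal cone *)

Section Separation.
Variable R : realType.
Local Notation C := R[i].
Local Notation conjC := (@Num.conj C).
Local Notation Re := complex.Re.
Variables (S T : opsys R) (Z : tprod (os_car S) (os_car T)).

Local Notation maxD := (@maxD R S T Z _).
Local Notation tunit := (@tunit R S T Z).

Lemma tunit_scale n (r : R) : tunit n r = mscale r%:C%C (tunit n 1).
Proof. by rewrite !tunitE; apply/matrixP => i j; rewrite !mxE scalerA rmorph1 mul1r. Qed.

Lemma maxD_separation n (X : 'M[Z]_n) (e : R) : 0 < e -> mstar X = X ->
  ~ maxD (X + tunit n e) ->
  exists f : 'I_n -> 'I_n -> {linear Z -> C^o},
  [/\ (forall Y, maxD Y -> 0 <= \sum_i \sum_j (f i j (Y i j) : C)),
      Re (\sum_i \sum_j (f i j (tunit n 1 i j) : C)) = 1 &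
      Re (\sum_i \sum_j (f i j (X i j) : C)) < 0].
Proof.
move=> e0 Xh nX.
(* Finite functions carry the complex module structure that the separation theorem asks for. *)
pose mxf (v : {ffun 'I_n * 'I_n -> Z}) : 'M[Z]_n := \matrix_(i, j) v (i, j).
pose D (Y : 'M[Z]_n) := maxD Y.
pose vx (Y : 'M[Z]_n) : {ffun 'I_n * 'I_n -> Z} := [ffun u => Y u.1 u.2].
have vxK Y : mxf (vx Y) = Y by apply/matrixP => i j; rewrite mxE ffunE.
have mxfD v w : mxf (v + w) = mxf v + mxf w.
  by apply/matrixP => i j; rewrite !mxE ffunE.
have mxfZ a v : mxf (a *: v) = mscale a (mxf v).
  by apply/matrixP => i j; rewrite !mxE ffunE.
(* This cone contains every skew-hermitian matrix, so a functional with nonnegative real part on it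
   is real on hermitian matrices. *)
pose K : set {ffun 'I_n * 'I_n -> Z} := [set v | D (mxf v + mstar (mxf v))]%classic.
have D0 : D 0.
  have := @maxD_unit _ S T Z n 0 (lexx 0); congr maxD; rewrite tunitE.
  by apply/matrixP => i j; rewrite !mxE mul0r scale0r.
have mscaleD (a : C) (Y Y' : 'M[Z]_n) : mscale a (Y + Y') = mscale a Y + mscale a Y'.
  by apply/matrixP => i j; rewrite !mxE scalerDr.
have Kc : convex_cone K.
  split=> [|v w|r v r0]; rewrite /K /=.
      have -> : mxf 0 = 0 by apply/matrixP => i j; rewrite !mxE ffunE.
      by rewrite mstar0 addr0.
    by move=> hv hw; rewrite mxfD mstarD addrACA; exact: maxD_add.
  move=> hv; rewrite mxfZ mstarZ conjCR -mscaleD; apply: maxD_scale => //.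
  by rewrite ler0c.
have u_herm : mstar (tunit n 1) = tunit n 1 by apply: maxD_herm; exact: maxD_unit.
have KE : K (vx (tunit n 1)).
  by rewrite /K /= vxK u_herm -tunitD; apply: maxD_unit; rewrite addr_ge0.
have ou v : exists t : R, K (t%:C%C *: vx (tunit n 1) - v).
  have [r r0 hr] := bounded_above_all (mxf v); exists (r / 2).
  rewrite /K /= mxfD mxfZ vxK -tunit_scale.
  have -> : mxf (- v) = - mxf v by apply/matrixP => i j; rewrite !mxE ffunE.
  rewrite mstarD.
  have -> : mstar (- mxf v) = - mstar (mxf v).
    apply/matrixP => i j; rewrite !mxE -scaleN1r tsZ rmorphN rmorph1 scaleN1r //.
  have -> : mstar (tunit n (r / 2)) = tunit n (r / 2).
    by apply: maxD_herm; apply: maxD_unit; rewrite divr_ge0.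
  by rewrite addrACA -tunitD -splitr -opprD.
have nK : ~ K (vx X + e%:C%C *: vx (tunit n 1)).
  rewrite /K /= mxfD mxfZ !vxK -tunit_scale => hK; apply: nX.
  have half0 : 0 <= 2%:R^-1 :> C by rewrite invr_ge0.
  have := maxD_scale half0 hK; congr maxD.
  rewrite mstarD Xh (maxD_herm (maxD_unit Z n (ltW e0))).
  apply/matrixP => i j; rewrite mxE [in LHS]mxE -mulr2n -[X in _ *: X]scaler_nat scalerA mulVf.
    by rewrite scale1r.
  by rewrite pnatr_eq0.
have [f [fK fE fX]] := krein_separation Kc KE ou e0 nK.
have fherm Y : mstar Y = Y -> complex.Im (f (vx Y)) = 0.
  move=> hY.
  have KY c : c + conjC c = 0 -> K (c *: vx Y).
    move=> c0; rewrite /K /= mxfZ vxK mstarZ hY.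
    have -> : mscale c Y + mscale (conjC c) Y = 0.
      by apply/matrixP => i j; rewrite !mxE -scalerDl c0 scale0r.
    exact: D0.
  have h1 := fK _ (KY 'i _); have h2 := fK _ (KY (- 'i) _).
  move: h1 h2; rewrite conjCi subrr rmorphN /= conjCi opprK addNr => /(_ erefl) h1 /(_ erefl).
  rewrite scaleNr linearN /=; move: h1; rewrite linearZ /= -complexiE.
  case: (f (vx Y)) => a b /=; rewrite mul0r mul1r sub0r opprK oppr_ge0 => h1 h2.
  by apply/eqP; rewrite eq_le h1 h2.
pose sg i j (z : Z) : {ffun 'I_n * 'I_n -> Z} := vx (single i j z).
have sgl i j : linear (fun z => f (sg i j z) : C^o).
  move=> a x y; rewrite -linearP; congr (f _); apply/ffunP => u.
  by rewrite !ffunE !mxE mulrnDl scalerMnr.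
pose g i j := mklin (sgl i j).
have gE (Y : 'M[Z]_n) : \sum_i \sum_j (g i j (Y i j) : C) = (f (vx Y) : C).
  rewrite /= /sg.
  have -> : vx Y = \sum_i \sum_j vx (single i j (Y i j)).
    apply/ffunP => -[k l]; rewrite sum_ffunE (bigD1 k) //= [X in _ + X]big1 ?addr0.
      rewrite sum_ffunE (bigD1 l) //= [X in _ + X]big1 ?addr0.
        by rewrite !ffunE !mxE !eqxx.
      by move=> j jl; rewrite ffunE mxE /= [l == j]eq_sym (negPf jl) andbF.
    move=> i ik; rewrite sum_ffunE big1 // => j _.
    by rewrite ffunE mxE /= [k == i]eq_sym (negPf ik).
  by rewrite linear_sum; apply: eq_bigr => i _; rewrite linear_sum.
exists g; split=> [Y hY||]; rewrite ?gE //.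
have hh := maxD_herm hY.
have : K (vx Y) by rewrite /K /= vxK hh; exact: maxD_add.
move/fK => f0; move: (fherm Y hh) f0; case: (f (vx Y)) => a b /= -> f0.
by rewrite lecE /= eqxx.
Qed.
End Separation.

(** * From the weak expectation property to the maximal inclusion *)

Section WepMax.
Variable R : realType.
Local Notation C := R[i].
Local Notation conjC := (@Num.conj C).
Local Notation Re := complex.Re.

Lemma sum_enum_rank (V : nmodType) (K : finType) (f : 'I_#|K| -> V) :
  \sum_i f i = \sum_k f (enum_rank k).
Proof.
rewrite (reindex_onto enum_rank enum_val) /=; last by move=> i _; exact: enum_valK.
by apply: eq_bigl => k; rewrite enum_rankK eqxx.
Qed.

Lemma exchange_big22 (V : nmodType) (I J K L : finType) (F : I -> J -> K -> L -> V) :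
  \sum_i \sum_j \sum_k \sum_l F i j k l = \sum_k \sum_l \sum_i \sum_j F i j k l.
Proof.
rewrite pair_bigA /=; under eq_bigr do rewrite pair_bigA /=.
rewrite exchange_big /= -(pair_bigA _ (fun k l => \sum_p F p.1 p.2 k l)) /=.
by apply: eq_bigr => k _; apply: eq_bigr => l _; rewrite [RHS]pair_bigA.
Qed.

Lemma functional_sumE (A : nmospace R) (I : finType) (F : I -> functional A) (x : A) :
  (\sum_i F i : functional A) x = \sum_i (F i x : C).
Proof. by rewrite -[LHS]/(@eval_at R A x (\sum_i F i)) linear_sum. Qed.

Lemma functional_scaleE (A : nmospace R) (a : C) (F : functional A) (x : A) :
  (a *: F) x = a * (F x : C).
Proof. by []. Qed.

Section DualPairing.
Variable A : nmospace R.

(** The matrix with entries [F k k' (G l l')] is positive; it is tested at the vector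
    [sum_k e_k (x) e_k]. *)
Lemma dual_pairing_ge0 (K : finType) (G : K -> K -> dual A) (F : K -> K -> dual (dual A)) :
  @mcone R (dual A) K G -> @mcone R (dual (dual A)) K F ->
  0 <= \sum_k \sum_k' (F k k' : functional (dual A)) (G k k').
Proof.
move=> hG hF; have := hF _ _ hG => /mo_cone_matn.
move=> /(_ (fun u => (u.1 == u.2)%:R)); congr (_ <= _).
rewrite sum_prod.
have red (h : 'I_#|K| -> 'I_#|K| -> C) : \sum_i \sum_j (i == j)%:R * h i j = \sum_i h i i.
  apply: eq_bigr => i _; rewrite (bigD1 i) //= big1 ?addr0 ?eqxx ?mul1r // => j ji.
  by rewrite eq_sym (negPf ji) mul0r.
transitivity (\sum_(i < #|K|) \sum_(j < #|K|) (F (enum_val i) (enum_val j) : functional (dual A)) (G (enum_val i) (enum_val j))).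
  rewrite -(red (fun i i' => \sum_(j < #|K|) (F (enum_val i) (enum_val j) : functional (dual A)) (G (enum_val i) (enum_val j)))).
  apply: eq_bigr => i _; apply: eq_bigr => i' _ /=.
  rewrite sum_prod conjC_nat.
  case: eqP => [<-|_]; last first.
    by rewrite mul0r big1 // => j _; rewrite big1 // => j' _; rewrite !mul0r.
  rewrite mul1r -(red (fun j j' => (F (enum_val i) (enum_val j) : functional (dual A)) (G (enum_val i) (enum_val j)))).
  apply: eq_bigr => j _; apply: eq_bigr => j' _ /=; rewrite mul1r !mxE mulrC.
  by case: eqP => [<-|_]; rewrite ?mul0r.
rewrite sum_enum_rank; apply: eq_bigr => k _; rewrite sum_enum_rank.
by apply: eq_bigr => k' _; rewrite !enum_rankK.
Qed.

Lemma functional_mcone (K : finType) (G : K -> K -> dual A) :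
  (forall (m : nat) (s : 'M[A]_m) (c : 'I_m -> K -> C), mo_cone s ->
     0 <= \sum_u \sum_v \sum_a \sum_b conjC (c u a) * c v b * (G a b : functional A) (s u v)) ->
  @mcone R (dual A) K G.
Proof.
move=> h m s hs; apply/mo_cone_matn => c.
have := h m s (fun u a => c (u, enum_rank a)) hs; congr (_ <= _).
rewrite sum_prod; apply: eq_bigr => u _; rewrite [RHS]sum_enum_rank.
under [RHS]eq_bigr do rewrite sum_prod.
rewrite [RHS]exchange_big /=; apply: eq_bigr => v _; apply: eq_bigr => a _.
rewrite [RHS]sum_enum_rank; apply: eq_bigr => b _ /=.
by rewrite !mxE !enum_rankK mulrAC.
Qed.
End DualPairing.

Lemma bounded_ext (A : nmospace R) (f g : A -> C^o) : f =1 g ->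
  f \in @bounded_functional R A -> g \in @bounded_functional R A.
Proof. by move=> /funext ->. Qed.

Lemma pos_bounded (S : opsys R) (f : {linear os_car S -> C^o}) :
  (forall x, os_pos x -> 0 <= (f x : C)) ->
  (f : os_nmospace S -> C^o) \in @bounded_functional R (os_nmospace S).
Proof.
move=> fp; apply/asboolP; split; first exact: linearP.
exists (2 * Re (f (os_one S))) => x.
apply: pos_functional_le => //; exact: linearP.
Qed.

Section Slots.
Variables (S T : opsys R) (Z : tprod (os_car S) (os_car T)) (n : nat).
Variable f : 'I_n -> 'I_n -> {linear Z -> C^o}.
Hypothesis fpos : forall Y, @maxD R S T Z n Y -> 0 <= \sum_i \sum_j (f i j (Y i j) : C).

Let slot (M : 'I_n -> 'I_n -> C) (t : os_car T) (s : os_nmospace S) : C^o :=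
  \sum_i \sum_j (M i j * (f i j (tn s t) : C)).

Lemma slot_linear M t : linear (slot M t).
Proof.
move=> a x y; rewrite /slot scaler_sumr -big_split; apply: eq_bigr => i _.
rewrite scaler_sumr -big_split; apply: eq_bigr => j _ /=.
rewrite tnDl tnZl linearP mulrDr -[a *: f i j _]/(a * _) -[a *: (_ * _)]/(a * _).
by rewrite mulrCA.
Qed.

Lemma slot_pos M t : psd M -> os_pos t -> slot M t \in @bounded_functional R (os_nmospace S).
Proof.
move=> hM ht; apply: (@pos_bounded S (mklin (@slot_linear M t))) => s hs.
have := fpos (maxD_simple Z hM hs ht); congr (_ <= _).
apply: eq_bigr => i _; apply: eq_bigr => j _; by rewrite mxE linearZ.
Qed.

(** [f] comes from an algebraic separation, and its boundedness has to be proved. For positive [M]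
    and [t] the slot is a positive functional, hence bounded, and such [M] and [t] span. *)
Lemma slot_bounded M t : slot M t \in @bounded_functional R (os_nmospace S).
Proof.
have bD (g h : os_nmospace S -> C^o) a : g \in @bounded_functional R (os_nmospace S) ->
    h \in @bounded_functional R (os_nmospace S) ->
    (fun x => a * g x + h x : C^o) \in @bounded_functional R (os_nmospace S).
  by move=> hg hh; have [_ bl] := @bounded_functional_closed R (os_nmospace S); exact: bl.
move: M; apply: (@os_pos_ind _ T (fun t => forall M, slot M t \in _)) => {t}.
  move=> a x y hx hy M; apply: bounded_ext (bD _ _ a (hx M) (hy M)) => s.
  rewrite /slot mulr_sumr -big_split; apply: eq_bigr => i _.
  rewrite mulr_sumr -big_split; apply: eq_bigr => j _ /=.
  by rewrite tnDr tnZr linearP mulrDr -[a *: f i j _]/(a * _) mulrCA.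
move=> t ht M.
have b0 : slot (fun _ _ => 0) t \in @bounded_functional R (os_nmospace S).
  apply: bounded_ext (_ : (0 : os_nmospace S -> C^o) \in _); last first.
    by have [b0 _] := @bounded_functional_closed R (os_nmospace S).
  by move=> s; rewrite /slot big1 // => i _; rewrite big1 // => j _; rewrite mul0r.
have lin (a : C) M1 M2 : slot M1 t \in @bounded_functional R (os_nmospace S) ->
    slot M2 t \in @bounded_functional R (os_nmospace S) ->
    slot (fun i j => a * M1 i j + M2 i j) t \in @bounded_functional R (os_nmospace S).
  move=> h1 h2; apply: bounded_ext (bD _ _ a h1 h2) => s.
  rewrite /slot mulr_sumr -big_split; apply: eq_bigr => i _.
  rewrite mulr_sumr -big_split; apply: eq_bigr => j _ /=.
  by rewrite mulrDl mulrA.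
pose E i0 j0 (i j : 'I_n) : C := ((i == i0) && (j == j0))%:R.
have Eb i0 j0 : slot (E i0 j0) t \in @bounded_functional R (os_nmospace S).
  have d := slot_pos (@psd_id R 'I_n) ht.
  have p1 := slot_pos (psd_le_one i0 j0 (1 : C)) ht.
  have pi := slot_pos (psd_le_one i0 j0 ('i : C)) ht.
  (* With [E] the matrix unit at [(i0, j0)] and [E'] its transpose, [h1] concerns [E + E'] and [h2]
     concerns [i (E - E')]; half of the first minus [i / 2] times the second is [E]. *)
  have h1 := lin 2%:R _ _ d (lin (- 1) _ _ p1 b0).
  have h2 := lin 2%:R _ _ d (lin (- 1) _ _ pi b0).
  have h := lin (2%:R^-1) _ _ h1 (lin (- 'i / 2%:R) _ _ h2 b0).
  apply: bounded_ext h => s; apply: eq_bigr => i _; apply: eq_bigr => j _; congr (_ * _).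
  have i2 : 'i * 'i = -1 :> C by rewrite -expr2 sqrCi.
  rewrite /E rmorph1 conjCi.
  set b1 := (i == i0) && _; set b2 := (i == j0) && _; set dd := (i == j)%:R.
  case: b1; case: b2; rewrite ?mulr1n ?mulr0n.
  1,2,3,4: by field: i2.
have -> : slot M t = slot (fun i j => \sum_i0 \sum_j0 M i0 j0 * E i0 j0 i j) t.
  congr (slot _ t); apply/funext => i; apply/funext => j.
  rewrite (bigD1 i) //= [X in _ + X]big1 ?addr0 => [|k ki]; last first.
    by rewrite big1 // => l _; rewrite /E eq_sym (negPf ki) mulr0.
  rewrite (bigD1 j) //= big1 ?addr0 => [|l lj]; first by rewrite /E !eqxx mulr1.
  by rewrite /E [j == l]eq_sym (negPf lj) andbF mulr0.
have sumb (I : finType) (G : I -> 'I_n -> 'I_n -> C) :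
   (forall k, slot (G k) t \in @bounded_functional R (os_nmospace S)) ->
   slot (fun i j => \sum_k G k i j) t \in @bounded_functional R (os_nmospace S).
  move=> hG.
  suff : forall r : seq I, slot (fun i j => \sum_(k <- r) G k i j) t \in @bounded_functional R (os_nmospace S) by exact.
  elim=> [|k r IH].
    apply: bounded_ext b0 => s; apply: eq_bigr => i _; apply: eq_bigr => j _.
    by rewrite big_nil.
  apply: bounded_ext (lin 1 _ _ (hG k) IH) => s; apply: eq_bigr => i _; apply: eq_bigr => j _.
  by rewrite big_cons mul1r.
apply: (sumb 'I_n) => i0; apply: (sumb 'I_n) => j0.
apply: bounded_ext (lin (M i0 j0) _ _ (Eb i0 j0) b0) => s; apply: eq_bigr => i _; apply: eq_bigr => j _.
by rewrite addr0.
Qed.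

Definition slot_functional i j t : functional (os_nmospace S) :=
  Functional (slot_bounded (fun a b => ((a == i) && (b == j))%:R) t).

Lemma slot_functionalE i j t s : slot_functional i j t s = f i j (tn s t).
Proof.
rewrite /slot_functional /= /slot (bigD1 i) //= [X in _ + X]big1 ?addr0 => [|k ki]; last first.
  by rewrite big1 // => l _; rewrite (negPf ki) mul0r.
rewrite (bigD1 j) //= big1 ?addr0 => [|l lj]; first by rewrite !eqxx mul1r.
by rewrite (negPf lj) andbF mul0r.
Qed.
End Slots.

Lemma mapl_mstar (S I T : opsys R) (Z : tprod (os_car S) (os_car T)) (Z' : tprod (os_car I) (os_car T))
  (kappa : {linear os_car S -> os_car I}) :
  (forall s, kappa (os_star s) = os_star (kappa s)) ->
  forall z, mapl Z Z' kappa (ts z) = ts (mapl Z Z' kappa z).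
Proof.
move=> kstar; apply: tp_ind => [|x y hx hy|a b]; first by rewrite !(ts0, linear0).
  by rewrite tsD !linearD tsD hx hy.
by rewrite ts_tn !mapl_tn ts_tn kstar.
Qed.

Lemma cp_star (S I : opsys R) (f : {linear os_car S -> os_car I}) : @cp R S I f ->
  forall s, f (os_star s) = os_star (f s).
Proof.
move=> cf; apply: os_pos_ind => [a x y hx hy|x hx].
  by rewrite os_starD os_starZ !linearP /= hx hy os_starD os_starZ.
rewrite os_pos_herm // os_pos_herm //.
have := cf 1%N (const_mx x); rewrite os_pos1 => /(_ hx).
have -> : map_mx f (const_mx x : 'M[_]_1) = const_mx (f x).
  by apply/matrixP => i j; rewrite !mxE.
by rewrite os_pos1.
Qed.

Definition vector_functional (T : opsys R) (v w : os_hilb T) (t : os_car T) : C^o :=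
  h_dot _ (os_act T t v) w.
Lemma vector_functional_linear (T : opsys R) (v w : os_hilb T) : linear (vector_functional v w).
Proof. by move=> a x y; rewrite /vector_functional actDl actZl dotDl dotZl. Qed.

Lemma vector_functional_sep (T : opsys R) (b : os_car T) :
  (forall g : {linear os_car T -> C^o},
     (exists v w, g = mklin (@vector_functional_linear T v w)) -> g b = 0) -> b = 0.
Proof.
move=> h; apply: os_eqP => v w; rewrite act0l dot0l.
exact: (h (mklin (@vector_functional_linear T v w)) (ex_intro _ v (ex_intro _ w erefl))).
Qed.

Theorem wep_max_inclusion (S I T : opsys R) (kappa : {linear os_car S -> os_car I})
  (Z : tprod (os_car S) (os_car T)) (Z' : tprod (os_car I) (os_car T))
  (Phi : {linear os_car I -> bidual S}) :
  @co_embedding R S I kappa -> @cp R I (bidual S) Phi ->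
  (forall s, Phi (kappa s) = bidual_embedding s) ->
  forall n (X : 'M[Z]_n),
  (forall e : R, 0 < e -> @maxD R I T Z' n (map_mx (mapl Z Z' kappa) X + @tunit R I T Z' n e)) ->
  forall e : R, 0 < e -> @maxD R S T Z n (X + @tunit R S T Z n e).
Proof.
move=> [kinj k1 kco] cPhi Phik n X hX e e0; apply: contrapT => nX.
have ck : @cp R S I kappa by move=> m Y /kco.
have mi : injective (mapl Z Z' kappa) by apply: mapl_inj kinj; exact: vector_functional_sep.
have Xh : mstar X = X.
  have h1 := maxD_herm (hX _ ltr01).
  move: h1; rewrite mstarD (maxD_herm (maxD_unit Z' n ler01)) => /addIr h1.
  apply/matrixP => i j; apply: mi; move/matrixP/(_ i j): h1; rewrite !mxE => <-.
  exact: (@mapl_mstar S I T Z Z' kappa (cp_star ck) _).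
have [f [fpos f1 fX]] := maxD_separation e0 Xh nX.
pose phi i j t := slot_functional fpos i j t.
have bl i j : bil (fun (b : os_car I) (t : os_car T) => (Phi b (phi i j t) : C^o)).
  split=> [k x y t|b k x y]; first by rewrite linearP.
  have -> : phi i j (k *: x + y) = k *: phi i j x + phi i j y.
    apply: val_inj; apply/funext => s.
    rewrite -[RHS]/(k *: (phi i j x s : C^o) + (phi i j y s : C^o)) -[LHS]/(phi i j (k *: x + y) s).
    by rewrite !slot_functionalE tnDr tnZr linearP.
  exact: (linearP (Phi b)).
pose ft i j : {linear Z' -> C^o} := tlift Z' (bl i j).
have ftk i j z : ft i j (mapl Z Z' kappa z) = f i j z.
  have : (ft i j \o mapl Z Z' kappa) =1 f i j.
    apply: (@tp_ext _ _ _ _ _ (ft i j \o mapl Z Z' kappa) (f i j)) => a b /=.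
    by rewrite mapl_tn tlift_tn Phik -[LHS]/(phi i j b a) slot_functionalE.
  exact.
have ftpos Y : @maxD R I T Z' n Y -> 0 <= \sum_i \sum_j (ft i j (Y i j) : C).
  move=> [K [L [P [Q [W [hP hQ ->]]]]]].
  (* Against a positive matrix [s] over [S], this pairing is the value of [f] at the element of the
     maximal cone built from [s] and [Q]. *)
  have hG : @mcone R (dual (os_nmospace S)) K (fun k k' => \sum_i \sum_j \sum_l \sum_l'
      (conjC (W k l i) * W k' l' j) *: phi i j (Q l l')).
    apply: functional_mcone => m s c hs.
    have := fpos (@max_form R S T Z _ _ n (fun u v => s u v) Q (fun u l i => \sum_k c u k * W k l i)).
    have h : maxD (@max_form R S T Z _ _ n (fun u v : 'I_m => s u v) Q (fun u l i => \sum_k c u k * W k l i)).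
      exists 'I_m, L, (fun u v => s u v), Q, (fun u l i => \sum_k c u k * W k l i).
      by split=> //; exact/(proj1 (mo_coneP _)).
    move=> /(_ h); congr (_ <= _).
    under [RHS]eq_bigr do under eq_bigr do under eq_bigr do under eq_bigr do
      (rewrite functional_sumE mulr_sumr; under eq_bigr do
       (rewrite functional_sumE mulr_sumr; under eq_bigr do
       (rewrite functional_sumE mulr_sumr; under eq_bigr do
       (rewrite functional_sumE mulr_sumr; under eq_bigr do
         rewrite functional_scaleE slot_functionalE)))).
    under [RHS]eq_bigr do under eq_bigr do rewrite exchange_big22.
    rewrite [RHS]exchange_big22; apply: eq_bigr => i _; apply: eq_bigr => j _.
    under [RHS]eq_bigr do under eq_bigr do rewrite exchange_big22.
    rewrite mxE linear_sum; apply: eq_bigr => u _.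
    rewrite [RHS]exchange_big linear_sum; apply: eq_bigr => l _.
    rewrite linear_sum; apply: eq_bigr => v _; rewrite linear_sum; apply: eq_bigr => l' _.
    rewrite linearZ /= -[_ *: _]/(_ * _) rmorph_sum mulr_suml mulr_suml; apply: eq_bigr => k _.
    rewrite mulr_sumr mulr_suml; apply: eq_bigr => k' _.
    by rewrite rmorphM /=; ring.
  have := dual_pairing_ge0 hG (cp_mcone cPhi hP); congr (_ <= _).
  under eq_bigr do under eq_bigr do
      (rewrite linear_sum; under eq_bigr do
       (rewrite linear_sum; under eq_bigr do
       (rewrite linear_sum; under eq_bigr do
       (rewrite linear_sum; under eq_bigr do
         rewrite linearZ /=)))).
  rewrite exchange_big22; apply: eq_bigr => i _; apply: eq_bigr => j _.
  rewrite mxE linear_sum; apply: eq_bigr => k _.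
  rewrite exchange_big linear_sum; apply: eq_bigr => l _.
  rewrite linear_sum; apply: eq_bigr => k' _; rewrite linear_sum; apply: eq_bigr => l' _.
  by rewrite linearZ /= tlift_tn.
set v := \sum_i _ in fX.
(* Half of the defect: [f] has real part [1] at the unit, so positivity at [X] plus this multiple of
   the unit would read [0 <= Re v / 2]. *)
have d0 : 0 < - Re v / 2 by rewrite divr_gt0 ?oppr_gt0.
have := ftpos _ (hX _ d0).
have -> : map_mx (mapl Z Z' kappa) X + @tunit R I T Z' n (- Re v / 2) =
    map_mx (mapl Z Z' kappa) (X + @tunit R S T Z n (- Re v / 2)).
  apply/matrixP => i j; rewrite !tunitE !mxE linearD; congr (_ + _).
  by rewrite linearZ /= mapl_tn k1.
under eq_bigr do under eq_bigr do rewrite mxE ftk mxE linearD.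
under eq_bigr do rewrite big_split /=.
rewrite big_split /= -/v tunit_scale.
under [X in _ + X]eq_bigr do under eq_bigr do rewrite mxE linearZ /=.
move=> h; have : 0 <= Re (v + (- Re v / 2)%:C%C * (\sum_i \sum_j (f i j (@tunit R S T Z n 1 i j) : C))).
  rewrite -ler0c ge0_RRe; last first.
    move: h; congr (_ <= _ + _); rewrite mulr_sumr; apply: eq_bigr => i _.
    by rewrite mulr_sumr; apply: eq_bigr => j _.
  move: h; congr (_ <= _ + _); rewrite mulr_sumr; apply: eq_bigr => i _.
  by rewrite mulr_sumr; apply: eq_bigr => j _.
rewrite raddfD /=; set w := \sum_i _ in f1 *; move: f1; case: w => a b /= ->.
rewrite mul0r subr0 mulr1 => h1.
have : Re v / 2 < 0 by rewrite ltr_pdivrMr // mul0r.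
rewrite ltNge => /negP; apply; move: h1; congr (_ <= _); by field.
Qed.

End WepMax.

(** * Choi matrices and quotients of matrix algebras *)

Section LinAlg.
Variable K : fieldType.
(** Vectors satisfying [Q] are adjoined as long as one lies outside; the codimension drops each
    time. *)
Lemma vspace_of_pred (V : vectType K) (Q : V -> Prop) : Q 0 ->
  (forall a x y, Q x -> Q y -> Q (a *: x + y)) ->
  exists U : {vspace V}, forall x, x \in U <-> Q x.
Proof.
move=> Q0 Ql.
suff h m (U : {vspace V}) : (forall x, x \in U -> Q x) -> (\dim {:V} - \dim U < m)%N ->
    exists U' : {vspace V}, forall x, x \in U' <-> Q x.
  by apply: (h (\dim {:V} - \dim (0 : {vspace V})).+1 0%VS) => // x; rewrite memv0 => /eqP ->.
elim: m U => // m IH U UQ dU.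
have [allU|] := pselect (forall x, Q x -> x \in U).
  by exists U => x; split; [exact: UQ|exact: allU].
move=> /existsNP[x /not_implyP[Qx /negP xU]].
apply: (IH (U + <[x]>)%VS).
  move=> y /memv_addP[u uU [w /vlineP[a ->] ->]]; rewrite addrC.
  by apply: Ql => //; exact: UQ.
have dlt : (\dim U < \dim (U + <[x]>))%N.
  rewrite (ltn_leqif (dimv_leqif_sup _)) ?addvSl //.
  apply: contra xU => /subvP; apply.
  by apply: (subvP (addvSr _ _)); exact: memv_line.
have dle := dimvS (subvf (U + <[x]>)%VS).
exact: leq_trans (ltn_sub2l (leq_trans dlt dle) dlt) dU.
Qed.
End LinAlg.

Section Choi.
Variable R : realType.
Local Notation C := R[i].
Local Notation conjC := (@Num.conj C).
Local Notation Re := complex.Re.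

Lemma eq_psd (I : finType) (M N : I -> I -> C) : (forall i j, M i j = N i j) -> psd M -> psd N.
Proof.
move=> e h c; have := h c; congr (_ <= _).
by apply: eq_bigr => i _; apply: eq_bigr => j _; rewrite e.
Qed.

Lemma psd_compress (I J : finType) (M : I -> I -> C) (A : I -> J -> C) : psd M ->
  psd (fun j j' => \sum_i \sum_i' conjC (A i j) * A i' j' * M i i').
Proof.
move=> h c; have := h (fun i => \sum_j A i j * c j); congr (_ <= _).
transitivity (\sum_i \sum_i' \sum_j \sum_j' conjC (c j) * (conjC (A i j) * A i' j' * M i i') * c j').
  apply: eq_bigr => i _; apply: eq_bigr => i' _.
  rewrite rmorph_sum mulr_suml mulr_suml; apply: eq_bigr => j _.
  rewrite mulr_sumr; apply: eq_bigr => j' _; rewrite rmorphM /=; ring.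
rewrite exchange_big22; apply: eq_bigr => j _; apply: eq_bigr => j' _.
rewrite mulr_sumr mulr_suml; apply: eq_bigr => i _.
by rewrite mulr_sumr mulr_suml.
Qed.

Lemma psd_reindex (I J : finType) (h : J -> I) (M : I -> I -> C) : psd M ->
  psd (fun j j' => M (h j) (h j')).
Proof.
move=> /(psd_compress (fun i j => (i == h j)%:R)); apply: eq_psd => j j'.
rewrite -[RHS](sum_delta (h j) (fun i => M i (h j'))); apply: eq_bigr => i _.
rewrite -(sum_delta (h j') (fun i' => M i i')) -sumrMnl; apply: eq_bigr => i' _.
by rewrite conjC_nat -natrM mulr_natl mulnC mulrnA.
Qed.

Lemma psd_sum (I K : finType) (M : K -> I -> I -> C) : (forall k, psd (M k)) ->
  psd (fun i j => \sum_k M k i j).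
Proof.
move=> h c; apply: le_trans (sumr_ge0 _ (fun k _ => h k c)) _.
rewrite exchange_big /= le_eqVlt; apply/orP; left; apply/eqP.
apply: eq_bigr => i _; rewrite exchange_big /=; apply: eq_bigr => j _.
by rewrite mulr_sumr mulr_suml.
Qed.

(** The contraction of [M] and [T] over their common index set [N]: with [M = B^* B] it is a sum of
    compressions of [T]. *)
Lemma psd_schur (I J N : finType) (M : I * N -> I * N -> C) (T : J * N -> J * N -> C) :
  psd M -> psd T ->
  psd (fun u v : I * J => \sum_a \sum_b M (u.1, a) (v.1, b) * T (u.2, a) (v.2, b)).
Proof.
move=> /psd_factor[B BE] hT.
have : psd (fun u v : I * J => \sum_k \sum_(x : J * N) \sum_(y : J * N)
   conjC (B k (u.1, x.2) * (x.1 == u.2)%:R) * (B k (v.1, y.2) * (y.1 == v.2)%:R) * T x y).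
  by apply: psd_sum => k; exact: (psd_compress (fun x u => B k (u.1, x.2) * (x.1 == u.2)%:R) hT).
apply: eq_psd => u v; rewrite exchange_big /= sum_prod /=.
rewrite (bigD1 u.2) //= [X in _ + X]big1 ?addr0 => [|j ju]; last first.
  rewrite big1 // => a _; rewrite big1 // => k _; rewrite big1 // => y _.
  by rewrite (negPf ju) mulr0 rmorph0 !mul0r.
apply: eq_bigr => a _; rewrite exchange_big /= sum_prod /=.
rewrite (bigD1 v.2) //= [X in _ + X]big1 ?addr0 => [|j jv]; last first.
  rewrite big1 // => b _; rewrite big1 // => k _.
  by rewrite (negPf jv) !mulr0 !mul0r.
apply: eq_bigr => b _; rewrite BE mulr_suml; apply: eq_bigr => k _.
by rewrite !eqxx !mulr1.
Qed.

Lemma psd_trace0 n (x : 'M[C]_n) : psd (fun i j => x i j) -> \tr x = 0 -> x = 0.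
Proof.
move=> /psd_factor[B BE] tr0.
have B0 k i : B k i = 0.
  have : \sum_i \sum_k `|B k i| ^+ 2 = 0.
    rewrite -[RHS]tr0; apply: eq_bigr => j _; rewrite BE; apply: eq_bigr => l _.
    by rewrite normCK mulrC.
  move/eqP; rewrite psumr_eq0 => [/allP/(_ i (mem_index_enum _))/= |j _]; last first.
    by apply: sumr_ge0 => l _; rewrite exprn_ge0.
  rewrite psumr_eq0 => [/allP/(_ k (mem_index_enum _))/= |l _]; last by rewrite exprn_ge0.
  by rewrite expf_eq0 /= normr_eq0 => /eqP.
by apply/matrixP => i j; rewrite BE mxE big1 // => k _; rewrite B0 rmorph0 mul0r.
Qed.

(** The pairing [tr (r^T x)]. It is bilinear rather than sesquilinear, and positive functionals
    correspond to positive matrices ([functional_psd]). *)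
Definition mxpair n (r x : 'M[C]_n) : C := \sum_a \sum_b r a b * x a b.

Lemma mxpairPr n (r : 'M[C]_n) a x y : mxpair r (a *: x + y) = a * mxpair r x + mxpair r y.
Proof.
rewrite /mxpair mulr_sumr -big_split; apply: eq_bigr => i _.
rewrite mulr_sumr -big_split; apply: eq_bigr => j _ /=.
by rewrite !mxE mulrDr mulrCA.
Qed.

Lemma mxpairC n (r x : 'M[C]_n) : mxpair r x = mxpair x r.
Proof. by apply: eq_bigr => i _; apply: eq_bigr => j _; rewrite mulrC. Qed.

Lemma mxpair1 n (x : 'M[C]_n) : mxpair 1%:M x = \tr x.
Proof.
apply: eq_bigr => i _; rewrite (bigD1 i) //= big1 ?addr0 => [|j ji].
  by rewrite !mxE eqxx mul1r.
by rewrite !mxE eq_sym (negPf ji) mul0r.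
Qed.

Lemma mxpair_delta n (r : 'M[C]_n) a b : mxpair r (delta_mx a b) = r a b.
Proof.
rewrite /mxpair (bigD1 a) //= [X in _ + X]big1 ?addr0 => [|i ia].
  rewrite (bigD1 b) //= big1 ?addr0 => [|j jb]; first by rewrite !mxE !eqxx mulr1.
  by rewrite !mxE (negPf jb) andbF mulr0.
by rewrite big1 // => j _; rewrite !mxE (negPf ia) mulr0.
Qed.

Lemma mxpair_star n (r x : 'M[C]_n) :
  mxpair r (x ^t conjC)%sesqui = conjC (mxpair (r ^t conjC)%sesqui x).
Proof.
rewrite /mxpair rmorph_sum exchange_big; apply: eq_bigr => i _.
rewrite rmorph_sum; apply: eq_bigr => j _.
by rewrite !mxE rmorphM /= conjCK.
Qed.

(** The double annihilator: the entries of [y - projv U y] are functionals of [y] vanishing on [U],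
    hence pairings with matrices that annihilate [U]. *)
Lemma mxpair_sep n (U : {vspace 'M[C]_n}) x :
  (forall r, (forall y, y \in U -> mxpair r y = 0) -> mxpair r x = 0) -> x \in U.
Proof.
move=> h; pose f y : 'M[C]_n := y - projv U y.
have f0 y : y \in U -> f y = 0 by move=> yU; rewrite /f projv_id ?subrr.
suff : f x = 0 by move/eqP; rewrite subr_eq0 => /eqP ->; exact: memv_proj.
have fl : linear f.
  by move=> a y z; rewrite /f linearP scalerBr opprD addrACA.
have fE y a b : f y a b = mxpair (\matrix_(i, j) f (delta_mx i j) a b) y.
  rewrite {1}[y]matrix_sum_delta -[f]/(mklin fl : _ -> _) linear_sum summxE.
  apply: eq_bigr => i _; rewrite linear_sum summxE; apply: eq_bigr => j _.
  by rewrite linearZ /= !mxE mulrC.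
apply/matrixP => a b; rewrite fE mxE; apply: h => y yU.
by rewrite -fE f0 // mxE.
Qed.

Section ChoiMap.
Variables (S : opsys R) (n : nat).

Definition choi_map (P : 'I_n -> 'I_n -> os_car S) (x : 'M[C]_n) : os_car S :=
  \sum_a \sum_b x a b *: P a b.

Lemma choi_mapE (f : {linear 'M[C]_n -> os_car S}) x :
  choi_map (fun a b => f (delta_mx a b)) x = f x.
Proof.
rewrite [in RHS](matrix_sum_delta x) linear_sum; apply: eq_bigr => i _.
by rewrite linear_sum; apply: eq_bigr => j _; rewrite linearZ.
Qed.
End ChoiMap.

(** The Choi matrix of the identity: its quadratic form is [|sum_i c_ii|^2]. *)
Lemma delta_cone n : @mcone R (matn R n) 'I_n (fun a b => delta_mx a b : 'M[C]_n).
Proof.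
apply/(os_mconeP (S := matn R n))/gcone_matn => c.
have := @mul_conjC_ge0 C (\sum_i c (i, i)); congr (_ <= _).
have red (f : 'I_n -> 'I_n -> C) i : \sum_j (j == i)%:R * f i j = f i i.
  rewrite (bigD1 i) //= big1 ?addr0 => [|j ji]; first by rewrite eqxx mul1r.
  by rewrite (negPf ji) mul0r.
rewrite rmorph_sum mulrC mulr_suml sum_prod; apply: eq_bigr => i _.
rewrite -(red (fun _ j => conjC (c (i, j)) * \sum_k c (k, k))); apply: eq_bigr => j _.
rewrite sum_prod mulr_sumr mulr_sumr; apply: eq_bigr => k _.
rewrite -(red (fun _ l => (j == i)%:R * (conjC (c (i, j)) * c (k, l)))); apply: eq_bigr => l _.
by rewrite !mxE /= -mulnb natrM; ring.
Qed.

Lemma choi_cone n (A : mospace R) (f : 'M[C]_n -> A) : @cp R (matn R n) A f ->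
  @mcone R A 'I_n (fun a b => f (delta_mx a b)).
Proof. by move=> cf; apply: (cp_mcone cf); exact: delta_cone. Qed.

End Choi.

(** * The quotient of a matrix algebra and its functionals *)

Section Quot.
Variable R : realType.
Local Notation C := R[i].
Local Notation conjC := (@Num.conj C).
Local Notation Re := complex.Re.
Variables (n : nat) (J : {vspace 'M[C]_n}).

Definition qpi (x : 'M[C]_n) : matn_quot_car J := lquot_pi (pred_of_vspace J) x.

Lemma qpi_linear : linear qpi.
Proof. have h := linearP (lquot_pi (pred_of_vspace J)); exact_no_check h. Qed.

HB.instance Definition _ := GRing.isLinear.Build C 'M[C]_n (matn_quot_car J) *:%R qpi qpi_linear.

Lemma qpi_surj y : exists x, qpi x = y.
Proof. by exists (repr y); rewrite /qpi lquot_reprK. Qed.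

Lemma qpi_eq0 x : qpi x = 0 <-> x \in J.
Proof.
have -> : (0 : matn_quot_car J) = qpi 0 by rewrite linear0.
by have := lquot_pi_eq (pred_of_vspace J) x 0; rewrite subr0.
Qed.

Lemma quot_coneP k (X : 'M[matn_quot_car J]_k) : @matn_quot_cone R n J k X <->
  forall e : R, 0 < e -> exists2 s : 'I_k -> 'I_k -> 'M[C]_n, gcone (S := matn R n) s &
    forall i j, X i j + (e%:C%C * (i == j)%:R) *: qpi 1%:M = qpi (s i j).
Proof.
split=> h e e0.
  have [s hs E] := h e e0; exists (fun i j => s i j); first exact/(mo_cone_os (S := matn R n)).
  move=> i j; move/matrixP/(_ i j): E; rewrite !mxE /qpi => <-.
  by case: (i == j); rewrite ?mulr1n ?mulr1 // mulr0n mulr0 scale0r.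
have [s hs E] := h e e0; exists (\matrix_(i, j) s i j).
  by apply/(mo_cone_os (S := matn R n)); apply: eq_gcone hs => i j; rewrite mxE.
apply/matrixP => i j; rewrite !mxE -[RHS]E.
by case: (i == j); rewrite ?mulr1n ?mulr1 // mulr0n mulr0 scale0r.
Qed.

Lemma qpi_cp : @cp R (matn R n) (matn_quot J) qpi.
Proof.
move=> k X /(mo_cone_os (S := matn R n)) hX; apply/quot_coneP => e e0.
exists (fun i j => X i j + (e%:C%C * (i == j)%:R) *: 1%:M); last first.
  by move=> i j; rewrite mxE linearD linearZ.
apply: gcone_add => //.
apply: (gcone_pos (S := matn R n) (M := fun i j : 'I_k => e%:C%C * (i == j)%:R) (s := 1%:M)).
  move=> c; have := @psd_id R _ c => h; have e0' : 0 <= e%:C%C :> C by rewrite ler0c ltW.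
  have := mulr_ge0 e0' h; congr (_ <= _); rewrite mulr_sumr; apply: eq_bigr => i _.
  by rewrite mulr_sumr; apply: eq_bigr => j _; ring.
exact: (@os_pos_one R (matn R n)).
Qed.

Section Annihilator.
Variables (r : 'M[C]_n) (hr : forall x, x \in J -> mxpair r x = 0).

(** Through the pairing the annihilator of [J] becomes the dual of the quotient; the choice of
    representative is harmless because [r] annihilates [J]. *)
Definition qfun (y : matn_quot_car J) : C^o := mxpair r (repr y).

Lemma qfun_pi x : qfun (qpi x) = mxpair r x.
Proof.
rewrite /qfun; have : repr (qpi x) - x \in J.
  by apply/qpi_eq0; rewrite linearB /= {1}/qpi lquot_reprK subrr.
move=> /hr; rewrite -scaleN1r addrC mxpairPr mulN1r => /eqP.
by rewrite addrC subr_eq0 => /eqP.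
Qed.

Lemma qfun_linear : linear qfun.
Proof.
move=> a x y; have [x' <-] := qpi_surj x; have [y' <-] := qpi_surj y.
by rewrite -linearP !qfun_pi mxpairPr.
Qed.
Definition qfunl : {linear matn_quot_car J -> C^o} := mklin qfun_linear.
Lemma qfunl_pi x : qfunl (qpi x) = mxpair r x.
Proof. exact: qfun_pi. Qed.
End Annihilator.

Lemma quot_sep (y : matn_quot_car J) :
  (forall g : {linear matn_quot_car J -> C^o},
     (exists r hr, g = @qfunl r hr) -> g y = 0) -> y = 0.
Proof.
have [x <-] := qpi_surj y => h; apply/qpi_eq0; apply: mxpair_sep => r hr.
by have := h (qfunl hr) (ex_intro _ r (ex_intro _ hr erefl)); rewrite /= qfun_pi.
Qed.
End Quot.

Section Annihil.
Variable R : realType.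
Local Notation C := R[i].
Local Notation conjC := (@Num.conj C).

Lemma annihilator_exists n (P : {vspace 'M[C]_n}) : exists J : {vspace 'M[C]_n},
  forall x, x \in J <-> (forall r, r \in P -> mxpair r x = 0).
Proof.
apply: vspace_of_pred => [r _|a x y hx hy r rP].
  by rewrite /mxpair big1 // => i _; rewrite big1 // => j _; rewrite mxE mulr0.
by rewrite mxpairPr hx // hy // mulr0 addr0.
Qed.

(** The identity belongs to the system, so the matrices it annihilates have trace zero, and a
    positive matrix of trace zero vanishes. *)
Lemma annihilator_null n (P : matrix_system R n) (J : {vspace 'M[C]_n}) :
  (forall x, x \in J <-> (forall r, r \in ms_space P -> mxpair r x = 0)) -> null_subspace J.
Proof.
move=> JP; split=> x.
  move/JP => h; apply/JP => r rP; rewrite mxpair_star h ?rmorph0 //.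
  exact: ms_star.
move=> /JP/(_ _ (ms_one P)); rewrite mxpair1 => tr0.
move=> /(mo_cone_os (S := matn R n)) /gcone_matn h; apply: psd_trace0 => //.
have := psd_reindex (fun i : 'I_n => (ord0 : 'I_1, i)) h.
by apply: eq_psd => i j /=; rewrite mxE.
Qed.

Lemma annihilatorK n (P J : {vspace 'M[C]_n}) :
  (forall x, x \in J <-> (forall r, r \in P -> mxpair r x = 0)) ->
  forall r, (forall x, x \in J -> mxpair r x = 0) -> r \in P.
Proof.
move=> JP r hr; apply: mxpair_sep => x hx; rewrite mxpairC; apply: hr.
by apply/JP => y yP; rewrite mxpairC; exact: hx.
Qed.
End Annihil.

(** * Lifting positive elements from a quotient *)

Section Lift.
Variable R : realType.
Local Notation C := R[i].
Local Notation conjC := (@Num.conj C).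
Local Notation Re := complex.Re.

Lemma tensor_matrix_mapE (A B : lmodType C) p q (f : {linear A -> 'M[C]_p}) (g : {linear B -> 'M[C]_q}) z :
  tensor_matrix_map f g z = mxmap (tensor_tprod A B) f g z.
Proof.
pose F (w : tensor_tprod A B) : 'M[C]_(p * q) := tensor_matrix_map f g w.
have Fl : linear F by have h := linearP (tensor_matrix_map f g); exact_no_check h.
have key a b : F (tn a b) = mxmap (tensor_tprod A B) f g (tn a b).
  rewrite mxmap_tn; have h := tensor_matrix_map_tens f g a b; exact_no_check h.
have h := @tp_ext _ _ _ _ _ (mklin Fl) (mxmap (tensor_tprod A B) f g) key z.
exact_no_check h.
Qed.

Definition tensor_mapl (A B A' : lmodType C) (f : {linear A -> A'})
  (w : tensor_tprod A B) : tensor_tprod A' B := tensor_map f (idfun : {linear B -> B}) w.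

Lemma tensor_maplE (A B A' : lmodType C) (f : {linear A -> A'}) z :
  @tensor_mapl A B A' f z = mapl (tensor_tprod A B) (tensor_tprod A' B) f z.
Proof.
have Fl : linear (@tensor_mapl A B A' f).
  have h := linearP (tensor_map f (idfun : {linear B -> B})); exact_no_check h.
have key a b : tensor_mapl f (tn a b) = mapl (tensor_tprod A B) (tensor_tprod A' B) f (tn a b).
  rewrite mapl_tn; have h := tensor_map_tens f (idfun : {linear B -> B}) a b; exact_no_check h.
have h := @tp_ext _ _ _ _ _ (mklin Fl) (mapl (tensor_tprod A B) (tensor_tprod A' B) f) key z.
exact_no_check h.
Qed.

(** Up to [e], [z] is a compression of [s (x) t]. Lifting [t] to a positive matrix [T] over [M_n]
    gives a positive element of [S (x) M_n], which is read as the Choi matrix of [psi]. One [e] of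
    the error is that of the hypothesis, the other pays for the lift of [t]. *)
Lemma max_quot_lift (S : opsys R) n (J : {vspace 'M[C]_n})
  (Z : tprod (os_car S) (matn_quot_car J)) (z : Z) (e : R) : 0 < e ->
  @maxD R S (matn_quot J) Z 1 (const_mx z + @tunit R S (matn_quot J) Z 1 e) ->
  exists2 psi : {linear 'M[C]_n -> os_car S}, @cp R (matn R n) S psi &
   forall r (hr : forall x, x \in J -> mxpair r x = 0),
     psi r = slice (qfunl hr) z + (2 * e)%:C%C * \tr r *: os_one S.
Proof.
move=> e0 [K [L [s [t [X [/os_mconeP hs ht E]]]]]].
pose x k l := X k l 0.
pose b := \sum_k \sum_k' (\sum_l conjC (x k l) * x k' l) *: s k k'.
have bp : os_pos b.
  have := gcone_sum (fun l => gcone_compress (fun k (_ : 'I_1) => x k l) hs).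
  move=> /(gcone_diag ord0); rewrite /b; congr os_pos.
  rewrite exchange_big /=; apply: eq_bigr => k _.
  rewrite exchange_big /=; apply: eq_bigr => k' _.
  by rewrite scaler_suml.
have [bn _] := herm_le_onorm (os_pos_herm bp).
(* Lifting [t] costs [d] times the unit, which contributes [d b] after compression. This [d] makes
   [d b <= e], and [q] fills the gap, so that the error is exactly [e]. *)
pose d := e / (onorm b + 1).
have nb0 := onorm_ge0 b.
have d0 : 0 < d by rewrite divr_gt0 // ltr_wpDl.
have /quot_coneP/(_ d d0)[t' ht' tE] := ht.
pose T l l' := t' (enum_rank l) (enum_rank l').
have hT : gcone (S := matn R n) T := gcone_reindex (@enum_rank L) ht'.
have TE l l' : t l l' = qpi J (T l l') - (d%:C%C * (l == l')%:R) *: qpi J 1%:M.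
  have := tE (enum_rank l) (enum_rank l'); rewrite mxE !enum_rankK => <-.
  by rewrite (inj_eq enum_rank_inj) addrK.
pose M (y : 'M[C]_n) k k' : C := \sum_l \sum_l' conjC (x k l) * x k' l' * mxpair y (T l l').
pose q := e%:C%C *: os_one S - d%:C%C *: b.
have qp : os_pos q.
  have d0' : 0 <= d%:C%C :> C by rewrite ler0c ltW.
  have de : 0 <= (e - d * onorm b)%:C%C :> C.
    rewrite ler0c subr_ge0 /d mulrAC ler_pdivrMr ?ltr_wpDl //.
    by rewrite ler_wpM2l ?lerDl // ltW.
  have := os_posD (os_posZ d0' bn) (os_posZ de (@os_pos_one _ S)); rewrite /q; congr os_pos.
  rewrite scalerBr scalerA addrAC -scalerDl -rmorphM -rmorphD; congr (_%:C%C *: _ - _).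
  by rewrite addrC subrK.
pose f (y : 'M[C]_n) : os_car S := \sum_k \sum_k' M y k k' *: s k k' + \tr y *: q.
have fl : linear f.
  move=> a y1 y2; rewrite /f mxtraceD mxtraceZ scalerDl [X in _ = X + _]scalerDr scalerA [RHS]addrACA; congr (_ + _).
  rewrite scaler_sumr -big_split; apply: eq_bigr => k _.
  rewrite scaler_sumr -big_split; apply: eq_bigr => k' _ /=.
  rewrite scalerA -scalerDl; congr (_ *: _); rewrite /M mulr_sumr -big_split.
  apply: eq_bigr => l _; rewrite mulr_sumr -big_split; apply: eq_bigr => l' _ /=.
  by rewrite mxpairC mxpairPr !(mxpairC _ (T l l')); ring.
exists (mklin fl).
  move=> m Y /mo_cone_matn hY; apply/(mo_cone_os (S := S)).
  have hT' := proj1 (gcone_matn T) hT.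
  have h1 := psd_schur hY hT'.
  have h2 : psd (fun u v : 'I_m * K => M (Y u.1 v.1) u.2 v.2).
    have := psd_compress (fun (w : 'I_m * L) (u : 'I_m * K) => x u.2 w.2 * (w.1 == u.1)%:R) h1.
    apply: eq_psd => u v; rewrite sum_prod (bigD1 u.1) //= [X in _ + X]big1 ?addr0 => [|i iu].
      apply: eq_bigr => l _; rewrite sum_prod (bigD1 v.1) //= [X in _ + X]big1 ?addr0 => [|j jv].
        by apply: eq_bigr => l' _; rewrite !eqxx !mulr1.
      by rewrite big1 // => l' _; rewrite (negPf jv) !(mulr0, mul0r).
    rewrite big1 // => l _; rewrite big1 // => w _; by rewrite (negPf iu) mulr0 rmorph0 !mul0r.
  have h3 : gcone (fun u v : 'I_m => \tr (Y u v) *: q).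
    apply: gcone_pos qp.
    have := psd_sum (fun a : 'I_n => psd_reindex (fun u : 'I_m => (u, a)) hY).
    by apply: eq_psd => u v.
  have := gcone_add (gcone_schur h2 hs) h3; apply: eq_gcone => u v.
  by rewrite mxE.
move=> r hr /=.
have zE : z = \sum_k \sum_l \sum_k' \sum_l' (conjC (x k l) * x k' l') *: tn (s k k') (t l l')
      - e%:C%C *: tn (os_one S) (qpi J 1%:M).
  move/matrixP/(_ 0 0): E; rewrite tunitE !mxE => <-.
  by rewrite mulr1 addrK.
have sE k k' l l' : slice (qfunl hr) (tn (s k k') (t l l') : Z) =
    (mxpair r (T l l') - d%:C%C * (l == l')%:R * \tr r) *: s k k'.
  have TE' : t l l' = qpi J (- (d%:C%C * (l == l')%:R) *: 1%:M + T l l').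
    by rewrite (qpi_linear J (- (d%:C%C * (l == l')%:R)) 1%:M (T l l')) TE scaleNr addrC.
  rewrite slice_tn TE' qfunl_pi mxpairPr [mxpair r 1%:M]mxpairC mxpair1.
  by congr (_ *: _); ring.
have -> : slice (qfunl hr) z = \sum_k \sum_k' M r k k' *: s k k' - (d%:C%C * \tr r) *: b
      - (e%:C%C * \tr r) *: os_one S.
  rewrite zE linearB linearZ /= slice_tn qfunl_pi [mxpair r 1%:M]mxpairC mxpair1 scalerA; congr (_ - _).
  rewrite linear_sum /b scaler_sumr -sumrB; apply: eq_bigr => k _.
  rewrite scaler_sumr -sumrB linear_sum.
  under eq_bigr do (rewrite linear_sum; under eq_bigr do rewrite linear_sum).
  rewrite exchange_big /=; apply: eq_bigr => k' _.
  rewrite scalerA /M -scalerBl mulr_sumr -sumrB scaler_suml; apply: eq_bigr => l _.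
  have -> : d%:C%C * \tr r * (conjC (x k l) * x k' l) = \sum_l' conjC (x k l) * x k' l' * (d%:C%C * (l == l')%:R * \tr r).
    rewrite (bigD1 l) //= big1 ?addr0 => [|l' ll]; first by rewrite eqxx mulr1; ring.
    by rewrite eq_sym (negPf ll) mulr0 mul0r mulr0.
  rewrite -sumrB scaler_suml; apply: eq_bigr => l' _.
  by rewrite linearZ /= sE scalerA mulrBr.
have -> : (2 * e)%:C%C * \tr r = e%:C%C * \tr r + e%:C%C * \tr r.
  by rewrite rmorphM rmorph_nat -mulrA mulr_natl mulr2n.
rewrite scalerDl addrA subrK -addrA; congr (_ + _).
by rewrite scalerBr !scalerA addrC ![\tr r * _]mulrC.
Qed.

(** The scalar matrix [1 - M^* M] is positive, hence equal to some [B^* B], and the difference of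
    the two sides is a sum of squared norms. The identity [Nq] serves twice: for scalars, where it
    gives the positivity, and for vectors of [H]. *)
Lemma scalar_contraction (H : hilbert R) k (M : 'I_k -> 'I_k -> C) :
  (forall c : 'I_k -> C, \sum_i `|\sum_j M i j * c j| ^+ 2 <= \sum_j `|c j| ^+ 2) ->
  forall xi : 'I_k -> H, \sum_i h_dot H (\sum_j M i j *: xi j) (\sum_j M i j *: xi j) <=
    \sum_j h_dot H (xi j) (xi j).
Proof.
move=> hM xi.
pose N j' j : C := (j' == j)%:R - \sum_i conjC (M i j') * M i j.
have Nq (V : lmodType C) (D : V -> V -> C) (x : 'I_k -> V) :
    (forall a v w, D (a *: v) w = a * D v w) -> (forall a v w, D v (a *: w) = conjC a * D v w) ->
    (forall (f : 'I_k -> V) w, D (\sum_i f i) w = \sum_i D (f i) w) ->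
    (forall (f : 'I_k -> V) w, D w (\sum_i f i) = \sum_i D w (f i)) ->
    \sum_j' \sum_j N j' j * D (x j) (x j') =
    \sum_j D (x j) (x j) - \sum_i D (\sum_j M i j *: x j) (\sum_j M i j *: x j).
  move=> Zl Zr Dl Dr.
  under [X in _ = _ - X]eq_bigr do (rewrite Dr; under eq_bigr do rewrite Dl).
  rewrite [X in _ = _ - X]exchange_big -sumrB; apply: eq_bigr => j' _.
  rewrite [X in _ = _ - X]exchange_big /=.
  rewrite -[X in _ = X - _](sum_delta j' (fun j => D (x j) (x j'))) -sumrB; apply: eq_bigr => j _.
  rewrite /N mulrBl [j' == j]eq_sym mulr_natl; congr (_ - _).
  rewrite mulr_suml; apply: eq_bigr => i _.
  by rewrite Zl Zr; ring.
have Npsd : psd N.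
  move=> c.
  have := Nq C^o (fun v w => (v : C) * conjC w) c.
  have -> : \sum_i \sum_j conjC (c i) * N i j * c j = \sum_j' \sum_j N j' j * ((c j : C) * conjC (c j')).
    by apply: eq_bigr => i _; apply: eq_bigr => j _; ring.
  move=> -> => [|a v w|a v w|f w|f w].
  rewrite subr_ge0; have := hM c; congr (_ <= _).
      by apply: eq_bigr => i _; rewrite normCK.
    by apply: eq_bigr => i _; rewrite normCK.
  by rewrite -mulrA.
  by rewrite -[a *: w]/(a * w) rmorphM mulrCA.
  by rewrite mulr_suml.
  by rewrite rmorph_sum mulr_sumr.
rewrite -subr_ge0 -(Nq H (h_dot H) xi) => [||||]; last 4 first.
by move=> a v w; exact: dotZl.
by move=> a v w; exact: dotZr.
by move=> f w; exact: dot_suml.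
by move=> f w; exact: dot_sumr.
have /psd_factor[B BE] := Npsd.
have : 0 <= \sum_k h_dot H (\sum_j B k j *: xi j) (\sum_j B k j *: xi j).
  by apply: sumr_ge0 => l _; exact: dot_ge0.
congr (_ <= _).
under eq_bigr do (rewrite dot_sumr; under eq_bigr do rewrite dot_suml).
rewrite exchange_big; apply: eq_bigr => j' _; rewrite exchange_big /=; apply: eq_bigr => j _.
rewrite BE mulr_suml; apply: eq_bigr => i _.
by rewrite dotZl dotZr; ring.
Qed.

(** The trace is the sum of [n] diagonal entries, each a completely contractive functional, and
    [dot_sum_le] handles the sum of [n] terms. *)
Lemma trace_cb_norm (S : opsys R) n (P : matrix_system R n) (e : R) : 0 <= e ->
  (cb_norm (fun x : ms_opsys P => ((e%:C%C * \tr (vsval x)) *: os_one S : S)) <= (e * n%:R)%:E)%E.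
Proof.
move=> e0; apply: ge_ereal_sup => _ [k [X [nX ->]]]; rewrite lee_fin.
apply: os_norm_le => [|xi]; first by rewrite mulr_ge0.
apply/sum_norm_le; first by rewrite mulr_ge0.
(* Apply [X], of norm at most one, to the vectors [c_j e_a], and keep the coordinate [a] of the
   result. *)
have hX (a : 'I_n) (c : 'I_k -> C) : \sum_i `|\sum_j vsval (X i j) a a * c j| ^+ 2 <= \sum_j `|c j| ^+ 2.
  have := os_normP X (fun j => c j *: (delta_mx a 0 : 'cV[C]_n)).
  move/sum_norm_le => /(_ (os_norm_ge0 _)) h.
  have dE (v : 'cV[C]_n) : cdot v v = \sum_b `|v b 0| ^+ 2.
    by apply: eq_bigr => b _; rewrite normCK.
  have sE : sum_dot (S := ms_opsys P) (fun j => c j *: (delta_mx a 0 : 'cV[C]_n))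
     (fun j => c j *: (delta_mx a 0 : 'cV[C]_n)) = \sum_j `|c j| ^+ 2.
    apply: eq_bigr => j _; rewrite -[LHS]/(cdot _ _) dE (bigD1 a) //= big1 ?addr0 => [|b ba].
      by rewrite !mxE !eqxx mulr1.
    by rewrite !mxE (negPf ba) mulr0 normr0 expr0n.
  have s0 : 0 <= \sum_j `|c j| ^+ 2 by apply: sumr_ge0 => j _; rewrite exprn_ge0.
  apply: le_trans (_ : _ <= sum_dot (S := ms_opsys P) (amp_act X (fun j => c j *: (delta_mx a 0 : 'cV[C]_n)))
     (amp_act X (fun j => c j *: (delta_mx a 0 : 'cV[C]_n)))) _.
    apply: ler_sum => i _; rewrite -[leRHS]/(cdot _ _) dE (bigD1 a) //=.
    have -> : \sum_j vsval (X i j) a a * c j =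
       (amp_act X (fun j => c j *: (delta_mx a 0 : 'cV[C]_n)) i : 'cV[C]_n) a 0.
      rewrite /amp_act summxE; apply: eq_bigr => j _.
      rewrite -[os_act _ _ _]/(vsval (X i j) *m (c j *: delta_mx a 0)) -scalemxAr !mxE mulrC; congr (_ * _).
      rewrite (bigD1 a) //= big1 ?addr0 => [|b ba]; first by rewrite !mxE !eqxx mulr1.
      by rewrite !mxE (negPf ba) mulr0.
    by rewrite lerDl; apply: sumr_ge0 => b _; rewrite exprn_ge0.
  apply: le_trans h _; rewrite sE -[leRHS]mul1r ler_wpM2r //.
  by rewrite -[1]/(1%:C%C) lecR expr_le1 // os_norm_ge0.
pose eta a i : os_hilb S := \sum_j vsval (X i j) a a *: xi j.
have hE i : amp_act (map_mx (fun x : ms_opsys P => (e%:C%C * \tr (vsval x)) *: os_one S : S) X) xi i =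
   e%:C%C *: \sum_a eta a i.
  rewrite /amp_act /eta exchange_big scaler_sumr; apply: eq_bigr => j _ /=.
  rewrite mxE actZl os_act_one -scaler_suml scalerA; congr (_ *: _).
rewrite /sum_dot; under eq_bigr do rewrite hE dotZl dotZr conjCR mulrA.
apply: (@le_trans _ _ (\sum_i (e%:C%C * e%:C%C) * (n%:R * \sum_a h_dot _ (eta a i) (eta a i)))).
  apply: ler_sum => i _; rewrite ler_wpM2l ?mulr_ge0 ?ler0c //; exact: dot_sum_le.
rewrite -mulr_sumr -mulr_sumr exchange_big /=.
have -> : ((e * n%:R) ^+ 2)%:C%C = e%:C%C * e%:C%C * (n%:R * n%:R) :> C.
  by rewrite rmorphXn rmorphM rmorph_nat; ring.
rewrite -!mulrA ler_wpM2l ?ler0c // ler_wpM2l ?ler0c // ler_wpM2l //.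
apply: (@le_trans _ _ (\sum_(a < n) \sum_j h_dot _ (xi j) (xi j))).
  by apply: ler_sum => a _; exact: (scalar_contraction (hX a)).
by rewrite sumr_const card_ord mulr_natl.
Qed.
End Lift.

(** * From nuclearity for quotients to approximate extension *)

Section NuclearExtension.
Variable R : realType.
Local Notation C := R[i].
Local Notation conjC := (@Num.conj C).
Local Notation Re := complex.Re.

Theorem nuclear_extension (S : opsys R) :
  (forall n (J : {vspace 'M[C]_n}), null_subspace J ->
     @co_iso R (tens_min S (matn_quot J)) (tens_max S (matn_quot J)) idfun) ->
  forall n (P : matrix_system R n) (phi : {linear ms_opsys P -> S}), cp phi ->
    forall e : R, 0 < e ->
    exists2 psi : {linear matn R n -> S}, cp psi &
      (cb_norm (fun x : ms_opsys P => (psi (vsval x) - phi x)%R : S) <= e%:E)%E.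
Proof.
move=> H2 n P phi cphi e e0.
have [J JP] := annihilator_exists (ms_space P).
have nJ := annihilator_null JP.
pose Z := tensor_tprod (os_car S) (matn_quot_car J).
(* An arbitrary linear extension of [phi]: the slices of [z] only see its values on the system. *)
pose ph (x : 'M[C]_n) : os_car S := phi (vsproj (ms_space P) x).
have phl : linear ph by move=> a x y; rewrite /ph !linearP.
have phC x : ph x = \sum_a \sum_b x a b *: ph (delta_mx a b).
  exact: (esym (choi_mapE (mklin phl) x)).
have phE r (rP : r \in ms_space P) : ph r = phi (Subvs rP).
  by rewrite /ph; congr (phi _); apply: val_inj; rewrite /= vsprojK.
pose z : Z := \sum_a \sum_b tn (ph (delta_mx a b)) (qpi J (delta_mx a b)).
(* The Choi matrix of [g] composed with the quotient map has blocks [B i j] that annihilate [J],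
   hence lie in the system. The image of [z] under [f (x) g] is [f] composed with [phi], applied to
   this positive matrix. *)
have zmin : @mo_cone R (tens_min S (matn_quot J)) 1 (const_mx z).
  move=> p q f g [cf _] [cg _]; apply/mo_cone_matn.
  pose B i j : 'M[C]_n := \matrix_(a, b) g (qpi J (delta_mx a b)) i j.
  have BP i j : B i j \in ms_space P.
    apply: (annihilatorK JP) => x xJ.
    have : (g (qpi J x) : 'M_q) i j = 0 by rewrite (proj2 (qpi_eq0 J x)) // linear0 mxE.
    rewrite {1}(matrix_sum_delta x) => <-.
    rewrite linear_sum linear_sum summxE; apply: eq_bigr => a _.
    rewrite linear_sum linear_sum summxE; apply: eq_bigr => b _.
    by rewrite !linearZ /= !mxE mulrC.
  have gB : psd (fun u v : 'I_q * 'I_n => B u.1 v.1 u.2 v.2).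
    have := cp_mcone cg (choi_cone (@qpi_cp R n J)).
    move=> /(os_mconeP (S := matn R q)) /gcone_matn.
    move=> /(psd_reindex (fun u : 'I_q * 'I_n => (u.2, u.1))).
    by apply: eq_psd => u v; rewrite mxE.
  have hB : @mcone R (ms_opsys P) 'I_q (fun i j => Subvs (BP i j)).
    apply/(os_mconeP (S := ms_opsys P)) => xi.
    exact: (proj2 (gcone_matn B) gB xi).
  have := cp_mcone cf (cp_mcone cphi hB).
  move=> /(os_mconeP (S := matn R p)) /gcone_matn h.
  have := psd_reindex (fun u : 'I_1 * 'I_(p * q) => ((mxtens_unindex u.2).2, (mxtens_unindex u.2).1)) h.
  apply: eq_psd => u v; rewrite !mxE.
  have -> : tensor_matrix_map f g z = mxmap Z f g z by exact: tensor_matrix_mapE.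
  rewrite -phE phC linear_sum /z linear_sum !summxE.
  apply: eq_bigr => a _; rewrite !linear_sum !summxE; apply: eq_bigr => b _.
  by rewrite mxmap_tn linearZ /= !mxE mulrC.
have [_ [_ _ co]] := H2 n J nJ.
have := proj1 (co 1%N (const_mx z)) zmin.
have -> : map_mx idfun (const_mx z : 'M[tensor (os_car S) (matn_quot_car J)]_1) = const_mx z.
  by apply/matrixP => i j; rewrite !mxE.
move=> /max_coneP hz.
(* The lift leaves the error [2 e1 tr], of cb-norm at most [2 e1 n]; the denominator [n + 1] covers
   [n = 0]. *)
pose e1 := e / (2 * (n.+1)%:R).
have e10 : 0 < e1 by rewrite divr_gt0 // mulr_gt0 // ltr0n.
have [psi cpsi psiE] := max_quot_lift e10 (hz e1 e10).
exists psi => //.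
have -> : (fun x : ms_opsys P => (psi (vsval x) - phi x)%R : S) =
  (fun x : ms_opsys P => (((2 * e1)%:C%C * \tr (vsval x)) *: os_one S : S)).
  apply/funext => x.
  have hr y : y \in J -> mxpair (vsval x) y = 0 by move=> /JP; apply; exact: subvsP.
  rewrite (psiE _ hr).
  suff -> : slice (qfunl hr) z = phi x by rewrite addrC addKr.
  have -> : phi x = ph (vsval x) by rewrite /ph vsvalK.
  rewrite phC /z linear_sum; apply: eq_bigr => a _.
  rewrite linear_sum; apply: eq_bigr => b _.
  by rewrite slice_tn qfunl_pi mxpair_delta.
apply: le_trans (trace_cb_norm _ _ _) _; first by rewrite mulr_ge0 // ltW.
rewrite lee_fin /e1.
have -> : 2 * (e / (2 * n.+1%:R)) * n%:R = e * (n%:R / n.+1%:R).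
  have : (n.+1%:R : R) != 0 by rewrite pnatr_eq0.
  by move: (n.+1%:R : R) => m m0; field.
rewrite -[leRHS]mulr1 ler_wpM2l ?(ltW e0) // ler_pdivrMr ?ltr0n // mul1r ler_nat.
exact: leqnSn.
Qed.
End NuclearExtension.

(** * Functionals on an operator system *)

Section Jordan.
Variable R : realType.
Local Notation C := R[i].
Local Notation conjC := (@Num.conj C).
Local Notation Re := complex.Re.

Section Order.
Variable S : opsys R.
Local Notation dot := (h_dot (os_hilb S)).
Local Notation act := (os_act S).

(** The identity [(r - h) (r + h) (r - h) + (r + h) (r - h) (r + h) = 2 r (r^2 - h^2)], read on
    quadratic forms, bounds [h^2]. For [r = 0] the form of [h] vanishes; then [i h] is hermitian as
    well, and [h = 0]. *)
Lemma le_herm_onorm (h : os_car S) (r : R) : 0 <= r -> os_star h = h ->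
  os_pos (r%:C%C *: os_one S - h) -> os_pos (r%:C%C *: os_one S + h) -> onorm h <= r.
Proof.
move=> r0 hh pA pB; apply: onorm_le => // v.
have hr u w : dot u (act h w) = dot (act h u) w by rewrite -os_starP hh.
move: r0; rewrite le_eqVlt => /predU1P[r0|r0].
  have h0 : forall u, dot (act h u) u = 0.
    move=> u; have := pA u; have := pB u; rewrite -r0 scale0r add0r sub0r actNl dotNl oppr_ge0 => h1 h2.
    by apply/eqP; rewrite eq_le h1 h2.
  have -> : h = 0.
    have h1 : os_star ('i *: h) = 'i *: h by apply: form_real_herm => u; rewrite actZl dotZl h0 mulr0 rpred0.
    move: h1; rewrite os_starZ hh conjCi => /eqP; rewrite -subr_eq0 -scalerBl scaler_eq0.
    have -> : (- 'i - 'i == 0 :> C) = false.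
      by rewrite -opprD oppr_eq0 -mulr2n mulrn_eq0 /= (negPf (neq0Ci _)).
    by move/eqP.
  by rewrite act0l dot0l mulr_ge0 ?dot_ge0 // ler0c sqr_ge0.
have r2 : 0 < 2%:R * r%:C%C :> C by rewrite mulr_gt0 ?ltr0n // ltcR.
rewrite -subr_ge0 -(pmulr_rge0 _ r2).
have := addr_ge0 (pB (r%:C%C *: v - act h v)) (pA (r%:C%C *: v + act h v)).
congr (_ <= _); rewrite !actDl !actNl !actZl !os_act_one !actDr !actNr !actZr.
rewrite !(dotDl, dotNl, dotDr, dotNr, dotZl, dotZr) !conjCR !hr.
by rewrite rmorphXn /=; ring.
Qed.

Lemma herm_majorized (x : os_car S) : exists2 r : R, 0 <= r &
  os_pos (r%:C%C *: os_one S - (x + os_star x)).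
Proof.
have hx : os_star (x + os_star x) = x + os_star x by rewrite os_starD os_starK addrC.
by exists (onorm (x + os_star x)); [exact: onorm_ge0|case: (herm_le_onorm hx)].
Qed.
End Order.

Lemma imag_skew (S : opsys R) (h : os_car S) : os_star h = h ->
  'i *: h + os_star ('i *: h) = 0.
Proof. by move=> hh; rewrite os_starZ hh conjCi scaleNr subrr. Qed.

Lemma Re_pm (x : C) : 0 <= Re ('i * x) -> 0 <= Re (- 'i * x) -> complex.Im x = 0.
Proof.
rewrite -complexiE; case: x => a b /=; rewrite !mul0r !mul1r !sub0r ?mulN1r ?oppr0 ?mul0r ?sub0r ?opprK ?oppr_ge0 => h1 h2.
by apply/eqP; rewrite eq_le h1 h2.
Qed.

Lemma ge0_Re_Im (x : C) : 0 <= Re x -> complex.Im x = 0 -> 0 <= x.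
Proof. by move=> h1 h2; rewrite lecE h2 /= eqxx h1. Qed.

(** Only the real part of [G] is controlled on the cone; the membership of both [i x] and [- i x]
    makes the imaginary part at [x] vanish. *)
Lemma linear_ge0 (V : lmodType C) (K : set V) (G : {linear V -> C^o}) x :
  (forall v, K v -> 0 <= Re (G v)) -> K x -> K ('i *: x) -> K (- 'i *: x) -> 0 <= (G x : C).
Proof.
move=> GK Kx Kix Knix; apply: ge0_Re_Im; first exact: GK.
apply: Re_pm.
  by have := GK _ Kix; rewrite linearZ.
by have := GK _ Knix; rewrite linearZ.
Qed.

Section Dec.
Variable S : opsys R.
Local Notation F := (functional (os_nmospace S)).

Lemma functional_eqP (f g : F) : (forall s, f s = g s) -> f = g.
Proof. by move=> e; apply: val_inj; apply/funext. Qed.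

Definition fpos1 (f : F) := forall s, os_pos s -> 0 <= (f s : C).

Lemma pos_cone_convex : convex_cone (V := (os_car S * os_car S)%type)
  (fun ab => os_pos (ab.1 + os_star ab.1) /\ os_pos (ab.2 + os_star ab.2)).
Proof.
have star0 : os_star (0 : os_car S) = 0 by have := os_starZ 0 (0 : os_car S); rewrite scaler0 rmorph0 scale0r.
split=> [|[a b] [a' b'] /= [h1 h2] [h3 h4]|r [a b] r0 /= [h1 h2]].
by rewrite /= star0 addr0; split; exact: os_pos0.
by rewrite !os_starD ![_ + (os_star _ + _)]addrACA; split; exact: os_posD.
by rewrite !os_starZ conjCR -!scalerDr; split; apply: os_posZ; rewrite ?ler0c.
Qed.

(** Krein's theorem on [S * S]: the functional [f s + c |f|] on the pairs [(s + c 1, - s + c 1)] is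
    positive, because [- c 1 <= s <= c 1] bounds the norm of a hermitian [s] by [c]. The components
    of an extension are [g] and [h], and its value at [(1, 1)] is the norm identity. *)
Lemma jordan_decomposition (f : F) :
  (forall s, f (os_star s) = conjC (f s)) ->
  exists g h : F, [/\ fpos1 g, fpos1 h, (forall s, f s = (g s : C) - h s) &
     (g (os_one S) : C) + h (os_one S) = (functional_norm f)%:C%C].
Proof.
move=> fh; pose M := functional_norm f.
have M0 : 0 <= M := functional_norm_ge0 f.
pose jf (sc : os_car S * C^o) : os_car S * os_car S :=
  (sc.1 + (sc.2 : C) *: os_one S, - sc.1 + (sc.2 : C) *: os_one S).
pose ff (sc : os_car S * C^o) : C^o := (f sc.1 : C) + (sc.2 : C) * M%:C%C.
have jl : linear jf.
  move=> a [s c] [s' c']; rewrite /jf /=; congr (_, _) => /=.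
    by rewrite scalerDr scalerDl -scalerA addrACA.
  by rewrite scalerDr scalerDl -scalerA scalerN opprD addrACA.
have fl : linear ff.
  move=> a [s c] [s' c']; rewrite /ff /=.
  have -> : f (a *: s + s') = a * (f s : C) + f s' :> C by exact: (linearP f a s s').
  have -> : a *: ((f s : C) + c * M%:C%C : C^o) = a * ((f s : C) + c * M%:C%C) by [].
  have -> : a *: c = a * c by [].
  by ring.
have star0 : os_star (0 : os_car S) = 0 by have := os_starZ 0 (0 : os_car S); rewrite scaler0 rmorph0 scale0r.
have [||G [GK Gj]] := krein_extension pos_cone_convex (j := mklin jl) (f0 := mklin fl).
move=> [s c] /= [h1 h2].
  have [h [k [hh hk sE _ _]]] := herm_parts s.
  have e1 : s + c *: os_one S + os_star (s + c *: os_one S) = 2%:R *: ((Re c)%:C%C *: os_one S + h).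
    rewrite os_starD os_starZ os_star1 sE os_starD hh addrACA -scalerDl.
    have -> : c + conjC c = 2%:R * (Re c)%:C%C by exact: addcJ.
    rewrite addrACA (imag_skew hk) addr0 scalerDr scalerA addrC; congr (_ + _).
    by rewrite scaler_nat mulr2n.
  have e2 : - s + c *: os_one S + os_star (- s + c *: os_one S) = 2%:R *: ((Re c)%:C%C *: os_one S - h).
    rewrite os_starD os_starZ os_star1 -[- s]scaleN1r os_starZ rmorphN rmorph1 !scaleN1r sE os_starD hh addrACA -scalerDl.
    have -> : c + conjC c = 2%:R * (Re c)%:C%C by exact: addcJ.
    rewrite -opprD addrACA (imag_skew hk) addr0 scalerBr scalerA addrC; congr (_ - _).
    by rewrite scaler_nat mulr2n.
  have half (x : os_car S) : os_pos (2%:R *: x) -> os_pos x.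
    move=> hx; have := os_posZ (_ : 0 <= 2%:R^-1) hx; rewrite invr_ge0 ler0n => /(_ isT).
    by rewrite scalerA mulVf ?scale1r // pnatr_eq0.
  rewrite e1 in h1; rewrite e2 in h2; move: (half _ h1) (half _ h2) => {}h1 {}h2.
  have fE : f s = (f h : C) + 'i * (f k : C) :> C.
    have e : f ('i *: k + h) = 'i * (f k : C) + f h :> C by exact: (linearP f 'i k h).
    by rewrite sE addrC e addrC.
  have fr x : os_star x = x -> (f x : C) \is Num.real.
    by move=> hx; apply/CrealP; rewrite -fh hx.
  have -> : Re (ff (s, c)) = Re (f h : C) + Re c * M.
    rewrite /ff /= fE; move: (fr k hk) (fr h hh); case: (f h) (f k) => u w [u' w'].
    rewrite !complex_real => /eqP -> /eqP ->; case: c {e1 e2 h1 h2} => c1 c2 /=.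
    by ring.
  (* On the zero Hilbert space the positivity of [c 1] does not give [0 <= c]; there the norm of [f]
     is zero. *)
  have [S0|] := pselect (forall v : os_hilb S, v = 0).
    have s0 x : x = 0 :> os_car S by apply: os_act_inj => v; rewrite [v]S0 act0r.
    have M00 : M = 0.
      apply/eqP; rewrite eq_le M0 andbT; apply: ge_inf; first by exists 0 => ? [].
      by split=> // x; rewrite mul0r (s0 x) (linear0 f) normr0.
    by rewrite M00 mulr0 addr0 (s0 h) (linear0 f).
  move=> /existsNP[v /eqP v0].
  have vv : 0 < h_dot _ v v by rewrite lt_def dot_eq0 v0 dot_ge0.
  have c0 : 0 <= Re c.
    have := os_posD h1 h2 => /(_ v); rewrite addrACA addrN addr0 -scalerDl actZl os_act_one dotZl.
    by rewrite pmulr_lge0 // -rmorphD ler0c -mulr2n pmulrn_lge0.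
  have hn := le_herm_onorm c0 hh h2 h1.
  have := functional_le f h; rewrite real_ler_norml ?fr // => /andP[le1 _].
  have {}le1 : - (onorm h * M) <= Re (f h : C).
    by move: le1; rewrite -{1}(RRe_real (fr h hh)) -rmorphN lecR.
  rewrite -[Re (f h : C)]opprK addrC subr_ge0; apply: le_trans (_ : _ <= onorm h * M) _.
    by rewrite lerNl.
  by rewrite ler_wpM2r.
move=> [a b]; have [r r0 hr] := herm_majorized a; have [t t0 ht] := herm_majorized b.
exists (0, (r + t)%:C%C) => /=.
have E x u w : 0 <= u -> 0 <= w -> os_pos (u%:C%C *: os_one S - (x + os_star x)) ->
   os_pos ((u + w)%:C%C *: os_one S - x + os_star ((u + w)%:C%C *: os_one S - x)).
  move=> u0 w0 hu.
  have uw : 0 <= (u + w + w)%:C%C :> C by rewrite ler0c !addr_ge0.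
  have := os_posD hu (os_posZ uw (@os_pos_one _ S)); congr os_pos.
  rewrite os_starD os_starZ os_star1 conjCR -[- x]scaleN1r os_starZ rmorphN rmorph1 !scaleN1r.
  rewrite addrAC [RHS]addrACA -opprD; congr (_ - _).
  by rewrite -!scalerDl -!rmorphD; congr (_%:C%C *: _); ring.
by rewrite add0r oppr0 add0r; split; [exact: E|rewrite [(r + t)%R]addrC; exact: E].
pose gf a : C^o := G (a, 0); pose hf b : C^o := G (0, b).
have gl : linear gf.
  move=> k x y; rewrite /gf -linearP; congr (G (_, _)).
  by rewrite /= scaler0 addr0.
have hl : linear hf.
  move=> k x y; rewrite /hf -linearP; congr (G (_, _)).
  by rewrite /= scaler0 addr0.
have key a : os_pos a -> forall k : C, k + conjC k = 0 -> os_pos (k *: a + os_star (k *: a)).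
  by move=> ha k k0; rewrite os_starZ (os_pos_herm ha) -scalerDl k0 scale0r; exact: os_pos0.
have i0 : 'i + conjC 'i = 0 :> C by rewrite conjCi subrr.
have i0' : - 'i + conjC (- 'i) = 0 :> C by rewrite rmorphN /= conjCi opprK addNr.
have gp x : os_pos x -> 0 <= (mklin gl x : C).
  move=> hx; have Z0 : os_pos (0 + os_star 0 : os_car S) by rewrite star0 addr0; exact: os_pos0.
  apply: (linear_ge0 (x := (x, 0) : os_car S * os_car S) GK) => /=; rewrite ?scaler0; split=> //; try exact: key.
  by rewrite os_pos_herm //; exact: os_posD.
have hp x : os_pos x -> 0 <= (mklin hl x : C).
  move=> hx; have Z0 : os_pos (0 + os_star 0 : os_car S) by rewrite star0 addr0; exact: os_pos0.
  apply: (linear_ge0 (x := (0, x) : os_car S * os_car S) GK) => /=; rewrite ?scaler0; split=> //; try exact: key.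
  by rewrite os_pos_herm //; exact: os_posD.
exists (Functional (pos_bounded gp)), (Functional (pos_bounded hp)); split=> //.
  move=> s; have := Gj (s, 0); rewrite /= /jf /ff /= scale0r !addr0 mul0r addr0 => <-.
  have -> : (s, - s) = (s, 0) - (0, s) :> os_car S * os_car S by congr (_, _); rewrite /= ?subr0 ?sub0r.
  by rewrite linearB.
have := Gj (0, 1); rewrite /= /jf /ff /= oppr0 scale1r !add0r mul1r (linear0 f) add0r => <-.
rewrite -[LHS]/(G (os_one S, 0) + G (0, os_one S) : C^o) -linearD; congr (G _).
by congr (_, _); rewrite /= ?addr0 ?add0r.
Qed.

Lemma fstar_bounded (f : F) : (fun s : os_nmospace S => conjC (f (os_star s)) : C^o) \in
  @bounded_functional R (os_nmospace S).
Proof.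
apply/asboolP; split.
  move=> a x y; rewrite os_starD os_starZ.
  have -> : f (conjC a *: os_star x + os_star y) = conjC a * (f (os_star x) : C) + f (os_star y) :> C.
    exact: (linearP f (conjC a) (os_star x) (os_star y)).
  by rewrite rmorphD rmorphM /= conjCK.
exists (functional_norm f) => x; rewrite norm_conjC mulrC.
apply: le_trans (functional_le f (os_star x)) _; rewrite lecR ler_wpM2r ?functional_norm_ge0 //.
apply: onorm_le => [|v]; first exact: onorm_ge0.
exact: onorm_star.
Qed.
Definition fstar (f : F) : F := Functional (fstar_bounded f).

Lemma fstar_conj : conj_linear fstar.
Proof.
move=> a f g; apply: functional_eqP => s.
by rewrite -[LHS]/(conjC (a * (f (os_star s) : C) + g (os_star s))) rmorphD rmorphM.
Qed.
Lemma fstarK : involutive fstar.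
Proof. by move=> f; apply: functional_eqP => s; rewrite -[LHS]/(conjC (conjC (f (os_star (os_star s))))) conjCK os_starK. Qed.

Lemma functional_parts (f : F) : exists f1 f2, [/\ fstar f1 = f1, fstar f2 = f2,
  f = f1 + 'i *: f2, functional_norm f1 <= functional_norm f & functional_norm f2 <= functional_norm f].
Proof.
have i2 : 'i * 'i = -1 :> C by rewrite -expr2 sqrCi.
have nrm (g : F) : (forall x, `|g x : C| <= (functional_norm f * onorm x)%:C%C) ->
    functional_norm g <= functional_norm f.
  move=> hg; apply: ge_inf; first by exists 0 => ? [].
  by split; [exact: functional_norm_ge0|exact: hg].
have fn x : `|f x : C| <= (functional_norm f * onorm x)%:C%C by rewrite mulrC; exact: functional_le.
have sn x : `|conjC (f (os_star x)) : C| <= (functional_norm f * onorm x)%:C%C.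
  rewrite norm_conjC mulrC; apply: le_trans (functional_le f (os_star x)) _.
  rewrite lecR ler_wpM2r ?functional_norm_ge0 //; apply: onorm_le => [|v]; first exact: onorm_ge0.
  exact: onorm_star.
have half (a b : C) (M : C) : `|a| <= M -> `|b| <= M -> `|2%:R^-1 * (a + b)| <= M.
  move=> ha hb; rewrite normrM normfV normr_nat ler_pdivrMl ?ltr0n //.
  by apply: le_trans (ler_normD _ _) _; rewrite mulr_natl mulr2n lerD.
exists (2%:R^-1 *: (f + fstar f)), (2%:R^-1 *: ((- 'i) *: f + 'i *: fstar f)); split.
    by rewrite (conj_linearZ fstar_conj) (conj_linearD fstar_conj) fstarK addrC fmorphV rmorph_nat.
   rewrite (conj_linearZ fstar_conj) (conj_linearD fstar_conj) !(conj_linearZ fstar_conj) fstarK.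
   by rewrite fmorphV rmorph_nat rmorphN /= conjCi opprK addrC.
  apply: functional_eqP => s.
  rewrite -[RHS]/(2%:R^-1 * ((f s : C) + fstar f s) + 'i * (2%:R^-1 * (- 'i * (f s : C) + 'i * (fstar f s : C)))).
  by field: i2.
 by apply: nrm => x; exact: (half (f x) (conjC (f (os_star x))) _ (fn x) (sn x)).
apply: nrm => x; apply: (half (- 'i * (f x : C)) ('i * conjC (f (os_star x)))).
  by rewrite normrM normrN normCi mul1r.
by rewrite normrM normCi mul1r.
Qed.
End Dec.
End Jordan.

(** * The evaluation pairing at strictly positive elements *)

Section Trace.
Variable R : realType.
Local Notation C := R[i].
Local Notation conjC := (@Num.conj C).
Local Notation Re := complex.Re.

Section Fpos.
Variable S : opsys R.
Local Notation F := (functional (os_nmospace S)).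

(* Positivity in [M_K(S^* )], tested on the positive matrices over [S]. *)
Definition fpos (K : finType) (G : K -> K -> F) := forall (U : finType) (s : U -> U -> os_car S) (c : U -> K -> C),
  gcone s -> 0 <= \sum_u \sum_v \sum_a \sum_b conjC (c u a) * c v b * (G a b (s u v) : C).

Lemma fpos_compress (K L : finType) (G : K -> K -> F) (A : K -> L -> C) : fpos G ->
  fpos (fun j j' => \sum_i \sum_i' (conjC (A i j) * A i' j') *: G i i').
Proof.
move=> hG U s c hs; have := hG U s (fun u k => \sum_j A k j * c u j) hs; congr (_ <= _).
apply: eq_bigr => u _; apply: eq_bigr => v _.
under [RHS]eq_bigr do under eq_bigr do (rewrite functional_sumE mulr_sumr; under eq_bigr do (rewrite functional_sumE mulr_sumr)).
rewrite [RHS]exchange_big22; apply: eq_bigr => i _; apply: eq_bigr => i' _.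
rewrite rmorph_sum mulr_suml mulr_suml; apply: eq_bigr => j _.
rewrite mulr_sumr mulr_suml; apply: eq_bigr => j' _.
by rewrite functional_scaleE rmorphM /=; ring.
Qed.

Lemma fpos_psd (K : finType) (G : K -> K -> F) s : fpos G -> os_pos s ->
  psd (fun a b => G a b s : C).
Proof.
move=> hG hs c; have := hG 'I_1 (fun _ _ => s) (fun _ a => c a) (os_posP hs).
rewrite !big_ord1; congr (_ <= _); apply: eq_bigr => a _; apply: eq_bigr => b _; by rewrite mulrAC.
Qed.

Lemma fpos_star (K : finType) (G : K -> K -> F) : fpos G ->
  forall s k l, (G l k (os_star s) : C) = conjC (G k l s).
Proof.
move=> hG; apply: os_pos_ind => [a x y hx hy k l|s hs k l].
  have e1 : G k l (a *: x + y) = a * (G k l x : C) + G k l y :> C by exact: (functional_linear (G k l)).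
  have e2 : G l k (os_star (a *: x + y)) = conjC a * (G l k (os_star x) : C) + G l k (os_star y) :> C.
    by rewrite os_starD os_starZ; exact: (functional_linear (G l k)).
  by rewrite e1 e2 rmorphD rmorphM /= hx hy.
by rewrite os_pos_herm //; exact: (psd_herm (fpos_psd hG hs)).
Qed.

Lemma evl_linear (s : os_car S) : linear (fun f : F => (f s : C^o)).
Proof. by move=> a f g. Qed.
Definition evl s : {linear F -> C^o} := mklin (evl_linear s).

Lemma evl_sep (f : F) : (forall g : {linear F -> C^o}, (exists s, g = evl s) -> g f = 0) -> f = 0.
Proof. by move=> h; apply: functional_eqP => s; exact: (h (evl s) (ex_intro _ s erefl)). Qed.

Lemma ev_bil : bil (fun (s : os_car S) (f : F) => (f s : C^o)).
Proof. by split=> [k x y f|s k f g] //; exact: (functional_linear f). Qed.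

Definition ev (Z : tprod (os_car S) F) : {linear Z -> C^o} := tlift Z ev_bil.
Lemma ev_tn (Z : tprod (os_car S) F) s f : ev Z (tn s f) = f s.
Proof. exact: tlift_tn. Qed.

Lemma slices_eq (Z : tprod (os_car S) F) (z w : Z) :
  (forall s, slice (evl s) z = slice (evl s) w) -> z = w.
Proof.
move=> e; apply/eqP; rewrite -subr_eq0; apply/eqP; apply: (slice_inj evl_sep) => _ [s ->].
by rewrite linearB /= e subrr.
Qed.
End Fpos.

(** If [B v = 0], then [B^* B >= d] gives [d |v|^2 <= 0]; an injective square matrix is
    invertible. *)
Lemma psd_lower_unit m (B : 'M[C]_m) (d : R) : 0 < d ->
  psd (fun k l => \sum_c conjC (B c k) * B c l - d%:C%C * (k == l)%:R) -> B \in unitmx.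
Proof.
move=> d0 hB.
have inj (v : 'cV[C]_m) : B *m v = 0 -> v = 0.
  move=> Bv; have := hB (fun k => v k 0).
  have -> : \sum_k \sum_l conjC (v k 0) * (\sum_c conjC (B c k) * B c l - d%:C%C * (k == l)%:R) * v l 0 =
     - (d%:C%C * \sum_k `|v k 0| ^+ 2).
    rewrite mulr_sumr -sumrN; apply: eq_bigr => k _.
    transitivity (\sum_l (\sum_c conjC (v k 0) * conjC (B c k) * (B c l * v l 0) - conjC (v k 0) * d%:C%C * (v l 0 *+ (l == k)))).
      apply: eq_bigr => l _; rewrite mulrBr mulrBl mulr_sumr mulr_suml; congr (_ - _).
        by apply: eq_bigr => c _; ring.
      by rewrite [l == k]eq_sym -mulr_natr; ring.
    rewrite sumrB exchange_big /= big1 ?sub0r => [|c _].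
      by rewrite -mulr_sumr sum_delta normCK; congr (- _); ring.
    rewrite -mulr_sumr; have := congr1 (fun M : 'cV_m => M c 0) Bv.
    by rewrite !mxE => ->; rewrite mulr0.
  rewrite oppr_ge0 pmulr_rle0 ?ltcR // => h.
  have : \sum_k `|v k 0| ^+ 2 = 0.
    by apply/eqP; rewrite eq_le h sumr_ge0 // => k _; rewrite exprn_ge0.
  move/eqP; rewrite psumr_eq0 => [/allP hv|k _]; last by rewrite exprn_ge0.
  apply/matrixP => k j; rewrite ord1 mxE; have := hv k (mem_index_enum _).
  by rewrite /= expf_eq0 /= normr_eq0 => /eqP.
rewrite -unitmx_tr -row_free_unit -kermx_eq0; apply/eqP/row_matrixP => i.
rewrite row0; set w := row i _.
have : w *m B^T = 0 by rewrite /w -row_mul mulmx_ker row0.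
move/(congr1 trmx); rewrite trmx_mul trmxK trmx0 => /inj.
by move/(congr1 trmx); rewrite trmxK trmx0.
Qed.

(** [x] is scaled into the unit ball by [onorm x + 1], which is positive even when the norm
    vanishes. *)
Lemma cb_norm_apply (A B : opsys R) (f : {linear os_car A -> os_car B}) (e : R) : 0 <= e ->
  (@cb_norm R A B f <= e%:E)%E -> forall x, onorm (f x) <= e * (onorm x + 1).
Proof.
move=> e0 he x; set t := onorm x + 1.
have t0 : 0 < t by rewrite ltr_wpDl ?onorm_ge0.
have nZ (V : opsys R) (r : R) (y : os_car V) : 0 <= r -> onorm (r%:C%C *: y) <= r * onorm y.
  move=> r0; apply: onorm_le => [|v]; first by rewrite mulr_ge0 ?onorm_ge0.
  rewrite actZl dotZl dotZr conjCR mulrA.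
  have -> : ((r * onorm y) ^+ 2)%:C%C = r%:C%C * r%:C%C * (onorm y ^+ 2)%:C%C :> C.
    by rewrite !rmorphXn rmorphM /=; ring.
  by rewrite -[X in _ <= X]mulrA ler_wpM2l ?mulr_ge0 ?ler0c //; exact: onormP.
have x1 : os_norm (const_mx (t^-1%:C%C *: x) : 'M[os_car A]_1) <= 1.
  rewrite -/(onorm _); apply: le_trans (nZ _ _ _ _) _; first by rewrite invr_ge0 ltW.
  by rewrite mulrC ler_pdivrMr // mul1r /t lerDl.
have : ((os_norm (map_mx f (const_mx (t^-1%:C%C *: x) : 'M[os_car A]_1) : 'M[os_car B]_1))%:E <= e%:E)%E.
  apply: le_trans he; apply: ereal_sup_ubound.
  by exists 1%N, (const_mx (t^-1%:C%C *: x)).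
rewrite lee_fin.
have -> : map_mx f (const_mx (t^-1%:C%C *: x) : 'M[os_car A]_1) = const_mx (f (t^-1%:C%C *: x)).
  by apply/matrixP => i j; rewrite !mxE.
rewrite -/(onorm _) => h.
have -> : f x = t%:C%C *: f (t^-1%:C%C *: x).
  by rewrite linearZ scalerA -rmorphM mulfV ?gt_eqF // scale1r.
apply: le_trans (nZ _ _ _ (ltW t0)) _.
by rewrite mulrC ler_wpM2r // ltW.
Qed.

Section Main.
Variables (S I : opsys R) (kappa : {linear os_car S -> os_car I}).
Hypothesis kco : @co_embedding R S I kappa.
Hypothesis H4 : forall n (P : matrix_system R n) (phi : {linear ms_opsys P -> S}), cp phi ->
    forall e : R, 0 < e ->
    exists2 psi : {linear matn R n -> S}, cp psi &
      (cb_norm (fun x : ms_opsys P => (psi (vsval x) - phi x)%R : S) <= e%:E)%E.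
Local Notation F := (functional (os_nmospace S)).
Variables (Z : tprod (os_car S) F) (Z' : tprod (os_car I) F).

Lemma ev_strict_ge0 m (P : 'I_m -> 'I_m -> os_car I) (G : 'I_m -> 'I_m -> F) (y : Z) (d : R) :
  0 < d -> gcone P -> fpos G ->
  psd (fun k l => (G k l (os_one S) : C) - d%:C%C * (k == l)%:R) ->
  mapl Z Z' kappa y = \sum_k \sum_l tn (P k l) (G k l) -> 0 <= Re (ev Z y).
Proof.
move=> d0 hP hG hd yE.
(* [(G k l 1) = B^* B], so [H s = D^* (G k l s) D] with [D = B^-1] is unital and its
   range is a matrix system, on which [y] induces a cp map [ph]. *)
have [B0 BE] := psd_factor (fpos_psd hG (@os_pos_one _ S)).
pose B : 'M[C]_m := \matrix_(c, k) B0 c k.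
have Bu : B \in unitmx.
  apply: (psd_lower_unit d0); apply: eq_psd hd => k l; rewrite BE; congr (_ - _).
  by apply: eq_bigr => c _; rewrite !mxE.
pose D := invmx B.
pose Gm (s : os_car S) : 'M[C]_m := \matrix_(k, l) G k l s.
pose H s := (D ^t conjC)%sesqui *m Gm s *m D.
have Gml : linear Gm.
  by move=> a x z; apply/matrixP => k l; rewrite !mxE; exact: (functional_linear (G k l)).
have Hl : linear H by move=> a x z; rewrite /H Gml mulmxDr mulmxDl -scalemxAr -scalemxAl.
have DB : D *m B = 1%:M by exact: mulVmx.
have BD : B *m D = 1%:M by exact: mulmxV.
have starM (M N : 'M[C]_m) : ((M *m N) ^t conjC)%sesqui = (N ^t conjC)%sesqui *m (M ^t conjC)%sesqui.
  by rewrite trmx_mul map_mxM.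
have star1m : ((1%:M : 'M[C]_m) ^t conjC)%sesqui = 1%:M by rewrite trmx1 map_mx1.
have GmE s : Gm s = (B ^t conjC)%sesqui *m H s *m B.
  rewrite /H !mulmxA -starM DB star1m mul1mx -mulmxA DB mulmx1 //.
have H1 : H (os_one S) = 1%:M.
  have -> : H (os_one S) = (D ^t conjC)%sesqui *m ((B ^t conjC)%sesqui *m B) *m D.
    rewrite /H; congr (_ *m _ *m _); apply/matrixP => k l; rewrite !mxE BE.
    by apply: eq_bigr => c _; rewrite !mxE.
  by rewrite mulmxA -starM BD star1m mul1mx BD.
have Hs s : (H s ^t conjC)%sesqui = H (os_star s).
  rewrite /H !starM trmxCK mulmxA; congr (_ *m _ *m _).
  by apply/matrixP => k l; rewrite !mxE (fpos_star hG).
have [U UE] := vspace_of_pred (Q := fun r : 'M[C]_m => exists s, H s = r)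
  (ex_intro _ 0 (linear0 (mklin Hl)))
  (fun a x z hx hz => let: ex_intro s sE := hx in let: ex_intro t tE := hz in
    ex_intro _ (a *: s + t) (etrans (Hl a s t) (congr2 (fun u v => a *: u + v) sE tE))).
have U1 : 1%:M \in U by apply/UE; exists (os_one S).
have Us A : A \in U -> (A ^t conjC)%sesqui \in U.
  by move=> /UE[s <-]; apply/UE; exists (os_star s); rewrite Hs.
pose Q := MatrixSystem U1 Us.
have sl s : kappa (slice (evl s) y) = \sum_k \sum_l (Gm s k l) *: P k l.
  rewrite -(@slice_mapl _ _ _ _ Z Z' kappa (evl s)) yE linear_sum; apply: eq_bigr => k _.
  by rewrite linear_sum; apply: eq_bigr => l _; rewrite slice_tn mxE.
have kinj : injective kappa by case: kco.
(* [H s] determines the slice: its image under [kappa] pairs [B^* H(s) B] with [P]. *)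
have wd s t : H s = H t -> slice (evl s) y = slice (evl t) y.
  by move=> e; apply: kinj; rewrite !sl !GmE e.
have /choice[sg sgE] : forall r : subvs_of U, exists s, H s = vsval r.
  by move=> r; apply/UE; exact: subvsP.
pose ph (r : subvs_of U) : os_car S := slice (evl (sg r)) y.
have sll : linear (fun s => slice (evl s) y).
  move=> a s t; apply: kinj; rewrite linearP /= !sl scaler_sumr -big_split.
  apply: eq_bigr => k _; rewrite scaler_sumr -big_split; apply: eq_bigr => l _ /=.
  by rewrite Gml !mxE scalerDl scalerA.
have phl : linear ph.
  move=> a r t; rewrite /ph -sll; apply: wd; rewrite sgE Hl !sgE.
  by [].
(* Composed with [kappa], the map [ph] is [x |-> sum_kl (B^* x B)_kl P_kl], which is cp since [P] is
   positive; and [kappa] reflects positivity. *)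
have cph : @cp R (ms_opsys Q) S (mklin phl).
  move=> k X /(mo_cone_os (S := ms_opsys Q)) hX.
  have [_ _ kk] := kco; apply/kk; apply/(mo_cone_os (S := I)).
  have hX' : psd (fun u v : 'I_k * 'I_m => vsval (X u.1 v.1) u.2 v.2).
    by apply/(gcone_matn (fun i j => vsval (X i j))) => xi; exact: hX.
  have := psd_compress (fun (x : 'I_k * 'I_m) (u : 'I_k * 'I_m) => B x.2 u.2 * (x.1 == u.1)%:R) hX'.
  move=> h; apply: eq_gcone (gcone_schur h hP) => u v; rewrite !mxE /= /ph sl.
  apply: eq_bigr => a _; apply: eq_bigr => b _; congr (_ *: _).
  rewrite GmE sgE sum_prod (bigD1 u) //= [X in X + _ = _](_ : _ = \sum_i \sum_j conjC (B i a) * B j b * vsval (X u v) i j); last first.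
    apply: eq_bigr => i _; rewrite sum_prod (bigD1 v) //= [X in _ + X]big1 ?addr0 => [|w wv].
      by apply: eq_bigr => j _; rewrite !eqxx !mulr1.
    by rewrite big1 // => j _; rewrite (negPf wv) !(mulr0, mul0r).
  rewrite [X in _ + X]big1 ?addr0 => [|w wu]; last first.
    by rewrite big1 // => j _; rewrite big1 // => x _; rewrite (negPf wu) mulr0 rmorph0 !mul0r.
  rewrite [RHS]mxE exchange_big; apply: eq_bigr => j _; rewrite [X in _ = X * _]mxE mulr_suml; apply: eq_bigr => i _.
  by rewrite !mxE; ring.
pose g a b : F := \sum_k \sum_l (conjC (D k a) * D l b) *: G k l.
have hg : fpos g := fpos_compress (fun k a => D k a) hG.
have gH s a b : (g a b s : C) = H s a b.
  rewrite functional_sumE [RHS]mxE.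
  under eq_bigr do rewrite functional_sumE.
  rewrite exchange_big /=; apply: eq_bigr => l _; rewrite [X in _ = X * _]mxE mulr_suml; apply: eq_bigr => k _.
  transitivity (conjC (D k a) * D l b * (G k l s : C)); first by [].
  by rewrite !mxE; ring.
pose pi (x : 'M[C]_m) : 'M[C]_m := vsval (vsproj U x).
have piH s : pi (H s) = H s by rewrite /pi vsprojK //; apply/UE; exists s.
(* A tensor whose slices are the [f (H s)] equals the sum of the [f (e_ab) (x) g_ab], which has the
   same slices. *)
have evE (f : {linear 'M[C]_m -> os_car S}) (w : Z) : (forall s, slice (evl s) w = f (H s)) ->
   ev Z w = \sum_a \sum_b (g a b (f (delta_mx a b)) : C).
  move=> hw; have -> : w = \sum_a \sum_b tn (f (delta_mx a b)) (g a b).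
    apply: slices_eq => s; rewrite hw linear_sum -(choi_mapE f); apply: eq_bigr => a _.
    by rewrite linear_sum; apply: eq_bigr => b _; rewrite slice_tn -gH.
  by rewrite linear_sum; apply: eq_bigr => a _; rewrite linear_sum; apply: eq_bigr => b _; rewrite ev_tn.
have phpl : linear (fun x => ph (vsproj U x)) by move=> a x z; rewrite linearP phl.
have y_ev : ev Z y = \sum_a \sum_b (g a b (ph (vsproj U (delta_mx a b))) : C).
  apply: (evE (mklin phpl)) => s /=; rewrite /ph; apply: wd; rewrite sgE -/(pi _) piH //.
rewrite leNgt; apply/negP => neg.
(* [c] bounds the effect on the pairing of an error of cb-norm one. The [e] below satisfies
   [e c < - Re (ev Z y)], which contradicts the positivity of the pairing with [psi]. *)
pose c := \sum_a \sum_b functional_norm (g a b) * (onorm (vsproj U (delta_mx a b) : os_car (ms_opsys Q)) + 1).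
have c0 : 0 <= c.
  apply: sumr_ge0 => a _; apply: sumr_ge0 => b _; rewrite mulr_ge0 ?functional_norm_ge0 //.
  by rewrite addr_ge0 ?onorm_ge0.
pose e := - Re (ev Z y) / (c + 1).
have c10 : 0 < c + 1 by rewrite ltr_wpDl.
have e0 : 0 < e by rewrite divr_gt0 // oppr_gt0.
have [psi cpsi psin] := H4 cph e0.
pose df (r : os_car (ms_opsys Q)) : os_car S := psi (vsval r) - ph r.
have dfl : linear df.
  move=> a r t; rewrite /df phl.
  have -> : psi (vsval (a *: r + t)) = a *: psi (vsval r) + psi (vsval t) by rewrite !linearP.
  by rewrite scalerBr opprD addrACA.
have dn := @cb_norm_apply (ms_opsys Q) S (mklin dfl) e (ltW e0) psin.
have psil : linear (fun x : 'M[C]_m => psi (pi x)) by move=> a x z; rewrite /pi !linearP.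
(* Both sides are [ev] of tensors having the same slices. *)
have E1 : \sum_a \sum_b (g a b (psi (delta_mx a b)) : C) = \sum_a \sum_b (g a b (psi (pi (delta_mx a b))) : C).
  pose w : Z := \sum_a \sum_b tn (psi (delta_mx a b)) (g a b).
  have wE s : slice (evl s) w = psi (H s).
    rewrite /w linear_sum -[in RHS](choi_mapE psi); apply: eq_bigr => a _.
    by rewrite linear_sum; apply: eq_bigr => b _; rewrite slice_tn -gH.
  rewrite -(evE psi w wE); apply: (evE (mklin psil)) => s /=.
  by rewrite wE piH.
have E2 : 0 <= \sum_a \sum_b (g a b (psi (delta_mx a b)) : C).
  have hc := choi_cone cpsi; move/(os_mconeP (S := S)): hc => hc.
  have := hg 'I_m _ (fun u a => (u == a)%:R) hc; congr (_ <= _).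
  apply: eq_bigr => u _; apply: eq_bigr => v _.
  rewrite (bigD1 u) //= [X in _ + X]big1 ?addr0 => [|a au]; last first.
    by rewrite big1 // => b _; rewrite eq_sym (negPf au) rmorph0 !mul0r.
  rewrite (bigD1 v) //= big1 ?addr0 => [|b bv]; last first.
    by rewrite [v == b]eq_sym (negPf bv) !(mulr0, mul0r).
  by rewrite !eqxx rmorph1 !mul1r.
have : `|\sum_a \sum_b (g a b (psi (pi (delta_mx a b))) : C) - ev Z y| <= (e * c)%:C%C.
  rewrite y_ev -sumrB; under eq_bigr do rewrite -sumrB.
  rewrite /c mulr_sumr rmorph_sum; apply: le_trans (ler_norm_sum _ _ _) _; apply: ler_sum => a _.
  rewrite mulr_sumr rmorph_sum; apply: le_trans (ler_norm_sum _ _ _) _; apply: ler_sum => b _.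
  have -> : (g a b (psi (pi (delta_mx a b))) : C) - g a b (ph (vsproj U (delta_mx a b))) =
     g a b (df (vsproj U (delta_mx a b))).
    by rewrite /df (raddfB (g a b)).
  apply: le_trans (functional_le _ _) _; rewrite lecR mulrC.
  rewrite mulrCA ler_wpM2l ?functional_norm_ge0 //; exact: dn.
rewrite -E1; set p := \sum_a _ in E2 *; move=> h.
have := le_trans (normc_ge_Re _) h; rewrite lecR raddfB /= => {}h.
have p0 : 0 <= Re p by rewrite -ler0c ge0_RRe.
have := le_trans (ler_norm _) h.
apply/negP; rewrite -ltNge; apply: lt_le_trans (_ : _ < - Re (ev Z y)) _; last by rewrite lerDr.
by rewrite /e mulrAC ltr_pdivrMr // ltr_pM2l ?oppr_gt0 // ltrDl.
Qed.
End Main.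
End Trace.

(** * From approximate extension to a weak expectation *)

Section Extension.
Variable R : realType.
Local Notation C := R[i].
Local Notation conjC := (@Num.conj C).
Local Notation Re := complex.Re.

Section FposOps.
Variable S : opsys R.
Local Notation F := (functional (os_nmospace S)).

Lemma functionalZ (f : F) (a : C) (x : os_car S) : (f (a *: x) : C) = a * (f x : C).
Proof.
have f0 : f 0 = 0 by exact: (linear0 (mklin (functional_linear f))).
by have := functional_linear f a x 0; rewrite addr0 f0 addr0.
Qed.

Lemma psd_scale (K : finType) (a : C) (M : K -> K -> C) : 0 <= a -> psd M ->
  psd (fun k l => a * M k l).
Proof.
move=> a0 hM c; have := mulr_ge0 a0 (hM c); congr (_ <= _).
rewrite mulr_sumr; apply: eq_bigr => k _; rewrite mulr_sumr; apply: eq_bigr => l _; ring.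
Qed.

Lemma eq_fpos (K : finType) (G G' : K -> K -> F) : (forall k l, G k l = G' k l) ->
  fpos G -> fpos G'.
Proof.
move=> e hG U s c hs; have := hG U s c hs; congr (_ <= _).
by do 4!(apply: eq_bigr => ? _); rewrite e.
Qed.

Lemma fpos_reindex (K L : finType) (h : L -> K) (G : K -> K -> F) : fpos G ->
  fpos (fun a b => G (h a) (h b)).
Proof.
move=> hG; apply: eq_fpos (fpos_compress (fun k l => (k == h l)%:R) hG) => a b.
rewrite (bigD1 (h a)) //= [X in _ + X]big1 ?addr0 => [|k kh]; last first.
  by rewrite big1 // => l _; rewrite (negPf kh) rmorph0 mul0r scale0r.
rewrite (bigD1 (h b)) //= big1 ?addr0 => [|l lh]; last first.
  by rewrite (negPf lh) mulr0 scale0r.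
by rewrite !eqxx rmorph1 mulr1 scale1r.
Qed.

Lemma fpos_add (K : finType) (G G' : K -> K -> F) : fpos G -> fpos G' ->
  fpos (fun a b => G a b + G' a b).
Proof.
move=> hG hG' U s c hs; have := addr_ge0 (hG U s c hs) (hG' U s c hs); congr (_ <= _).
rewrite -big_split; apply: eq_bigr => u _; rewrite -big_split; apply: eq_bigr => v _.
rewrite -big_split; apply: eq_bigr => a _; rewrite -big_split; apply: eq_bigr => b _ /=.
by rewrite -mulrDr.
Qed.

Lemma fpos_psd_scale (K : finType) (M : K -> K -> C) (f : F) : psd M -> fpos1 f ->
  fpos (fun a b => M a b *: f).
Proof.
move=> hM hf U s c hs.
have hN : psd (fun u v : unit * U => \sum_a \sum_b conjC (c u.2 a) * c v.2 b * M a b).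
  exact: (psd_reindex (fun u : unit * U => u.2) (psd_compress (fun a u => c u a) hM)).
have /(gcone_diag tt) /hf := gcone_schur hN hs; congr (_ <= _).
rewrite (linear_sum f); apply: eq_bigr => u _; rewrite (linear_sum f); apply: eq_bigr => v _ /=.
rewrite functionalZ mulr_suml; apply: eq_bigr => a _.
rewrite mulr_suml; apply: eq_bigr => b _.
exact: (esym (mulrA _ _ _)).
Qed.

Lemma fpos_sumtype (I J : finType) (X : I -> I -> F) (Y : J -> J -> F) :
  fpos X -> fpos Y -> fpos (fun a b : I + J => match a, b with
   | inl i, inl j => X i j | inr i, inr j => Y i j | _, _ => 0 end).
Proof.
move=> hX hY U s c hs.
have := addr_ge0 (hX U s (fun u a => c u (inl a)) hs) (hY U s (fun u a => c u (inr a)) hs).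
congr (_ <= _); rewrite -big_split; apply: eq_bigr => u _; rewrite -big_split.
apply: eq_bigr => v _; rewrite big_sumType /=; congr (_ + _).
  apply: eq_bigr => a _; rewrite big_sumType /= [X in _ = _ + X]big1 ?addr0 // => b _.
  exact: mulr0.
apply: eq_bigr => a _; rewrite big_sumType /= [X in _ = X + _]big1 ?add0r // => b _.
exact: mulr0.
Qed.

Lemma functional_cone_fpos m (G : 'M[F]_m) :
  @functional_cone R (os_nmospace S) m G -> fpos (fun a b => G a b).
Proof.
move=> hG U s c /(os_mconeP (S := S)) hs.
have := cp_mcone hG hs; move/(os_mconeP (S := matn R m))/gcone_matn.
move/(_ (fun x => c x.1 x.2)); congr (_ <= _); rewrite !sum_prod /=.
apply: eq_bigr => u _; under eq_bigr do rewrite sum_prod.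
rewrite exchange_big /=; apply: eq_bigr => v _.
by apply: eq_bigr => a _; apply: eq_bigr => b _; rewrite mxE mulrAC.
Qed.
End FposOps.

Section Main.
Variables (S I : opsys R) (kappa : {linear os_car S -> os_car I}).
Hypothesis kco : @co_embedding R S I kappa.
Hypothesis H4 : forall n (P : matrix_system R n) (phi : {linear ms_opsys P -> S}), cp phi ->
    forall e : R, 0 < e ->
    exists2 psi : {linear matn R n -> S}, cp psi &
      (cb_norm (fun x : ms_opsys P => (psi (vsval x) - phi x)%R : S) <= e%:E)%E.
Local Notation F := (functional (os_nmospace S)).
Variables (Z : tprod (os_car S) F) (Z' : tprod (os_car I) F).

(** Up to boundedness, a functional that is nonnegative on this cone is a cp map from [I] to the
    bidual of [S]. *)
Definition pairing_cone (w : Z') := exists (K : finType) (P : K -> K -> os_car I) (G : K -> K -> F),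
  [/\ gcone P, fpos G & w = \sum_k \sum_l tn (P k l) (G k l)].

Lemma ev_strict_ge0_fin (K : finType) (P : K -> K -> os_car I) (G : K -> K -> F) (y : Z) (d : R) :
  0 < d -> gcone P -> fpos G ->
  psd (fun k l => (G k l (os_one S) : C) - d%:C%C * (k == l)%:R) ->
  mapl Z Z' kappa y = \sum_k \sum_l tn (P k l) (G k l) -> 0 <= Re (ev Z y).
Proof.
move=> d0 hP hG hd yE.
apply: (ev_strict_ge0 kco H4 d0 (gcone_reindex (fun i : 'I_#|K| => enum_val i) hP)
   (fpos_reindex (fun i : 'I_#|K| => enum_val i) hG) _ (Z' := Z')).
  apply: eq_psd (psd_reindex (fun i : 'I_#|K| => enum_val i) hd) => i j.
  by rewrite (inj_eq enum_val_inj).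
rewrite yE [RHS]sum_enum_rank; apply: eq_bigr => k _.
by rewrite [RHS]sum_enum_rank; apply: eq_bigr => l _; rewrite !enum_rankK.
Qed.

Lemma exists_state : (exists2 t : F, fpos1 t & 0 < Re (t (os_one S) : C)) \/ forall s : os_car S, s = 0.
Proof.
have [[v v0]|h] := pselect (exists v : os_hilb S, v != 0); [left|right].
  pose g : {linear os_car S -> C^o} := mklin (@vector_functional_linear R S v v).
  have gp x : os_pos x -> 0 <= (g x : C) by move=> hx; exact: hx.
  exists (Functional (pos_bounded gp)); first exact: gp.
  rewrite /= /vector_functional os_act_one.
  have : 0 < h_dot (os_hilb S) v v by rewrite lt_def dot_eq0 v0 dot_ge0.
  by rewrite -{1}(ge0_RRe (dot_ge0 v)) ltcR.
move=> s; apply: os_act_inj => v; apply/eqP/negP => /negP sv; apply: h.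
by exists (os_act S s v).
Qed.

Lemma ev_ge0 (y : Z) : pairing_cone (mapl Z Z' kappa y) -> 0 <= Re (ev Z y).
Proof.
move=> [K [P [G [hP hG yE]]]].
have [[t tp t0]|S0] := exists_state; last first.
  have [m [a [b ->]]] := tn_spanned y.
  rewrite linear_sum big1 ?raddf0 // => l _.
  by rewrite (S0 (a l)) tn0l linear0.
pose p := \sum_k P k k.
have pp : os_pos p.
  apply: (gcone_diag tt (X := fun _ _ : unit => p)).
  apply: (gcone_sum (X := fun k _ _ => P k k)) => k.
  exact: (gcone_reindex (fun _ : unit => k) hP).
pose c := onorm p.
have [hc _] := herm_le_onorm (os_pos_herm pp).
have k1 : kappa (os_one S) = os_one I by case: kco.
pose st := Re (t (os_one S) : C).
have tE : (t (os_one S) : C) = st%:C%C by rewrite /st ge0_RRe //; apply: tp; exact: os_pos_one.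
(* Adding a multiple of [1 (x) t] to [y] makes [G] strictly positive at the unit. *)
have key (d : R) : 0 < d -> 0 <= Re (ev Z y) + d * c * st.
  move=> d0; pose y' := y + (d * c)%:C%C *: tn (os_one S) t.
  have -> : Re (ev Z y) + d * c * st = Re (ev Z y').
    rewrite /y' linearD linearZ ev_tn tE raddfD; congr (_ + _).
    rewrite -[d * c * st]/(Re (d * c * st)%:C%C) rmorphM; congr (Re _).
  pose U := (K + unit)%type.
  (* Raising the diagonal of [G] by [d t] adds [p (x) d t], which need not come from [S]; the corner
     [c - p], paired with [d t], completes it to [d c (1 (x) t)]. *)
  pose P' (a b : U) : os_car I := match a, b with | inl i, inl j => P i j
    | inr _, inr _ => c%:C%C *: os_one I - p | _, _ => 0 end.
  pose G' (a b : U) : F := match a, b with | inl i, inl j => G i j | inr _, inr _ => 0 | _, _ => 0 end.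
  have hG' : fpos G'.
    apply: (fpos_sumtype hG (Y := fun _ _ : unit => 0)) => V s e _.
    by rewrite big1 // => u _; rewrite big1 // => v _; rewrite big1 // => a _; rewrite big1 // => b _; rewrite mulr0.
  apply: (@ev_strict_ge0_fin _ P' (fun a b => G' a b + (d%:C%C * (a == b)%:R) *: t) y' (d * st)).
      by rewrite mulr_gt0.
    apply: gcone_sumtype => //; apply: (gcone_reindex (fun _ : unit => ord0) (os_posP hc)).
    apply: fpos_add => //; apply: fpos_psd_scale => //.
    by apply: psd_scale; [rewrite ler0c ltW|exact: psd_id].
    apply: eq_psd (fpos_psd hG' (@os_pos_one _ S)) => a b.
    rewrite -[X in _ = X - _]/((G' a b (os_one S) : C) + (d%:C%C * (a == b)%:R) * (t (os_one S) : C)).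
    by rewrite tE rmorphM /=; ring.
  rewrite /y' linearD linearZ mapl_tn k1 yE big_sumType /=.
  have -> : \sum_(k : K) \sum_(l : U) (tn (P' (inl k) l) (G' (inl k) l + (d%:C%C * (inl k == l)%:R) *: t) : Z') =
     \sum_k \sum_l tn (P k l) (G k l) + d%:C%C *: tn p t.
    rewrite tn_suml scaler_sumr -big_split; apply: eq_bigr => k _.
    rewrite big_sumType /= [X in _ + X]big1 ?addr0 => [|l _]; last by rewrite tn0l.
    under eq_bigr do rewrite tnDr tnZr; rewrite big_split /=; congr (_ + _).
    rewrite (bigD1 k) //= big1 ?addr0 ?eqxx ?mulr1 // => l lk.
    have -> : (inl k == inl l :> U) = false by apply/eqP => -[e]; rewrite e eqxx in lk.
    by rewrite mulr0 scale0r.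
  have bu (g : unit -> Z') : \sum_u g u = g tt by rewrite (bigD1 tt) //= big1 ?addr0 // => -[].
  rewrite bu big_sumType /= [X in _ + (X + _)]big1 ?add0r => [|l _]; last by rewrite tn0l.
  rewrite bu tnZr mulr1 tnBl tnZl scalerBr scalerA -addrA; congr (_ + _).
  by rewrite [RHS]addrC subrK -rmorphM.
have [c0 s0] : 0 <= c /\ 0 <= st by split; [exact: onorm_ge0|exact: ltW].
apply/ler_addgt0Pr => e e0; have cs0 : 0 < c * st + 1 by rewrite ltr_wpDl ?mulr_ge0.
apply: le_trans (key (e / (c * st + 1)) _) _; first by rewrite divr_gt0.
rewrite lerD2l -mulrA mulrAC ler_pdivrMr // ler_wpM2l ?lerDl // ltW //.
Qed.

Local Notation tI := (@tstar R _ _ Z' _ _ (@os_star_conj R I) (@fstar_conj R S)).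
Local Notation tS := (@tstar R _ _ Z _ _ (@os_star_conj R S) (@fstar_conj R S)).

Lemma tI_conj : conj_linear tI. Proof. exact: tstar_conj. Qed.
Lemma tS_conj : conj_linear tS. Proof. exact: tstar_conj. Qed.

Lemma pairing_coneD w w' : pairing_cone w -> pairing_cone w' -> pairing_cone (w + w').
Proof.
move=> [K [P [G [hP hG ->]]]] [K' [P' [G' [hP' hG' ->]]]].
exists (K + K')%type.
exists (fun a b => match a, b with | inl i, inl j => P i j | inr i, inr j => P' i j | _, _ => 0 end).
exists (fun a b => match a, b with | inl i, inl j => G i j | inr i, inr j => G' i j | _, _ => 0 end).
split; [exact: gcone_sumtype|exact: fpos_sumtype|].
rewrite big_sumType /=; congr (_ + _); apply: eq_bigr => k _; rewrite big_sumType /=.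
  by rewrite [X in _ = _ + X]big1 ?addr0 // => l _; rewrite tn0l.
by rewrite [X in _ = X + _]big1 ?add0r // => l _; rewrite tn0l.
Qed.

Lemma pairing_coneZ (r : R) w : 0 <= r -> pairing_cone w -> pairing_cone (r%:C%C *: w).
Proof.
move=> r0 [K [P [G [hP hG ->]]]]; exists K, (fun k l => r%:C%C *: P k l), G.
split=> //; first by apply: gcone_scale; rewrite ?ler0c.
rewrite scaler_sumr; apply: eq_bigr => k _; rewrite scaler_sumr.
by apply: eq_bigr => l _; rewrite tnZl.
Qed.

Lemma pairing_cone_tn b f : os_pos b -> fpos1 f -> pairing_cone (tn b f : Z').
Proof.
move=> hb hf; exists 'I_1, (fun _ _ => b), (fun k l => (k == l)%:R *: f).
split; [exact: os_posP|apply: fpos_psd_scale => //; exact: psd_id|].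
by rewrite !big_ord1 eqxx scale1r.
Qed.

Lemma pairing_cone0 : pairing_cone 0.
Proof. by rewrite -(tn0l Z' 0); apply: pairing_cone_tn; [exact: os_pos0|move=> s _]. Qed.

Lemma pairing_cone_herm w : pairing_cone w -> tI w = w.
Proof.
move=> [K [P [G [hP hG ->]]]].
rewrite (conj_linear_sum tI_conj); under eq_bigr do rewrite (conj_linear_sum tI_conj).
rewrite exchange_big; apply: eq_bigr => k _; apply: eq_bigr => l _.
rewrite tstar_tn (gcone_herm hP); congr tn; apply: functional_eqP => s /=.
by rewrite (fpos_star hG) conjCK.
Qed.

(** The cone enlarged by all skew-hermitian tensors, as Krein's theorem controls real parts only. *)
Definition pairing_real (w : Z') := pairing_cone (w + tI w).

Lemma pairing_real_convex : convex_cone pairing_real.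
Proof.
have cj := tI_conj.
split=> [|x y hx hy|r x r0 hx]; rewrite /pairing_real.
  by rewrite (conj_linear0 cj) addr0; exact: pairing_cone0.
  by rewrite (conj_linearD cj) addrACA; exact: pairing_coneD.
by rewrite (conj_linearZ cj) conjCR -scalerDr; exact: pairing_coneZ.
Qed.

Lemma pairing_cone_real w : pairing_cone w -> pairing_real w.
Proof. by move=> h; rewrite /pairing_real (pairing_cone_herm h); exact: pairing_coneD. Qed.

Lemma pairing_real_skew w : tI w = w -> forall c, conjC c = - c -> pairing_real (c *: w).
Proof.
move=> h c hc; have cj := tI_conj.
by rewrite /pairing_real (conj_linearZ cj) h hc scaleNr subrr; exact: pairing_cone0.
Qed.

Lemma kappa_one : kappa (os_one S) = os_one I.
Proof. by case: kco. Qed.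

Lemma kappa_cp : @cp R S I kappa.
Proof. by move=> n X; case: kco => _ _ ->. Qed.

(** For hermitian [b] and positive [g], [b (x) g <= |b| 1 (x) g], which comes from [S]. Hermitian
    functionals are differences of positive ones by [jordan_decomposition], and the cross terms with
    a factor [i] are skew-hermitian. *)
Lemma pairing_majorized (v : Z') : exists l : Z, pairing_real (mapl Z Z' kappa l - v).
Proof.
have [K0 KD _] := pairing_real_convex.
pose M (v : Z') := exists l : Z, pairing_real (mapl Z Z' kappa l - v).
have MD x y : M x -> M y -> M (x + y).
  by move=> [l hl] [m hm]; exists (l + m); rewrite linearD opprD addrACA; exact: KD.
have Mp b g : os_star b = b -> fpos1 g -> M (tn b g) /\ M (- tn b g).
  move=> hb hg; have [h1 h2] := herm_le_onorm hb.
  split; exists ((onorm b)%:C%C *: tn (os_one S) g); rewrite linearZ /= mapl_tn kappa_one -tnZl;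
    rewrite ?opprK -?tnBl -?tnDl; exact/pairing_cone_real/pairing_cone_tn.
have Mh b f : os_star b = b -> fstar f = f -> M (tn b f) /\ M (- tn b f).
  move=> hb hf.
  have [|g [h [hg hh fE _]]] := jordan_decomposition (f := f).
    by move=> s; rewrite -{1}hf /= os_starK.
  have -> : tn b f = tn b g - tn b h :> Z'.
    by rewrite -tnBr; congr tn; apply: functional_eqP => s; rewrite fE.
  have [g1 g2] := Mp b g hb hg; have [k1 k2] := Mp b h hb hh.
  by split; rewrite ?opprB ?[- _ + _]addrC; apply: MD => //; rewrite ?opprK.
have Mi b f (c : C) : os_star b = b -> fstar f = f -> conjC c = - c -> M (c *: tn b f).
  move=> hb hf hc; exists 0; rewrite linear0 sub0r -scaleNr.
  apply: pairing_real_skew; first by rewrite tstar_tn hb hf.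
  by rewrite rmorphN; congr (- _).
have ci : conjC 'i = - 'i :> C by exact: conjCi.
apply: (tp_ind (P := M)) v => //; first by exists 0; rewrite linear0 subr0.
move=> b f; have [h [k [hh hk -> _ _]]] := herm_parts b.
have [f1 [f2 [hf1 hf2 -> _ _]]] := functional_parts f.
rewrite tnDl !tnDr !tnZl !tnZr scalerA -expr2 sqrCi scaleN1r.
apply: (MD); apply: (MD).
  by have [] := Mh h f1 hh hf1.
  exact: Mi.
  exact: Mi.
by have [] := Mh k f2 hk hf2.
Qed.

Lemma mapl_star (l : Z) : mapl Z Z' kappa (tS l) = tI (mapl Z Z' kappa l).
Proof.
have cS := tS_conj.
have cI := tI_conj.
move: l; apply: tp_ind => [|x y hx hy|a b].
  by rewrite (conj_linear0 cS) !linear0 (conj_linear0 cI).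
  by rewrite (conj_linearD cS) !linearD (conj_linearD cI) hx hy.
by rewrite tstar_tn !mapl_tn tstar_tn (cp_star kappa_cp).
Qed.

Lemma ev_star (l : Z) : (ev Z (tS l) : C) = conjC (ev Z l : C).
Proof.
have cS := tS_conj.
move: l; apply: tp_ind => [|x y hx hy|a b].
  by rewrite (conj_linear0 cS) linear0 rmorph0.
  by rewrite (conj_linearD cS) !linearD rmorphD hx hy.
by rewrite tstar_tn !ev_tn /= os_starK.
Qed.

Lemma ev_pairing_real (l : Z) : pairing_real (mapl Z Z' kappa l) -> 0 <= Re (ev Z l).
Proof.
rewrite /pairing_real -mapl_star -linearD => /ev_ge0; rewrite linearD raddfD ev_star /=.
have -> : Re (conjC (ev Z l : C)) = Re (ev Z l) by case: (ev Z l).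
by rewrite -mulr2n pmulrn_lge0.
Qed.

Theorem wep_of_extension : wep kappa.
Proof.
have [f [fpos fE]] := krein_extension pairing_real_convex ev_pairing_real pairing_majorized.
have f_ge0 w : pairing_cone w -> 0 <= (f w : C).
  move=> hw; apply: (linear_ge0 fpos); first exact: pairing_cone_real.
    by apply: pairing_real_skew (pairing_cone_herm hw) _ (conjCi _).
  apply: pairing_real_skew; [exact: pairing_cone_herm|rewrite rmorphN; congr (- _); exact: conjCi].
have fk s g : f (tn (kappa s) g) = g s by rewrite -(mapl_tn Z) fE ev_tn.
have f1 g : f (tn (os_one I) g) = g (os_one S) by rewrite -kappa_one fk.
(* The extension [f] is only algebraic. For positive [x] and hermitian [g = p - q], the value at
   [x (x) g] is at most [|x| (p 1 + q 1)], and this is [|x| |g|] by the norm identity of the Jordan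
   decomposition. *)
have bd b : exists M : R, forall g : F, `|f (tn b g) : C| <= (M * functional_norm g)%:C%C.
  have bd_herm x g : os_pos x -> fstar g = g ->
      `|f (tn x g) : C| <= (onorm x * functional_norm g)%:C%C.
    move=> hx hg.
    have [|p [q [hp hq gE pq]]] := jordan_decomposition (f := g).
      by move=> s; rewrite -{1}hg /= os_starK.
    have -> : g = p - q by apply: functional_eqP => s; rewrite gE.
    have -> : functional_norm (p - q) = functional_norm g.
      by congr functional_norm; apply: functional_eqP => s; rewrite gE.
    rewrite tnBr linearB; apply: le_trans (ler_normB _ _) _.
    have [hx' _] := herm_le_onorm (os_pos_herm hx).
    rewrite !ger0_norm; try exact/f_ge0/pairing_cone_tn.
    have := f_ge0 _ (pairing_coneD (pairing_cone_tn hx' hp) (pairing_cone_tn hx' hq)).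
    rewrite -tnDr tnBl tnZl linearB linearZ f1 subr_ge0 tnDr linearD.
    have -> // : (onorm x * functional_norm g)%:C%C = (onorm x)%:C%C * ((p (os_one S) : C) + q (os_one S)) :> C.
    by rewrite rmorphM pq.
  move: b; apply: os_pos_ind => [a x y [M hM] [N hN]|x hx].
    exists (Re `|a| * M + N) => g; rewrite tnDl tnZl linearP.
    apply: le_trans (ler_normD _ _) _; rewrite mulrDl rmorphD lerD //.
    have -> : `|a *: f (tn x g)| = `|a| * `|f (tn x g) : C| by exact: normrM.
    apply: le_trans (ler_wpM2l (normr_ge0 a) (hM g)) _.
    rewrite -{1}(ge0_RRe (normr_ge0 a)) -rmorphM mulrA; exact: lexx.
  exists (onorm x + onorm x) => g; have [g1 [g2 [h1 h2 -> n1 n2]]] := functional_parts g.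
  rewrite tnDr tnZr linearD linearZ; apply: le_trans (ler_normD _ _) _.
  rewrite mulrDl rmorphD lerD //.
    by apply: le_trans (bd_herm _ _ hx h1) _; rewrite lecR ler_wpM2l ?onorm_ge0.
  have eN : `|'i * f (tn x g2) : C| = `|f (tn x g2) : C| by rewrite normrM normCi mul1r.
  apply: le_trans (_ : `|f (tn x g2) : C| <= _); first by rewrite -eN.
  by apply: le_trans (bd_herm _ _ hx h2) _; rewrite lecR ler_wpM2l ?onorm_ge0.
have lin b : linear (fun g : dual (os_nmospace S) => f (tn b (g : F)) : C^o).
  by move=> a g h; rewrite tnDr tnZr linearP.
have bdd b : (fun g : dual (os_nmospace S) => f (tn b (g : F)) : C^o) \in @bounded_functional R (dual (os_nmospace S)).
  by apply/asboolP; split; [exact: lin|exact: bd].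
pose Phi (b : os_car I) : functional (dual (os_nmospace S)) := Functional (bdd b).
have Pl : linear Phi.
  move=> a x y; apply: val_inj; apply/funext => g /=.
  by rewrite tnDl tnZl linearP.
exists (mklin Pl : {linear I -> bidual S}); last first.
  by move=> s; apply: val_inj; apply/funext => g; exact: fk.
split; last by apply: val_inj; apply/funext => g; exact: f1.
move=> n X /(mo_cone_os (S := I)) hX m G hG.
apply/mo_cone_matn => c.
have hG' := functional_cone_fpos hG.
(* The test vector [c] is moved to the first leg, where it compresses the positive matrix [X]. *)
have /f_ge0 : pairing_cone (\sum_u \sum_v
    tn (\sum_a \sum_b (conjC (c (u, a)) * c (v, b)) *: X a b) (G u v)).
  exists 'I_m, (fun u v => \sum_a \sum_b (conjC (c (u, a)) * c (v, b)) *: X a b), (fun u v => G u v).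
  split=> // xi; have := hX (fun a => \sum_u c (u, a) *: xi u); congr (_ <= _).
  transitivity (\sum_a \sum_b \sum_u \sum_v
      (conjC (c (u, a)) * c (v, b)) * h_dot _ (os_act _ (X a b) (xi v)) (xi u)).
    apply: eq_bigr => a _; apply: eq_bigr => b _; rewrite act_sumr dot_sumr; apply: eq_bigr => u _.
    rewrite dot_suml; apply: eq_bigr => v _; rewrite actZr dotZl dotZr; ring.
  rewrite exchange_big22; apply: eq_bigr => u _; apply: eq_bigr => v _.
  rewrite act_suml dot_suml; apply: eq_bigr => a _; rewrite act_suml dot_suml; apply: eq_bigr => b _.
  by rewrite actZl dotZl.
congr (_ <= _); rewrite linear_sum sum_prod; apply: eq_bigr => u _.
rewrite linear_sum; under [RHS]eq_bigr do rewrite sum_prod; rewrite [RHS]exchange_big.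
apply: eq_bigr => v _; rewrite tn_suml linear_sum; apply: eq_bigr => a _.
rewrite tn_suml linear_sum; apply: eq_bigr => b _.
by rewrite tnZl linearZ !mxE /= mulrAC.
Qed.
End Main.
End Extension.

(** * Faithful functionals annihilating a null-subspace *)

Section Faithful.
Variable R : realType.
Local Notation C := R[i].
Local Notation conjC := (@Num.conj C).
Local Notation Re := complex.Re.

Lemma os_pos_matn n (x : 'M[C]_n) : @os_pos R (matn R n) x <-> psd (fun a b => x a b).
Proof.
split=> [h|h].
  exact: (psd_reindex (fun a => (ord0, a)) (proj1 (gcone_matn _) (os_posP h))).
apply: (gcone_diag ord0 (X := fun _ _ : 'I_1 => x : os_car (matn R n))).
by apply/(gcone_matn (I := 'I_1)); exact: (psd_reindex (fun u : 'I_1 * 'I_n => u.2) h).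
Qed.

Lemma os_star_matn n (x : 'M[C]_n) : @os_star R (matn R n) x = (x ^t conjC)%sesqui.
Proof. by apply: os_star_uniq => v w; exact: cdot_adj. Qed.

Definition pd n (D : 'M[C]_n) := exists2 mu : R, 0 < mu &
  psd (fun a b => D a b - mu%:C%C * (a == b)%:R).

Section Pd.
Variable n : nat.
Implicit Types D x : 'M[C]_n.

Lemma psd_add (N : finType) (M M' : N -> N -> C) : psd M -> psd M' -> psd (fun a b => M a b + M' a b).
Proof.
move=> h h' c; have := addr_ge0 (h c) (h' c); congr (_ <= _).
rewrite -big_split; apply: eq_bigr => a _; rewrite -big_split; apply: eq_bigr => b _ /=; ring.
Qed.

Lemma pd_psd D : pd D -> psd (fun a b => D a b).
Proof.
move=> [mu mu0 h]; apply: eq_psd (psd_add h (psd_scale (a := mu%:C%C) _ (@psd_id R _))) => [a b|].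
  by rewrite subrK.
by rewrite ler0c ltW.
Qed.

Lemma pd_add_psd D x : pd D -> psd (fun a b => x a b) -> pd (D + x).
Proof.
move=> [mu mu0 h] hx; exists mu => //; apply: eq_psd (psd_add h hx) => a b.
by rewrite !mxE addrAC.
Qed.

Lemma pd_scale (r : R) D : 0 < r -> pd D -> pd (r%:C%C *: D).
Proof.
move=> r0 [mu mu0 h]; exists (r * mu); first exact: mulr_gt0.
apply: eq_psd (psd_scale (a := r%:C%C) _ h) => [a b|]; last by rewrite ler0c ltW.
by rewrite !mxE rmorphM /=; ring.
Qed.

Lemma psd_adj x : psd (fun a b => x a b) -> (x ^t conjC)%sesqui = x.
Proof. by move=> h; apply/matrixP => a b; rewrite !mxE -(psd_herm h). Qed.

Lemma mxpair0 x : mxpair 0 x = 0.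
Proof. by rewrite /mxpair big1 // => a _; rewrite big1 // => b _; rewrite mxE mul0r. Qed.

Lemma psd0 (N : finType) : psd (fun _ _ : N => 0 : C).
Proof. by move=> c; rewrite big1 // => a _; rewrite big1 // => b _; rewrite mulr0 mul0r. Qed.

Lemma mxpairPl (r s x : 'M[C]_n) a : mxpair (a *: r + s) x = a * mxpair r x + mxpair s x.
Proof. by rewrite mxpairC mxpairPr !(mxpairC x). Qed.

Lemma mxpairZr D x a : mxpair D (a *: x) = a * mxpair D x.
Proof. by rewrite -[_ *: _]addr0 mxpairPr [mxpair D 0]mxpairC mxpair0 addr0. Qed.

Lemma mxpairDr D x y : mxpair D (x + y) = mxpair D x + mxpair D y.
Proof. by rewrite -[x]scale1r mxpairPr mxpairZr. Qed.

Lemma adjP (a : C) (x y : 'M[C]_n) :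
  ((a *: x + y) ^t conjC)%sesqui = conjC a *: (x ^t conjC)%sesqui + (y ^t conjC)%sesqui.
Proof. by apply/matrixP => i j; rewrite !mxE rmorphD rmorphM. Qed.

Lemma mxpair_adjl (l j : 'M[C]_n) : (j ^t conjC)%sesqui = j ->
  mxpair (l ^t conjC)%sesqui j = conjC (mxpair l j).
Proof. by move=> hj; rewrite -[in LHS]hj mxpair_star trmxCK. Qed.

Lemma herm_majorized_pd D x : pd D -> (x ^t conjC)%sesqui = x ->
  exists2 c : R, 0 <= c & psd (fun a b => (c%:C%C *: D - x) a b).
Proof.
move=> [mu mu0 hD] hx; have [|h _] := @herm_le_onorm R (matn R n) x.
  by rewrite os_star_matn.
move/os_pos_matn in h; set r := onorm _ in h.
have r0 : 0 <= r by exact: onorm_ge0.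
exists (r / mu); first by rewrite divr_ge0 // ltW.
apply: eq_psd (psd_add (psd_scale (a := (r / mu)%:C%C) _ hD) h) => [a b|]; last by rewrite ler0c divr_ge0 // ltW.
rewrite -[os_one _]/(1%:M : 'M[C]_n) !mxE mulrBr mulrA -rmorphM divfK ?(gt_eqF mu0) //; ring.
Qed.
End Pd.

Lemma psd_rank1 (N : finType) (c : N -> C) : psd (fun a b => conjC (c a) * c b).
Proof.
move=> d; have := mul_conjC_ge0 (\sum_a conjC (d a) * conjC (c a)); congr (_ <= _).
rewrite rmorph_sum mulr_suml; apply: eq_bigr => a _; rewrite mulr_sumr; apply: eq_bigr => b _.
by rewrite rmorphM /= !conjCK; ring.
Qed.

Section Functional.
Variables (N : nat) (f : {linear 'M[C]_N -> C^o}).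
Let x0 : 'M[C]_N := \matrix_(a, b) (f (delta_mx a b) : C).

Lemma functional_mxpair x : f x = mxpair x0 x.
Proof.
rewrite {1}[x]matrix_sum_delta linear_sum; apply: eq_bigr => a _.
by rewrite linear_sum; apply: eq_bigr => b _; rewrite linearZ mxE mulrC.
Qed.

(** Test [f] at the rank one matrices with entries [conj(c_a) c_b]. *)
Lemma functional_psd : (forall x : 'M[C]_N, psd (fun a b => x a b) -> 0 <= (f x : C)) ->
  psd (fun a b => x0 a b).
Proof.
move=> h c; pose X : 'M[C]_N := \matrix_(a, b) (conjC (c a) * c b).
have hX : psd (fun a b => X a b) by apply: eq_psd (psd_rank1 c) => a b; rewrite mxE.
have := h X hX; rewrite functional_mxpair; congr (_ <= _); apply: eq_bigr => a _.
by apply: eq_bigr => b _; rewrite [X a b]mxE; ring.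
Qed.
End Functional.

Section Step.
Variables (n : nat) (hs : seq 'M[C]_n) (j D' : 'M[C]_n).
Hypothesis hs_herm : forall h, h \in hs -> (h ^t conjC)%sesqui = h.
Hypothesis j_herm : (j ^t conjC)%sesqui = j.
Hypothesis null : forall (x : 'M[C]_n) a, psd (fun i k => x i k) -> x - a *: j \in (span hs : {vspace 'M[C]_n}) -> x = 0.
Hypothesis D'_pd : pd D'.
Hypothesis D'_hs : forall h, h \in hs -> mxpair D' h = 0.
Hypothesis D'_j : 0 < Re (mxpair D' j).

Let real D : (D ^t conjC)%sesqui = D -> mxpair D j = (Re (mxpair D j))%:C%C.
Proof.
move=> hD; have /esym := mxpair_adjl D j_herm; rewrite hD.
by move/CrealP/RRe_real.
Qed.

Lemma faithful_step : exists2 D, pd D &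
  mxpair D j = 0 /\ forall h, h \in hs -> mxpair D h = 0.
Proof.
(* Otherwise the pairing with [j] is positive on the positive definite elements of the
   annihilator of [hs]. By Krein it extends to the pairing with some positive [x0], and
   then [x0 - j] is in the span of [hs]. *)
apply: contrapT => no.
(* A positive definite [D] in the annihilator with pairing [q <= 0] could be combined with [D'],
   whose pairing [p] is positive, into one that annihilates [j] as well. *)
have pos D : pd D -> (forall h, h \in hs -> mxpair D h = 0) -> 0 < Re (mxpair D j).
  move=> pD hD; rewrite ltNge le_eqVlt; apply/negP => /orP[/eqP D0|D0]; apply: no.
    by exists D => //; split=> //; rewrite real ?D0 // psd_adj //; exact: pd_psd.
  set q := Re (mxpair D j) in D0; pose p := Re (mxpair D' j); have p0 : 0 < p by [].
  exists ((- q)%:C%C *: D' + p%:C%C *: D).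
    apply: pd_add_psd; first by apply: pd_scale => //; rewrite oppr_gt0.
    by apply: pd_psd; apply: pd_scale.
  have DD x : mxpair ((- q)%:C%C *: D' + p%:C%C *: D) x = (- q)%:C%C * mxpair D' x + p%:C%C * mxpair D x.
    by rewrite mxpairPl -[_ *: D]addr0 mxpairPl mxpair0 addr0.
  split=> [|h hh]; rewrite DD.
    have E (x y z t : R) : x%:C%C * y%:C%C + z%:C%C * t%:C%C = (x * y + z * t)%:C%C :> C.
      by rewrite rmorphD !rmorphM.
    rewrite (real (psd_adj (pd_psd D'_pd))) (real (psd_adj (pd_psd pD))) -/p -/q E.
    by rewrite mulNr mulrC addNr.
  by rewrite D'_hs // hD // !mulr0 addr0.
have [U UE] := vspace_of_pred (Q := fun l : 'M[C]_n => forall h, h \in hs -> mxpair l h = 0)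
  (fun h hh => mxpair0 h)
  (fun a x y hx hy h hh => etrans (mxpairPl x y h a) (etrans (congr2 (fun u v => a * u + v) (hx h hh) (hy h hh)) (etrans (addr0 _) (mulr0 a)))).
pose K (x : 'M[C]_n) := psd (fun a b => (x + (x ^t conjC)%sesqui) a b).
have adjD (x y : 'M[C]_n) : ((x + y) ^t conjC)%sesqui = (x ^t conjC)%sesqui + (y ^t conjC)%sesqui.
  by have := adjP 1 x y; rewrite !scale1r rmorph1 scale1r.
have adjZ a (x : 'M[C]_n) : ((a *: x) ^t conjC)%sesqui = conjC a *: (x ^t conjC)%sesqui.
  by apply/matrixP => i k; rewrite !mxE rmorphM.
have Kc : convex_cone K.
  split=> [|x y hx hy|r x r0 hx]; rewrite /K.
    move=> c; rewrite big1 // => a _; rewrite big1 // => b _.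
    by rewrite !mxE rmorph0 addr0 mulr0 mul0r.
    by apply: eq_psd (psd_add hx hy) => a b; rewrite adjD !mxE addrACA.
  apply: eq_psd (psd_scale (a := r%:C%C) _ hx) => [a b|]; last by rewrite ler0c.
  by rewrite adjZ conjCR -scalerDr !mxE.
pose iota : {linear subvs_of U -> 'M[C]_n} := vsval.
have f0l : linear (fun l : subvs_of U => mxpair (iota l) j : C^o).
  by move=> a x y; rewrite linearP mxpairPl.
have adjB (x y : 'M[C]_n) : ((x - y) ^t conjC)%sesqui = (x ^t conjC)%sesqui - (y ^t conjC)%sesqui.
  by apply/matrixP => i k; rewrite !mxE rmorphB.
have Re2 l : mxpair (l + (l ^t conjC)%sesqui) j = (Re (mxpair l j) *+ 2)%:C%C.
  rewrite -[l]scale1r mxpairPl mxpairC -(mxpairC l) scale1r mul1r mxpair_adjl //.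
  by rewrite mulr2n; case: (mxpair l j) => a b; apply/eqP; rewrite eq_complex /= addrN !eqxx.
have fpos l : K (iota l) -> 0 <= Re (mklin f0l l : C).
  move=> hl; rewrite leNgt; apply/negP => neg; set x := iota l in hl.
  have xU : forall h, h \in hs -> mxpair x h = 0 by apply/UE; exact: subvsP.
  set t := Re _ in neg; set p := Re (mxpair D' j).
  have p0 : 0 < p by [].
  (* The sum of [x] and its adjoint is positive but perhaps not definite. This multiple of [D']
     makes it definite and brings the pairing with [j] to [- t + 2 t = t < 0]. *)
  have e0 : 0 < - t / p by rewrite divr_gt0 // oppr_gt0.
  have := pos ((- t / p)%:C%C *: D' + (x + (x ^t conjC)%sesqui)).
  rewrite mxpairPl Re2 (real (psd_adj (pd_psd D'_pd))) -/p -/t => /(_ _ _) hp.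
  have /hp : pd ((- t / p)%:C%C *: D' + (x + (x ^t conjC)%sesqui)).
    by apply: pd_add_psd => //; exact: pd_scale.
  have -> : (- t / p)%:C%C * p%:C%C + (t *+ 2)%:C%C = t%:C%C :> C.
    by rewrite -rmorphM -rmorphD divfK ?gt_eqF // mulr2n addKr.
  move=> h; suff /h /lt_trans/(_ neg) : forall k, k \in hs -> mxpair ((- t / p)%:C%C *: D' + (x + (x ^t conjC)%sesqui)) k = 0.
    by rewrite ltxx.
  move=> k hk.
  rewrite mxpairPl D'_hs // mulr0 add0r -[x]scale1r mxpairPl scale1r xU // mulr0 add0r.
  by rewrite mxpair_adjl ?hs_herm // xU // rmorph0.
have maj v : exists l, K (iota l - v).
  have [|c c0 hc] := herm_majorized_pd (x := v + (v ^t conjC)%sesqui) D'_pd.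
    by rewrite adjD trmxCK addrC.
  have D'U : c%:C%C *: D' \in U by apply: memvZ; apply/UE.
  exists (Subvs D'U).
  apply: eq_psd (psd_add hc (psd_scale (a := c%:C%C) _ (pd_psd D'_pd))) => [a b|]; last by rewrite ler0c.
  rewrite adjB adjZ conjCR psd_adj; last exact: pd_psd.
  rewrite !mxE; ring.
have [f [fK fE]] := krein_extension Kc fpos maj.
have K_psd (x : 'M[C]_n) : psd (fun a b => x a b) -> K x.
  by move=> hx; apply: eq_psd (psd_add hx hx) => a b; rewrite psd_adj // mxE.
have K_skew (x : 'M[C]_n) c : psd (fun a b => x a b) -> conjC c = - c -> K (c *: x).
  move=> hx hc; have h0 : psd (fun _ _ : 'I_n => 0 : C) by exact: psd0.
  apply: eq_psd h0 => a b.
  by rewrite adjZ hc psd_adj // scaleNr subrr mxE.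
have f_ge0 (x : 'M[C]_n) : psd (fun a b => x a b) -> 0 <= (f x : C).
  move=> hx; apply: (linear_ge0 fK); [exact: K_psd|apply: K_skew => //; exact: conjCi|].
  by apply: K_skew => //; rewrite rmorphN; congr (- _); exact: conjCi.
have := functional_psd f_ge0; have := functional_mxpair f; set x0 := \matrix_(_, _) _ => fx x0_psd.
have x00 : x0 = 0.
  apply: (null (a := 1)) => //; apply: mxpair_sep => r hr.
  have rU : r \in U by apply/UE => h hh; exact/hr/memv_span.
  rewrite scale1r addrC -scaleN1r mxpairPr mulN1r [mxpair r x0]mxpairC -fx.
  by rewrite (fE (Subvs rU)) addNr.
have D'U : D' \in U by apply/UE.
have : Re (f D' : C) = Re (mxpair D' j) by rewrite (fE (Subvs D'U)).
rewrite fx x00 mxpair0 => e; move: D'_j; rewrite -e; by rewrite ltxx.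
Qed.
End Step.

(** Induction on the generators: the [D'] found for the tail already works if it annihilates the new
    [j]; otherwise [faithful_step] applies to [j] or to [- j], according to the sign of the
    pairing. *)
Lemma faithful_seq n (hs : seq 'M[C]_n) : (forall h, h \in hs -> (h ^t conjC)%sesqui = h) ->
  (forall x : 'M[C]_n, psd (fun a b => x a b) -> x \in (span hs : {vspace 'M[C]_n}) -> x = 0) ->
  exists2 D, pd D & forall h, h \in hs -> mxpair D h = 0.
Proof.
elim: hs => [|j hs IH] hh null.
  exists 1%:M; last by []. exists 1; first exact: ltr01. have h : psd (fun _ _ : 'I_n => 0 : C) by exact: psd0.
  apply: eq_psd h => a b.
  by rewrite mxE mul1r subrr.
have hs_herm h : h \in hs -> (h ^t conjC)%sesqui = h.
  by move=> hhs; apply: hh; rewrite inE hhs orbT.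
have j_herm : (j ^t conjC)%sesqui = j by apply: hh; rewrite inE eqxx.
have null' (x : 'M[C]_n) (a : C) : psd (fun i k => x i k) -> x - a *: j \in (span hs : {vspace 'M[C]_n}) -> x = 0.
  move=> px hx; apply: null => //; rewrite span_cons -[x](subrK (a *: j)) addrC.
  by rewrite memv_add // memvZ // memv_line.
have [|D' D'pd D'hs] := IH hs_herm.
  by move=> x px hx; apply: (null' x 0) => //; rewrite scale0r subr0.
have fin D : pd D -> mxpair D j = 0 -> (forall h, h \in hs -> mxpair D h = 0) ->
    exists2 D, pd D & forall h, h \in j :: hs -> mxpair D h = 0.
  move=> Dp Dj Dh; exists D => // h; rewrite inE => /predU1P[->|] //; exact: Dh.
have D'real : mxpair D' j = (Re (mxpair D' j))%:C%C.
  have /esym := mxpair_adjl D' j_herm; rewrite psd_adj; last exact: pd_psd.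
  by move/CrealP/RRe_real.
have [D'j|D'j|D'j] := ltgtP (Re (mxpair D' j)) 0.
have jN_herm : ((- j) ^t conjC)%sesqui = - j.
    by apply/matrixP => a b; rewrite !mxE rmorphN -[in RHS]j_herm !mxE.
  have nullN (x : 'M[C]_n) (a : C) : psd (fun i k => x i k) -> x - a *: - j \in (span hs : {vspace 'M[C]_n}) -> x = 0.
    by rewrite scalerN -scaleNr; exact: null'.
  have pN D : mxpair D (- j) = - mxpair D j.
    by have := mxpairPr D (- 1) j 0; rewrite addr0 scaleN1r mulN1r [mxpair D 0]mxpairC mxpair0 addr0.
  have D'jN : 0 < Re (mxpair D' (- j)) by rewrite pN raddfN oppr_gt0.
  have [D Dp [Dj Dh]] := faithful_step hs_herm jN_herm nullN D'pd D'hs D'jN.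
  by apply: (fin D) => //; apply/eqP; rewrite -oppr_eq0 -pN Dj.
have [D Dp [Dj Dh]] := faithful_step hs_herm j_herm null' D'pd D'hs D'j.
  exact: (fin D).
by apply: (fin D') => //; rewrite D'real D'j.
Qed.

(** A self-adjoint space is spanned by hermitian elements, here twice the real parts and multiples
    of the imaginary parts of a basis. *)
Theorem faithful_annihilator n (J : {vspace 'M[C]_n}) : null_subspace J ->
  exists2 D, pd D & forall x, x \in J -> mxpair D x = 0.
Proof.
move=> [Jstar Jnull].
pose b1 := [seq x + (x ^t conjC)%sesqui | x <- vbasis J].
pose b2 := [seq 'i *: (x - (x ^t conjC)%sesqui) | x <- vbasis J].
have hJ h : h \in b1 ++ b2 -> h \in J.
  rewrite mem_cat => /orP[] /mapP[x /vbasis_mem xJ ->].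
    by rewrite memvD // Jstar.
  by rewrite memvZ // memvB // Jstar.
have hherm h : h \in b1 ++ b2 -> (h ^t conjC)%sesqui = h.
  rewrite mem_cat => /orP[] /mapP[x _ ->]; apply/matrixP => a b; rewrite !mxE.
    by rewrite rmorphD /= conjCK addrC.
  by rewrite rmorphM rmorphB /= conjCK conjCi mulNr -mulrN opprB.
have [|D Dp Dh] := faithful_seq hherm.
  move=> x px xs; apply: Jnull.
    by apply: (subvP _ _ xs); apply/span_subvP.
  apply/(mo_cone_os (S := matn R n))/(gcone_matn (I := 'I_1)).
  by apply: eq_psd (psd_reindex (fun u : 'I_1 * 'I_n => u.2) px) => u v; rewrite mxE.
exists D => // x xJ; rewrite (coord_vbasis xJ).
have D0 i : mxpair D (vbasis J)`_i = 0.
  have [iJ|iJ] := ltnP i (\dim J); last by rewrite nth_default ?size_tuple // mxpairC mxpair0.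
  set y := _`_i; have yb : y \in (vbasis J : seq _) by rewrite mem_nth ?size_tuple.
  have -> : y = (2^-1 : C) *: ((y + (y ^t conjC)%sesqui) + (- 'i) *: ('i *: (y - (y ^t conjC)%sesqui))).
    rewrite scalerA mulNr -expr2 sqrCi opprK scale1r addrACA addrN addr0.
    have -> : y + y = (2 : C) *: y by rewrite scaler_nat.
    by rewrite scalerA mulVf ?scale1r // pnatr_eq0.
  rewrite mxpairZr mxpairDr mxpairZr.
  have m1 : y + (y ^t conjC)%sesqui \in b1 ++ b2.
    by rewrite mem_cat; apply/orP; left; apply/mapP; exists y.
  have m2 : 'i *: (y - (y ^t conjC)%sesqui) \in b1 ++ b2.
    by rewrite mem_cat; apply/orP; right; apply/mapP; exists y.
  by rewrite (Dh _ m1) (Dh _ m2) !mulr0 addr0 mulr0.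
elim/big_rec: _ => [|i z _ hz]; first by rewrite mxpairC mxpair0.
by rewrite mxpairPr D0 hz mulr0 addr0.
Qed.
End Faithful.

(** * Testing positivity on ucp maps *)

Section UcpTest.
Variable R : realType.
Local Notation C := R[i].
Local Notation conjC := (@Num.conj C).
Local Notation Re := complex.Re.

(** [b] is any complex number: [e = 1] and [e = 2] force the imaginary part of [a] to vanish, and
    [e = - a / (1 + |b|)] refutes a negative real part. *)
Lemma ge0_limit (a b : C) : (forall e : R, 0 < e -> 0 <= a + e%:C%C * b) -> 0 <= a.
Proof.
move=> h; have h1 := h 1 ltr01; have h2 := h 2 (ltr0n _ 2).
case: a b h h1 h2 => [a a'] [b b'] h; rewrite !lecE /= => /andP[/eqP i1 _] /andP[/eqP i2 _].
have b0 : b' = 0 by lra.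
have -> : a' = 0 by lra.
rewrite eqxx /= leNgt; apply/negP => a0.
have bp : 0 < 1 + `|b| by rewrite ltr_pwDl.
have := h (- a / (1 + `|b|)); rewrite lecE /= divr_gt0 ?oppr_gt0 // => /(_ isT) /andP[_].
rewrite mul0r subr0 mulrAC -[X in X + _](mulfK (lt0r_neq0 bp)) -mulrDl pmulr_lge0 ?invr_gt0 // mulrDr mulr1.
have := ler_norm b; nra.
Qed.

Lemma psd_kron (I J : finType) (M : I -> I -> C) (N : J -> J -> C) : psd M -> psd N ->
  psd (fun u v : I * J => M u.1 v.1 * N u.2 v.2).
Proof.
move=> hM hN.
have := psd_schur (psd_reindex (fun u : I * unit => u.1) hM) (psd_reindex (fun u : J * unit => u.1) hN).
have bu (g : unit -> C) : \sum_u g u = g tt by rewrite (bigD1 tt) //= big1 ?addr0 // => -[].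
by apply: eq_psd => u v; rewrite !bu.
Qed.

Lemma psd_block_compress (K I J : finType) (B : I -> J -> C) (M : K * I -> K * I -> C) : psd M ->
  psd (fun u v : K * J => \sum_k \sum_l conjC (B k u.2) * B l v.2 * M (u.1, k) (v.1, l)).
Proof.
move=> hM c; have := hM (fun x => \sum_j B x.2 j * c (x.1, j)); congr (_ <= _).
rewrite !sum_prod; apply: eq_bigr => x _ /=.
under eq_bigr do rewrite sum_prod; under [RHS]eq_bigr do rewrite sum_prod.
rewrite exchange_big [RHS]exchange_big; apply: eq_bigr => y _ /=.
transitivity (\sum_j \sum_j' \sum_k \sum_l
   conjC (c (x, j)) * (conjC (B k j) * B l j' * M (x, k) (y, l)) * c (y, j')).
  rewrite [RHS]exchange_big22; apply: eq_bigr => k _; apply: eq_bigr => l _.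
  rewrite rmorph_sum !mulr_suml; apply: eq_bigr => j _; rewrite mulr_sumr.
  by apply: eq_bigr => j' _; rewrite rmorphM /=; ring.
apply: eq_bigr => j _; apply: eq_bigr => j' _; rewrite mulr_sumr mulr_suml; apply: eq_bigr => k _.
by rewrite mulr_sumr mulr_suml.
Qed.

Section Test.
Variable A : uospace R.

(** The second alternative covers the zero space, which has no unital functional. *)
Definition has_state := (exists sg : {linear A -> C^o},
  (forall n (X : 'M[A]_n), mo_cone X -> psd (fun i j => sg (X i j) : C)) /\ sg (uo_one A) = 1)
  \/ (forall x : A, x = 0).

Definition mat_psd (K : finType) p (X : K -> K -> A) (al : A -> 'M[C]_p) :=
  psd (fun u v : K * 'I_p => al (X u.1 v.1) u.2 v.2).

(** This bridges the minimal cone, which is tested on ucp maps, and the arguments below, which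
    produce maps that are merely cp. The perturbation by [e] times a state is removed in the
    limit. *)
Lemma ucp_test (K : finType) (X : K -> K -> A) : has_state ->
  (@mo_cone R A 1 (const_mx (uo_one A))) ->
  (forall p (al : {linear A -> matn R p}), ucp al -> mat_psd X al) ->
  forall p (al : {linear A -> matn R p}), cp al -> mat_psd X al.
Proof.
move=> [[sg [sgp sg1]]|A0] one_pos hX p al cpal; last first.
  move=> c; rewrite big1 // => u _; rewrite big1 // => v _.
  by rewrite (A0 (X _ _)) linear0 mxE mulr0 mul0r.
suff key (e : R) : 0 < e -> psd (fun u v : K * 'I_p =>
    (al (X u.1 v.1) : 'M_p) u.2 v.2 + e%:C%C * ((sg (X u.1 v.1) : C) * (u.2 == v.2)%:R)).
  move=> c; apply: (ge0_limit (b := \sum_u \sum_v conjC (c u) * ((sg (X u.1 v.1) : C) * (u.2 == v.2)%:R) * c v)).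
  move=> e e0; have := key e e0 c; congr (_ <= _).
  rewrite mulr_sumr -big_split; apply: eq_bigr => u _; rewrite mulr_sumr -big_split.
  by apply: eq_bigr => v _ /=; ring.
(* [ale] is invertible at the unit, hence equal to [B^* al' B] for a ucp map [al']. *)
move=> e0; pose ale (x : A) : 'M[C]_p := al x + (e%:C%C * (sg x : C))%:M.
have aleE x a b : ale x a b = (al x : 'M_p) a b + e%:C%C * ((sg x : C) * (a == b)%:R).
  by rewrite mulrA mulr_natr /ale mxE [X in _ + X]mxE.
have alel : linear ale.
  move=> k x y; apply/matrixP => a b.
  transitivity (k * ale x a b + ale y a b); last by rewrite !mxE.
  have e1 : (sg (k *: x + y) : C) = k * (sg x : C) + sg y by rewrite linearP.
  have e2 : (al (k *: x + y) : 'M_p) a b = k * (al x : 'M_p) a b + (al y : 'M_p) a b by rewrite linearP !mxE.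
  by rewrite !aleE e1 e2; ring.
have cpe n (Y : 'M[A]_n) : mo_cone Y -> psd (fun u v : 'I_n * 'I_p => ale (Y u.1 v.1) u.2 v.2).
  move=> hY; have h1 := proj1 (mo_cone_matn _) (cpal n Y hY).
  have h2 := psd_scale (a := e%:C%C) _ (psd_kron (sgp n Y hY) (@psd_id R 'I_p)).
  apply: eq_psd (psd_add h1 (h2 _)) => [u v|]; last by rewrite ler0c ltW.
  by rewrite aleE mxE.
pose P0 := ale (uo_one A).
have hP0 : psd (fun a b => P0 a b).
  apply: eq_psd (psd_reindex (fun a => (ord0, a)) (cpe _ _ one_pos)) => a b.
  by rewrite [const_mx _ _ _]mxE.
have [B0 BE] := psd_factor hP0.
pose B : 'M[C]_p := \matrix_(c, k) B0 c k.
have Bu : B \in unitmx.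
  apply: (psd_lower_unit e0).
  have := psd_reindex (fun a => (ord0, a)) (proj1 (mo_cone_matn _) (cpal _ _ one_pos)).
  apply: eq_psd => k l; rewrite !mxE; under eq_bigr do rewrite !mxE.
  by rewrite -BE aleE sg1 mul1r addrK.
pose D := invmx B.
have DB : D *m B = 1%:M by exact: mulVmx.
have BD : B *m D = 1%:M by exact: mulmxV.
have starM (M N : 'M[C]_p) : ((M *m N) ^t conjC)%sesqui = (N ^t conjC)%sesqui *m (M ^t conjC)%sesqui.
  by rewrite trmx_mul map_mxM.
have star1m : ((1%:M : 'M[C]_p) ^t conjC)%sesqui = 1%:M by rewrite trmx1 map_mx1.
pose al' (x : A) : 'M[C]_p := (D ^t conjC)%sesqui *m ale x *m D.
have al'l : linear al' by move=> a x z; rewrite /al' alel mulmxDr mulmxDl -scalemxAr -scalemxAl.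
have conjE (M N : 'M[C]_p) a b : ((M ^t conjC)%sesqui *m N *m M) a b =
    \sum_k \sum_l conjC (M k a) * M l b * N k l.
  rewrite mxE exchange_big; apply: eq_bigr => l _; rewrite mxE mulr_suml; apply: eq_bigr => k _.
  by rewrite !mxE; ring.
have ucpal : @ucp R A (matn R p) (mklin al'l).
  split=> [n Y hY|].
    apply/mo_cone_matn; apply: eq_psd (psd_block_compress (fun k a => D k a) (cpe n Y hY)) => u v.
    by rewrite mxE conjE.
  rewrite /= /al'; have -> : ale (uo_one A) = (B ^t conjC)%sesqui *m B.
    apply/matrixP => k l; rewrite -/P0 BE mxE; apply: eq_bigr => c _; by rewrite !mxE.
  by rewrite mulmxA -starM BD star1m mul1mx BD.
have := psd_block_compress (fun k a => B k a) (hX p (mklin al'l) ucpal).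
apply: eq_psd => u v; rewrite -aleE.
transitivity (((B ^t conjC)%sesqui *m al' (X u.1 v.1) *m B) u.2 v.2); first by rewrite conjE.
rewrite /al' !mulmxA -starM DB star1m mul1mx.
by rewrite -mulmxA DB mulmx1.
Qed.
End Test.

Lemma opsys_has_state (S : opsys R) : has_state S.
Proof.
have [[v v0]|h] := pselect (exists v : os_hilb S, v != 0); [left|right].
  have vv : 0 < h_dot _ v v by rewrite lt_def dot_eq0 v0 dot_ge0.
  pose g : {linear os_car S -> C^o} := mklin (@vector_functional_linear R S v v).
  have gl : linear (fun s : os_car S => (h_dot _ v v)^-1 * (g s : C) : C^o).
    by move=> a x y; rewrite linearP mulrDr -[a *: _]/(a * _) -[RHS]/(a * (_ * _) + _) mulrCA.
  exists (mklin gl); split=> [n X /(mo_cone_os (S := S)) hX|].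
    apply: psd_scale; first by rewrite invr_ge0 ltW.
    move=> c; have := hX (fun i => c i *: v); congr (_ <= _).
    apply: eq_bigr => i _; apply: eq_bigr => j _.
    by rewrite actZr dotZl dotZr /= /vector_functional; ring.
  by rewrite /= /vector_functional os_act_one mulVf // gt_eqF.
move=> s; apply: os_act_inj => v; apply/eqP/negP => /negP sv; apply: h.
by exists (os_act S s v).
Qed.

Section Min.
Variables (S : opsys R) (n : nat) (J : {vspace 'M[C]_n}).
Hypothesis Jnull : null_subspace J.
Variable Z : tprod (os_car S) (matn_quot_car J).

(** A positive block matrix annihilating [J] is a cp map from the quotient to matrices: contract it
    with a positive lift of [X + e], and let [e] tend to zero. *)
Lemma functionals_quot_psd (Q : finType) (r : Q -> Q -> 'M[C]_n)
  (hr : forall a b x, x \in J -> mxpair (r a b) x = 0) :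
  psd (fun u v : Q * 'I_n => r u.1 v.1 u.2 v.2) ->
  forall k (X : 'M[matn_quot J]_k), mo_cone X ->
  psd (fun u v : 'I_k * Q => qfunl (hr u.2 v.2) (X u.1 v.1) : C).
Proof.
move=> pr k X /quot_coneP hX c.
apply: (ge0_limit (b := \sum_u \sum_v conjC (c u) * ((u.1 == v.1)%:R * \tr (r u.2 v.2)) * c v)) => e e0.
have [s /gcone_matn hs sE] := hX e e0.
have := psd_schur hs pr => /(_ c); congr (_ <= _).
rewrite mulr_sumr -big_split; apply: eq_bigr => u _; rewrite mulr_sumr -big_split.
apply: eq_bigr => v _; cbv beta.
have E : \sum_a \sum_b s u.1 v.1 a b * r u.2 v.2 a b =
    (qfunl (hr u.2 v.2) (X u.1 v.1) : C) + e%:C%C * (u.1 == v.1)%:R * \tr (r u.2 v.2).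
  rewrite -[LHS]/(mxpair (s u.1 v.1) (r u.2 v.2)) mxpairC -(qfunl_pi (hr u.2 v.2)) -sE linearD linearZ.
  by congr (_ + _); rewrite qfunl_pi mxpairC mxpair1.
transitivity (conjC (c u) * (\sum_a \sum_b s u.1 v.1 a b * r u.2 v.2 a b) * c v); first by [].
rewrite E mulrDr mulrDl -[RHS]/(_ + _); congr (_ + _); ring.
Qed.

Lemma functional_quot_psd D (hD : forall x, x \in J -> mxpair D x = 0) :
  psd (fun a b => D a b) -> forall k (X : 'M[matn_quot J]_k), mo_cone X ->
  psd (fun i j => qfunl hD (X i j) : C).
Proof.
move=> pD k X hX.
have pD' : psd (fun u v : unit * 'I_n => D u.2 v.2) by exact: (psd_reindex (fun u : unit * 'I_n => u.2) pD).
exact: (psd_reindex (fun i : 'I_k => (i, tt)) (functionals_quot_psd (r := fun _ _ : unit => D) (fun _ _ => hD) pD' hX)).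
Qed.

(** The pairing with a positive definite matrix annihilating [J], divided by its trace, which is
    positive unless [n = 0]. *)
Lemma quot_has_state : has_state (matn_quot J).
Proof.
have [D [mu mu0 Dp] DJ] := faithful_annihilator Jnull.
case: (posnP n) => [n0|n0]; [right|left].
  move=> x; have [y <-] := qpi_surj x; apply/qpi_eq0.
  have -> : y = 0 by apply/matrixP => -[i hi]; exfalso; move: hi; rewrite n0.
  exact: mem0v.
have trD : 0 < \tr D.
  apply: lt_le_trans (_ : 0 < \sum_(i < n) mu%:C%C) _.
    by rewrite sumr_const card_ord pmulrn_lgt0 // ltcR.
  apply: ler_sum => i _; rewrite -subr_ge0.
  have := psd_two Dp i i 1 0; rewrite !(rmorph0, rmorph1, mul0r, mulr0, addr0, mul1r).
  by rewrite eqxx mulr1.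
have tl : linear (fun y => (\tr D)^-1 * (qfunl DJ y : C) : C^o).
  by move=> a x y; rewrite linearP mulrDr -[a *: _]/(a * _) -[RHS]/(a * (_ * _) + _) mulrCA.
exists (mklin tl); split=> [k X hX|].
  apply: psd_scale; first by rewrite invr_ge0 ltW.
  by apply: functional_quot_psd => //; apply: pd_psd; exists mu.
have e : (qfunl DJ (uo_one (matn_quot J)) : C) = \tr D by rewrite qfunl_pi mxpairC mxpair1.
by rewrite -[LHS]/((\tr D)^-1 * (qfunl DJ (uo_one (matn_quot J)) : C)) e mulVf // gt_eqF.
Qed.

Lemma quot_one_pos : @mo_cone R (matn_quot J) 1 (const_mx (uo_one (matn_quot J))).
Proof.
have := @qpi_cp R n J 1 (const_mx 1%:M); have -> : map_mx (qpi J) (const_mx 1%:M : 'M_1) = const_mx (uo_one (matn_quot J)).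
  by apply/matrixP => i j; rewrite !mxE.
apply; apply/(os_pos1 (S := matn R n)); exact: os_pos_one.
Qed.

Lemma slicel_bil (h : {linear os_car S -> C^o}) : bil (fun (s : os_car S) (y : matn_quot_car J) => (h s : C) *: y).
Proof.
split=> [k x y b|a k x y]; last by rewrite scalerDr !scalerA mulrC.
by rewrite linearP scalerDl scalerA.
Qed.
Definition slicel h : {linear Z -> matn_quot_car J} := tlift Z (slicel_bil h).
Lemma slicel_tn h s y : slicel h (tn s y) = (h s : C) *: y.
Proof. exact: tlift_tn. Qed.

Lemma entry_linear (V : lmodType C) q (f : {linear V -> 'M[C]_q}) a b :
  linear (fun x => f x a b : C^o).
Proof. by move=> k x y; rewrite linearP !mxE. Qed.
Definition entry (V : lmodType C) q (f : {linear V -> 'M[C]_q}) a b : {linear V -> C^o} :=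
  mklin (entry_linear f a b).

Lemma mxmap_slice p q (f : {linear os_car S -> 'M[C]_p}) (g : {linear matn_quot_car J -> 'M[C]_q}) z
  (u v : 'I_p) (a b : 'I_q) :
  mxmap Z f g z (mxtens_index (u, a)) (mxtens_index (v, b)) = f (slice (entry g a b) z) u v.
Proof.
move: z; apply: tp_ind => [|x y hx hy|s y]; first by rewrite !linear0 !mxE.
  by rewrite !linearD !mxE hx hy.
by rewrite mxmap_tn slice_tn linearZ /= !mxE !mxtens_indexK /= mulrC.
Qed.

Lemma slice_slicel p q (f : {linear os_car S -> 'M[C]_p}) (g : {linear matn_quot_car J -> 'M[C]_q}) z
  (u v : 'I_p) (a b : 'I_q) :
  g (slicel (entry f u v) z) a b = f (slice (entry g a b) z) u v.
Proof.
move: z; apply: tp_ind => [|x y hx hy|s y]; first by rewrite !linear0 !mxE.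
  by rewrite !linearD !mxE hx hy.
by rewrite slicel_tn slice_tn !linearZ /= !mxE mulrC.
Qed.

(** Slicing turns a condition on scalar matrices into positivity over [S] itself. Unitality is
    relaxed first on the leg of [S], then on that of the quotient; the map used on [S] is its
    compression to the vectors [xi] at which positivity is tested. *)
Theorem min_slices k (z : 'I_k -> 'I_k -> Z) :
  (forall p q (f : {linear os_car S -> 'M[C]_p}) (g : {linear matn_quot_car J -> 'M[C]_q}),
     @ucp R S (matn R p) f -> @ucp R (matn_quot J) (matn R q) g ->
     psd (fun u v : 'I_k * 'I_(p * q) => mxmap Z f g (z u.1 v.1) u.2 v.2)) ->
  forall q (g : {linear matn_quot_car J -> 'M[C]_q}), @cp R (matn_quot J) (matn R q) g ->
  gcone (fun u v : 'I_k * 'I_q => slice (entry g u.2 v.2) (z u.1 v.1)).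
Proof.
move=> hmin q g cpg.
have step1 q' (g' : {linear matn_quot_car J -> 'M[C]_q'}) : @ucp R (matn_quot J) (matn R q') g' ->
    forall p (f : {linear os_car S -> 'M[C]_p}), @cp R S (matn R p) f ->
    psd (fun u v : ('I_k * 'I_q') * 'I_p => f (slice (entry g' u.1.2 v.1.2) (z u.1.1 v.1.1)) u.2 v.2).
  move=> ug p f cf.
  apply: (@ucp_test S ('I_k * 'I_q')%type (fun u v => slice (entry g' u.2 v.2) (z u.1 v.1)) (opsys_has_state S) _ _ p f cf).
    apply/(os_pos1 (S := S)); exact: os_pos_one.
  move=> p' f' uf.
  have := psd_reindex (fun u : ('I_k * 'I_q') * 'I_p' => (u.1.1, mxtens_index (u.2, u.1.2))) (hmin p' q' f' g' uf ug).
  by apply: eq_psd => u v; rewrite mxmap_slice.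
move=> xi; pose N := #|{: 'I_k * 'I_q}|.
pose f (s : os_car S) : 'M[C]_N := \matrix_(u, v) h_dot _ (os_act _ s (xi (enum_val v))) (xi (enum_val u)).
have fl : linear f by move=> a x y; apply/matrixP => u v; rewrite !mxE actDl actZl dotDl dotZl.
have cf : @cp R S (matn R N) (mklin fl).
  move=> m X /(mo_cone_os (S := S)) hX; apply/mo_cone_matn => c.
  have := hX (fun i => \sum_u c (i, u) *: xi (enum_val u)); congr (_ <= _).
  rewrite sum_prod; apply: eq_bigr => i _; under [RHS]eq_bigr do rewrite sum_prod.
  rewrite [RHS]exchange_big; apply: eq_bigr => j _; rewrite dot_sumr; apply: eq_bigr => u _.
  rewrite act_sumr dot_suml; apply: eq_bigr => v _; rewrite actZr dotZl dotZr !mxE /=; ring.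
have step2 : psd (fun u v : ('I_k * 'I_N) * 'I_q => g (slicel (entry (mklin fl) u.1.2 v.1.2) (z u.1.1 v.1.1)) u.2 v.2).
  apply: (@ucp_test (matn_quot J) ('I_k * 'I_N)%type (fun u v => slicel (entry (mklin fl) u.2 v.2) (z u.1 v.1)) quot_has_state quot_one_pos _ q g cpg).
  move=> q' g' ug'.
  have := psd_reindex (fun u : ('I_k * 'I_N) * 'I_q' => ((u.1.1, u.2), u.1.2)) (step1 q' g' ug' _ _ cf).
  by apply: eq_psd => u v; rewrite slice_slicel.
have := psd_reindex (fun w : 'I_k * 'I_q => ((w.1, enum_rank w), w.2)) step2 (fun=> 1).
congr (_ <= _); apply: eq_bigr => u _; apply: eq_bigr => v _.
by rewrite rmorph1 mul1r mulr1 slice_slicel mxE !enum_rankK.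
Qed.
End Min.
End UcpTest.

(** * Minimal and maximal cones over an injective operator system *)

Section Injective.
Variable R : realType.
Local Notation C := R[i].
Local Notation conjC := (@Num.conj C).
Local Notation Re := complex.Re.
Variables (I : opsys R) (hI : injective_opsys I).

Theorem injective_cp_extension n (P : matrix_system R n) (phi : {linear ms_opsys P -> I}) :
  cp phi -> exists2 psi : {linear matn R n -> I}, cp psi & forall x, psi (vsval x) = phi x.
Proof.
(* Injectivity only concerns ucp maps: [phi / c] is made unital by an additional corner,
   which is mapped to [1 - phi 1 / c]. *)
move=> cphi; pose a : os_car I := phi (os_one (ms_opsys P)).
have ap : os_pos a.
  apply/(os_pos1 (S := I)); have := cphi 1%N (const_mx (os_one (ms_opsys P))).
  have -> : map_mx phi (const_mx (os_one (ms_opsys P)) : 'M_1) = const_mx a.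
    by apply/matrixP => i j; rewrite !mxE.
  by apply; apply/(os_pos1 (S := ms_opsys P)); exact: os_pos_one.
pose c := onorm a + 1; have c0 : 0 < c by rewrite ltr_wpDl ?onorm_ge0.
have cV : c^-1%:C%C * c%:C%C = 1 :> C by rewrite -rmorphM mulVf ?gt_eqF.
have ca : os_pos (os_one I - c^-1%:C%C *: a).
  have -> : os_one I - c^-1%:C%C *: a = c^-1%:C%C *: (((onorm a)%:C%C *: os_one I - a) + os_one I).
    have -> : (onorm a)%:C%C *: os_one I - a + os_one I = c%:C%C *: os_one I - a.
      by rewrite addrAC /c rmorphD rmorph1 scalerDl scale1r.
    by rewrite scalerBr scalerA cV scale1r.
  apply: os_posZ; first by rewrite ler0c invr_ge0 ltW.
  apply: os_posD; last exact: os_pos_one.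
  by have [] := herm_le_onorm (os_pos_herm ap).
have bP k (x y : 'M[C]_(n + 1)) : [/\ ulsubmx (k *: x + y) = k *: ulsubmx x + ulsubmx y,
    ursubmx (k *: x + y) = k *: ursubmx x + ursubmx y,
    dlsubmx (k *: x + y) = k *: dlsubmx x + dlsubmx y &
    drsubmx (k *: x + y) = k *: drsubmx x + drsubmx y].
  by split; apply/matrixP => i j; rewrite !mxE.
have [U UE] : exists U : {vspace 'M[C]_(n + 1)}, forall y, y \in U <->
    [/\ ulsubmx y \in ms_space P, ursubmx y = 0 & dlsubmx y = 0].
  apply: vspace_of_pred.
    have -> : ulsubmx (0 : 'M[C]_(n + 1)) = 0 by apply/matrixP => i j; rewrite !mxE.
    by split; [exact: mem0v|apply/matrixP => i j; rewrite !mxE|apply/matrixP => i j; rewrite !mxE].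
  move=> k x y [x1 x2 x3] [y1 y2 y3]; have [-> -> -> _] := bP k x y.
  by rewrite x2 x3 y2 y3 !scaler0 !addr0 memvD // memvZ.
have blockU x b : x \in ms_space P -> block_mx x 0 0 b \in U.
  by move=> xP; apply/UE; rewrite block_mxKul block_mxKur block_mxKdl.
have U1 : 1%:M \in U by rewrite scalar_mx_block; apply: blockU; exact: ms_one.
have Us A : A \in U -> (A ^t conjC)%sesqui \in U.
  move=> /UE[h1 h2 h3]; apply/UE; split.
    have -> : ulsubmx (A ^t conjC)%sesqui = ((ulsubmx A) ^t conjC)%sesqui.
      by apply/matrixP => i j; rewrite !mxE.
    exact: ms_star.
    have -> : ursubmx (A ^t conjC)%sesqui = ((dlsubmx A) ^t conjC)%sesqui.
      by apply/matrixP => i j; rewrite !mxE.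
    by rewrite h3 trmx0 map_mx0.
  have -> : dlsubmx (A ^t conjC)%sesqui = ((ursubmx A) ^t conjC)%sesqui.
    by apply/matrixP => i j; rewrite !mxE.
  by rewrite h2 trmx0 map_mx0.
pose Q := MatrixSystem U1 Us.
pose ph (y : subvs_of U) : os_car I :=
  c^-1%:C%C *: phi (vsproj (ms_space P) (ulsubmx (vsval y))) +
  drsubmx (vsval y) 0 0 *: (os_one I - c^-1%:C%C *: a).
have phl : linear ph.
  move=> k x y; have [e1 _ _ e2] := bP k (vsval x) (vsval y).
  rewrite /ph [vsval (_ + _)]linearP e1 e2 !linearP /= [in X in _ + X *: _]mxE [in X in _ + X *: _]mxE.
  by rewrite scalerDl -scalerA [LHS]addrACA; congr (_ + _ + _); rewrite !scalerA mulrC.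
have uph : @ucp R (ms_opsys Q) I (mklin phl).
  split=> [k X /(mo_cone_os (S := ms_opsys Q)) hX|].
    have hX' : psd (fun u v : 'I_k * 'I_(n + 1) => vsval (X u.1 v.1) u.2 v.2).
      by apply/(gcone_matn (fun i j => vsval (X i j))) => xi; exact: hX.
    apply/(mo_cone_os (S := I)).
    pose Y : 'M[subvs_of (ms_space P)]_k := \matrix_(i, j) vsproj (ms_space P) (ulsubmx (vsval (X i j))).
    have YE i j : vsval (Y i j) = ulsubmx (vsval (X i j)).
      by rewrite mxE vsprojK //; have /UE[] := subvsP (X i j).
    have hY : @mo_cone R (ms_opsys P) k Y.
      apply/(mo_cone_os (S := ms_opsys P)) => xi.
      suff h : psd (fun u v : 'I_k * 'I_n => vsval (Y u.1 v.1) u.2 v.2).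
        exact: (proj2 (gcone_matn (fun i j => vsval (Y i j))) h xi).
      apply: eq_psd (psd_reindex (fun u : 'I_k * 'I_n => (u.1, lshift 1 u.2)) hX') => u v.
      by rewrite YE !mxE.
    have := cphi k Y hY => /(mo_cone_os (S := I)) h1.
    have h2 := psd_reindex (fun u : 'I_k => (u, rshift n (0 : 'I_1))) hX'.
    have ci : 0 <= c^-1%:C%C by rewrite ler0c invr_ge0 ltW.
    apply: eq_gcone (gcone_add (gcone_scale ci h1) (gcone_pos h2 ca)) => i j.
    by rewrite !mxE /= /ph !mxE.
  rewrite /= /ph /= scalar_mx_block block_mxKul block_mxKdr mxE mulr1n scale1r.
  have -> : vsproj (ms_space P) 1%:M = os_one (ms_opsys P).
    by apply: val_inj; rewrite /= vsprojK //; exact: ms_one.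
  by rewrite addrC subrK.
have co : @co_embedding R (ms_opsys Q) (matn R (n + 1)) (vsval : {linear subvs_of U -> _}).
  split=> [|//|k X]; first exact: val_inj.
  split=> [/(mo_cone_os (S := ms_opsys Q)) h|/(mo_cone_os (S := matn R (n + 1))) h].
    have h' : gcone (S := matn R (n + 1)) (fun i j => vsval (X i j)) := h.
    by apply/(mo_cone_os (S := matn R (n + 1))); apply: eq_gcone h' => i j; rewrite mxE.
  have h' : gcone (S := matn R (n + 1)) (fun i j => vsval (X i j)).
    by apply: eq_gcone h => i j; rewrite mxE.
  exact/(mo_cone_os (S := ms_opsys Q)).
have [g [cg _] gE] := hI co uph.
(* The ucp extension restricted to the first corner, with the division by [c] undone. *)
pose ps (x : 'M[C]_n) : os_car I := c%:C%C *: g (block_mx x 0 0 0).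
have psl : linear ps.
  move=> k x y; rewrite /ps scalerA mulrC -scalerA -scalerDr -linearP; congr (_ *: g _).
  by rewrite scale_block_mx add_block_mx !scaler0 !addr0.
exists (mklin psl); last first.
  move=> x /=; rewrite /ps; have bU := blockU (vsval x) 0 (subvsP x).
  rewrite -[block_mx _ _ _ _]/(vsval (Subvs bU)) gE /= /ph /= block_mxKul block_mxKdr mxE scale0r addr0.
  by rewrite vsvalK scalerA mulrC cV scale1r.
move=> k X /mo_cone_matn hX.
have := psd_block_compress (fun (i : 'I_n) (u : 'I_(n + 1)) => (u == lshift 1 i)%:R) hX.
set M := (fun _ _ => _) => hM.
have : @mo_cone R (matn R (n + 1)) k (\matrix_(i, j) block_mx (X i j) 0 0 0).
  apply/mo_cone_matn; apply: eq_psd hM => u v; rewrite /M mxE.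
  case: (split_ordP u.2) => x xE; case: (split_ordP v.2) => y yE; rewrite xE yE.
    rewrite block_mxEul (bigD1 x) //= [X in _ + X]big1 ?addr0 => [|i ix]; last first.
      by rewrite big1 // => j _; rewrite eq_lshift eq_sym (negPf ix) rmorph0 !mul0r.
    rewrite (bigD1 y) //= big1 ?addr0 => [|j jy]; last first.
      by rewrite [lshift 1 y == _]eq_lshift [y == j]eq_sym (negPf jy) mulr0 mul0r.
    by rewrite !eqxx rmorph1 !mul1r.
    rewrite block_mxEur mxE big1 // => i _; rewrite big1 // => j _.
    by rewrite eq_rlshift mulr0 mul0r.
    rewrite block_mxEdl mxE big1 // => i _; rewrite big1 // => j _.
    by rewrite eq_rlshift rmorph0 !mul0r.
  rewrite block_mxEdr mxE big1 // => i _; rewrite big1 // => j _.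
  by rewrite eq_rlshift rmorph0 !mul0r.
move/cg/(mo_cone_os (S := I)) => h; apply/(mo_cone_os (S := I)).
have ci : 0 <= c%:C%C :> C by rewrite ler0c ltW.
by apply: eq_gcone (gcone_scale ci h) => i j; rewrite !mxE.
Qed.
End Injective.

Section MinMax.
Variable R : realType.
Local Notation C := R[i].
Local Notation conjC := (@Num.conj C).
Local Notation Re := complex.Re.

Section Block.
Variables (k n : nat).
Local Notation K := ('I_k * 'I_n)%type.
Local Notation N := #|{: K}|.
Implicit Types x y : 'M[C]_N.

Definition block x (i j : 'I_k) : 'M[C]_n :=
  \matrix_(c, d) x (enum_rank (i, c)) (enum_rank (j, d)).

Lemma blockP a x y i j : block (a *: x + y) i j = a *: block x i j + block y i j.
Proof. by apply/matrixP => c d; rewrite !mxE. Qed.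

Lemma blockD x y i j : block (x + y) i j = block x i j + block y i j.
Proof. by rewrite -[x]scale1r blockP !scale1r. Qed.

Lemma block0 i j : block 0 i j = 0.
Proof. by apply/matrixP => c d; rewrite !mxE. Qed.

Lemma blockZ a x i j : block (a *: x) i j = a *: block x i j.
Proof. by rewrite -[a *: x]addr0 blockP block0 addr0. Qed.

Lemma block_adj x i j : block (x ^t conjC)%sesqui i j = (block x j i ^t conjC)%sesqui.
Proof. by apply/matrixP => c d; rewrite !mxE. Qed.

Lemma block1 i j : block 1%:M i j = (i == j)%:R%:M.
Proof.
apply/matrixP => c d; rewrite !mxE (inj_eq enum_rank_inj) xpair_eqE.
by case: (i == j) (c == d) => [] [].
Qed.

Definition of_blocks (z : 'I_k -> 'I_k -> 'M[C]_n) : 'M[C]_N :=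
  \matrix_(u, v) z (enum_val u : K).1 (enum_val v : K).1 (enum_val u : K).2 (enum_val v : K).2.

Lemma of_blocksE z i j : block (of_blocks z) i j = z i j.
Proof. by apply/matrixP => c d; rewrite !mxE !enum_rankK. Qed.

Lemma psd_block x : psd (fun u v => x u v) ->
  psd (fun u v : K => block x u.1 v.1 u.2 v.2).
Proof.
move=> h; apply: eq_psd (psd_reindex (fun u : K => enum_rank u) h) => u v.
by rewrite mxE -!surjective_pairing.
Qed.

Lemma mxpair_block x y : mxpair x y = \sum_i \sum_j mxpair (block x i j) (block y i j).
Proof.
rewrite /mxpair sum_enum_rank sum_prod; apply: eq_bigr => i _ /=.
rewrite [RHS]exchange_big; apply: eq_bigr => c _; rewrite sum_enum_rank sum_prod.
by apply: eq_bigr => j _; apply: eq_bigr => d _; rewrite !mxE.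
Qed.
End Block.

Lemma quot_coords (A : lmodType C) n (J : {vspace 'M[C]_n}) (Z : tprod A (matn_quot_car J)) (z : Z) :
  exists t : 'I_n -> 'I_n -> A, z = \sum_a \sum_b tn (t a b) (qpi J (delta_mx a b)).
Proof.
move: z; apply: tp_ind => [|x y [t ->] [t' ->]|s y].
  by exists (fun _ _ => 0); rewrite big1 // => a _; rewrite big1 // => b _; rewrite tn0l.
  exists (fun a b => t a b + t' a b); rewrite -big_split; apply: eq_bigr => a _.
  by rewrite -big_split; apply: eq_bigr => b _; rewrite tnDl.
have [x <-] := qpi_surj y; exists (fun a b => x a b *: s).
pose q : {linear 'M[C]_n -> matn_quot_car J} := mklin (qpi_linear J).
rewrite -[qpi J x]/(q x) {1}[x]matrix_sum_delta linear_sum tn_sumr; apply: eq_bigr => a _.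
rewrite linear_sum tn_sumr; apply: eq_bigr => b _.
by rewrite linearZ tnZl tnZr.
Qed.

Lemma slice_coords (A : lmodType C) n (J : {vspace 'M[C]_n}) (Z : tprod A (matn_quot_car J))
  (t : 'I_n -> 'I_n -> A) r (hr : forall x, x \in J -> mxpair r x = 0) :
  slice (qfunl hr) (\sum_a \sum_b tn (t a b) (qpi J (delta_mx a b)) : Z) = \sum_a \sum_b r a b *: t a b.
Proof.
rewrite linear_sum; apply: eq_bigr => a _; rewrite linear_sum; apply: eq_bigr => b _.
by rewrite slice_tn qfunl_pi mxpair_delta.
Qed.

Lemma slice_ext (A B : lmodType C) (Z : tprod A B) (g h : {linear B -> C^o}) (z : Z) :
  (forall b, g b = h b) -> slice g z = slice h z.
Proof.
move=> e; apply: (tp_ext (f := slice g) (g := slice h)) => a b.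
by rewrite !slice_tn e.
Qed.

Lemma sum_pair_delta (V : lmodType C) (I J : finType) (i : I) (f : I * J -> V) :
  \sum_u (u.1 == i)%:R *: f u = \sum_j f (i, j).
Proof.
rewrite sum_prod (bigD1 i) //= [X in _ + X]big1 ?addr0 => [|i' ii].
  by apply: eq_bigr => j _; rewrite eqxx scale1r.
by rewrite big1 // => j _; rewrite (negPf ii) scale0r.
Qed.

(** [z] is read as a cp map [ph], defined by slices of [z] along block matrices that annihilate [J].
    The Choi matrix of an extension to all matrices, with the conjugation by [B] undone, is a
    positive [P] such that [z] is the sum of the [P (x) (e_ab + J)]. *)
Theorem injective_min_max (I : opsys R) (hI : injective_opsys I) n (J : {vspace 'M[C]_n})
  (Jnull : null_subspace J) (Z : tprod (os_car I) (matn_quot_car J)) k (z : 'M[Z]_k) :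
  (forall p q (f : {linear os_car I -> 'M[C]_p}) (g : {linear matn_quot_car J -> 'M[C]_q}),
     @ucp R I (matn R p) f -> @ucp R (matn_quot J) (matn R q) g ->
     psd (fun u v : 'I_k * 'I_(p * q) => mxmap Z f g (z u.1 v.1) u.2 v.2)) ->
  forall e : R, 0 < e -> @maxD R I (matn_quot J) Z k (z + @tunit R I (matn_quot J) Z k e).
Proof.
move=> hmin e e0.
have hsl := min_slices Jnull hmin.
have [D [mu mu0 Dp] DJ] := faithful_annihilator Jnull.
have Dpd : pd D by exists mu.
have [B0 BE] := psd_factor (pd_psd Dpd).
pose B : 'M[C]_n := \matrix_(c, a) B0 c a.
have DE a b : D a b = \sum_c conjC (B c a) * B c b.
  by rewrite BE; apply: eq_bigr => c _; rewrite !mxE.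
have Bu : B \in unitmx.
  by apply: (psd_lower_unit mu0); apply: eq_psd Dp => a b; rewrite DE.
pose Bi := invmx B.
have BiB : Bi *m B = 1%:M by exact: mulVmx.
pose K : finType := ('I_k * 'I_n)%type; pose N := #|K|.
pose rk (u : K) : 'I_N := enum_rank u.
have /choice[t0 t0E] : forall ij : 'I_k * 'I_k, exists t : 'I_n -> 'I_n -> os_car I,
    z ij.1 ij.2 = \sum_a \sum_b tn (t a b) (qpi J (delta_mx a b)).
  by move=> ij; exact: quot_coords.
pose t (u v : K) := t0 (u.1, v.1) u.2 v.2.
have zE i j : z i j = \sum_a \sum_b tn (t (i, a) (j, b)) (qpi J (delta_mx a b)) by exact: (t0E (i, j)).
(* The faithful functional [D = B^* B] is the image of the unit under [cj], so the block
   matrices annihilating [J] are the image of a matrix system. *)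
pose cj (x : 'M[C]_N) i j : 'M[C]_n := (B ^t conjC)%sesqui *m block x i j *m B.
have cjP a x y i j : cj (a *: x + y) i j = a *: cj x i j + cj y i j.
  by rewrite /cj blockP mulmxDr mulmxDl -scalemxAr -scalemxAl.
have cjPe k' x y i j a b : cj (k' *: x + y) i j a b = k' * cj x i j a b + cj y i j a b.
  by rewrite cjP; move: (cj x i j) (cj y i j) => p q; rewrite !mxE.
have cjE x i j a b : cj x i j a b = \sum_c \sum_d conjC (B c a) * B d b * x (rk (i, c)) (rk (j, d)).
  rewrite mxE exchange_big; apply: eq_bigr => d _; rewrite mxE mulr_suml; apply: eq_bigr => c _.
  by rewrite !mxE; ring.
have starM (M M' : 'M[C]_n) : ((M *m M') ^t conjC)%sesqui = (M' ^t conjC)%sesqui *m (M ^t conjC)%sesqui.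
  by rewrite trmx_mul map_mxM.
have cjS x i j : cj (x ^t conjC)%sesqui i j = (cj x j i ^t conjC)%sesqui.
  rewrite /cj block_adj; move: (block x j i) => y; rewrite !starM trmxCK mulmxA //.
have cj1 i j : cj 1%:M i j = (i == j)%:R *: D.
  have -> : cj 1%:M i j = (i == j)%:R *: ((B ^t conjC)%sesqui *m B).
    rewrite /cj block1.
    by rewrite mul_mx_scalar -scalemxAl.
  congr (_ *: _); apply/matrixP => a b; rewrite DE mxE; apply: eq_bigr => c _; by rewrite !mxE.
have [U UE] : exists U : {vspace 'M[C]_N}, forall x, x \in U <->
    (forall i j y, y \in J -> mxpair (cj x i j) y = 0).
  apply: vspace_of_pred.
    move=> i j y _; have -> : cj 0 i j = 0; last exact: mxpair0.
    by rewrite /cj block0 mulmx0 mul0mx.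
  move=> a x y hx hy i j w wJ; by rewrite cjP mxpairPl hx // hy // mulr0 addr0.
have [Jstar _] := Jnull.
have U1 : 1%:M \in U.
  by apply/UE => i j y yJ; rewrite cj1 mxpairC mxpairZr mxpairC DJ // mulr0.
have Us A : A \in U -> (A ^t conjC)%sesqui \in U.
  move=> /UE h; apply/UE => i j y yJ; rewrite cjS.
  by rewrite -[y]trmxCK mxpair_star trmxCK h ?rmorph0 //; exact: Jstar.
pose Q := MatrixSystem U1 Us.
pose ph (x : subvs_of U) : os_car I := \sum_i \sum_j \sum_a \sum_b cj (vsval x) i j a b *: t (i, a) (j, b).
have phl : linear ph.
  move=> a x y; have vP : vsval (a *: x + y) = a *: vsval x + vsval y by rewrite linearP.
  rewrite /ph vP; do 4!(rewrite scaler_sumr -big_split; apply: eq_bigr => ? _).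
  by rewrite (cjPe a (vsval x) (vsval y)) scalerDl scalerA.
have Ux (x : subvs_of U) : forall i j y, y \in J -> mxpair (cj (vsval x) i j) y = 0 by apply/UE; exact: subvsP.
have phE x : ph x = \sum_i \sum_j slice (qfunl (Ux x i j)) (z i j).
  by apply: eq_bigr => i _; apply: eq_bigr => j _; rewrite zE slice_coords.
(* A positive matrix over the system has positive image under [cj], with blocks annihilating [J]; it
   is therefore a cp map [g] from the quotient, and [min_slices] makes the slices along [g]
   positive. *)
have cph : @cp R (ms_opsys Q) I (mklin phl).
  move=> p X /(mo_cone_os (S := ms_opsys Q)) hX.
  have hX' : psd (fun u v : 'I_p * 'I_N => vsval (X u.1 v.1) u.2 v.2).
    by apply/(gcone_matn (fun i j => vsval (X i j))) => xi; exact: hX.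
  pose Qp : finType := ('I_p * 'I_k)%type.
  pose r (s s' : Qp) := cj (vsval (X s.1 s'.1)) s.2 s'.2.
  have hr s s' x : x \in J -> mxpair (r s s') x = 0 by exact: Ux.
  have pr : psd (fun u v : Qp * 'I_n => r u.1 v.1 u.2 v.2).
    have := psd_block_compress (fun c a => B c a) (psd_reindex (fun u : Qp * 'I_n => (u.1.1, rk (u.1.2, u.2))) hX').
    by apply: eq_psd => u v; rewrite cjE.
  pose q := #|Qp|.
  pose g (y : matn_quot_car J) : 'M[C]_q := \matrix_(s, s') (qfunl (hr (enum_val s) (enum_val s')) y : C).
  have gl : linear g by move=> a x y; apply/matrixP => s s'; rewrite mxE linearP !mxE.
  have cg : @cp R (matn_quot J) (matn R q) (mklin gl).
    move=> m Y hY; apply/mo_cone_matn.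
    apply: eq_psd (psd_reindex (fun u : 'I_m * 'I_q => (u.1, enum_val u.2 : Qp)) (functionals_quot_psd hr pr hY)) => u v.
    by rewrite mxE /= mxE.
  have h1 := gcone_reindex (fun s : Qp => (s.2, enum_rank s)) (hsl q _ cg).
  have h2 := gcone_compress (fun (s : Qp) (i : 'I_p) => (s.1 == i)%:R) h1.
  apply/(mo_cone_os (S := I)); apply: eq_gcone h2 => i j; rewrite mxE /= phE.
  under eq_bigr do (under eq_bigr do rewrite rmorph_nat -scalerA; rewrite -scaler_sumr sum_pair_delta).
  rewrite sum_pair_delta; apply: eq_bigr => i' _; apply: eq_bigr => j' _ /=.
  by apply: slice_ext => y; rewrite /= mxE !enum_rankK.
have [psi cpsi psiE] := injective_cp_extension hI cph.
pose P0 (u v : 'I_N) : os_car I := psi (delta_mx u v).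
have hP0 : gcone P0 by have /(os_mconeP (S := I)) := choi_cone cpsi.
pose P (u v : K) : os_car I := \sum_c \sum_d (conjC (Bi u.2 c) * Bi v.2 d) *: P0 (rk (u.1, c)) (rk (v.1, d)).
have hP : gcone P.
  have := gcone_compress (fun w u : K => (w.1 == u.1)%:R * Bi u.2 w.2) (gcone_reindex (fun u : K => rk u) hP0).
  apply: eq_gcone => u v.
  transitivity (\sum_w (w.1 == u.1)%:R *: \sum_w' (w'.1 == v.1)%:R *:
      ((conjC (Bi u.2 w.2) * Bi v.2 w'.2) *: P0 (rk w) (rk w'))).
    apply: eq_bigr => w _; rewrite scaler_sumr; apply: eq_bigr => w' _.
    by rewrite !scalerA rmorphM rmorph_nat; congr (_ *: _); ring.
  by under eq_bigr do rewrite sum_pair_delta; rewrite sum_pair_delta.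
(* [P] and the coordinates [t] agree on the annihilator of [J]: its elements are pulled back by [B]
   to the system, where [psi] extends [ph]. *)
have key i j rho (hrho : forall x, x \in J -> mxpair rho x = 0) :
    \sum_a \sum_b rho a b *: P (i, a) (j, b) = \sum_a \sum_b rho a b *: t (i, a) (j, b).
  pose x0 : 'M[C]_n := (Bi ^t conjC)%sesqui *m rho *m Bi.
  pose x : 'M[C]_N := \matrix_(u, v) ((((enum_val u : K).1 == i) && ((enum_val v : K).1 == j))%:R * x0 (enum_val u : K).2 (enum_val v : K).2).
  have blx i' j' : block x i' j' = ((i' == i) && (j' == j))%:R *: x0.
    by apply/matrixP => c d; rewrite !mxE !enum_rankK.
  have cjx i' j' : cj x i' j' = ((i' == i) && (j' == j))%:R *: rho.
    rewrite /cj blx -scalemxAr -scalemxAl; congr (_ *: _).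
    by rewrite /x0 !mulmxA -starM BiB trmx1 map_mx1 mul1mx -mulmxA BiB mulmx1.
  have xU : x \in U.
    by apply/UE => i' j' y yJ; rewrite cjx mxpairC mxpairZr mxpairC hrho // mulr0.
  have := psiE (Subvs xU); rewrite /= /ph /= => e1.
  transitivity (psi x).
    rewrite -(choi_mapE psi) /choi_map sum_enum_rank.
    transitivity (\sum_w (w.1 == i)%:R *: \sum_w' (w'.1 == j)%:R *: (x0 w.2 w'.2 *: P0 (rk w) (rk w'))); last first.
      apply: eq_bigr => w _; rewrite sum_enum_rank scaler_sumr; apply: eq_bigr => w' _.
      by rewrite !scalerA [x _ _]mxE !enum_rankK -mulnb natrM.
    under [RHS]eq_bigr do rewrite sum_pair_delta; rewrite sum_pair_delta /=.
    transitivity (\sum_a \sum_b \sum_c \sum_d (rho a b * (conjC (Bi a c) * Bi b d)) *: P0 (rk (i, c)) (rk (j, d))).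
      apply: eq_bigr => a _; apply: eq_bigr => b _; rewrite scaler_sumr; apply: eq_bigr => c _.
      by rewrite scaler_sumr; apply: eq_bigr => d _; rewrite scalerA.
    rewrite exchange_big22; apply: eq_bigr => c _; apply: eq_bigr => d _.
    rewrite /x0 mxE scaler_suml exchange_big; apply: eq_bigr => b _.
    rewrite mxE mulr_suml scaler_suml; apply: eq_bigr => a _; congr (_ *: _).
    by rewrite !mxE; ring.
  rewrite e1 (bigD1 i) //= [X in _ + X]big1 ?addr0 => [|i' ii]; last first.
    rewrite big1 // => j' _; rewrite big1 // => a _; rewrite big1 // => b _.
    by rewrite cjx (negPf ii) !mxE mul0r scale0r.
  rewrite (bigD1 j) //= [X in _ + X]big1 ?addr0 => [|j' jj]; last first.
    rewrite big1 // => a _; rewrite big1 // => b _.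
    by rewrite cjx (negPf jj) andbF !mxE mul0r scale0r.
  by apply: eq_bigr => a _; apply: eq_bigr => b _; rewrite cjx !eqxx scale1r.
have zP i j : z i j = \sum_a \sum_b tn (P (i, a) (j, b)) (qpi J (delta_mx a b)).
  apply/eqP; rewrite -subr_eq0; apply/eqP; apply: (slice_inj (@quot_sep R n J)) => _ [r [hr ->]].
  by rewrite linearB zE !slice_coords key // subrr.
(* The factors are [P + e] and the classes of the matrix units. The scalar matrix identifies the
   inner index of [P] with that of the matrix units; the diagonal classes add up to the unit, so the
   summand [e] becomes [e] times the unit. *)
exists K, 'I_n, (fun u v => P u v + (e%:C%C * (u == v)%:R) *: os_one I).
exists (fun a b => qpi J (delta_mx a b)), (fun u a i => (u.1 == i)%:R * (u.2 == a)%:R).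
split.
  apply/(os_mconeP (S := I)); apply: gcone_add => //; apply: gcone_pos; last exact: os_pos_one.
  by apply: psd_scale; [rewrite ler0c ltW|exact: psd_id].
  exact: (choi_cone (@qpi_cp R n J)).
have sum_delta1 (V : lmodType C) (c : 'I_n) (f : 'I_n -> V) : \sum_a (c == a)%:R *: f a = f c.
  rewrite (bigD1 c) //= big1 ?addr0 ?eqxx ?scale1r // => a ac.
  by rewrite eq_sym (negPf ac) scale0r.
apply/matrixP => i j; rewrite mxE tunitE [X in _ + X]mxE [RHS]mxE.
pose f (u v : K) a b : Z := tn (P u v + (e%:C%C * (u == v)%:R) *: os_one I) (qpi J (delta_mx a b)).
transitivity (\sum_u (u.1 == i)%:R *: \sum_a (u.2 == a)%:R *:
   \sum_v (v.1 == j)%:R *: \sum_b (v.2 == b)%:R *: f u v a b); last first.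
  apply: eq_bigr => u _; rewrite scaler_sumr; apply: eq_bigr => a _.
  rewrite !scaler_sumr; apply: eq_bigr => v _; rewrite !scaler_sumr; apply: eq_bigr => b _.
  by rewrite !scalerA rmorphM !rmorph_nat mulrA.
under eq_bigr do rewrite sum_delta1.
under eq_bigr do under eq_bigr do rewrite sum_delta1.
under eq_bigr do rewrite sum_pair_delta; rewrite sum_pair_delta /= /f zP.
under [RHS]eq_bigr do under eq_bigr do rewrite tnDl tnZl xpair_eqE.
under [RHS]eq_bigr do rewrite big_split /=; rewrite big_split /=; congr (_ + _).
have -> : matn_quot_one J = \sum_a qpi J (delta_mx a a).
  rewrite -[matn_quot_one J]/(qpi J 1%:M) -[qpi J]/(mklin (qpi_linear J) : _ -> _) -linear_sum; congr (mklin _ _).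
  apply/matrixP => a b; rewrite summxE mxE (bigD1 a) //= big1 ?addr0 => [|c ca].
    by rewrite mxE eqxx [a == b]eq_sym.
  by rewrite mxE eq_sym (negPf ca).
rewrite tn_sumr scaler_sumr; apply: eq_bigr => a _.
rewrite (bigD1 a) //= big1 ?addr0 ?eqxx ?andbT // => b ba.
by rewrite [a == b]eq_sym (negPf ba) andbF mulr0 scale0r.
Qed.
End MinMax.

(** * Hilbert sums *)

Section FamilySum.
Variables (R : realType) (T : choiceType).
Implicit Types a b r : T -> R.

Definition bounded_sum a := exists M : R, forall s, uniq s -> \sum_(i <- s) a i <= M.

(** The sum of a nonnegative family over an arbitrary index set, as a supremum of partial sums;
    duplicate-free sequences stand for finite subsets. *)
Definition psum a : R := sup [set x | exists2 s, uniq s & x = \sum_(i <- s) a i]%classic.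

Lemma psum_ub a s : bounded_sum a -> uniq s -> \sum_(i <- s) a i <= psum a.
Proof.
move=> [M hM] us; apply: ub_le_sup; last by exists s.
by exists M => _ [s' us' ->]; exact: hM.
Qed.

Lemma psum_le a M : (forall s, uniq s -> \sum_(i <- s) a i <= M) -> psum a <= M.
Proof.
move=> h; apply: ge_sup; first by exists 0; exists [::]; rewrite ?big_nil.
by move=> _ [s us ->]; exact: h.
Qed.

Lemma psum_ge0 a : bounded_sum a -> 0 <= psum a.
Proof. by move=> h; have := psum_ub h (s := [::]) isT; rewrite big_nil. Qed.

Lemma sum_sub_uniq a (s u : seq T) : (forall i, 0 <= a i) -> uniq s -> uniq u ->
  {subset s <= u} -> \sum_(i <- s) a i <= \sum_(i <- u) a i.
Proof.
move=> a0 us uu su; rewrite [leRHS](bigID (mem s)) /=.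
have -> : \sum_(i <- u | i \in s) a i = \sum_(i <- s) a i; last by rewrite lerDl; apply: sumr_ge0.
rewrite -big_filter; apply: perm_big; apply: uniq_perm => //; first exact: filter_uniq.
by move=> i; rewrite mem_filter; case: (boolP (i \in s)) => // /su ->.
Qed.

Lemma bounded_sumD a b : bounded_sum a -> bounded_sum b -> bounded_sum (fun i => a i + b i).
Proof.
move=> [M hM] [N hN]; exists (M + N) => s us; rewrite big_split; apply: lerD; auto.
Qed.

Lemma bounded_sumZ (k : R) a : 0 <= k -> bounded_sum a -> bounded_sum (fun i => k * a i).
Proof. by move=> k0 [M hM]; exists (k * M) => s us; rewrite -mulr_sumr ler_wpM2l ?hM. Qed.

Lemma bounded_sum_le a b : (forall i, a i <= b i) -> bounded_sum b -> bounded_sum a.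
Proof.
move=> ab [M hM]; exists M => s us; apply: le_trans (hM s us).
by apply: ler_sum => i _; exact: ab.
Qed.

Lemma psumD a b : (forall i, 0 <= a i) -> (forall i, 0 <= b i) ->
  bounded_sum a -> bounded_sum b -> psum (fun i => a i + b i) = psum a + psum b.
Proof.
move=> a0 b0 ha hb; apply/eqP; rewrite eq_le; apply/andP; split.
  by apply: psum_le => s us; rewrite big_split; apply: lerD; exact: psum_ub.
rewrite -lerBrDr; apply: psum_le => s us; rewrite lerBrDr -lerBrDl; apply: psum_le => t ut.
rewrite lerBrDl; apply: le_trans (psum_ub (s := undup (s ++ t)) (bounded_sumD ha hb) _); last exact: undup_uniq.
rewrite big_split; apply: lerD; apply: sum_sub_uniq => //; rewrite ?undup_uniq // => i hi.
  by rewrite mem_undup mem_cat hi.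
by rewrite mem_undup mem_cat hi orbT.
Qed.

Lemma psumZ (k : R) a : 0 <= k -> (forall i, 0 <= a i) -> bounded_sum a ->
  psum (fun i => k * a i) = k * psum a.
Proof.
move=> k0 a0 ha; have [->|kn] := eqVneq k 0.
  rewrite mul0r; apply/eqP; rewrite eq_le psum_ge0 ?andbT; last by apply: bounded_sumZ.
  by apply: psum_le => s _; rewrite big1 // => i _; rewrite mul0r.
have kp : 0 < k by rewrite lt_def kn.
apply/eqP; rewrite eq_le; apply/andP; split.
  by apply: psum_le => s us; rewrite -mulr_sumr ler_wpM2l // psum_ub.
rewrite mulrC -ler_pdivlMr //; apply: psum_le => s us.
by rewrite ler_pdivlMr // mulrC mulr_sumr psum_ub //; exact: bounded_sumZ.
Qed.

Definition asummable r := bounded_sum (fun i => `|r i|).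

(** [r] is the difference of the nonnegative families [|r| + r] and [|r|]. By [asumE] every such
    decomposition gives the same value, whence linearity. *)
Definition asum r : R := psum (fun i => `|r i| + r i) - psum (fun i => `|r i|).

Lemma asummable_split r : asummable r -> bounded_sum (fun i => `|r i| + r i).
Proof.
move=> h; apply: bounded_sum_le (bounded_sumD h h) => i.
by rewrite lerD2l ler_norm.
Qed.

Lemma norm_add_ge0 (x : R) : 0 <= `|x| + x.
Proof. by rewrite -[X in _ + X]opprK subr_ge0 -normrN ler_norm. Qed.

Lemma asumE a b r : (forall i, 0 <= a i) -> (forall i, 0 <= b i) ->
  bounded_sum a -> bounded_sum b -> (forall i, r i = a i - b i) ->
  asummable r /\ asum r = psum a - psum b.
Proof.
move=> a0 b0 ha hb rE.
have hr : asummable r.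
  apply: bounded_sum_le (bounded_sumD ha hb) => i; rewrite rE.
  by apply: le_trans (ler_normB _ _) _; rewrite !ger0_norm.
split=> //; rewrite /asum; apply/eqP; rewrite subr_eq addrAC eq_sym subr_eq; apply/eqP.
rewrite -!psumD //; try exact: asummable_split; try (by move=> i; exact: norm_add_ge0).
by congr psum; apply/funext => i; rewrite rE; ring.
Qed.

Lemma asumP r : asummable r -> [/\ (forall i, 0 <= `|r i| + r i), (forall i, 0 <= `|r i|),
  bounded_sum (fun i => `|r i| + r i), bounded_sum (fun i => `|r i|) & forall i, r i = (`|r i| + r i) - `|r i|].
Proof.
move=> h; split=> // [i||i]; [exact: norm_add_ge0|exact: asummable_split|by rewrite addrC addKr].
Qed.

Lemma asum_pos a : (forall i, 0 <= a i) -> bounded_sum a -> asummable a /\ asum a = psum a.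
Proof.
move=> a0 ha; have z : bounded_sum (fun _ : T => 0) by exists 0 => s _; rewrite big1.
have [|h ->] := asumE a0 (fun _ => lexx 0) ha z (r := a); first by move=> i; rewrite subr0.
split=> //; rewrite [X in _ - X](_ : _ = 0) ?subr0 //.
apply/eqP; rewrite eq_le psum_ge0 // andbT; apply: psum_le => s _; by rewrite big1.
Qed.

Lemma asumD r s : asummable r -> asummable s ->
  asummable (fun i => r i + s i) /\ asum (fun i => r i + s i) = asum r + asum s.
Proof.
move=> /asumP[r1 r2 r3 r4 rE] /asumP[s1 s2 s3 s4 sE].
have [|h ->] := asumE (fun i => addr_ge0 (r1 i) (s1 i)) (fun i => addr_ge0 (r2 i) (s2 i))
  (bounded_sumD r3 s3) (bounded_sumD r4 s4) (r := fun i => r i + s i).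
  by move=> i; rewrite {1}rE {1}sE opprD addrACA.
by split=> //; rewrite (psumD r1 s1 r3 s3) (psumD r2 s2 r4 s4) opprD addrACA.
Qed.

Lemma asumN r : asummable r -> asummable (fun i => - r i) /\ asum (fun i => - r i) = - asum r.
Proof.
move=> /asumP[r1 r2 r3 r4 rE].
have [|h ->] := asumE r2 r1 r4 r3 (r := fun i => - r i).
  by move=> i; rewrite {1}rE opprB.
by rewrite opprB.
Qed.

Lemma asumZ k r : asummable r -> asummable (fun i => k * r i) /\ asum (fun i => k * r i) = k * asum r.
Proof.
have pos q s : 0 <= q -> asummable s -> asummable (fun i => q * s i) /\ asum (fun i => q * s i) = q * asum s.
  move=> q0 /asumP[r1 r2 r3 r4 rE].
  have [|h ->] := asumE (fun i => mulr_ge0 q0 (r1 i)) (fun i => mulr_ge0 q0 (r2 i)) (bounded_sumZ q0 r3) (bounded_sumZ q0 r4) (r := fun i => q * s i).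
    by move=> i; rewrite {1}rE mulrBr.
  by rewrite !psumZ // mulrBr.
move=> hr; have [k0|/ltW k0] := leP 0 k; first exact: pos.
rewrite -oppr_ge0 in k0; have [h1 h2] := pos (- k) r k0 hr.
have [h3 h4] := asumN h1.
have e : (fun i => k * r i) = (fun i => - (- k * r i)) by apply/funext => i; rewrite mulNr opprK.
by rewrite e h4 h2 mulNr opprK; split.
Qed.
End FamilySum.

Section DirectSum.
Variable R : realType.
Local Notation C := R[i].
Local Notation conjC := (@Num.conj C).
Local Notation Re := complex.Re.
Local Notation Im := complex.Im.

Section Sq.
Variable H : hilbert R.
Definition hsq (x : H) : R := Re (h_dot H x x).

Lemma hsqE x : (hsq x)%:C%C = h_dot H x x.
Proof. by rewrite ge0_RRe // dot_ge0. Qed.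

Lemma hsq_ge0 x : 0 <= hsq x.
Proof. by rewrite -ler0c hsqE dot_ge0. Qed.

Lemma hsqZ (a : C) x : hsq (a *: x) = (Re a ^+ 2 + Im a ^+ 2) * hsq x.
Proof.
rewrite {1}/hsq dotZl dotZr mulrA -hsqE; case: a => a b /=.
by rewrite !mulr0 subr0 mulrN opprK !expr2.
Qed.

Lemma hsqN x : hsq (- x) = hsq x.
Proof. by rewrite /hsq dotNl dotNr opprK. Qed.

Lemma re_dot_le x y : 2 * Re (h_dot H x y) <= hsq x + hsq y.
Proof.
have := dot_cross x y; rewrite -!hsqE -rmorphD (dotC x y).
by case: (h_dot H x y) => a b; rewrite lecE /= => /andP[_ h]; rewrite mulr_natl mulr2n.
Qed.

Lemma re_dot_abs x y : `|Re (h_dot H x y)| <= hsq x + hsq y.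
Proof.
have h1 := re_dot_le x y; have h2 := re_dot_le (- x) y.
have := hsq_ge0 x; have := hsq_ge0 y; rewrite hsqN dotNl raddfN /= in h2.
by rewrite ler_norml => *; apply/andP; split; lra.
Qed.

Lemma im_dot_abs x y : `|Im (h_dot H x y)| <= hsq x + hsq y.
Proof.
have -> : Im (h_dot H x y) = Re (h_dot H (- 'i%C *: x) y).
  by rewrite dotZl; case: (h_dot H x y) => a b /=; ring.
by apply: le_trans (re_dot_abs _ _) _; rewrite hsqZ /=; have := hsq_ge0 x; nra.
Qed.

Lemma hsqD x y : hsq (x + y) <= 2 * hsq x + 2 * hsq y.
Proof.
rewrite {1}/hsq dotDl !dotDr !raddfD /=; have := re_dot_le x y.
have -> : Re (h_dot H y x) = Re (h_dot H x y) by rewrite (dotC x y); case: (h_dot H x y).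
rewrite -/(hsq x) -/(hsq y); lra.
Qed.

Lemma hsq_eq0 x : hsq x = 0 -> x = 0.
Proof. by move=> h; apply/eqP; rewrite -dot_eq0 -hsqE h. Qed.
End Sq.

Section Sum.
Variables (T : choiceType) (H : T -> hilbert R).

Record l2sum := L2sum {
  l2_val :> forall b, H b;
  l2_bounded : bounded_sum (fun b => hsq (l2_val b))
}.

Lemma l2_eq (x y : l2sum) : (forall b, x b = y b) -> x = y.
Proof.
case: x y => [x hx] [y hy] /= e.
have xy : x = y by apply: functional_extensionality_dep.
by rewrite -xy in hy *; rewrite (Prop_irrelevance hx hy).
Qed.

Lemma l2_add_bounded (x y : l2sum) : bounded_sum (fun b => hsq (x b + y b)).
Proof.
apply: bounded_sum_le (bounded_sumD (bounded_sumZ (ler0n _ 2) (l2_bounded x)) (bounded_sumZ (ler0n _ 2) (l2_bounded y))) => b.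
exact: hsqD.
Qed.

Lemma l2_scale_bounded (a : C) (x : l2sum) : bounded_sum (fun b => hsq (a *: x b)).
Proof.
apply: bounded_sum_le (bounded_sumZ _ (l2_bounded x)) => [b|]; first by rewrite hsqZ.
by rewrite addr_ge0 ?sqr_ge0.
Qed.

Lemma l2_zero_bounded : bounded_sum (fun b => hsq (0 : H b)).
Proof. by exists 0 => s _; rewrite big1 // => b _; rewrite /hsq dot0l. Qed.

Lemma l2_opp_bounded (x : l2sum) : bounded_sum (fun b => hsq (- x b)).
Proof. by apply: bounded_sum_le (l2_bounded x) => b; rewrite hsqN. Qed.

Definition l2_add x y := L2sum (l2_add_bounded x y).
Definition l2_opp x := L2sum (l2_opp_bounded x).
Definition l2_zero := L2sum l2_zero_bounded.
Definition l2_scale a x := L2sum (l2_scale_bounded a x).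

HB.instance Definition _ := gen_eqMixin l2sum.
HB.instance Definition _ := gen_choiceMixin l2sum.

Let addA : associative l2_add.
Proof. by move=> x y z; apply: l2_eq => b; exact: addrA. Qed.
Let addC : commutative l2_add.
Proof. by move=> x y; apply: l2_eq => b; exact: addrC. Qed.
Let add0 : left_id l2_zero l2_add.
Proof. by move=> x; apply: l2_eq => b; exact: add0r. Qed.
Let addN : left_inverse l2_zero l2_opp l2_add.
Proof. by move=> x; apply: l2_eq => b; exact: addNr. Qed.

HB.instance Definition _ := GRing.isZmodule.Build l2sum addA addC add0 addN.

Let scaleA a b x : l2_scale a (l2_scale b x) = l2_scale (a * b) x.
Proof. by apply: l2_eq => c; exact: scalerA. Qed.
Let scale1 : left_id 1 l2_scale.
Proof. by move=> x; apply: l2_eq => c; exact: scale1r. Qed.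
Let scaleDr : right_distributive l2_scale +%R.
Proof. by move=> a x y; apply: l2_eq => c; exact: scalerDr. Qed.
Let scaleDl x : {morph l2_scale^~ x : a b / a + b}.
Proof. by move=> a b; apply: l2_eq => c; exact: scalerDl. Qed.

HB.instance Definition _ := GRing.Zmodule_isLmodule.Build C l2sum scaleA scale1 scaleDr scaleDl.

Lemma l2P a (x y : l2sum) b : (a *: x + y) b = a *: x b + y b.
Proof. by []. Qed.

Lemma l2_re_summable (x y : l2sum) : asummable (fun b => Re (h_dot _ (x b) (y b))).
Proof.
apply: bounded_sum_le (bounded_sumD (l2_bounded x) (l2_bounded y)) => b.
exact: re_dot_abs.
Qed.

Lemma l2_im_summable (x y : l2sum) : asummable (fun b => Im (h_dot _ (x b) (y b))).
Proof.
apply: bounded_sum_le (bounded_sumD (l2_bounded x) (l2_bounded y)) => b.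
exact: im_dot_abs.
Qed.

Definition csum (f : T -> C) : C := (asum (fun b => Re (f b)) +i* asum (fun b => Im (f b)))%C.

Lemma csumP (f g : T -> C) (a : C) :
  asummable (fun b => Re (f b)) -> asummable (fun b => Im (f b)) ->
  asummable (fun b => Re (g b)) -> asummable (fun b => Im (g b)) ->
  csum (fun b => a * f b + g b) = a * csum f + csum g.
Proof.
case: a => x y f1 f2 g1 g2; rewrite /csum.
have [xf1 xf1E] := asumZ x f1; have [yf2 yf2E] := asumZ (- y) f2.
have [xf2 xf2E] := asumZ x f2; have [yf1 yf1E] := asumZ y f1.
have [h1 e1] := asumD xf1 yf2; have [h2 e2] := asumD xf2 yf1.
have [h3 e3] := asumD h1 g1; have [h4 e4] := asumD h2 g2.
rewrite [X in (X +i* _)%C](_ : _ = x * asum (fun b => Re (f b)) + - y * asum (fun b => Im (f b)) + asum (fun b => Re (g b))); last first.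
  rewrite -xf1E -yf2E -e1 -e3; congr asum; apply/funext => b.
  by case: (f b) (g b) => [p q] [p' q'] /=; ring.
rewrite [X in (_ +i* X)%C](_ : _ = x * asum (fun b => Im (f b)) + y * asum (fun b => Re (f b)) + asum (fun b => Im (g b))); last first.
  rewrite -xf2E -yf1E -e2 -e4; congr asum; apply/funext => b.
  by case: (f b) (g b) => [p q] [p' q'] /=; ring.
by apply/eqP; rewrite eq_complex /=; apply/andP; split; apply/eqP; ring.
Qed.

Lemma csum_conj (f : T -> C) : asummable (fun b => Im (f b)) ->
  csum (fun b => conjC (f b)) = conjC (csum f).
Proof.
move=> h; have [_ e] := asumN h; apply/eqP; rewrite eq_complex /= -e; apply/andP; split; apply/eqP; congr asum; apply/funext => b; by case: (f b).
Qed.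

Definition l2_dot (x y : l2sum) : C := csum (fun b => h_dot _ (x b) (y b)).

Lemma l2_dotPl a x y z : l2_dot (a *: x + y) z = a * l2_dot x z + l2_dot y z.
Proof.
rewrite /l2_dot -csumP; try exact: l2_re_summable; try exact: l2_im_summable.
by congr csum; apply/funext => b; rewrite l2P dotDl dotZl.
Qed.

Lemma l2_dotC x y : l2_dot y x = conjC (l2_dot x y).
Proof.
rewrite /l2_dot -csum_conj; last exact: l2_im_summable.
by congr csum; apply/funext => b; rewrite -dotC.
Qed.

Lemma l2_dot_bilinear : bilinear_for *%R (conjC \; *%R) l2_dot.
Proof.
split=> [z a x y|z a x y]; first exact: l2_dotPl.
by rewrite (l2_dotC (a *: x + y) z) l2_dotPl rmorphD rmorphM (l2_dotC x z) (l2_dotC y z).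
Qed.

HB.instance Definition _ :=
  bilinear_isBilinear.Build C l2sum l2sum C *%R (conjC \; *%R) l2_dot l2_dot_bilinear.

Lemma l2_dot_hermitian x y : l2_dot x y = (-1) ^+ false * conjC (l2_dot y x).
Proof. by rewrite mul1r -l2_dotC. Qed.

HB.instance Definition _ :=
  isHermitianSesquilinear.Build C l2sum false conjC l2_dot l2_dot_hermitian.

Lemma l2_dotE x : l2_dot x x = (psum (fun b => hsq (x b)))%:C%C.
Proof.
rewrite /l2_dot /csum; have [_ e] := asum_pos (fun b => hsq_ge0 (x b)) (l2_bounded x).
rewrite -e; congr (_ +i* _)%C.
have z0 : bounded_sum (fun _ : T => 0 : R) by exists 0 => s _; rewrite big1.
have [_ e0] := asum_pos (fun _ => lexx 0) z0.
rewrite (_ : (fun b => _) = fun=> 0); last by apply/funext => b; rewrite -hsqE.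
rewrite e0; apply/eqP; rewrite eq_le psum_ge0 // andbT; apply: psum_le => s _; by rewrite big1.
Qed.

Lemma l2_dot_gt0 x : x != 0 -> 0 < l2_dot x x.
Proof.
move=> x0; rewrite l2_dotE ltcR lt_def psum_ge0 ?andbT; last exact: l2_bounded.
apply: contra x0 => /eqP h; apply/eqP; apply: l2_eq => b; apply: hsq_eq0.
apply/eqP; rewrite eq_le hsq_ge0 andbT -h.
by have := psum_ub (s := [:: b]) (l2_bounded x) isT; rewrite big_seq1.
Qed.

HB.instance Definition _ := isDotProduct.Build C l2sum l2_dot l2_dot_gt0.

(** The coordinates converge by completeness of each summand. On a finite set of coordinates the
    limit is compared with a late [u m] that depends on the set; the resulting bound does not, and
    passes to the supremum. *)
Lemma l2_complete (u : nat -> l2sum) :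
  (forall e : R, 0 < e -> exists N, forall m n, (N <= m)%N -> (N <= n)%N ->
     dot_norm l2_dot (u m - u n) < e) ->
  exists l, forall e : R, 0 < e -> exists N, forall n, (N <= n)%N ->
    dot_norm l2_dot (u n - l) < e.
Proof.
move=> hu.
have dn x : dot_norm l2_dot x = Num.sqrt (psum (fun b => hsq (x b))) by rewrite /dot_norm l2_dotE.
have sq_lt (p e : R) : 0 < e -> Num.sqrt p < e -> p < e ^+ 2.
  by move=> e0; rewrite -{1}(ger0_norm (ltW e0)) -sqrtr_sqr ltr_sqrt // exprn_gt0.
have pt b : exists l, forall e : R, 0 < e -> exists N, forall n, (N <= n)%N ->
    dot_norm (@h_dot R (H b)) (u n b - l) < e.
  apply: h_complete => e e0; have [N hN] := hu e e0; exists N => m n Nm Nn.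
  apply: le_lt_trans (hN m n Nm Nn); rewrite dn; apply: ler_wsqrtr.
  by have := psum_ub (s := [:: b]) (l2_bounded (u m - u n)) isT; rewrite big_seq1.
pose l b := projT1 (cid (pt b)).
have lP b e : 0 < e -> exists N, forall n, (N <= n)%N -> hsq (u n b - l b) < e ^+ 2.
  move=> e0; have [N hN] := projT2 (cid (pt b)) e e0; exists N => n Nn.
  exact: sq_lt (hN n Nn).
have fin s d : 0 < d -> exists M, forall m, (M <= m)%N -> \sum_(b <- s) hsq (u m b - l b) <= d.
  elim: s d => [|b s IH] d d0; first by exists 0%N => m _; rewrite big_nil ltW.
  have d2 : 0 < d / 2 by rewrite divr_gt0.
  have [M hM] := IH _ d2; have sd : 0 < Num.sqrt (d / 2) by rewrite sqrtr_gt0.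
  have [N hN] := lP b _ sd; exists (maxn M N) => m; rewrite geq_max => /andP[Mm Nm].
  rewrite big_cons; have := hM m Mm; have := hN m Nm; rewrite sqr_sqrtr ?(ltW d2) //; lra.
have tail e : 0 < e -> exists N, forall n, (N <= n)%N -> forall s, uniq s ->
    \sum_(b <- s) hsq (u n b - l b) <= e ^+ 2 / 4.
  move=> e0; have e4 : 0 < e / 4 by rewrite divr_gt0.
  have [N hN] := hu _ e4; exists N => n Nn s us.
  (* [hsqD] doubles both contributions: [2 (e / 4)^2 + 2 e^2 / 16 = e^2 / 4]. *)
  have e16 : 0 < e ^+ 2 / 16 by rewrite divr_gt0 // exprn_gt0.
  have [M hM] := fin s _ e16; pose m := maxn M N.
  have h1 := hM m (leq_maxl _ _).
  have h2 : \sum_(b <- s) hsq (u n b - u m b) <= (e / 4) ^+ 2.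
    apply: le_trans (psum_ub (l2_bounded (u n - u m)) us) _; apply/ltW/sq_lt => //.
    by rewrite -dn; apply: hN => //; exact: leq_maxr.
  have h3 : \sum_(b <- s) hsq (u n b - l b) <=
      2 * \sum_(b <- s) hsq (u n b - u m b) + 2 * \sum_(b <- s) hsq (u m b - l b).
    rewrite !mulr_sumr -big_split; apply: ler_sum => b _.
    have -> : u n b - l b = (u n b - u m b) + (u m b - l b) by rewrite addrA subrK.
    exact: hsqD.
  have e2 : (e / 4) ^+ 2 = e ^+ 2 / 16 by field.
  rewrite e2 in h2; lra.
have [N0 hN0] := tail 1 ltr01.
have lb : bounded_sum (fun b => hsq (l b)).
  have hb : bounded_sum (fun b => hsq (u N0 b - l b)) by exists (1 ^+ 2 / 4); exact: hN0.
  apply: bounded_sum_le (bounded_sumD (bounded_sumZ (ler0n _ 2) (l2_bounded (u N0))) (bounded_sumZ (ler0n _ 2) hb)) => b.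
  rewrite -(hsqN (u N0 b - l b)); have := hsqD (u N0 b) (- (u N0 b - l b)).
  by rewrite [X in hsq X <= _ -> _](_ : _ = l b) // opprB addrC subrK.
exists (L2sum lb) => e e0; have [N hN] := tail e e0; exists N => n Nn.
rewrite dn -[X in _ < X](ger0_norm (ltW e0)) -sqrtr_sqr ltr_sqrt ?exprn_gt0 //.
apply: le_lt_trans (psum_le (hN n Nn)) _.
by rewrite ltr_pdivrMr // ltr_pMr ?exprn_gt0 // ltr1n.
Qed.

Definition l2_hilbert : hilbert R := @Hilbert R l2sum l2_dot l2_complete.
End Sum.
End DirectSum.

(** * Operator systems represented on a Hilbert sum *)

Section Representation.
Variable R : realType.
Local Notation C := R[i].
Local Notation conjC := (@Num.conj C).
Local Notation Re := complex.Re.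
Local Notation Im := complex.Im.

Section Csum.
Variable T : choiceType.
Implicit Types f : T -> C.
Definition csummable f := asummable (fun b => Re (f b)) /\ asummable (fun b => Im (f b)).

Lemma csummable0 : csummable (fun _ : T => 0).
Proof. by split; exists 0 => s _; rewrite big1 // => b _; rewrite normr0. Qed.

Lemma csummableD f g : csummable f -> csummable g -> csummable (fun b => f b + g b).
Proof.
move=> [f1 f2] [g1 g2]; have [h1 _] := asumD f1 g1; have [h2 _] := asumD f2 g2.
by split; [move: h1|move: h2]; congr (asummable _); apply/funext => b; rewrite raddfD.
Qed.

Lemma csumD f g : csummable f -> csummable g -> csum (fun b => f b + g b) = csum f + csum g.
Proof.
move=> [f1 f2] [g1 g2]; have := csumP 1 f1 f2 g1 g2; rewrite mul1r => <-.
by congr csum; apply/funext => b; rewrite mul1r.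
Qed.

Lemma csum_ge0 f : csummable f -> (forall b, 0 <= f b) -> 0 <= csum f.
Proof.
move=> [h1 _] f0.
have r0 b : 0 <= Re (f b) by rewrite -ler0c ge0_RRe.
have i0 : (fun b => Im (f b)) = (fun=> 0) by apply/funext => b; rewrite -(ge0_RRe (f0 b)).
have hb : bounded_sum (fun b => Re (f b)).
  by apply: bounded_sum_le h1 => b; rewrite ger0_norm.
have [_ e1] := asum_pos r0 hb.
have z0 : bounded_sum (fun _ : T => 0 : R) by exists 0 => s _; rewrite big1.
have [_ e0] := asum_pos (fun _ => lexx 0) z0.
have p0 : psum (fun _ : T => 0 : R) = 0.
  by apply/eqP; rewrite eq_le psum_ge0 // andbT; apply: psum_le => s _; rewrite big1.
by rewrite /csum i0 e1 e0 p0 lecE /= eqxx psum_ge0.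
Qed.

Lemma csum_sum (I : finType) (F : I -> T -> C) : (forall i, csummable (F i)) ->
  csummable (fun b => \sum_i F i b) /\ csum (fun b => \sum_i F i b) = \sum_i csum (F i).
Proof.
move=> hF; elim: (index_enum I) => [|i s [IH1 IH2]].
  have -> : (fun b : T => \sum_(i <- [::]) F i b) = (fun=> 0) by apply/funext => b; rewrite big_nil.
  split; first exact: csummable0; rewrite big_nil.
  have := csumD csummable0 csummable0; rewrite (_ : (fun=> 0 + 0) = (fun=> 0)) ?addr0 //.
  by move=> h; apply: (@addrI _ (csum (fun=> 0))); rewrite addr0; exact: esym h.
have -> : (fun b : T => \sum_(j <- i :: s) F j b) = (fun b => F i b + \sum_(j <- s) F j b).
  by apply/funext => b; rewrite big_cons.
by rewrite big_cons -IH2 -csumD //; split=> //; exact: csummableD.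
Qed.

Lemma asum_single (r : T -> R) b0 : (forall b, b != b0 -> r b = 0) -> asum r = r b0.
Proof.
have ps (a : T -> R) : (forall b, 0 <= a b) -> (forall b, b != b0 -> a b = 0) -> psum a = a b0.
  move=> a0 az.
  have le s : uniq s -> \sum_(b <- s) a b <= a b0.
    elim: s => [|b s IH]; first by rewrite big_nil.
    rewrite big_cons => /andP[bs us]; have [e|bb] := eqVneq b b0; last by rewrite az // add0r IH.
    rewrite e big_seq big1 ?addr0 // => c cs; apply: az; apply: contra bs => /eqP ec.
    by rewrite e -ec.
  have hb : bounded_sum a by exists (a b0).
  apply/eqP; rewrite eq_le psum_le //=.
  by have := psum_ub (s := [:: b0]) hb isT; rewrite big_seq1.
move=> rz; rewrite /asum (ps (fun b => `|r b| + r b)) ?(ps (fun b => `|r b|)) //.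
  by rewrite addrC addKr.
  by move=> b /rz ->; rewrite normr0.
  by move=> b; exact: norm_add_ge0.
by move=> b /rz ->; rewrite normr0 addr0.
Qed.

Lemma csum_single f b0 : (forall b, b != b0 -> f b = 0) -> csum f = f b0.
Proof.
move=> fz; rewrite /csum (asum_single (b0 := b0)) ?(asum_single (r := fun b => Im (f b)) (b0 := b0)) => [|b /fz ->|b /fz ->] //.
by case: (f b0).
Qed.
End Csum.

Variables (V : lmodType C) (u : V) (B : choiceType) (T : B -> opsys R).
Variable beta : forall b, {linear V -> os_car (T b)}.
Hypothesis beta1 : forall b, beta b u = os_one (T b).
Hypothesis beta_star : forall x, exists y, forall b, os_star (beta b x) = beta b y.
Hypothesis beta_bd : forall x, exists2 M : R, 0 <= M & forall b v,
  hsq (os_act (T b) (beta b x) v) <= M ^+ 2 * hsq v.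
Hypothesis beta_inj : forall x, (forall b, beta b x = 0) -> x = 0.

Local Notation HH := (l2_hilbert (fun b => os_hilb (T b))).

Lemma rep_act_bounded_sum (x : V) (xi : HH) :
  bounded_sum (fun b => hsq (os_act (T b) (beta b x) ((xi : l2sum _) b))).
Proof.
have [M M0 hM] := beta_bd x.
by apply: bounded_sum_le (bounded_sumZ (sqr_ge0 M) (l2_bounded xi)) => b; exact: hM.
Qed.

Definition rep_act (x : V) (xi : HH) : HH := L2sum (rep_act_bounded_sum x xi).

Lemma rep_act_bilinear : bilinear_for *:%R *:%R rep_act.
Proof.
split=> [xi a x y|x a xi eta]; apply: l2_eq => b /=.
  by rewrite linearP /= actDl actZl.
by rewrite actDr actZr.
Qed.

HB.instance Definition _ := bilinear_isBilinear.Build C V HH HH *:%R *:%R rep_act rep_act_bilinear.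

Lemma l2_single_bounded b (v : os_hilb (T b)) :
  bounded_sum (fun b' => hsq (eqtype.dfwith (fun b' => 0 : os_hilb (T b')) v b')).
Proof.
have z b' : hsq (0 : os_hilb (T b')) = 0 by rewrite /hsq dot0l.
exists (hsq v) => s us; elim: s us => [|c s IH]; first by rewrite big_nil hsq_ge0.
rewrite big_cons => /andP[cs us].
have [e|bc] := eqVneq b c; last by rewrite (dfwith_out _ _ bc) z add0r IH.
move: cs; rewrite -e => cs; rewrite dfwith_in big_seq big1 ?addr0 // => d ds.
by rewrite dfwith_out ?z //; apply: contraNneq cs => ->.
Qed.

Definition l2_single b v : HH := L2sum (@l2_single_bounded b v).

Lemma rep_act_inj x : (forall xi, rep_act x xi = 0) -> x = 0.
Proof.
move=> h; apply: beta_inj => b; apply: os_act_inj => v.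
have := congr1 (fun z : l2sum _ => z b) (h (@l2_single b v)).
by rewrite /= dfwith_in.
Qed.

Lemma rep_act_bounded x : exists M : R, forall xi, hnorm (rep_act x xi) <= M * hnorm xi.
Proof.
have [M M0 hM] := beta_bd x; exists M => xi; apply/hnorm_le => //.
rewrite [h_dot _ _ _]l2_dotE [h_dot _ _ _]l2_dotE -rmorphM lecR -psumZ ?sqr_ge0 //; last exact: l2_bounded.
  by apply: psum_le => s us; apply: le_trans (psum_ub (bounded_sumZ (sqr_ge0 M) (l2_bounded xi)) us); apply: ler_sum => b _; exact: hM.
by move=> b; exact: hsq_ge0.
Qed.

Lemma rep_act_one xi : rep_act u xi = xi.
Proof. by apply: l2_eq => b /=; rewrite beta1 os_act_one. Qed.

Lemma rep_act_adj x : exists y, forall xi eta,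
  h_dot _ (rep_act y xi) eta = h_dot _ xi (rep_act x eta).
Proof.
have [y hy] := beta_star x; exists y => xi eta.
by congr csum; apply/funext => b /=; rewrite -hy os_starP.
Qed.

Definition rep_opsys : opsys R := @OpSys R V HH rep_act rep_act_inj rep_act_bounded u
  rep_act_one rep_act_adj.

Lemma l2_csummable (xi eta : HH) : csummable (fun b => h_dot _ ((xi : l2sum _) b) ((eta : l2sum _) b)).
Proof. by split; [exact: l2_re_summable|exact: l2_im_summable]. Qed.

(** A nonnegative summable family has a nonnegative sum; conversely, vectors concentrated in one
    summand isolate the component [b]. *)
Lemma rep_gcone (I : finType) (X : I -> I -> V) :
  gcone (S := rep_opsys) X <-> forall b, gcone (fun i j => beta b (X i j)).
Proof.
have key (xi : I -> HH) : let f b := \sum_i \sum_j h_dot _ (os_act (T b) (beta b (X i j)) ((xi j : l2sum _) b)) ((xi i : l2sum _) b) in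
    csummable f /\ csum f = \sum_i \sum_j h_dot HH (rep_act (X i j) (xi j)) (xi i).
  move=> f; have hf i := csum_sum (fun j => l2_csummable (rep_act (X i j) (xi j)) (xi i)).
  have [h1 h2] := csum_sum (fun i => proj1 (hf i)); split=> //.
  by rewrite /f h2; apply: eq_bigr => i _; rewrite (proj2 (hf i)).
split=> [h b v|h xi]; last first.
  by have [h1 <-] := key xi; apply: csum_ge0 => // b; exact: h.
have [_ e] := key (fun i => @l2_single b (v i)).
have := h (fun i => @l2_single b (v i)); rewrite -[X in _ <= X -> _]e (csum_single (b0 := b)).
  by congr (_ <= _); apply: eq_bigr => i _; apply: eq_bigr => j _; rewrite /= !dfwith_in.
move=> c cb; rewrite big1 // => i _; rewrite big1 // => j _ /=.
by rewrite dfwith_out 1?eq_sym // act0r dot0l.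
Qed.
End Representation.

(** * A concrete representation of the quotient *)

Section ConcreteQuotient.
Variable R : realType.
Local Notation C := R[i].
Local Notation conjC := (@Num.conj C).
Local Notation Re := complex.Re.

Lemma cp_os_pos (A B : opsys R) (f : A -> B) : cp f -> forall x, os_pos x -> os_pos (f x).
Proof.
move=> cf x hx; apply/(os_pos1 (S := B)).
have := cf 1%N (const_mx x) (proj2 (@os_pos1 R A x) hx).
by congr (mo_cone _); apply/matrixP => i j; rewrite !mxE.
Qed.

Lemma onorm_hsq (A : opsys R) (x : os_car A) (r : R) v : onorm x <= r ->
  hsq (os_act A x v) <= r ^+ 2 * hsq v.
Proof.
move=> xr; have r0 : 0 <= r by apply: le_trans xr; exact: onorm_ge0.
have := onormP x v; rewrite -!hsqE -rmorphM lecR => h; apply: le_trans h _.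
by rewrite ler_wpM2r ?hsq_ge0 // lerXn2r ?nnegrE ?onorm_ge0.
Qed.

Lemma sqr_imaginary : Re ('i : C) ^+ 2 + complex.Im ('i : C) ^+ 2 = 1.
Proof.
have h1 : (Num.sqrt (Re ('i : C) ^+ 2 + complex.Im ('i : C) ^+ 2))%:C%C = 1%:C%C :> C.
  by rewrite -normc_def normCi.
case: h1 => h1; rewrite -[LHS]sqr_sqrtr ?addr_ge0 ?sqr_ge0 // h1 expr1n //.
Qed.

Variables (n : nat) (J : {vspace 'M[C]_n}).
Hypothesis Jnull : null_subspace J.

(* The index set of the Hilbert sum on which [M_n / J] is represented. *)
Record quot_ucp := QuotUcp {
  qu_dim : nat;
  qu_map : {linear matn_quot_car J -> 'M[C]_qu_dim};
  qu_ucp : @ucp R (matn_quot J) (matn R qu_dim) qu_map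
}.
HB.instance Definition _ := gen_eqMixin quot_ucp.
HB.instance Definition _ := gen_choiceMixin quot_ucp.

Let V : lmodType C := matn_quot_car J.
Let T (b : quot_ucp) : opsys R := matn R (qu_dim b).
Let beta (b : quot_ucp) : {linear V -> os_car (T b)} := qu_map b.

Lemma beta_lift_linear b : linear (fun y : 'M[C]_n => beta b (qpi J y)).
Proof. by move=> a x y; rewrite (qpi_linear J a x y) linearP. Qed.
Let lift b : {linear os_car (matn R n) -> os_car (T b)} := mklin (beta_lift_linear b).

Lemma beta_lift_cp b : @cp R (matn R n) (T b) (lift b).
Proof.
move=> k X hX; have [cb _] := qu_ucp b; have := cb k _ (@qpi_cp R n J k X hX).
by congr (mo_cone _); apply/matrixP => i j; rewrite !mxE.
Qed.

Lemma beta1 b : beta b (qpi J 1%:M) = os_one (T b).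
Proof. by have [_ ->] := qu_ucp b. Qed.

Lemma beta_starE b y : os_star (beta b (qpi J y)) = beta b (qpi J (y ^t conjC)%sesqui).
Proof. by have := cp_star (@beta_lift_cp b) y; rewrite os_star_matn => h; exact: esym h. Qed.

Lemma beta_star x : exists y, forall b, os_star (beta b x) = beta b y.
Proof.
by have [y <-] := qpi_surj x; exists (qpi J (y ^t conjC)%sesqui) => b; exact: beta_starE.
Qed.

(** A ucp map preserves [- r 1 <= h <= r 1], so it does not increase the norm of a hermitian
    element; this gives a bound independent of [b]. The constant combines the real and imaginary
    parts through [hsqD]. *)
Lemma beta_bounded x : exists2 M : R, 0 <= M & forall b v,
  hsq (os_act (T b) (beta b x) v) <= M ^+ 2 * hsq v.
Proof.
have [y <-] := qpi_surj x.
have [h [k [hh hk yE _ _]]] := @herm_parts R (matn R n) y.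
have bd z b : os_star (z : os_car (matn R n)) = z -> onorm (lift b z) <= onorm (z : os_car (matn R n)).
  move=> hz; have [h1 h2] := herm_le_onorm hz.
  have l1 : lift b (os_one (matn R n)) = os_one (T b) by exact: beta1.
  apply: le_herm_onorm; first exact: onorm_ge0.
    by rewrite -(cp_star (@beta_lift_cp b)) hz.
    by have := cp_os_pos (@beta_lift_cp b) h1; rewrite linearB linearZ l1.
    by have := cp_os_pos (@beta_lift_cp b) h2; rewrite linearD linearZ l1.
pose rh := onorm (h : os_car (matn R n)); pose rk := onorm (k : os_car (matn R n)).
have s0 : 0 <= 2 * rh ^+ 2 + 2 * rk ^+ 2 by rewrite addr_ge0 // mulr_ge0 ?sqr_ge0.
exists (Num.sqrt (2 * rh ^+ 2 + 2 * rk ^+ 2)) => [|b v]; first exact: sqrtr_ge0.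
rewrite sqr_sqrtr //.
have -> : beta b (qpi J y) = lift b h + 'i *: lift b k.
  by rewrite -[beta b _]/(lift b y) {1}yE linearD linearZ.
rewrite actDl actZl; apply: le_trans (hsqD _ _) _.
rewrite [leRHS]mulrDl -[X in _ <= X + _]mulrA -[X in _ <= _ + X]mulrA.
rewrite hsqZ sqr_imaginary mul1r lerD // ler_wpM2l //; apply: onorm_hsq; exact: bd.
Qed.

Lemma annihilator_star r : (forall x, x \in J -> mxpair r x = 0) ->
  forall x, x \in J -> mxpair (r ^t conjC)%sesqui x = 0.
Proof.
move=> hr x xJ; have [Js _] := Jnull.
by rewrite -[x]trmxCK mxpair_star trmxCK hr ?rmorph0 //; exact: Js.
Qed.

(** If all ucp maps into matrices vanish at [x], then [ucp_test] at [x] and [- x] kills the positive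
    functionals. A hermitian [a] annihilating [J] is [c D - (c D - a)], a difference of positive
    ones, and such [a] span the annihilator. *)
Lemma beta_inj x : (forall b, beta b x = 0) -> x = 0.
Proof.
move=> hx; have [y yx] := qpi_surj x.
have pos D (hD : forall x, x \in J -> mxpair D x = 0) : psd (fun a b => D a b) ->
    forall z, (forall b, beta b z = 0) -> 0 <= (qfunl hD z : C).
  move=> pD z hz.
  have al : linear (fun w : V => (qfunl hD w : C)%:M : 'M[C]_1).
    by move=> a v w; rewrite linearP; apply/matrixP => i j; rewrite !mxE mulrnDl mulrnAr.
  have cal : @cp R (matn_quot J) (matn R 1) (mklin al).
    move=> m X hX; apply/mo_cone_matn.
    apply: eq_psd (psd_reindex (fun u : 'I_m * 'I_1 => u.1) (functional_quot_psd hD pD hX)) => u v.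
    by rewrite !mxE !ord1 eqxx mulr1n.
  have := @ucp_test R (matn_quot J) unit (fun _ _ => z) (quot_has_state Jnull) (quot_one_pos J) _ 1%N (mklin al) cal.
  move=> h; have {}h := h _ (fun=> 1).
  have : 0 <= \sum_(u : unit * 'I_1) \sum_(v : unit * 'I_1) conjC 1 * (qfunl hD z : C)%:M u.2 v.2 * 1.
    apply: h => p a ua c; rewrite big1 // => u _; rewrite big1 // => v _.
    by have := hz (QuotUcp ua); rewrite /beta /= => ->; rewrite mxE mulr0 mul0r.
  rewrite (bigD1 (tt, ord0)) //= [X in _ + X]big1 ?addr0 => [|[[] i]]; last by rewrite ord1 eqxx.
  rewrite (bigD1 (tt, ord0)) //= [X in _ + X]big1 ?addr0 => [|[[] i]]; last by rewrite ord1 eqxx.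
  by rewrite rmorph1 mul1r mulr1 mxE eqxx mulr1n.
have zero D (hD : forall x, x \in J -> mxpair D x = 0) : psd (fun a b => D a b) -> mxpair D y = 0.
  move=> pD; have h1 := pos D hD pD x hx.
  have h2 := pos D hD pD (- x) (fun b => etrans (linearN _ _) (etrans (congr1 -%R (hx b)) (oppr0 _))).
  rewrite -(qfunl_pi hD) yx; apply/eqP; rewrite eq_le h1 andbT -oppr_ge0.
  by rewrite linearN in h2.
have [D Dpd DJ] := faithful_annihilator Jnull.
have herm a : (a ^t conjC)%sesqui = a -> (forall x, x \in J -> mxpair a x = 0) -> mxpair a y = 0.
  move=> ha aJ; have [c c0 hc] := herm_majorized_pd Dpd ha.
  have hD : forall x, x \in J -> mxpair (c%:C%C *: D - a) x = 0.
    by move=> z zJ; rewrite mxpairC addrC -scaleN1r mxpairPr mxpairZr !(mxpairC z) DJ // aJ // !mulr0 addr0.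
  have := zero _ hD hc; rewrite mxpairC addrC -scaleN1r mxpairPr mxpairZr !(mxpairC y).
  rewrite (zero D DJ (pd_psd Dpd)) mulr0 addr0 mulN1r => /eqP; rewrite oppr_eq0 => /eqP //.
apply: quot_sep => _ [r [hr ->]]; rewrite -yx qfunl_pi.
have hrs := annihilator_star hr.
have a1 : mxpair (r + (r ^t conjC)%sesqui) y = 0.
  apply: herm; first by apply/matrixP => i j; rewrite !mxE rmorphD /= conjCK addrC.
  by move=> z zJ; rewrite mxpairC mxpairDr !(mxpairC z) hr // hrs // addr0.
have a2 : mxpair ('i *: (r - (r ^t conjC)%sesqui)) y = 0.
  apply: herm.
    apply/matrixP => i j; rewrite !mxE rmorphM rmorphB /= conjCK conjCi; ring.
  by move=> z zJ; rewrite mxpairC mxpairZr addrC -scaleN1r mxpairPr !(mxpairC z) hr // hrs // !mulr0 addr0 mulr0.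
rewrite mxpairC mxpairDr !(mxpairC y) in a1.
rewrite mxpairC mxpairZr addrC -scaleN1r mxpairPr !(mxpairC y) in a2.
move/eqP: a2; rewrite mulf_eq0 (negPf (neq0Ci _)) /= mulN1r addrC subr_eq0 => /eqP a2.
move: a1; rewrite -a2 -mulr2n => /eqP; rewrite mulrn_eq0 /= => /eqP //.
Qed.

Definition quot_opsys : opsys R := rep_opsys beta1 beta_star beta_bounded beta_inj.
End ConcreteQuotient.

(** * The cones of the represented quotient *)

Section QuotCone.
Variable R : realType.
Local Notation C := R[i].
Local Notation conjC := (@Num.conj C).
Local Notation Re := complex.Re.

Lemma half_double (V : lmodType C) (v : V) : (2^-1 : C) *: (v + v) = v.
Proof.
have -> : v + v = (2 : C) *: v by rewrite scaler_nat.
by rewrite scalerA mulVf ?scale1r // pnatr_eq0.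
Qed.

Lemma pd1 N : pd (1%:M : 'M[C]_N).
Proof.
exists 1; first exact: ltr01; have h : psd (fun _ _ : 'I_N => 0 : C) by exact: psd0.
by apply: eq_psd h => a b; rewrite mxE mul1r subrr.
Qed.

Variables (n : nat) (J : {vspace 'M[C]_n}).
Hypothesis Jnull : null_subspace J.

Theorem quot_opsys_cone k (X : 'M[matn_quot_car J]_k) :
  @mo_cone R (quot_opsys Jnull) k X <-> @mo_cone R (matn_quot J) k X.
Proof.
split=> [/(mo_cone_os (S := quot_opsys Jnull)) /rep_gcone hX|hX]; last first.
  apply/(mo_cone_os (S := quot_opsys Jnull)); apply/rep_gcone => b.
  have [cb _] := qu_ucp b; have /(mo_cone_os (S := matn R (qu_dim b))) := cb _ _ hX.
  by apply: eq_gcone => i j; rewrite mxE.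
apply/quot_coneP => e e0; apply: contrapT => no.
have /choice[x0 x0E] : forall ij : 'I_k * 'I_k, exists x, qpi J x = X ij.1 ij.2.
  by move=> ij; exact: qpi_surj.
pose x i j := x0 (i, j); have xE i j : qpi J (x i j) = X i j by exact: (x0E (i, j)).
(* The images of [X] under ucp maps are hermitian, and these maps separate points; so [X] is
   hermitian and has a hermitian lift [h]. *)
have xs i j : qpi J ((x j i) ^t conjC)%sesqui = X i j.
  apply/eqP; rewrite -subr_eq0; apply/eqP; apply: (beta_inj Jnull) => b.
  have e2 := gcone_herm (hX b) j i.
  have e1 : os_star (qu_map b (qpi J (x j i)) : os_car (matn R _)) = qu_map b (qpi J ((x j i) ^t conjC)%sesqui).
    exact: beta_starE.
  by rewrite linearB -e1 xE; apply/eqP; rewrite subr_eq0; apply/eqP; exact: e2.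
pose N := #|{: 'I_k * 'I_n}|.
pose h : 'M[C]_N := of_blocks (fun i j => (2^-1 : C) *: (x i j + ((x j i) ^t conjC)%sesqui)).
have hs : (h ^t conjC)%sesqui = h.
  apply/matrixP => u v; rewrite !mxE rmorphM rmorphD /= conjCK addrC; congr (_ * _).
  by rewrite fmorphV rmorph_nat.
have q2 (y z : 'M[C]_n) : qpi J (y + z) = qpi J y + qpi J z by have := qpi_linear J 1 y z; rewrite !scale1r.
have qZ a (y : 'M[C]_n) : qpi J (a *: y) = a *: qpi J y.
  by rewrite -[qpi J]/(mklin (qpi_linear J) : _ -> _) linearZ.
have hE i j : qpi J (block h i j) = X i j.
  by rewrite of_blocksE qZ q2 xE xs half_double.
(* Positive matrices modulo block matrices over [J]. If [h + e] is outside, a separating functional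
   vanishes on these block matrices and so defines a cp map from the quotient to [M_k]; [ucp_test]
   then contradicts its negativity at [h]. *)
pose Kc (y : 'M[C]_N) := exists2 w : 'M[C]_N, (forall i j, block w i j \in J) &
   psd (fun u v => (y + (y ^t conjC)%sesqui + w) u v).
have [Js _] := Jnull.
have adjD (y z : 'M[C]_N) : ((y + z) ^t conjC)%sesqui = (y ^t conjC)%sesqui + (z ^t conjC)%sesqui.
  by apply/matrixP => i j; rewrite !mxE rmorphD.
have adjZ a (y : 'M[C]_N) : ((a *: y) ^t conjC)%sesqui = conjC a *: (y ^t conjC)%sesqui.
  by apply/matrixP => i j; rewrite !mxE rmorphM.
have psd00 : psd (fun u v : 'I_N => (0 : 'M[C]_N) u v).
  have z : psd (fun _ _ : 'I_N => 0 : C) by exact: psd0.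
  by apply: eq_psd z => a b; rewrite mxE.
have Kw (w : 'M[C]_N) : (forall i j, block w i j \in J) -> forall c, Kc (c *: w).
  move=> hw c; exists (- (c *: w + ((c *: w) ^t conjC)%sesqui)) => [i j|].
    rewrite -scaleN1r blockZ blockD adjZ !blockZ block_adj memvZ // memvD // memvZ //; exact: Js.
  by rewrite subrr.
have Kpsd (y : 'M[C]_N) : psd (fun u v => y u v) -> Kc y.
  move=> hy; exists 0 => [i j|]; first by rewrite block0 mem0v.
  by rewrite addr0 psd_adj //; apply: eq_psd (psd_add hy hy) => u v; rewrite mxE.
have Kskew (y : 'M[C]_N) c : psd (fun u v => y u v) -> conjC c = - c -> Kc (c *: y).
  move=> hy hc; exists 0 => [i j|]; first by rewrite block0 mem0v.
  by rewrite addr0 adjZ hc psd_adj // scaleNr subrr.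
have Kcc : convex_cone Kc.
  split=> [|y z [w hw hy] [w' hw' hz]|r y r0 [w hw hy]].
    by apply: Kpsd.
    exists (w + w') => [i j|]; first by rewrite blockD memvD.
    apply: eq_psd (psd_add hy hz) => u v; rewrite adjD !mxE; ring.
  exists (r%:C%C *: w) => [i j|]; first by rewrite blockZ memvZ.
  apply: eq_psd (psd_scale (a := r%:C%C) _ hy) => [u v|]; last by rewrite ler0c.
  rewrite adjZ conjCR !mxE; ring.
have psd1 : psd (fun u v : 'I_N => (1%:M : 'M[C]_N) u v) by exact: pd_psd (pd1 N).
have maj (v : 'M[C]_N) : exists t : R, Kc (t%:C%C *: 1%:M - v).
  have [|c c0 hc] := herm_majorized_pd (x := v + (v ^t conjC)%sesqui) (pd1 N).
    by rewrite adjD trmxCK addrC.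
  exists c; exists 0 => [i j|]; first by rewrite block0 mem0v.
  apply: eq_psd (psd_add hc (psd_scale (a := c%:C%C) _ psd1)) => [a b|]; last by rewrite ler0c.
  have -> : ((c%:C%C *: 1%:M - v) ^t conjC)%sesqui = c%:C%C *: 1%:M - (v ^t conjC)%sesqui.
    by rewrite -scaleN1r adjD !adjZ conjCR rmorphN1 scaleN1r psd_adj.
  rewrite addr0 !mxE; ring.
have nK : ~ Kc (h + e%:C%C *: 1%:M).
  move=> [w hw hy]; apply: no.
  set g := h + _ in hy; have gs : (g ^t conjC)%sesqui = g.
    by rewrite /g adjD adjZ conjCR hs psd_adj.
  exists (fun i j => (2^-1 : C) *: block (g + g + w) i j).
    apply/(gcone_matn (I := 'I_k)); rewrite gs in hy.
    apply: eq_psd (psd_scale (a := 2^-1 : C) _ (psd_block hy)) => [u v|]; first by rewrite [RHS]mxE.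
    by rewrite invr_ge0 ler0n.
  move=> i j; rewrite qZ !blockD !q2.
  have -> : qpi J (block w i j) = 0 by apply/qpi_eq0.
  rewrite addr0 half_double.
  rewrite hE blockZ block1 qZ -scalerA; congr (_ + _ *: _).
  by rewrite -[((i == j)%:R)%:M]scalemx1 qZ.
have [f [fK _ fh]] := krein_separation Kcc (Kpsd _ psd1) maj e0 nK.
have f_ge0 (y : 'M[C]_N) : psd (fun u v => y u v) -> 0 <= (f y : C).
  move=> hy; apply: (linear_ge0 fK); [exact: Kpsd|apply: Kskew => //; exact: conjCi|].
  by apply: Kskew => //; rewrite rmorphN; congr (- _); exact: conjCi.
have f_w (w : 'M[C]_N) : (forall i j, block w i j \in J) -> (f w : C) = 0.
  move=> hw; have key c := fK _ (Kw w hw c).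
  have h1 := key 1; have h2 := key (-1); have h3 := key 'i; have h4 := key (- 'i).
  rewrite !linearZ /= in h1 h2 h3 h4.
  have Im0 := Re_pm h3 h4.
  have Re0 : Re (f w : C) = 0.
    move: h1 h2; rewrite scale1r scaleN1r raddfN /= => h1 h2.
    by apply/eqP; rewrite eq_le h1 andbT -oppr_ge0.
  by move: Im0 Re0; case: (f w) => p q /= -> ->.
have := functional_psd f_ge0; set y0 := \matrix_(_, _) _ => y0_psd.
have fE (y : 'M[C]_N) : f y = mxpair y0 y by exact: functional_mxpair.
have hr i j (y : 'M[C]_n) : y \in J -> mxpair (block y0 i j) y = 0.
  move=> yJ; pose w : 'M[C]_N := of_blocks (fun i' j' => ((i' == i) && (j' == j))%:R *: y).
  have := f_w w; rewrite fE mxpair_block => hz.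
  rewrite -[RHS]hz => [|i' j']; last by rewrite of_blocksE memvZ.
  rewrite (bigD1 i) //= [X in _ + X]big1 ?addr0 => [|i' ii]; last first.
    by rewrite big1 // => j' _; rewrite of_blocksE (negPf ii) mxpairZr mul0r.
  rewrite (bigD1 j) //= big1 ?addr0 => [|j' jj]; last first.
    by rewrite of_blocksE (negPf jj) andbF mxpairZr mul0r.
  by rewrite of_blocksE !eqxx scale1r.
pose al (y : matn_quot_car J) : 'M[C]_k := \matrix_(i, j) (qfunl (hr i j) y : C).
have all : linear al by move=> a y z; apply/matrixP => i j; rewrite mxE linearP !mxE.
have cal : @cp R (matn_quot J) (matn R k) (mklin all).
  move=> m Y hY; apply/mo_cone_matn.
  apply: eq_psd (functionals_quot_psd hr (psd_block y0_psd) hY) => u v.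
  by rewrite mxE /= mxE.
have := @ucp_test R (matn_quot J) 'I_k (fun i j => X i j) (quot_has_state Jnull) (quot_one_pos J) _ k (mklin all) cal.
move=> hh; have {}hh : @mat_psd R (matn_quot J) 'I_k k (fun i j => X i j) (mklin all).
  apply: hh => p a ua; exact: (proj1 (gcone_matn _) (hX (QuotUcp ua))).
have := psd_reindex (fun i : 'I_k => (i, i)) hh (fun=> 1) => fh0.
have : 0 <= (f h : C).
  move: fh0; rewrite fE mxpair_block; congr (_ <= _); apply: eq_bigr => i _; apply: eq_bigr => j _.
  by rewrite rmorph1 mul1r mulr1 /= mxE -hE qfunl_pi.
move=> f0; have : 0 <= Re (f h : C) by rewrite -ler0c ge0_RRe.
by move: fh => /lt_le_trans h1 /h1; rewrite ltxx.
Qed.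
End QuotCone.

(** * The equivalences *)

Section Assembly.
Variable R : realType.
Local Notation C := R[i].
Local Notation conjC := (@Num.conj C).
Local Notation Re := complex.Re.

(** [f (x) g] sends a compression of [S (x) T] to the same compression of a Kronecker product of
    positive matrices. *)
Lemma maxD_psd (A B : uospace R) (Z : tprod A B) n (Y : 'M[Z]_n) p q
  (f : {linear A -> 'M[C]_p}) (g : {linear B -> 'M[C]_q}) :
  @cp R A (matn R p) f -> @cp R B (matn R q) g -> maxD Y ->
  psd (fun u v : 'I_n * 'I_(p * q) => mxmap Z f g (Y u.1 v.1) u.2 v.2).
Proof.
move=> cf cg [I [J [S [T [X [hS hT ->]]]]]].
have /(os_mconeP (S := matn R p)) /gcone_matn pS := cp_mcone cf hS.
have /(os_mconeP (S := matn R q)) /gcone_matn pT := cp_mcone cg hT.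
have pST := psd_kron pS pT.
have h := psd_block_compress (fun (kl : I * J) (i : 'I_n) => X kl.1 kl.2 i)
  (psd_reindex (fun w : 'I_(p * q) * (I * J) => ((w.2.1, (mxtens_unindex w.1).1), (w.2.2, (mxtens_unindex w.1).2))) pST).
have := psd_reindex (fun u : 'I_n * 'I_(p * q) => (u.2, u.1)) h.
apply: eq_psd => u v /=; rewrite mxE.
transitivity (\sum_(k : I) \sum_(l : J) \sum_(k' : I) \sum_(l' : J)
   conjC (X k l u.1) * X k' l' v.1 * ((f (S k k') : 'M_p) (mxtens_unindex u.2).1 (mxtens_unindex v.2).1 *
     (g (T l l') : 'M_q) (mxtens_unindex u.2).2 (mxtens_unindex v.2).2)).
  rewrite sum_prod; apply: eq_bigr => k _; apply: eq_bigr => l _.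
  by rewrite sum_prod.
rewrite linear_sum summxE; apply: eq_bigr => k _.
rewrite linear_sum summxE; apply: eq_bigr => l _.
rewrite linear_sum summxE; apply: eq_bigr => k' _.
rewrite linear_sum summxE; apply: eq_bigr => l' _.
by rewrite linearZ mxE mxmap_tn mxE.
Qed.

Lemma maxD_limit_psd (A B : uospace R) (Z : tprod A B) n (X : 'M[Z]_n) p q
  (f : {linear A -> 'M[C]_p}) (g : {linear B -> 'M[C]_q}) :
  @cp R A (matn R p) f -> @cp R B (matn R q) g ->
  (forall e : R, 0 < e -> maxD (X + tunit Z n e)) ->
  psd (fun u v : 'I_n * 'I_(p * q) => mxmap Z f g (X u.1 v.1) u.2 v.2).
Proof.
move=> cf cg hX c.
apply: (ge0_limit (b := \sum_u \sum_v conjC (c u) * mxmap Z f g ((u.1 == v.1)%:R *: (tn (uo_one A) (uo_one B) : Z)) u.2 v.2 * c v)) => e e0.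
have := maxD_psd cf cg (hX e e0) c; congr (_ <= _).
rewrite mulr_sumr -big_split; apply: eq_bigr => u _; rewrite mulr_sumr -big_split.
apply: eq_bigr => v _; cbv beta.
have -> : mxmap Z f g ((X + tunit Z n e) u.1 v.1) u.2 v.2 =
   mxmap Z f g (X u.1 v.1) u.2 v.2 +
   e%:C%C * mxmap Z f g ((u.1 == v.1)%:R *: (tn (uo_one A) (uo_one B) : Z)) u.2 v.2.
  by rewrite mxE tunitE [X in _ + X]mxE -scalerA linearD linearZ mxE [X in _ + X]mxE.
rewrite -[RHS]/(_ + _); ring.
Qed.

Lemma min_coneP (A B : uospace R) n (X : 'M[tensor A B]_n) :
  @mo_cone R (tens_min A B) n X <->
  forall p q (f : {linear A -> 'M[C]_p}) (g : {linear B -> 'M[C]_q}),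
     @ucp R A (matn R p) f -> @ucp R B (matn R q) g ->
     psd (fun u v : 'I_n * 'I_(p * q) => mxmap (tensor_tprod A B) f g (X u.1 v.1) u.2 v.2).
Proof.
split=> h p q f g uf ug.
  have /mo_cone_matn := h p q f g uf ug; apply: eq_psd => u v.
  by rewrite mxE; congr (fun_of_matrix _ _ _); exact: tensor_matrix_mapE.
apply/mo_cone_matn; have := h p q f g uf ug; apply: eq_psd => u v.
transitivity ((tensor_matrix_map f g (X u.1 v.1)) u.2 v.2); last by rewrite mxE.
by congr (fun_of_matrix _ _ _); exact/esym/tensor_matrix_mapE.
Qed.

Lemma max_min (A B : uospace R) n (X : 'M[tensor A B]_n) :
  @mo_cone R (tens_max A B) n X -> @mo_cone R (tens_min A B) n X.
Proof.
move=> /max_coneP hX; apply/min_coneP => p q f g uf ug.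
exact: (maxD_limit_psd (proj1 uf) (proj1 ug) hX).
Qed.

Section Kappa.
Variables (S I : opsys R) (kappa : {linear os_car S -> os_car I}).
Hypothesis kco : @co_embedding R S I kappa.

Lemma kappa_ucp : @ucp R S I kappa.
Proof. by case: kco => _ k1 kc; split=> // n X /kc. Qed.

Lemma tensor_map_mx (B : lmodType C) n (X : 'M[tensor (os_car S) B]_n) :
  map_mx (tensor_map kappa (idfun : {linear B -> B})) X =
  map_mx (mapl (tensor_tprod (os_car S) B) (tensor_tprod (os_car I) B) kappa) X
  :> 'M[tensor_tprod (os_car I) B]_n.
Proof. by apply/matrixP => i j; rewrite !mxE; exact: tensor_maplE. Qed.

Lemma mapl_max (B : uospace R) (Z : tprod (os_car S) B) (Z' : tprod (os_car I) B) n (X : 'M[Z]_n) :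
  (forall e : R, 0 < e -> @maxD R S B Z n (X + @tunit R S B Z n e)) ->
  forall e : R, 0 < e -> @maxD R I B Z' n (map_mx (mapl Z Z' kappa) X + @tunit R I B Z' n e).
Proof.
move=> hX e e0; have := @maxD_map R S I B Z Z' kappa n _ (proj1 kappa_ucp) (hX e e0).
congr (@maxD R I B Z' n _); rewrite map_mxD; congr (_ + _).
case: kco => _ k1 _.
have key (a : C) : mapl Z Z' kappa (a *: (tn (uo_one S) (uo_one B) : Z)) = a *: (tn (uo_one I) (uo_one B) : Z').
  by rewrite linearZ /= mapl_tn k1.
apply/matrixP => i j; transitivity (mapl Z Z' kappa (@tunit R S B Z n e i j)); first by rewrite [LHS]mxE.
by rewrite !tunitE [X in mapl Z Z' kappa X]mxE [RHS]mxE; exact: key.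
Qed.

Theorem wep_max_embedding : wep kappa -> forall T : opsys R,
  @co_embedding R (tens_max S T) (tens_max I T) (tensor_map kappa idfun).
Proof.
move=> [Phi [cPhi _] PhiE] T; have [kinj k1 kc] := kco; split.
- move=> x y e; apply: (mapl_inj (@vector_functional_sep R T) kinj (Z := tensor_tprod (os_car S) (os_car T)) (Z' := tensor_tprod (os_car I) (os_car T))).
  have h := e; rewrite -[LHS]tensor_maplE -[RHS]tensor_maplE; exact: h.
- by rewrite /= tensor_map_tens; congr tens.
move=> n X; split=> [/max_coneP hX|/max_coneP hX]; apply/max_coneP => e e0.
  rewrite tensor_map_mx.
  exact: (@mapl_max T (tensor_tprod (os_car S) (os_car T)) (tensor_tprod (os_car I) (os_car T)) n X hX e e0).
apply: (wep_max_inclusion (Z' := tensor_tprod (os_car I) (os_car T)) kco cPhi PhiE _ e0) => d d0.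
by rewrite -tensor_map_mx; exact: hX.
Qed.

Lemma max_embedding_el_nuclear :
  (forall T : opsys R, @co_embedding R (tens_max S T) (tens_max I T) (tensor_map kappa idfun)) ->
  el_max_nuclear kappa.
Proof.
move=> h T; have [_ _ hc] := h T; split; first by exists idfun.
split=> // n X.
have -> : map_mx idfun X = X by exact: map_mx_id.
by split=> hX; apply/hc.
Qed.

Theorem el_nuclear_quot (hI : injective_opsys I) : el_max_nuclear kappa ->
  forall n (J : {vspace 'M[C]_n}), null_subspace J ->
  @co_iso R (tens_min S (matn_quot J)) (tens_max S (matn_quot J)) idfun.
Proof.
move=> hel n J Jnull; split; first by exists idfun.
split=> // k X; have -> : map_mx idfun X = X by exact: map_mx_id.
split=> [hX|]; last exact: max_min.
(* [quot_opsys] has the underlying space and the unit of the quotient, so matching the cones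
   suffices to pass between the two maximal tensor products. *)
have mE (N : finType) (Y : N -> N -> matn_quot_car J) :
    @mcone R (quot_opsys Jnull) N Y <-> @mcone R (matn_quot J) N Y by exact: quot_opsys_cone.
have := proj1 (min_coneP X) hX => hmin.
pose Z : tprod (os_car S) (matn_quot_car J) := tensor_tprod (os_car S) (matn_quot_car J).
pose Z' : tprod (os_car I) (matn_quot_car J) := tensor_tprod (os_car I) (matn_quot_car J).
pose Y : 'M[Z']_k := map_mx (mapl Z Z' kappa) X.
have hY := @injective_min_max R I hI n J Jnull Z' k Y.
have {}hY e : 0 < e -> @maxD R I (matn_quot J) Z' k (Y + @tunit R I (matn_quot J) Z' k e).
  apply: hY => p q f g uf ug.
  pose fk : {linear os_car S -> 'M[C]_p} := f \o kappa.
  have ufk : @ucp R S (matn R p) fk.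
    have [ck k1] := kappa_ucp; have [cf f1] := uf; split; last by rewrite /fk /= k1.
    by move=> m W /ck /cf; rewrite -map_mx_comp.
  have := hmin p q fk g ufk ug; apply: eq_psd => u v.
  rewrite [Y _ _]mxE; move: (X u.1 v.1); apply: (tp_ind (Z := Z)) => [|x y hx hy|s y].
    by rewrite !linear0.
    by rewrite !linearD mxE [RHS]mxE hx hy.
  by rewrite mapl_tn !mxmap_tn.
have [_ [_ _ hc]] := hel (quot_opsys Jnull).
have hmax : @mo_cone R (tens_max S (quot_opsys Jnull)) k X.
  have <- : map_mx idfun X = X by exact: map_mx_id.
  apply/hc; apply/max_coneP => e e0; rewrite tensor_map_mx.
  have [N1 [N2 [P [T [W [hP hT e1]]]]]] := hY e e0.
  by exists N1, N2, P, T, W; split=> //; apply/mE.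
move: hmax => /max_coneP hmax; apply/max_coneP => e e0.
have [N1 [N2 [P [T [W [hP hT e1]]]]]] := hmax e e0.
by exists N1, N2, P, T, W; split=> //; apply/mE.
Qed.
End Kappa.
End Assembly.

(** Condition (3) occurs in both of its wordings: as an inclusion, of which injectivity on the
    algebraic tensor product is a part, and as nuclearity, which compares two families of cones on
    one space. *)
Theorem theorem2p2 (R : realType) (S I : opsys R) (kappa : {linear S -> I})
  (kappa_env : injective_envelope kappa) :
  [<-> wep kappa;
       (forall n (J : {vspace 'M[R[i]]_n}), null_subspace J ->
          @co_iso R (tens_min S (matn_quot J)) (tens_max S (matn_quot J)) idfun);
       (forall T : opsys R,
          @co_embedding R (tens_max S T) (tens_max I T) (tensor_map kappa idfun));
       el_max_nuclear kappa;
       (forall n (P : matrix_system R n) (phi : {linear ms_opsys P -> S}), cp phi ->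
          forall e : R, 0 < e ->
          exists2 psi : {linear matn R n -> S}, cp psi &
            (cb_norm (fun x : ms_opsys P => (psi (vsval x) - phi x)%R : S) <= e%:E)%E)].
Proof.
have [kco hI _] := kappa_env.
have wep_max := wep_max_embedding kco.
have max_el := @max_embedding_el_nuclear R S I kappa.
have el_min := el_nuclear_quot kco hI.
have min_ext := @nuclear_extension R S.
pose Z := tensor_tprod (os_car S) (functional (os_nmospace S)).
pose Z' := tensor_tprod (os_car I) (functional (os_nmospace S)).
have ext_wep := fun h => @wep_of_extension R S I kappa kco h Z Z'.
split; first by move=> /wep_max/max_el/el_min.
split; first by move=> /min_ext/ext_wep/wep_max.
split; first exact: max_el.
split; first by move=> /el_min/min_ext.
exact: ext_wep.
Qed.
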